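(* Let $M$ be a Kähler manifold of real dimension $2m$, $\rho$ a dominant integral weight of $U(m)$, $D_{\pm i}:\Gamma(\mathbf{S}_\rho)\to\Gamma(\mathbf{S}_{\rho\pm\mu_i})$ $(1\le i\le m)$ the Kählerian gradients and $D_{\pm i}^{\ast}:\Gamma(\mathbf{S}_{\rho\pm\mu_i})\to\Gamma(\mathbf{S}_\rho)$ their formal adjoints. With the conformal weights $w_{\pm i}$, the curvature endomorphisms $R^q_\rho$ and the polynomials $K_n(-\tilde c)$ of the context, the following identities hold on $\Gamma(\mathbf{S}_\rho)$. (1) (degree $0$) $$\sum_{i}D_{-i}^{\ast}D_{-i}=\nabla^{1,0\,\ast}\nabla^{1,0},\qquad\sum_{i}D_{+i}^{\ast}D_{+i}=\nabla^{0,1\,\ast}\nabla^{0,1},$$ $$\sum_{i}\big(D_{-i}^{\ast}D_{-i}+D_{+i}^{\ast}D_{+i}\big)=\nabla^{1,0\,\ast}\nabla^{1,0}+\nabla^{0,1\,\ast}\nabla^{0,1}=\nabla^{\ast}\nabla,$$ $$\sum_{i}\big(D_{-i}^{\ast}D_{-i}-D_{+i}^{\ast}D_{+i}\big)=\nabla^{1,0\,\ast}\nabla^{1,0}-\nabla^{0,1\,\ast}\nabla^{0,1}=R^0_\rho.$$ In particular, if $M$ is Ricci-flat, then $\sum_iD_{-i}^{\ast}D_{-i}=\sum_iD_{+i}^{\ast}D_{+i}$. (2) (degree $1$) $$\sum_{i}\big(w_{-i}D_{-i}^{\ast}D_{-i}+w_{+i}D_{+i}^{\ast}D_{+i}\big)=R^1_\rho.$$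 (3) (degree $q$, for every $q\in\mathbb{Z}_{\ge0}$) $$\sum_{p=0}^q\binom{q}{p}(-m)^{q-p}R^p_\rho=(-1)^{q+1}\sum_{i}\Big(\sum_{p=0}^q\pi_\rho(K_{q-p}(-\tilde c))\,w_{+i}^p\Big)D_{+i}^{\ast}D_{+i}+\sum_{i}(w_{-i}-m)^qD_{-i}^{\ast}D_{-i}.$$ (All sums over $i$ run over $1\le i\le m$.) In particular, each $D_{-i}^{\ast}D_{-i}$ is a linear combination of $\{D_{+j}^{\ast}D_{+j}\}_{j=1}^m$ and $\{R^q_\rho\}_{q=0}^{m-1}$.
   Context: Representations. Irreducible unitary representations $(\pi_\rho,V_\rho)$ of $U(m)$ are labelled by highest weights $\rho=(\rho^1,\dots,\rho^m)\in\mathbb{Z}^m$, $\rho^1\ge\cdots\ge\rho^m$ (''dominant integral''); weights are simultaneous eigenvalues of $e_{11},\dots,e_{mm}$, $e_{kl}$ being the matrix units of $\mathfrak{gl}(m,\mathbb{C})=\mathfrak{u}(m)\otimes\mathbb{C}$. $\pi_\rho$ also denotes the representation of $U(\mathfrak{gl}(m,\mathbb{C}))$. Let $\mu_i$ be the $i$-th standard basis vector of $\mathbb{Z}^m$. One has multiplicity-free orthogonal decompositions $V_\rho\otimes\mathbb{C}^m=\bigoplus_iV_{\rho+\mu_i}$, $V_\rho\otimes\overline{\mathbb{C}^m}=\bigoplus_iV_{\rho-\mu_i}$, with $V_{\rho\pm\mu_i}:=\{0\}$ when $\rho\pm\mu_i$ is not dominant integral; $\Pi_{\pm i}$ is the orthogonal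 projection onto $V_{\rho\pm\mu_i}$. Conformal weights: $w_{+i}:=-\rho^i+i-1$, $w_{-i}:=\rho^i+m-i$. Convention $0^0=1$. Algebra. $e_{kl}^0:=\delta_{kl}$ and $e_{kl}^q:=\sum_{i_1,\dots,i_{q-1}}e_{ki_1}e_{i_1i_2}\cdots e_{i_{q-1}l}$ for $q\ge1$. $\tilde c_0:=m$ and $\tilde c_q:=(-1)^q\sum_{k,i_1,\dots,i_{q-1}}e_{i_1k}e_{i_2i_1}\cdots e_{ki_{q-1}}$ for $q\ge1$ (central elements, acting on $V_\rho$ as scalars). $K_n(-\tilde c):=\sum_{i_1+2i_2+\cdots+ni_n=n}\frac{(i_1+\cdots+i_n)!}{i_1!\cdots i_n!}\tilde c_0^{\,i_1}\tilde c_1^{\,i_2}\cdots\tilde c_{n-1}^{\,i_n}$, $K_0(-\tilde c)=1$. Geometry. $M$ is Kähler with metric $g$ (extended complex bilinearly), $\mathbf{U}(M)$ its principal $U(m)$-bundle of unitary frames $(\epsilon_1,\dots,\epsilon_m)$ of $T^{1,0}(M)$ (so $g(\epsilon_k,\bar\epsilon_l)=\delta_{kl}$), with the Levi-Civita connection. $\mathbf{S}_\rho:=\mathbf{U}(M)\times_{\pi_\rho}V_\rho$ with induced Hermitian metric and covariant derivative $\nabla=\nabla^{1,0}+\nabla^{0,1}$. Identifying $\Lambda^{0,1}(M)\simeq T^{1,0}(M)$ and $\Lambda^{1,0}(M)\simeq T^{0,1}(M)$ by $g$, $\nabla^{0,1}\phi=\sum_k\nabla_{\bar\epsilon_k}\phi\otimes\epsilon_k$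 and $\nabla^{1,0}\phi=\sum_k\nabla_{\epsilon_k}\phi\otimes\bar\epsilon_k$ for a local unitary frame. The Kählerian gradients are $D_{+i}:=\Pi_{+i}\circ\nabla^{0,1}$ and $D_{-i}:=\Pi_{-i}\circ\nabla^{1,0}$ (fibrewise projections). ${}^{\ast}$ denotes formal adjoint with respect to $L^2$ inner products. Curvature endomorphisms. Let $R_\rho$ be the curvature of $\nabla$ on $\mathbf{S}_\rho$, $R_\rho(V,W)=\nabla_V\nabla_W-\nabla_W\nabla_V-\nabla_{[V,W]}$, extended complex bilinearly. Put $R^q_\rho:=\sum_{k,l}\pi_\rho(e_{lk}^q)R_\rho(\epsilon_k,\bar\epsilon_l)\in\Gamma(\mathrm{End}(\mathbf{S}_\rho))$, where $\pi_\rho(e_{lk}^q)$ acts through the trivialization of $\mathbf{S}_\rho$ given by the frame $\{\epsilon_k\}$ (the result is independent of the frame). *)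

(* Defs.v *)
From HB Require Import structures.
From mathcomp Require Import all_boot all_order all_algebra.
From mathcomp Require Import all_classical all_reals all_analysis.
From mathcomp Require Import complex spectral.
Import Order.TTheory GRing.Theory Num.Theory.
Import numFieldNormedType.Exports.

Set Implicit Arguments.
Unset Strict Implicit.
Unset Printing Implicit Defensive.

Local Open Scope classical_set_scope.
Local Open Scope ring_scope.
Local Open Scope sesquilinear_scope.

Section Euclidean.
Context {R : realType}.

Definition pderiv n (j : 'I_n) (f : 'rV[R]_n -> R) (y : 'rV[R]_n) : R :=
  'D_(delta_mx 0 j : 'rV[R]_n) f y.

Fixpoint Ck_on n (k : nat) (U : set 'rV[R]_n) (f : 'rV[R]_n -> R) : Prop :=
  (forall y, U y -> {for y, continuous f}) /\
  match k with
  | 0 => True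
  | k'.+1 => forall j : 'I_n,
      (forall y, U y -> derivable f y (delta_mx 0 j : 'rV[R]_n)) /\
      Ck_on k' U (pderiv j f)
  end.

Definition smooth_on n (U : set 'rV[R]_n) (f : 'rV[R]_n -> R) : Prop :=
  forall k, Ck_on k U f.

Definition cpderiv n (j : 'I_n) (f : 'rV[R]_n -> R[i]) (y : 'rV[R]_n) : R[i] :=
  Complex (pderiv j (fun z => complex.Re (f z)) y)
          (pderiv j (fun z => complex.Im (f z)) y).

(* Lebesgue integral over R^n as an iterated integral; it is only applied to
   continuous functions with compact support. *)
Fixpoint integralRn n : ('rV[R]_n -> R) -> R :=
  match n with
  | 0 => fun f => f 0
  | n'.+1 => fun f =>
      \int[@lebesgue_measure R]_t
         integralRn (fun y : 'rV[R]_n' => f (row_mx (const_mx t : 'rV[R]_1) y))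
  end.

End Euclidean.

Definition toC (R : realType) a b (A : 'M[R]_(a, b)) : 'M[R[i]]_(a, b) :=
  map_mx (fun r => Complex r 0) A.

Definition conjmx (R : realType) a b (A : 'M[R[i]]_(a, b)) : 'M[R[i]]_(a, b) :=
  map_mx Num.conj A.

(* The atlas is indexed by the points: [cmap p] is a chart around p, defined on
   [cdom p], with inverse [cinv p]. The tangent space at x is R^n, a tangent
   vector being identified with its row of components in the chart [cmap x].
   The carrier is pointed because measurable types are. *)
Record manifold (R : realType) (n : nat) := Manifold {
  carrier :> ptopologicalType ;
  cdom : carrier -> set carrier ;
  cmap : carrier -> carrier -> 'rV[R]_n ;
  cinv : carrier -> 'rV[R]_n -> carrier ;
  man_hausdorff : hausdorff_space carrier ;
  man_countable : @second_countable carrier ;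
  man_center : forall p, cdom p p ;
  man_dom_open : forall p, open (cdom p) ;
  man_cod_open : forall p, open (cmap p @` cdom p) ;
  man_cmapK : forall p x, cdom p x -> cinv p (cmap p x) = x ;
  man_cmap_cont : forall p x, cdom p x -> {for x, continuous (cmap p)} ;
  man_cinv_cont : forall p x, cdom p x -> {for cmap p x, continuous (cinv p)} ;
  man_smooth : forall p q (j : 'I_n),
    smooth_on ((cmap p @` cdom p) `&` (cinv p @^-1` cdom q))
              (fun y => cmap q (cinv p y) 0 j)
}.

Section ManifoldTheory.
Context {R : realType} {n : nat} (M : manifold R n).
Implicit Types (p q x : M) (W : set M).

Definition smooth_fun W (f : M -> R) : Prop :=
  forall p, smooth_on ((cmap p @` cdom p) `&` (cinv p @^-1` W)) (f \o cinv p).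

Definition csmooth_fun W (f : M -> R[i]) : Prop :=
  smooth_fun W (fun x => complex.Re (f x)) /\
  smooth_fun W (fun x => complex.Im (f x)).

(* If v is the row of components in the chart p of a vector at x, then
   [v *m jac p q x] is its row of components in the chart q. *)
Definition jac p q x : 'M[R]_n :=
  \matrix_(i, j) pderiv i (fun y => cmap q (cinv p y) 0 j) (cmap p x).

Definition dirder (f : M -> R[i]) x (v : 'rV[R[i]]_n) : R[i] :=
  \sum_j v 0 j * cpderiv j (f \o cinv x) (cmap x x).

Definition dirdermx a b (f : M -> 'M[R[i]]_(a, b)) x (v : 'rV[R[i]]_n) :
    'M[R[i]]_(a, b) :=
  \matrix_(i, j) dirder (fun y => f y i j) x v.

(* Lie bracket at x of complex vector fields, computed in the chart at x. *)
Definition bracket (V W : M -> 'rV[R[i]]_n) x : 'rV[R[i]]_n :=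
  dirdermx (fun y => W y *m toC (jac y x y)) x (V x) -
  dirdermx (fun y => V y *m toC (jac y x y)) x (W x).

Definition borel := g_sigma_algebraType (@open M).

End ManifoldTheory.

Record riemannian (R : realType) (n : nat) := Riemannian {
  rman :> manifold R n ;
  met : rman -> 'M[R]_n ; (* Gram matrix at x, in the chart at x *)
  met_sym : forall x, (met x)^T = met x ;
  met_pos : forall x (v : 'rV[R]_n), v != 0 -> 0 < (v *m met x *m v^T) 0 0 ;
  met_smooth : forall p i j,
    smooth_on (cmap p @` cdom p)
      (fun y => let x := cinv p y in
                (jac p x x *m met x *m (jac p x x)^T) i j)
}.

Section RiemannianTheory.
Context {R : realType} {n : nat} (M : riemannian R n).
Implicit Types (p x : M).

Definition gram p x : 'M[R]_n := jac p x x *m met x *m (jac p x x)^T.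

Definition dgram p x (k i j : 'I_n) : R :=
  pderiv k (fun y => gram p (cinv p y) i j) (cmap p x).

(* [christoffel p x k i j] is the coefficient of d_j in nabla_{d_k} d_i, for the
   Levi-Civita connection in the chart p. *)
Definition christoffel p x (k : 'I_n) : 'M[R]_n :=
  \matrix_(i, j) (2^-1 * \sum_l invmx (gram p x) l j *
     (dgram p x k i l + dgram p x i k l - dgram p x l k i)).

(* [riem x k l] is the matrix, acting on rows, of the Riemann curvature
   R(d_k, d_l) = [nabla_{d_k}, nabla_{d_l}] in the chart at x. *)
Definition dchristoffel x (l k : 'I_n) : 'M[R]_n :=
  \matrix_(i, j) pderiv l (fun y => christoffel x (cinv x y) k i j) (cmap x x).

Definition riem x (k l : 'I_n) : 'M[R]_n :=
  dchristoffel x k l - dchristoffel x l k +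
  christoffel x x l *m christoffel x x k - christoffel x x k *m christoffel x x l.

(* Ric(Y, Z) is the trace of X |-> R(X, Y)Z. *)
Definition ricci x : 'M[R]_n := \matrix_(l, i) \sum_k riem x k l i k.

Definition ricci_flat : Prop := forall x, ricci x = 0.

(* The Riemannian measure: in a chart it is sqrt (det g) times the Lebesgue
   measure, tested on continuous functions with compact support in the chart. *)
Definition is_volume (vol : {measure set (borel M) -> \bar R}) : Prop :=
  forall p (f : M -> R), continuous f ->
    (exists K : set M, [/\ compact K, K `<=` cdom p &
                           forall x, ~ K x -> f x = 0]) ->
    (\int[vol]_x (f x)%:E)%E =
    (integralRn (fun y => (\1_(cmap p @` cdom p) y : R) *
       (f (cinv p y) * Num.sqrt (\det (gram p (cinv p y))))))%:E.

Definition cintegral (vol : {measure set (borel M) -> \bar R}) (f : M -> R[i]) :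
    R[i] :=
  Complex (\int[vol]_x (complex.Re (f x) : R)) (\int[vol]_x (complex.Im (f x) : R)).

End RiemannianTheory.

(* A Kaehler manifold of real dimension 2m: a Riemannian manifold with an
   orthogonal almost complex structure parallel for the Levi-Civita connection.
   The complex structure at x sends the row v to [v *m cpx x]. *)
Record kahler (R : realType) (m : nat) := Kahler {
  kman :> riemannian R m.*2 ;
  cpx : kman -> 'M[R]_(m.*2) ;
  cpx_in_chart := fun p x : kman => jac p x x *m cpx x *m jac x p x ;
  cpx_sqr : forall x, cpx x *m cpx x = - 1%:M ;
  cpx_orth : forall x, cpx x *m met x *m (cpx x)^T = met x ;
  cpx_smooth : forall p i j,
    smooth_on (cmap p @` cdom p) (fun y => cpx_in_chart p (cinv p y) i j) ;
  cpx_parallel : forall p x (k : 'I_(m.*2)), cdom p x ->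
    (\matrix_(i, j) pderiv k (fun y => cpx_in_chart p (cinv p y) i j) (cmap p x)) +
    cpx_in_chart p x *m christoffel p x k - christoffel p x k *m cpx_in_chart p x
    = 0
}.

Section Algebra.
Variables (A : pzRingType) (m : nat) (e : 'I_m -> 'I_m -> A).

(* e^q_{kl} = sum e_{k i_1} e_{i_1 i_2} ... e_{i_{q-1} l} *)
Fixpoint epow (q : nat) (k l : 'I_m) : A :=
  if q is q'.+1 then \sum_i e k i * epow q' i l else (k == l)%:R.

(* sum e_{i_1 k} e_{i_2 i_1} ... e_{l i_{q-1}} *)
Fixpoint epow_rev (q : nat) (k l : 'I_m) : A :=
  if q is q'.+1 then \sum_i e i k * epow_rev q' i l else (k == l)%:R.

Definition ctilde (q : nat) : A := (-1) ^+ q * \sum_k epow_rev q k k.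

(* K_n(- ctilde); the component j of t is the exponent i_{j+1} of ctilde_j. *)
Definition Kpoly (n : nat) : A :=
  \sum_(t : {ffun 'I_n -> 'I_n.+1} | (\sum_(j < n) j.+1 * t j == n)%N)
    ((\sum_(j < n) t j)`! %/ \prod_(j < n) (t j)`!)%N%:R *
    \prod_(j < n) ctilde j ^+ t j.

End Algebra.

Section Reps.
Context {R : realType} {m : nat}.
Local Notation C := R[i].

Definition dominant (rho : 'I_m -> int) : Prop :=
  forall i j : 'I_m, (i <= j)%N -> rho j <= rho i.

Definition addmu (rho : 'I_m -> int) (i : 'I_m) : 'I_m -> int :=
  fun j => rho j + (j == i)%:Z.
Definition submu (rho : 'I_m -> int) (i : 'I_m) : 'I_m -> int :=
  fun j => rho j - (j == i)%:Z.

(* Ordinals start at 0, whence the i.+1 for the index i = 1, ..., m. *)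
Definition wplus (rho : 'I_m -> int) (i : 'I_m) : int :=
  - rho i + i.+1%:Z - 1.
Definition wminus (rho : 'I_m -> int) (i : 'I_m) : int :=
  rho i + m%:Z - i.+1%:Z.

Section Subreps.
Context {F : vectType C}.
Implicit Types (act dact : 'M[C]_m -> F -> F) (W : {vspace F}).

Definition invariant_sub act W : Prop :=
  forall a, a \is unitarymx -> forall v, v \in W -> act a v \in W.

Definition irreducible_sub act W : Prop :=
  [/\ W <> 0%VS, invariant_sub act W &
      forall W', (W' <= W)%VS -> invariant_sub act W' -> W' = 0%VS \/ W' = W].

(* [dact] is the action of gl(m, C). *)
Definition has_highest_weight dact W (lam : 'I_m -> int) : Prop :=
  exists v, [/\ v \in W, v != 0,
    forall k, dact (delta_mx k k) v = (lam k)%:~R *: v &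
    forall k l : 'I_m, (k < l)%N -> dact (delta_mx k l) v = 0].

(* The irreducible summand of highest weight lam in a multiplicity free
   representation, and 0 if there is none. *)
Definition summand act dact (lam : 'I_m -> int) : {vspace F} :=
  xget 0%VS
    [set W | irreducible_sub act W /\ has_highest_weight dact W lam].

End Subreps.

Definition mx_derive0 a b (c : R -> 'M[C]_(a, b)) (X : 'M[C]_(a, b)) : Prop :=
  forall i j, is_derive (0 : R) 1 (fun t => complex.Re (c t i j)) (complex.Re (X i j)) /\
              is_derive (0 : R) 1 (fun t => complex.Im (c t i j)) (complex.Im (X i j)).

(* An irreducible unitary representation of U(m) with highest weight rho, on
   C^d (columns) with its standard Hermitian product. Only the values of [rmap]
   on U(m) matter; [rdiff] is the complex linear extension to gl(m, C) of the
   differential of [rmap] at 1. *)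
Record unirrep (rho : 'I_m -> int) := Unirrep {
  rdim : nat ;
  rmap : 'M[C]_m -> 'M[C]_rdim ;
  rdiff : {linear 'M[C]_m -> 'M[C]_rdim} ;
  rmap1 : rmap 1%:M = 1%:M ;
  rmapM : forall a b, a \is unitarymx -> b \is unitarymx ->
    rmap (a *m b) = rmap a *m rmap b ;
  rmap_unitary : forall a, a \is unitarymx -> rmap a \is unitarymx ;
  rdiffP : forall (c : R -> 'M[C]_m) (X : 'M[C]_m),
    (forall t, c t \is unitarymx) -> c 0 = 1%:M -> mx_derive0 c X ->
    mx_derive0 (rmap \o c) (rdiff X) ;
  rirr : irreducible_sub (fun a (v : 'cV[C]_rdim) => rmap a *m v) fullv ;
  rhw : has_highest_weight (fun X (v : 'cV[C]_rdim) => rdiff X *m v) fullv rho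
}.

Definition hdot d k (A B : 'M[C]_(d, k)) : C := \tr (A *m B ^t*).

Definition orth_proj d k (W : {vspace 'M[C]_(d, k)}) (A : 'M[C]_(d, k)) :
    'M[C]_(d, k) :=
  xget 0 [set B | B \in W /\ forall B', B' \in W -> hdot (A - B) B' = 0].

Section Tensor.
Context {rho : 'I_m -> int} (V : unirrep rho).
Local Notation d := (rdim V).

(* V (x) C^m and V (x) conj(C^m) are the spaces of d x m matrices: the column k
   is the coefficient of the k-th basis vector of C^m, resp. conj(C^m). The
   actions of gl(m, C) below are the derivatives of those of U(m); for the
   second one, conj(X)^T = - X for X in u(m). *)
Definition act_plus (a : 'M[C]_m) (A : 'M[C]_(d, m)) := rmap V a *m A *m a^T.
Definition dact_plus (X : 'M[C]_m) (A : 'M[C]_(d, m)) :=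
  rdiff V X *m A + A *m X^T.
Definition act_minus (a : 'M[C]_m) (A : 'M[C]_(d, m)) := rmap V a *m A *m a ^t*.
Definition dact_minus (X : 'M[C]_m) (A : 'M[C]_(d, m)) :=
  rdiff V X *m A - A *m X.

Definition Vplus (i : 'I_m) : {vspace 'M[C]_(d, m)} :=
  summand (@act_plus) (@dact_plus) (addmu rho i).
Definition Vminus (i : 'I_m) : {vspace 'M[C]_(d, m)} :=
  summand (@act_minus) (@dact_minus) (submu rho i).

Definition pi_e (k l : 'I_m) : 'M[C]_d := rdiff V (delta_mx k l).

End Tensor.
End Reps.

Arguments act_plus {R m rho} V a A.
Arguments dact_plus {R m rho} V X A.
Arguments act_minus {R m rho} V a A.
Arguments dact_minus {R m rho} V X A.

Section Bundles.
Context {R : realType} {m : nat} (M : kahler R m).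
Local Notation C := R[i].
Local Notation n := (m.*2).

(* A unitary frame of T^{1,0} at x is a matrix u whose rows are the components
   of eps_1, ..., eps_m in the chart at x. *)
Definition unitary_frame (x : M) (u : 'M[C]_(m, n)) : Prop :=
  u *m toC (cpx x) = 'i *: u /\ u *m toC (met x) *m u ^t* = 1%:M.

Definition local_frame (W : set M) (s : M -> 'M[C]_(m, n)) : Prop :=
  (forall x, W x -> unitary_frame x (s x)) /\
  forall p k j, csmooth_fun (W `&` cdom p)
                  (fun x => (s x *m toC (jac x p x)) k j).

Definition frame_at (x : M) : 'M[C]_(m, n) := xget 0 [set u | unitary_frame x u].

Definition frame_through (x : M) (u : 'M[C]_(m, n)) : M -> 'M[C]_(m, n) :=
  xget (fun=> 0) [set s | s x = u /\
                          exists W, [/\ open W, W x & local_frame W s]].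

(* The matrix omega(v) with nabla_v eps_l = sum_k omega_{kl}(v) eps_k, for the
   Levi-Civita connection and the local frame eps = s. *)
Definition connection_form (s : M -> 'M[C]_(m, n)) (x : M) (v : 'rV[C]_n) : 'M[C]_m :=
  let nabla_s := dirdermx (fun y => s y *m toC (jac y x y)) x v +
                 s x *m \sum_k (v 0 k *: toC (christoffel x x k)) in
  (nabla_s *m toC (met x) *m (s x) ^t*)^T.

(* A section of a bundle associated with the bundle U(M) of unitary frames, with
   fibre the d x k matrices, is given by its values on pairs (point, unitary
   frame), subject to equivariance under the right action of U(m) on frames,
   (eps . a)_l = sum_k eps_k a_{kl}. Its values elsewhere are irrelevant. *)
Definition sect d k := M -> 'M[C]_(m, n) -> 'M[C]_(d, k).

(* [b_act] is the action of U(m) on the fibre and [b_crd p x] gives the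
   components in the chart p of an element of the fibre at x (this is only
   nontrivial for T*M (x) S, whose forms are written in coordinates). *)
Record hbundle d k := HBundle {
  b_act : 'M[C]_m -> 'M[C]_(d, k) -> 'M[C]_(d, k) ;
  b_crd : M -> M -> 'M[C]_(d, k) -> 'M[C]_(d, k) ;
  b_herm : M -> 'M[C]_(d, k) -> 'M[C]_(d, k) -> C
}.

Definition Gamma d k (B : hbundle d k) : set (sect d k) :=
  [set phi |
    (forall x u a, unitary_frame x u -> a \is unitarymx ->
       b_act B a (phi x (a^T *m u)) = phi x u) /\
    (forall W s, open W -> local_frame W s -> forall p i j,
       csmooth_fun (W `&` cdom p) (fun x => b_crd B p x (phi x (s x)) i j))].

Definition Gamma_sub d k (B : hbundle d k) (W : {vspace 'M[C]_(d, k)}) :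
    set (sect d k) :=
  [set phi | Gamma B phi /\ forall x u, unitary_frame x u -> phi x u \in W].

Definition compactly_supported d k (phi : sect d k) : Prop :=
  exists2 K : set M, compact K &
    forall x u, ~ K x -> unitary_frame x u -> phi x u = 0.

Definition L2dot (vol : {measure set (borel M) -> \bar R}) d k (B : hbundle d k)
    (phi psi : sect d k) : C :=
  cintegral vol
    (fun x => b_herm B x (phi x (frame_at x)) (psi x (frame_at x))).

Definition formal_adjoint (vol : {measure set (borel M) -> \bar R}) d k d' k'
    (E : hbundle d k) (GE : set (sect d k))
    (F : hbundle d' k') (GF : set (sect d' k'))
    (D : sect d k -> sect d' k') (Dstar : sect d' k' -> sect d k) : Prop :=
  forall psi, GF psi -> GE (Dstar psi) /\
    forall phi, GE phi -> compactly_supported phi ->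
      L2dot vol F (D phi) psi = L2dot vol E phi (Dstar psi).

Section Gradients.
Context {rho : 'I_m -> int} (V : unirrep (R := R) rho).
Local Notation d := (rdim V).

Definition S_bundle : hbundle d 1 :=
  HBundle (fun a v => rmap V a *m v) (fun _ _ v => v) (fun _ => hdot (k := 1)).
(* S (x) T^{1,0} = S (x) Lambda^{0,1} *)
Definition S10_bundle : hbundle d m :=
  HBundle (act_plus V) (fun _ _ A => A) (fun _ => hdot (k := m)).
(* S (x) T^{0,1} = S (x) Lambda^{1,0} *)
Definition S01_bundle : hbundle d m :=
  HBundle (act_minus V) (fun _ _ A => A) (fun _ => hdot (k := m)).
(* S (x) (T*M (x) C); the column j is the value of the form on d_j in the chart
   at x. *)
Definition SForm_bundle : hbundle d n :=
  HBundle (fun a A => rmap V a *m A)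
          (fun p x A => A *m (toC (jac p x x))^T)
          (fun x A B => \tr (A *m toC (invmx (met x)) *m B ^t*)).

(* nabla_v phi in the frame u, for a complex tangent vector v at x. *)
Definition nabla_at (phi : sect d 1) (x : M) (u : 'M[C]_(m, n)) (v : 'rV[C]_n) :
    'cV[C]_d :=
  let s := frame_through x u in
  dirdermx (fun y => phi y (s y)) x v +
  rdiff V (connection_form s x v) *m phi x u.

Definition nabla (phi : sect d 1) : sect d n :=
  fun x u => \matrix_(i, j) nabla_at phi x u (delta_mx 0 j) i 0.

(* nabla^{0,1} phi = sum_k nabla_{conj eps_k} phi (x) eps_k *)
Definition nabla01 (phi : sect d 1) : sect d m :=
  fun x u => \matrix_(i, k) nabla_at phi x u (conjmx (row k u)) i 0.

(* nabla^{1,0} phi = sum_k nabla_{eps_k} phi (x) conj eps_k *)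
Definition nabla10 (phi : sect d 1) : sect d m :=
  fun x u => \matrix_(i, k) nabla_at phi x u (row k u) i 0.

Definition Dplus (i : 'I_m) (phi : sect d 1) : sect d m :=
  fun x u => orth_proj (Vplus V i) (nabla01 phi x u).
Definition Dminus (i : 'I_m) (phi : sect d 1) : sect d m :=
  fun x u => orth_proj (Vminus V i) (nabla10 phi x u).

Definition Gamma_S : set (sect d 1) := Gamma S_bundle.
Definition Gamma_Splus (i : 'I_m) : set (sect d m) :=
  Gamma_sub S10_bundle (Vplus V i).
Definition Gamma_Sminus (i : 'I_m) : set (sect d m) :=
  Gamma_sub S01_bundle (Vminus V i).

Definition nabla_field (X : M -> 'rV[C]_n) (phi : sect d 1) : sect d 1 :=
  fun x u => nabla_at phi x u (X x).

Definition curvature (X Y : M -> 'rV[C]_n) (phi : sect d 1) : sect d 1 :=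
  fun x u => nabla_field X (nabla_field Y phi) x u
           - nabla_field Y (nabla_field X phi) x u
           - nabla_field (bracket X Y) phi x u.

(* R^q_rho = sum_{k,l} pi_rho (e^q_{lk}) R_rho (eps_k, conj eps_l) *)
Definition Rq (q : nat) (phi : sect d 1) : sect d 1 :=
  fun x u =>
    let s := frame_through x u in
    \sum_k \sum_l epow (pi_e V) q l k *m
      curvature (fun y => row k (s y)) (fun y => conjmx (row l (s y))) phi x u.

End Gradients.
End Bundles.

Arguments S_bundle {R m} M {rho} V.
Arguments S10_bundle {R m} M {rho} V.
Arguments S01_bundle {R m} M {rho} V.
Arguments SForm_bundle {R m} M {rho} V.
Arguments Gamma_S {R m} M {rho} V _.
Arguments Gamma_Splus {R m} M {rho} V i _.
Arguments Gamma_Sminus {R m} M {rho} V i _.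
Arguments nabla {R m} M {rho} V phi x u.
Arguments nabla01 {R m} M {rho} V phi x u.
Arguments nabla10 {R m} M {rho} V phi x u.
Arguments Dplus {R m} M {rho} V i phi x u.
Arguments Dminus {R m} M {rho} V i phi x u.
Arguments Rq {R m} M {rho} V q phi x u.

(* Main.v *)
(* Sections are tested against sections supported in a chart, so every identity
   only has to be proved weakly. The operator e = (e_kl) on V (x) conj(C^m) acts
   on the summand V_{rho - mu_i} as w_{-i}, and minus its transpose acts on
   V_{rho + mu_i} in V (x) C^m as w_{+i}; so sum_i w_{-i}^q Pi_{-i} is e^q, and
   the powers of the transpose are related to those of e through the polynomials
   K_n(- ctilde). In real coordinates, with eps_k = sum_j S_k^j d_j, put
     M^{ji} = sum_{k,l} conj(S_k^j) S_l^i e^q_{kl},   N^{ji} = M^{ji} - M^{ij}.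
   The field N is parallel and skew, hence by the Ricci identity the vector field
   Z^j = <phi', sum_i N^{ji} nabla_i phi> has divergence
     <nabla10 phi', e^q nabla10 phi> - <nabla01 phi', (e^q)^T nabla01 phi>
       - <phi', R^q phi>.
   Its integral vanishes for phi' supported in the chart: every linear relation
   between powers of e and projections becomes a Bochner-Weitzenboeck formula.
   Solving (3) for the D_{-i}^* D_{-i} is Lagrange interpolation at the distinct
   points w_{-i} - m. *)

Require Import Defs.
From HB Require Import structures.
From mathcomp Require Import all_boot all_order all_algebra.
From mathcomp Require Import all_classical all_reals all_analysis.
From mathcomp Require Import complex spectral perm.
From mathcomp Require Import ring lra zify.
Import Order.TTheory GRing.Theory Num.Theory.
Import numFieldNormedType.Exports.

Set Implicit Arguments.
Unset Strict Implicit.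
Unset Printing Implicit Defensive.

Local Open Scope classical_set_scope.
Local Open Scope ring_scope.
Local Open Scope sesquilinear_scope.

(** No decomposition of V (x) C^m is assumed: the summands are defined by choice and might be 0.
    They exhaust the space because an invariant complement would contain a highest weight vector;
    its weight must be some rho +- mu_k, so the k-th summand is nonzero, and such a vector is unique
    up to a scalar. Dominance makes the conformal weights distinct, hence the summands orthogonal.
    The representation is differentiable only along curves of unitary matrices through 1. Facts
    about [rdiff] are therefore proved on the one-parameter groups of orthogonal projections; these
    projections span gl(m, C) and their groups generate U(m). The measure is known only through
    continuous functions supported in one chart. Test sections are supported in half of a chart
    ball, so that they and their derivatives vanish outside the whole ball. Since formal adjoints
    produce smooth sections, a weak identity becomes pointwise on testing the difference of its
    sides against a cutoff multiple of itself. The skewness of N is what reduces second derivatives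
    to curvature and the Christoffel terms to the derivative of the density. *)

Local Notation cjmx := Defs.conjmx.

(** * Differential calculus on Euclidean space *)

Section EuclideanCalculus.
Context {R : realType}.

Section FixedDim.
Context {n : nat}.
Implicit Types (U : set 'rV[R]_n) (f g : 'rV[R]_n -> R) (y v : 'rV[R]_n).
Local Notation e_ j := (delta_mx 0 j : 'rV[R]_n).

Lemma rV_norm_le v (c : R) : 0 <= c -> (forall i, `|v 0 i| <= c) -> `|v| <= c.
Proof.
move=> c0 H; rewrite /Num.Def.normr/= mx_normrE; apply: bigmax_le => // -[i j] _ /=.
by rewrite (ord1 i).
Qed.

Lemma rV_coord_le v i : `|v 0 i| <= `|v|.
Proof. rewrite [leRHS]/Num.Def.normr/= mx_normrE; exact: (le_bigmax _ (fun x : 'I_1 * 'I_n => `|v x.1 x.2|) (0, i)). Qed.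

Lemma nbhs_rV_ball y (A : set 'rV[R]_n) :
  nbhs y A -> exists2 r, 0 < r & forall z, `|z - y| < r -> A z.
Proof.
move=> /nbhs_ballP[r /= r0 H]; exists r => // z zr; apply: H.
by rewrite mx_norm_ball /ball_/= distrC.
Qed.

Lemma ball_nbhs_rV y r (A : set 'rV[R]_n) : 0 < r ->
  (forall z, `|z - y| < r -> A z) -> nbhs y A.
Proof.
move=> r0 H; apply/nbhs_ballP; exists r => // z; rewrite mx_norm_ball /ball_/= distrC; exact: H.
Qed.

Lemma pderiv_ext U f g j y : open U -> (forall z, U z -> f z = g z) -> U y ->
  pderiv j f y = pderiv j g y.
Proof.
move=> oU fg Uy; apply: near_eq_derive.
have nU : nbhs y U by exact: open_nbhs_nbhs.
by apply: (@filterS _ _ _ U) => // z /fg.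
Qed.

Lemma derivable_open_ext U f g v y : open U -> (forall z, U z -> f z = g z) -> U y ->
  derivable f y v -> derivable g y v.
Proof.
move=> oU fg Uy; apply: near_eq_derivable.
have nU : nbhs y U by exact: open_nbhs_nbhs.
by apply: (@filterS _ _ _ U) => // z /fg.
Qed.

Lemma continuous_open_ext U f g y : open U -> (forall z, U z -> f z = g z) -> U y ->
  {for y, continuous f} -> {for y, continuous g}.
Proof.
move=> oU fg Uy; rewrite /prop_for /continuous_at -(fg y Uy) => cf.
have nU : nbhs y U by exact: open_nbhs_nbhs.
have H : \forall z \near y, f z = g z by apply: filterS nU => z /fg.
exact: (cvg_trans (near_eq_cvg H) cf).
Qed.

Lemma Ck_on_ext k U f g : open U -> (forall z, U z -> f z = g z) ->
  Ck_on k U f -> Ck_on k U g.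
Proof.
move=> oU; elim: k f g => [|k IH] f g fg /= [cf H]; split=> //;
  try by move=> y Uy; exact: (continuous_open_ext oU fg Uy (cf y Uy)).
move=> j; have [d1 d2] := H j; split.
- by move=> y Uy; exact: (derivable_open_ext oU fg Uy (d1 y Uy)).
- by apply: IH d2 => z Uz; exact: (pderiv_ext j oU fg Uz).
Qed.

Lemma Ck_on_sub k U U' f : U' `<=` U -> Ck_on k U f -> Ck_on k U' f.
Proof.
move=> sU; elim: k f => [|k IH] f /= [cf H]; split=> //; first by move=> y /sU/cf.
- by move=> y /sU/cf.
- by move=> j; have [d1 d2] := H j; split; [move=> y /sU/d1|exact: IH].
Qed.

(** The sets V i may be arbitrary: each clause of [Ck_on] is a condition at single points. *)
Lemma Ck_on_setU k (I : Type) (V : I -> set 'rV[R]_n) U f :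
  (forall y, U y -> exists i, V i y) -> (forall i, Ck_on k (V i) f) -> Ck_on k U f.
Proof.
move=> cov; elim: k f => [|k IH] f H /=; split=> //.
- by move=> y /cov[i Viy]; apply: (H i).1.
- by move=> y /cov[i Viy]; apply: (H i).1.
- move=> j; split; first by move=> y /cov[i Viy]; apply: ((H i).2 j).1.
  by apply: IH => i; exact: ((H i).2 j).2.
Qed.

Lemma Ck_on_pred k U f : Ck_on k.+1 U f -> Ck_on k U f.
Proof.
elim: k f => [|k IH] f [cf H] //; split=> // j.
by have [d1 d2] := H j; split=> //; exact: IH.
Qed.

Lemma Ck_on_cst k U c : Ck_on k U (fun=> c).
Proof.
elim: k c => [|k IH] c; split=> //; try by move=> y _; exact: cst_continuous.
move=> j; split; first by move=> y _; exact: (derivable_cst c y _).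
have -> : pderiv j (fun=> c) = (fun=> 0) :> ('rV[R]_n -> R) by apply: funext => y; exact: derive_cst.
exact: IH.
Qed.

Lemma Ck_on_add k U f g : open U -> Ck_on k U f -> Ck_on k U g ->
  Ck_on k U (fun y => f y + g y).
Proof.
move=> oU; elim: k f g => [|k IH] f g [cf Hf] [cg Hg]; split=> //;
  try by move=> y Uy; apply: continuousD; [exact: cf|exact: cg].
move=> j; have [f1 f2] := Hf j; have [g1 g2] := Hg j; split.
  by move=> y Uy; apply: derivableD; [exact: f1|exact: g1].
apply: Ck_on_ext (IH _ _ f2 g2) => // y Uy; rewrite /pderiv.
by rewrite -deriveD; [|exact: f1|exact: g1].
Qed.

Lemma Ck_on_mul k U f g : open U -> Ck_on k U f -> Ck_on k U g ->
  Ck_on k U (fun y => f y * g y).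
Proof.
move=> oU; elim: k f g => [|k IH] f g Hf0 Hg0; have [cf Hf] := Hf0; have [cg Hg] := Hg0; split=> //;
  try by move=> y Uy; apply: continuousM; [exact: cf|exact: cg].
move=> j; have [f1 f2] := Hf j; have [g1 g2] := Hg j; split.
  by move=> y Uy; apply: derivableM; [exact: f1|exact: g1].
have := Ck_on_add oU (IH _ _ (Ck_on_pred Hf0) g2) (IH _ _ (Ck_on_pred Hg0) f2).
apply: Ck_on_ext => // y Uy; rewrite /pderiv.
by rewrite [in RHS](_ : (fun _ => _) = f * g)// deriveM; [|exact: f1|exact: g1].
Qed.

Lemma line_derive f y v t : derivable f (y + t *: v) v ->
  is_derive t 1 (fun s : R => f (y + s *: v)) ('D_v f (y + t *: v)).
Proof.
move=> df.
have E : (fun h : R => h^-1 *: (((fun s => f (y + s *: v)) \o shift t) (h *: (1:R)) - f (y + t *: v)))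
       = (fun h : R => h^-1 *: ((f \o shift (y + t *: v)) (h *: v) - f (y + t *: v))).
  apply: funext => h /=; congr (_ *: (f _ - _)).
  by rewrite [_%:A]mulr1 scalerDl addrCA.
by apply: DeriveDef; rewrite /derivable /derive E.
Qed.

(** Increments of both signs are covered, since difference quotients approach 0 from both sides. *)
Lemma line_MVT f y v (t : R) :
  (forall s : R, `|s| <= `|t| -> derivable f (y + s *: v) v) ->
  exists2 s : R, `|s| <= `|t| & f (y + t *: v) - f y = t * 'D_v f (y + s *: v).
Proof.
move=> df; pose F (s : R) := f (y + s *: v).
have dF (s : R) : `|s| <= `|t| -> is_derive s 1 F ('D_v f (y + s *: v)).
  by move=> st; exact/line_derive/df.
have cF (a b : R) : (forall s : R, s \in `[a, b] -> `|s| <= `|t|) -> {within `[a, b], continuous F}.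
  move=> H; apply: derivable_within_continuous => s /H st.
  by have [] := dF s st.
have F0 : F 0 = f y by rewrite /F scale0r addr0.
have [t0|t0] := leP 0 t.
- have H (s : R) : s \in `[0, t] -> `|s| <= `|t|.
    by rewrite in_itv /= => /andP[s0 st]; rewrite !ger0_norm.
  have [|c /H ct E] := @MVT_segment _ F (fun s => 'D_v f (y + s *: v)) _ _ t0 _ (cF _ _ H).
    move=> s; rewrite in_itv /= => /andP[/ltW s0 /ltW st].
    by apply: dF; rewrite !ger0_norm.
  by exists c => //; rewrite -F0 E subr0 mulrC.
- have H (s : R) : s \in `[t, 0] -> `|s| <= `|t|.
    by rewrite in_itv /= => /andP[s0 st]; rewrite (ler0_norm st) (ltr0_norm t0) lerN2.
  have [|c /H ct E] := @MVT_segment _ F (fun s => 'D_v f (y + s *: v)) _ _ (ltW t0) _ (cF _ _ H).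
    by move=> s; rewrite in_itv /= => /andP[s0 st]; apply/dF/H; rewrite in_itv/= !ltW.
  exists c => //; have : F t - F 0 = - ('D_v f (y + c *: v) * (0 - t)) by rewrite -E opprB.
  by rewrite F0 sub0r mulrN opprK mulrC.
Qed.

(** The points y + [prefix l v] are the corners of a staircase from y to y + v with edges parallel
    to the axes. *)
Definition prefix (l : nat) v : 'rV[R]_n := \row_i (if (i < l)%N then v 0 i else 0).

Lemma prefix0 v : prefix 0 v = 0.
Proof. by apply/rowP => i; rewrite !mxE. Qed.

Lemma prefix_full v : prefix n v = v.
Proof. by apply/rowP => i; rewrite !mxE ltn_ord. Qed.

Lemma prefixS (l : 'I_n) v : prefix l.+1 v = prefix l v + v 0 l *: e_ l.
Proof.
apply/rowP => i; rewrite !mxE eqxx /= ltnS leq_eqVlt (inj_eq val_inj).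
have [->|il] := eqVneq i l; first by rewrite ltnn /= add0r mulr1.
by rewrite /= mulr0 addr0.
Qed.

(** Caratheodory's form of differentiability: an exact expansion whose coefficients tend to the
    partial derivatives as v tends to 0. It composes with a curve without dividing by the increments
    of the curve. The increment of f is telescoped along the staircase of [prefix], with the mean
    value theorem on each edge. *)
Lemma C1_caratheodory U f y : open U -> Ck_on 1 U f -> U y ->
  exists q : 'I_n -> 'rV[R]_n -> R,
    (forall v, f (y + v) - f y = \sum_i v 0 i * q i v) /\
    (forall i (e : R), 0 < e -> exists2 r, 0 < r &
      forall v, `|v| < r -> `|pderiv i f y - q i v| <= e).
Proof.
move=> oU [cf H] Uy.
(* The slope along the i-th edge. On an edge of length 0 any value satisfies the expansion, and the
   partial derivative keeps the limit. *)
pose q (i : 'I_n) v := if v 0 i == 0 then pderiv i f y else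
  (v 0 i)^-1 * (f (y + prefix i.+1 v) - f (y + prefix i v)).
exists q; split.
  move=> v; have E (i : 'I_n) : v 0 i * q i v = f (y + prefix i.+1 v) - f (y + prefix i v).
    rewrite /q; case: eqP => [v0|/eqP v0]; last by rewrite mulrA divff ?mul1r.
    by rewrite prefixS v0 scale0r addr0 mul0r subrr.
  under eq_bigr do rewrite E.
  pose F l := f (y + prefix l v).
  rewrite -(big_mkord xpredT (fun i => F i.+1 - F i)) telescope_sumr //.
  by rewrite /F prefix_full prefix0 addr0.
move=> i e e0.
have [d1 [c2 _]] := H i.
have nU : nbhs y (U `&` [set z | `|pderiv i f y - pderiv i f z| <= e]).
  apply: filterI; first exact: open_nbhs_nbhs.
  by have /cvgrPdist_le /(_ e e0) := c2 y Uy.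
have [r r0 Hr] := nbhs_rV_ball nU.
exists r => // v vr.
rewrite /q; case: eqP => [_|/eqP vi0]; first by rewrite subrr normr0 ltW.
have pr (s : R) : `|s| <= `|v 0 i| -> `|y + prefix i v + s *: e_ i - y| < r.
  move=> sv; rewrite -(addrA y) [y + (_ + _)]addrC addrK; apply: le_lt_trans vr.
  apply: rV_norm_le => // j; rewrite !mxE eqxx /=.
  have [->|ji] := eqVneq j i; first by rewrite ltnn add0r mulr1 (le_trans sv) ?rV_coord_le.
  by rewrite mulr0 addr0; case: ifP => _; rewrite ?rV_coord_le ?normr0.
have [|s sv E] := @line_MVT f (y + prefix i v) (e_ i) (v 0 i).
  by move=> s /pr/Hr[Us _]; exact: d1.
rewrite prefixS addrA E mulrA mulVf // mul1r.
by have [_] := Hr _ (pr s sv).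
Qed.

End FixedDim.

(** The inner map is differentiable in the single direction v. The expansion of [C1_caratheodory],
    taken at the increments of h along v, makes the difference quotient a sum of products of
    convergent factors. *)
Lemma chain_rule n (V : normedModType R) (U : set 'rV[R]_n) (f : 'rV[R]_n -> R)
    (h : V -> 'rV[R]_n) x v (d : 'I_n -> R) : open U -> Ck_on 1 U f -> U (h x) ->
  (forall i, is_derive x v (fun z => h z 0 i) (d i)) ->
  is_derive x v (f \o h) (\sum_i d i * pderiv i f (h x)).
Proof.
move=> oU Cf Uh dh; have [q [Eq Cq]] := C1_caratheodory oU Cf Uh.
suff cv : (fun t : R => t^-1 *: (((f \o h) \o shift x) (t *: v) - (f \o h) x)) t @[t --> 0^'] -->
    \sum_i d i * pderiv i f (h x).
  by apply: DeriveDef; [apply/cvg_ex; eexists; exact: cv|apply: cvg_lim].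
have E : (fun t : R => t^-1 *: (((f \o h) \o shift x) (t *: v) - (f \o h) x)) =
  fun t : R => \sum_i (t^-1 *: (((fun z => h z 0 i) \o shift x) (t *: v) - h x 0 i)) *
                   q i (h (t *: v + x) - h x).
  apply: funext => t /=; rewrite -[in f (h (_ + _))](subrK (h x) (h _)) addrC.
  rewrite [X in _ *: (- _ + f X)]addrC [X in _ *: X]addrC Eq scaler_sumr; apply: eq_bigr => i _.
  by rewrite !mxE; rewrite /GRing.scale /= mulrA.
have dhi i : (fun t : R => t^-1 *: (((fun z => h z 0 i) \o shift x) (t *: v) - h x 0 i)) t
     @[t --> 0^'] --> d i.
  by have [d1 <-] := dh i; exact: d1.
rewrite E; apply: cvg_big; first exact: add_continuous.
move=> i _; apply: cvgM; first exact: dhi.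
apply/cvgrPdist_le => /= e e0; have [r r0 Hr] := Cq i e e0.
(* h is continuous along the line, because its increment is t times a convergent difference
   quotient. *)
have hc : \forall t \near (0:R)^', forall j : 'I_n, `|h (t *: v + x) 0 j - h x 0 j| < r / 2.
  apply: filter_forall => j.
  have cj : (fun t : R => t * (t^-1 *: (((fun z => h z 0 j) \o shift x) (t *: v) - h x 0 j))) t
      @[t --> 0^'] --> 0 * d j.
    by apply: cvgM; [exact: cvg_within|exact: dhi].
  have r2 : 0 < r / 2 by rewrite divr_gt0.
  move/cvgrPdist_lt : cj => /(_ _ r2); rewrite mul0r => cj; near=> t.
  have t0 : t != 0 by near: t; exact: nbhs_dnbhs_neq.
  have : `|0 - t * (t^-1 *: (h (t *: v + x) 0 j - h x 0 j))| < r / 2 by near: t; exact: cj.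
  by rewrite sub0r normrN /GRing.scale /= mulrA divff // mul1r.
apply: filterS hc => t ht; apply: Hr.
apply: (@le_lt_trans _ _ (r / 2)); last by rewrite ltr_pdivrMr // ltr_pMr // ltr1n.
by apply: rV_norm_le => [|j]; [rewrite divr_ge0 // ltW|rewrite !mxE ltW].
Unshelve. all: by end_near. Qed.

Lemma is_derive_shift_arg n (f : 'rV[R]_n -> R) (y v w : 'rV[R]_n) :
  derivable f (y + w) v -> is_derive y v (fun z => f (z + w)) ('D_v f (y + w)).
Proof.
move=> df.
have E : (fun h : R => h^-1 *: (((fun z => f (z + w)) \o shift y) (h *: v) - f (y + w)))
       = (fun h : R => h^-1 *: ((f \o shift (y + w)) (h *: v) - f (y + w))).
  by apply: funext => h /=; rewrite addrA.
by apply: DeriveDef; rewrite /derivable /derive E.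
Qed.

Section Schwarz.
Context {n : nat} (U : set 'rV[R]_n) (f : 'rV[R]_n -> R) (y : 'rV[R]_n).
Hypothesis Cf : Ck_on 2 U f.
Local Notation e_ j := (delta_mx 0 j : 'rV[R]_n).

(** Two uses of the mean value theorem. The second difference is symmetric in i and j, so both mixed
    derivatives, at points near y, are the same number divided by t^2; continuity then gives
    [schwarz]. *)
Lemma second_difference (i j : 'I_n) (r t : R) : (forall z, `|z - y| < r -> U z) ->
  `|t| + `|t| < r ->
  exists2 z, `|z - y| < r &
    f (y + t *: e_ i + t *: e_ j) - f (y + t *: e_ i) - (f (y + t *: e_ j) - f y)
    = t * (t * pderiv j (pderiv i f) z).
Proof.
move=> Hr tr; have [cf H] := Cf; have [di [ci Hi]] := H i; have [dj _] := Hi j.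
have ne (k : 'I_n) (s : R) : `|s *: e_ k| <= `|s|.
  apply: rV_norm_le => // l; rewrite !mxE eqxx /=.
  by case: (l == k); rewrite ?mulr1 ?mulr0 ?normr0.
have inU (s s' : R) : `|s| <= `|t| -> `|s'| <= `|t| -> `|y + s *: e_ i + s' *: e_ j - y| < r.
  move=> st st'; rewrite -(addrA y) [y + (_ + _)]addrC addrK; apply: le_lt_trans tr.
  by apply: (le_trans (ler_normD _ _)); apply: lerD; exact: le_trans (ne _ _) _.
pose G z := f (z + t *: e_ j) + - f z.
have t0 : `|0 : R| <= `|t| by rewrite normr0.
have inU0 (s : R) : `|s| <= `|t| -> `|y + s *: e_ i - y| < r.
  by move=> st; have := inU s 0 st t0; rewrite scale0r addr0.
have dG (s : R) : `|s| <= `|t| -> is_derive (y + s *: e_ i) (e_ i) G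
   (pderiv i f (y + s *: e_ i + t *: e_ j) + - pderiv i f (y + s *: e_ i)).
  move=> st; apply: is_deriveD.
    by apply: is_derive_shift_arg; apply/di/Hr/inU.
  by apply: is_deriveN; apply: derivableP; apply/di/Hr/inU0.
have [|s st Es] := @line_MVT _ G y (e_ i) t; first by move=> s /dG[].
have [|s' st' Es'] := @line_MVT _ (pderiv i f) (y + s *: e_ i) (e_ j) t.
  by move=> s' st'; apply/dj/Hr/inU.
exists (y + s *: e_ i + s' *: e_ j); first exact: inU.
rewrite -[pderiv j (pderiv i f) _]/('D_(e_ j) (pderiv i f) _) -Es'.
by have [_ <-] := dG s st; rewrite -Es.
Qed.
End Schwarz.

Lemma schwarz n (U : set 'rV[R]_n) f y (i j : 'I_n) : open U -> Ck_on 2 U f -> U y ->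
  pderiv i (pderiv j f) y = pderiv j (pderiv i f) y.
Proof.
move=> oU Cf Uy; have [cf H] := Cf; have [_ [_ Hi]] := H i; have [_ [_ Hj]] := H j.
have [_ [cij _]] := Hi j; have [_ [cji _]] := Hj i.
apply/eqP; rewrite -subr_eq0 -normr_le0; apply/ler_addgt0Pl => e e0; rewrite addr0.
have e2 : 0 < e / 2 by rewrite divr_gt0.
have nU : nbhs y (U `&` ([set z | `|pderiv j (pderiv i f) y - pderiv j (pderiv i f) z| <= e / 2] `&`
   [set z | `|pderiv i (pderiv j f) y - pderiv i (pderiv j f) z| <= e / 2])).
  apply: filterI; first exact: open_nbhs_nbhs.
  apply: filterI.
    by have /cvgrPdist_le /(_ _ e2) := cij y Uy.
  by have /cvgrPdist_le /(_ _ e2) := cji y Uy.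
have [r r0 Hr] := nbhs_rV_ball nU.
have HU z : `|z - y| < r -> U z by move=> /Hr[].
have [t t0 tr] : exists2 t : R, 0 < t & `|t| + `|t| < r.
  by exists (r / 3); rewrite ?gtr0_norm ?divr_gt0 //; lra.
have [z1 /Hr[_ [z1e _]] E1] := second_difference Cf i j HU tr.
have [z2 /Hr[_ [_ z2e]] E2] := second_difference Cf j i HU tr.
have E : pderiv j (pderiv i f) z1 = pderiv i (pderiv j f) z2.
  have tn : t != 0 by rewrite gt_eqF.
  have S (a b c d : R) : a - b - (c - d) = a - c - (b - d) by ring.
  have C : y + t *: (delta_mx 0 j : 'rV[R]_n) + t *: (delta_mx 0 i : 'rV[R]_n) =
           y + t *: (delta_mx 0 i : 'rV[R]_n) + t *: (delta_mx 0 j : 'rV[R]_n) by exact: addrAC.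
  rewrite C in E2; apply: (mulfI tn); apply: (mulfI tn).
  by apply: etrans E2; apply: etrans (esym E1) _; exact: S.
move: z1e z2e; rewrite [X in X -> _]/= [X in _ -> X -> _]/= E.
move: (pderiv i _ z2) (pderiv j _ y) (pderiv i _ y) => a b c; rewrite (distrC b) => H1 H2.
apply: le_trans (ler_distD a _ _) _; rewrite [e](splitr e) lerD // distrC //.
Qed.

Lemma Ck_on_leq n k l (U : set 'rV[R]_n) f : (k <= l)%N -> Ck_on l U f -> Ck_on k U f.
Proof.
move=> kl; rewrite -(subnKC kl); elim: (l - k)%N => [|d IH]; first by rewrite addn0.
by rewrite addnS => /Ck_on_pred.
Qed.

Lemma Ck_on_sum n k (U : set 'rV[R]_n) I (r : seq I) (f : I -> 'rV[R]_n -> R) : open U ->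
  (forall i, Ck_on k U (f i)) -> Ck_on k U (fun y => \sum_(i <- r) f i y).
Proof.
move=> oU H; elim: r => [|i r IH].
  by apply: (@Ck_on_ext n k U (fun=> 0)) => //; [move=> y _; rewrite big_nil|exact: Ck_on_cst].
apply: (@Ck_on_ext n k U (fun y => f i y + \sum_(j <- r) f j y)) => //.
  by move=> y _; rewrite big_cons.
exact: Ck_on_add.
Qed.

Lemma Ck_on_coord n k (U : set 'rV[R]_n) (i : 'I_n) : open U -> Ck_on k U (fun y => y 0 i).
Proof.
move=> oU; have cc y : {for y, continuous (fun y : 'rV[R]_n => y 0 i)} by exact: coord_continuous.
have dc y j : is_derive y (delta_mx 0 j : 'rV[R]_n) (fun y : 'rV[R]_n => y 0 i) (i == j)%:R.
  have E : (fun h : R => h^-1 *: (((fun y : 'rV[R]_n => y 0 i) \o shift y) (h *: (delta_mx 0 j : 'rV[R]_n)) - y 0 i))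
     = (fun h : R => h^-1 * h * (i == j)%:R).
    by apply: funext => h /=; rewrite !mxE eqxx /= addrK /GRing.scale /= mulrA.
  have cv : (fun h : R => h^-1 *: (((fun y : 'rV[R]_n => y 0 i) \o shift y) (h *: (delta_mx 0 j : 'rV[R]_n)) - y 0 i)) h @[h --> 0^'] --> ((i == j)%:R : R).
    have H : \forall h \near (0:R)^', ((i == j)%:R : R) = h^-1 * h * (i == j)%:R.
      near=> h; have h0 : h != 0 by near: h; exact: nbhs_dnbhs_neq.
      by rewrite mulVf // mul1r.
    by rewrite E; exact: (cvg_trans (near_eq_cvg H) (cvg_cst _)).
  by apply: DeriveDef; [apply/cvg_ex; eexists; exact: cv|apply: cvg_lim].
elim: k => [|k IH]; split=> // j; split; first by move=> y _; case: (dc y j).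
apply: (@Ck_on_ext n k U (fun=> (i == j)%:R)) => //; last exact: Ck_on_cst.
by move=> y _; have [_ <-] := dc y j.
Unshelve. all: by end_near. Qed.

Lemma continuous_rV (T : topologicalType) n (h : T -> 'rV[R]_n) x :
  (forall i, {for x, continuous (fun z => h z 0 i)}) -> {for x, continuous h}.
Proof.
move=> H A /nbhs_rV_ball[r r0 Hr].
have r2 : 0 < r / 2 by rewrite divr_gt0.
have : \forall z \near x, forall i : 'I_n, `|h x 0 i - h z 0 i| < r / 2.
  by apply: filter_forall => i; have /cvgrPdist_lt /(_ _ r2) := H i.
apply: filterS => z Hz; apply: Hr.
apply: (@le_lt_trans _ _ (r / 2)); last by rewrite ltr_pdivrMr // ltr_pMr // ltr1n.
by apply: rV_norm_le => [|j]; [exact: ltW|rewrite !mxE distrC ltW].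
Qed.

Lemma derivable_chain n l (U : set 'rV[R]_n) (V : set 'rV[R]_l) f (h : 'rV[R]_n -> 'rV[R]_l) y
    (j : 'I_n) : open V -> Ck_on 1 V f -> U y -> V (h y) -> (forall i, Ck_on 1 U (fun y => h y 0 i)) ->
  is_derive y (delta_mx 0 j : 'rV[R]_n) (f \o h)
     (\sum_i pderiv j (fun y => h y 0 i) y * pderiv i f (h y)).
Proof.
move=> oV Cf Uy Vy Ch; apply: chain_rule oV Cf Vy _ => i.
by have [_ /(_ j)[/(_ y Uy) d _]] := Ch i; exact: derivableP.
Qed.

Lemma Ck_on_comp n l k (U : set 'rV[R]_n) (V : set 'rV[R]_l) f (h : 'rV[R]_n -> 'rV[R]_l) :
  open U -> open V -> (forall y, U y -> V (h y)) -> Ck_on k V f ->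
  (forall i, Ck_on k U (fun y => h y 0 i)) -> Ck_on k U (f \o h).
Proof.
move=> oU oV UV; elim: k f => [|k IH] f Cf Ch.
all: have cfh : forall y, U y -> {for y, continuous (f \o h)}.
- move=> y Uy; apply: continuous_comp; last by apply: Cf.1; exact: UV.
  by apply: continuous_rV => i; apply: (Ch i).1.
- by [].
- move=> y Uy; apply: continuous_comp; last by apply: Cf.1; exact: UV.
  by apply: continuous_rV => i; apply: (Ch i).1.
have C1 : Ck_on 1 V f by apply: Ck_on_leq Cf.
have Ch1 i : Ck_on 1 U (fun y => h y 0 i) by apply: Ck_on_leq (Ch i).
have D y j : U y -> is_derive y (delta_mx 0 j : 'rV[R]_n) (f \o h)
     (\sum_i pderiv j (fun y => h y 0 i) y * pderiv i f (h y)).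
  by move=> Uy; exact: (derivable_chain j oV C1 Uy (UV y Uy) Ch1).
split=> // j; split; first by move=> y /(D _ j)[].
apply: (@Ck_on_ext n k U (fun y => \sum_i pderiv j (fun y => h y 0 i) y * pderiv i f (h y))) => //.
  by move=> y /(D _ j)[_ <-].
apply: Ck_on_sum => // i; apply: Ck_on_mul => //; first by have [_ /(_ j)[]] := Ch i.
apply: IH; first by have [_ /(_ i)[]] := Cf.
by move=> i'; exact: Ck_on_pred.
Qed.

Lemma pderiv_comp n l (U : set 'rV[R]_n) (V : set 'rV[R]_l) f (h : 'rV[R]_n -> 'rV[R]_l) y
    (j : 'I_n) : open V -> Ck_on 1 V f -> U y -> V (h y) -> (forall i, Ck_on 1 U (fun y => h y 0 i)) ->
  pderiv j (f \o h) y = \sum_i pderiv j (fun y => h y 0 i) y * pderiv i f (h y).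
Proof. by move=> oV Cf Uy Vy Ch; have [_ <-] := derivable_chain j oV Cf Uy Vy Ch. Qed.

End EuclideanCalculus.

(** * Derivatives of complex and matrix valued functions *)

HB.lock Definition mpderiv (R : realType) (n a b : nat) (k : 'I_n)
    (F : 'rV[R]_n -> 'M[R[i]]_(a, b)) (y : 'rV[R]_n) : 'M[R[i]]_(a, b) :=
  \matrix_(i, j) cpderiv k (fun z => F z i j) y.

Section ComplexCalculus.
Context {R : realType}.
Local Notation C := R[i].

Lemma ReD (a b : C) : complex.Re (a + b) = complex.Re a + complex.Re b.
Proof. by case: a; case: b. Qed.
Lemma ImD (a b : C) : complex.Im (a + b) = complex.Im a + complex.Im b.
Proof. by case: a; case: b. Qed.
Lemma ReM (a b : C) : complex.Re (a * b) = complex.Re a * complex.Re b - complex.Im a * complex.Im b.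
Proof. by case: a; case: b. Qed.
Lemma ImM (a b : C) : complex.Im (a * b) = complex.Re a * complex.Im b + complex.Im a * complex.Re b.
Proof. by case: a; case: b. Qed.
Lemma ReJ (a : C) : complex.Re (Num.conj a) = complex.Re a.
Proof. by case: a. Qed.
Lemma ImJ (a : C) : complex.Im (Num.conj a) = - complex.Im a.
Proof. by case: a. Qed.
Lemma complexE (a b : C) : complex.Re a = complex.Re b -> complex.Im a = complex.Im b -> a = b.
Proof. by case: a; case: b => /= ? ? ? ? -> ->. Qed.

Lemma re_sum I (r : seq I) (F : I -> C) :
  complex.Re (\sum_(i <- r) F i) = \sum_(i <- r) complex.Re (F i).
Proof. by elim: r => [|i r IH]; rewrite ?big_nil // !big_cons ReD IH. Qed.
Lemma im_sum I (r : seq I) (F : I -> C) :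
  complex.Im (\sum_(i <- r) F i) = \sum_(i <- r) complex.Im (F i).
Proof. by elim: r => [|i r IH]; rewrite ?big_nil // !big_cons ImD IH. Qed.

Section Derivatives.
Context {V : normedModType R}.
Implicit Types (x v : V) (f g : V -> C).

Definition is_cderive x v f (l : C) : Prop :=
  is_derive x v (fun z => complex.Re (f z)) (complex.Re l) /\
  is_derive x v (fun z => complex.Im (f z)) (complex.Im l).

Lemma is_cderive_eq x v f l l' : is_cderive x v f l -> l = l' -> is_cderive x v f l'.
Proof. by move=> H <-. Qed.

Lemma is_cderive_ext x v f g l : (\forall z \near x, f z = g z) ->
  is_cderive x v f l -> is_cderive x v g l.
Proof.
move=> fg [H1 H2]; split; [apply: near_eq_is_derive H1|apply: near_eq_is_derive H2];
 by apply: filterS fg => z ->.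
Qed.

Lemma is_cderive_cst x v c : is_cderive x v (fun=> c) 0.
Proof. by split; exact: is_derive_cst. Qed.

Lemma is_cderiveD x v f g l l' : is_cderive x v f l -> is_cderive x v g l' ->
  is_cderive x v (fun z => f z + g z) (l + l').
Proof.
move=> [f1 f2] [g1 g2]; split.
- under [X in is_derive _ _ X]funext do rewrite ReD; rewrite ReD; exact: is_deriveD.
- under [X in is_derive _ _ X]funext do rewrite ImD; rewrite ImD; exact: is_deriveD.
Qed.

Lemma is_cderiveM x v f g l l' : is_cderive x v f l -> is_cderive x v g l' ->
  is_cderive x v (fun z => f z * g z) (l * g x + f x * l').
Proof.
have M (a b : V -> R) da db : is_derive x v a da -> is_derive x v b db ->
    is_derive x v (fun z => a z * b z) (da * b x + a x * db).
  by move=> Ha Hb; apply: is_derive_eq; rewrite /GRing.scale /= addrC mulrC.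
move=> [f1 f2] [g1 g2]; split.
- under [X in is_derive _ _ X]funext do rewrite ReM.
  apply: is_derive_eq (is_deriveB (M _ _ _ _ f1 g1) (M _ _ _ _ f2 g2)) _.
  by rewrite ReD !ReM; ring.
- under [X in is_derive _ _ X]funext do rewrite ImM.
  apply: is_derive_eq (is_deriveD (M _ _ _ _ f1 g2) (M _ _ _ _ f2 g1)) _.
  by rewrite ImD !ImM; ring.
Qed.

Lemma is_cderiveJ x v f l : is_cderive x v f l ->
  is_cderive x v (fun z => Num.conj (f z)) (Num.conj l).
Proof.
move=> [f1 f2]; split.
- by under [X in is_derive _ _ X]funext do rewrite ReJ; rewrite ReJ.
- by under [X in is_derive _ _ X]funext do rewrite ImJ; rewrite ImJ; exact: is_deriveN.
Qed.

Lemma is_cderive_sum x v I (r : seq I) (F : I -> V -> C) (l : I -> C) :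
  (forall i, is_cderive x v (F i) (l i)) ->
  is_cderive x v (fun z => \sum_(i <- r) F i z) (\sum_(i <- r) l i).
Proof.
move=> H; elim: r => [|i r IH].
  rewrite big_nil; under [X in is_cderive _ _ X]funext do rewrite big_nil; exact: is_cderive_cst.
rewrite big_cons; under [X in is_cderive _ _ X]funext do rewrite big_cons; exact: is_cderiveD.
Qed.

Definition is_mxderive a b x v (F : V -> 'M[C]_(a, b)) (L : 'M[C]_(a, b)) : Prop :=
  forall i j, is_cderive x v (fun z => F z i j) (L i j).

Lemma is_mxderive_eq a b x v F (L L' : 'M[C]_(a, b)) :
  is_mxderive x v F L -> L = L' -> is_mxderive x v F L'.
Proof. by move=> H <-. Qed.

Lemma is_mxderive_ext a b x v (F G : V -> 'M[C]_(a, b)) L : (\forall z \near x, F z = G z) ->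
  is_mxderive x v F L -> is_mxderive x v G L.
Proof. by move=> FG H i j; apply: is_cderive_ext (H i j); apply: filterS FG => z ->. Qed.

Lemma is_mxderive_cst a b x v (c : 'M[C]_(a, b)) : is_mxderive x v (fun=> c) 0.
Proof. by move=> i j; rewrite mxE; exact: is_cderive_cst. Qed.

Lemma is_mxderiveD a b x v (F G : V -> 'M[C]_(a, b)) L L' :
  is_mxderive x v F L -> is_mxderive x v G L' -> is_mxderive x v (fun z => F z + G z) (L + L').
Proof.
move=> H H' i j; rewrite mxE; under [X in is_cderive _ _ X]funext do rewrite mxE.
exact: is_cderiveD.
Qed.

Lemma is_mxderiveM a b c x v (F : V -> 'M[C]_(a, b)) (G : V -> 'M[C]_(b, c)) L L' :
  is_mxderive x v F L -> is_mxderive x v G L' ->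
  is_mxderive x v (fun z => F z *m G z) (L *m G x + F x *m L').
Proof.
move=> H H' i j; under [X in is_cderive _ _ X]funext do rewrite mxE.
apply: is_cderive_eq (is_cderive_sum _ (fun k => is_cderiveM (H i k) (H' k j))) _.
by rewrite !mxE -big_split.
Qed.

Lemma is_mxderiveT a b x v (F : V -> 'M[C]_(a, b)) L :
  is_mxderive x v F L -> is_mxderive x v (fun z => (F z)^T) L^T.
Proof. by move=> H i j; rewrite mxE; under [X in is_cderive _ _ X]funext do rewrite mxE. Qed.

Lemma is_mxderiveJ a b x v (F : V -> 'M[C]_(a, b)) L :
  is_mxderive x v F L -> is_mxderive x v (fun z => cjmx (F z)) (cjmx L).
Proof.
move=> H i j; rewrite mxE; under [X in is_cderive _ _ X]funext do rewrite mxE.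
exact: is_cderiveJ.
Qed.

Lemma is_mxderiveZ a b x v f (F : V -> 'M[C]_(a, b)) l L :
  is_cderive x v f l -> is_mxderive x v F L ->
  is_mxderive x v (fun z => f z *: F z) (l *: F x + f x *: L).
Proof.
move=> Hf H i j; rewrite !mxE; under [X in is_cderive _ _ X]funext do rewrite mxE.
exact: is_cderiveM.
Qed.

Lemma is_mxderive_sum a b x v I (r : seq I) (F : I -> V -> 'M[C]_(a, b)) L :
  (forall k, is_mxderive x v (F k) (L k)) ->
  is_mxderive x v (fun z => \sum_(k <- r) F k z) (\sum_(k <- r) L k).
Proof.
move=> H i j; rewrite summxE; under [X in is_cderive _ _ X]funext do rewrite summxE.
exact: (is_cderive_sum r (fun k => H k i j)).
Qed.

Lemma is_mxderive_lin a b c d x v (h : {linear 'M[C]_(a, b) -> 'M[C]_(c, d)}) F L :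
  is_mxderive x v F L -> is_mxderive x v (fun z => h (F z)) (h L).
Proof.
move=> H i j.
have E (A : 'M[C]_(a, b)) : h A i j = \sum_k \sum_l A k l * h (delta_mx k l) i j.
  rewrite [in LHS](matrix_sum_delta A) linear_sum summxE; apply: eq_bigr => k _.
  by rewrite linear_sum summxE; apply: eq_bigr => l _; rewrite linearZ mxE.
rewrite E; under [X in is_cderive _ _ X]funext do rewrite E.
apply: is_cderive_sum => k; apply: is_cderive_sum => l.
apply: is_cderive_eq (is_cderiveM (H k l) (is_cderive_cst _ _ _)) _.
by rewrite mulr0 addr0.
Qed.

End Derivatives.

Section Smooth.
Context {n : nat}.
Implicit Types (U : set 'rV[R]_n) (y : 'rV[R]_n).
Local Notation e_ j := (delta_mx 0 j : 'rV[R]_n).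

Definition csmooth_on U (f : 'rV[R]_n -> C) : Prop :=
  smooth_on U (fun y => complex.Re (f y)) /\ smooth_on U (fun y => complex.Im (f y)).

Definition msmooth_on a b U (F : 'rV[R]_n -> 'M[C]_(a, b)) : Prop :=
  forall i j, csmooth_on U (fun y => F y i j).

Lemma mpderivE a b (k : 'I_n) (F : 'rV[R]_n -> 'M[C]_(a, b)) y i j :
  mpderiv k F y i j = cpderiv k (fun z => F z i j) y.
Proof. by rewrite mpderiv.unlock mxE. Qed.

Lemma smooth_pderiv U (f : 'rV[R]_n -> R) j : smooth_on U f -> smooth_on U (pderiv j f).
Proof. by move=> H k; have [_ /(_ j)[]] := H k.+1. Qed.

Lemma smooth_derivable U (f : 'rV[R]_n -> R) j y : smooth_on U f -> U y -> derivable f y (e_ j).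
Proof. by move=> H Uy; have [_ /(_ j)[/(_ y Uy)]] := H 1%N. Qed.

Lemma csmooth_ext U f g : open U -> (forall y, U y -> f y = g y) -> csmooth_on U f -> csmooth_on U g.
Proof.
move=> oU fg [H1 H2]; split=> k; [apply: Ck_on_ext (H1 k)|apply: Ck_on_ext (H2 k)] => //;
 by move=> y /fg ->.
Qed.

Lemma csmooth_sub U U' f : U' `<=` U -> csmooth_on U f -> csmooth_on U' f.
Proof. by move=> s [H1 H2]; split=> k; apply: Ck_on_sub s _. Qed.

Lemma csmooth_cst U c : csmooth_on U (fun=> c).
Proof. by split=> k; exact: Ck_on_cst. Qed.

Lemma csmooth_add U f g : open U -> csmooth_on U f -> csmooth_on U g ->
  csmooth_on U (fun y => f y + g y).
Proof.
move=> oU [f1 f2] [g1 g2]; split=> k.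
- under [X in Ck_on _ _ X]funext do rewrite ReD; exact: Ck_on_add.
- under [X in Ck_on _ _ X]funext do rewrite ImD; exact: Ck_on_add.
Qed.

Lemma Ck_on_opp k U (f : 'rV[R]_n -> R) : open U -> Ck_on k U f -> Ck_on k U (fun y => - f y).
Proof.
move=> oU H; have := Ck_on_mul oU (Ck_on_cst k U (-1)) H.
by under [X in Ck_on _ _ X]funext do rewrite mulN1r.
Qed.

Lemma csmooth_mul U f g : open U -> csmooth_on U f -> csmooth_on U g ->
  csmooth_on U (fun y => f y * g y).
Proof.
move=> oU [f1 f2] [g1 g2]; split=> k.
- under [X in Ck_on _ _ X]funext do rewrite ReM.
  by apply: Ck_on_add => //; [|apply: Ck_on_opp => //]; exact: Ck_on_mul.
- under [X in Ck_on _ _ X]funext do rewrite ImM; apply: Ck_on_add => //; exact: Ck_on_mul.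
Qed.

Lemma csmooth_conj U f : open U -> csmooth_on U f -> csmooth_on U (fun y => Num.conj (f y)).
Proof.
move=> oU [f1 f2]; split=> k.
- by under [X in Ck_on _ _ X]funext do rewrite ReJ.
- by under [X in Ck_on _ _ X]funext do rewrite ImJ; exact: Ck_on_opp.
Qed.

Lemma csmooth_sum U I (r : seq I) (F : I -> 'rV[R]_n -> C) : open U ->
  (forall i, csmooth_on U (F i)) -> csmooth_on U (fun y => \sum_(i <- r) F i y).
Proof.
move=> oU H; elim: r => [|i r IH].
  under [X in csmooth_on _ X]funext do rewrite big_nil; exact: csmooth_cst.
under [X in csmooth_on _ X]funext do rewrite big_cons; exact: csmooth_add.
Qed.

Lemma csmooth_real U (f : 'rV[R]_n -> R) : smooth_on U f -> csmooth_on U (fun y => Complex (f y) 0).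
Proof. by move=> H; split=> // k; exact: Ck_on_cst. Qed.

Lemma csmooth_pderiv U f j : csmooth_on U f -> csmooth_on U (cpderiv j f).
Proof. by move=> [H1 H2]; split; exact: smooth_pderiv. Qed.

Lemma csmooth_is_derive U f j y : csmooth_on U f -> U y ->
  is_cderive y (e_ j) f (cpderiv j f y).
Proof. by move=> [H1 H2] Uy; split; apply: derivableP; [exact: smooth_derivable H1 _|exact: smooth_derivable H2 _]. Qed.

Lemma is_cderive_pderiv f j y l : is_cderive y (e_ j) f l -> cpderiv j f y = l.
Proof. by move=> [[_ H1] [_ H2]]; apply: complexE. Qed.

Lemma cpderiv_ext U f g j y : open U -> (forall z, U z -> f z = g z) -> U y ->
  cpderiv j f y = cpderiv j g y.
Proof.
by move=> oU fg Uy; apply: complexE; apply: (pderiv_ext j oU _ Uy) => z /fg ->.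
Qed.

Lemma cschwarz U f y i j : open U -> csmooth_on U f -> U y ->
  cpderiv i (cpderiv j f) y = cpderiv j (cpderiv i f) y.
Proof. by move=> oU [H1 H2] Uy; apply: complexE; [apply: schwarz oU (H1 2%N) Uy|apply: schwarz oU (H2 2%N) Uy]. Qed.

Lemma msmooth_ext a b U (F G : _ -> 'M[C]_(a, b)) : open U -> (forall y, U y -> F y = G y) ->
  msmooth_on U F -> msmooth_on U G.
Proof. by move=> oU FG H i j; apply: csmooth_ext (H i j) => // y /FG ->. Qed.

Lemma msmooth_sub a b U U' (F : _ -> 'M[C]_(a, b)) : U' `<=` U -> msmooth_on U F -> msmooth_on U' F.
Proof. by move=> s H i j; exact: csmooth_sub s (H i j). Qed.

Lemma msmooth_cst a b U (c : 'M[C]_(a, b)) : msmooth_on U (fun=> c).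
Proof. by move=> i j; exact: csmooth_cst. Qed.

Lemma msmooth_add a b U (F G : _ -> 'M[C]_(a, b)) : open U -> msmooth_on U F -> msmooth_on U G ->
  msmooth_on U (fun y => F y + G y).
Proof. by move=> oU H H' i j; under [X in csmooth_on _ X]funext do rewrite mxE; exact: csmooth_add. Qed.

Lemma msmooth_mul a b c U (F : _ -> 'M[C]_(a, b)) (G : _ -> 'M[C]_(b, c)) : open U ->
  msmooth_on U F -> msmooth_on U G -> msmooth_on U (fun y => F y *m G y).
Proof.
move=> oU H H' i j; under [X in csmooth_on _ X]funext do rewrite mxE.
by apply: csmooth_sum => // k; exact: csmooth_mul.
Qed.

Lemma msmooth_scale a b U f (F : _ -> 'M[C]_(a, b)) : open U ->
  csmooth_on U f -> msmooth_on U F -> msmooth_on U (fun y => f y *: F y).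
Proof. by move=> oU H H' i j; under [X in csmooth_on _ X]funext do rewrite mxE; exact: csmooth_mul. Qed.

Lemma msmooth_opp a b U (F : _ -> 'M[C]_(a, b)) : open U -> msmooth_on U F ->
  msmooth_on U (fun y => - F y).
Proof.
move=> oU H; have := msmooth_scale oU (csmooth_cst U (-1)) H.
by under [X in msmooth_on _ X]funext do rewrite scaleN1r.
Qed.

Lemma msmooth_tr a b U (F : _ -> 'M[C]_(a, b)) : msmooth_on U F -> msmooth_on U (fun y => (F y)^T).
Proof. by move=> H i j; under [X in csmooth_on _ X]funext do rewrite mxE. Qed.

Lemma msmooth_conj a b U (F : _ -> 'M[C]_(a, b)) : open U -> msmooth_on U F ->
  msmooth_on U (fun y => cjmx (F y)).
Proof. by move=> oU H i j; under [X in csmooth_on _ X]funext do rewrite mxE; exact: csmooth_conj. Qed.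

Lemma msmooth_sum a b U I (r : seq I) (F : I -> _ -> 'M[C]_(a, b)) : open U ->
  (forall k, msmooth_on U (F k)) -> msmooth_on U (fun y => \sum_(k <- r) F k y).
Proof.
move=> oU H i j; under [X in csmooth_on _ X]funext do rewrite summxE.
exact: (csmooth_sum r oU (fun k => H k i j)).
Qed.

Lemma msmooth_toC a b U (F : _ -> 'M[R]_(a, b)) : (forall i j, smooth_on U (fun y => F y i j)) ->
  msmooth_on U (fun y => toC (F y)).
Proof. by move=> H i j; under [X in csmooth_on _ X]funext do rewrite mxE; exact: csmooth_real. Qed.

Lemma msmooth_pderiv a b U k (F : _ -> 'M[C]_(a, b)) : msmooth_on U F -> msmooth_on U (mpderiv k F).
Proof. by move=> H i j; under [X in csmooth_on _ X]funext do rewrite mpderivE; exact: csmooth_pderiv. Qed.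

Lemma msmooth_lin a b c d U (h : {linear 'M[C]_(a, b) -> 'M[C]_(c, d)}) F : open U ->
  msmooth_on U F -> msmooth_on U (fun z => h (F z)).
Proof.
move=> oU H i j.
have E (A : 'M[C]_(a, b)) : h A i j = \sum_k \sum_l A k l * h (delta_mx k l) i j.
  rewrite [in LHS](matrix_sum_delta A) linear_sum summxE; apply: eq_bigr => k _.
  by rewrite linear_sum summxE; apply: eq_bigr => l _; rewrite linearZ mxE.
under [X in csmooth_on _ X]funext do rewrite E.
apply: csmooth_sum => // k; apply: csmooth_sum => // l.
apply: csmooth_mul => //; exact: csmooth_cst.
Qed.

Lemma msmooth_is_derive a b U (F : _ -> 'M[C]_(a, b)) j y : msmooth_on U F -> U y ->
  is_mxderive y (e_ j) F (mpderiv j F y).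
Proof. by move=> H Uy i k; rewrite mpderivE; exact: csmooth_is_derive (H i k) Uy. Qed.

Lemma is_mxderive_pderiv a b (F : _ -> 'M[C]_(a, b)) j y L : is_mxderive y (e_ j) F L ->
  mpderiv j F y = L.
Proof. by move=> H; apply/matrixP => i k; rewrite mpderivE; exact: is_cderive_pderiv. Qed.

Lemma mpderiv_ext a b U (F G : _ -> 'M[C]_(a, b)) j y : open U -> (forall z, U z -> F z = G z) -> U y ->
  mpderiv j F y = mpderiv j G y.
Proof.
by move=> oU FG Uy; apply/matrixP => i k; rewrite !mpderivE; apply: (cpderiv_ext j oU _ Uy) => z /FG ->.
Qed.

Lemma mschwarz a b U (F : _ -> 'M[C]_(a, b)) y i j : open U -> msmooth_on U F -> U y ->
  mpderiv i (mpderiv j F) y = mpderiv j (mpderiv i F) y.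
Proof.
move=> oU H Uy; apply/matrixP => k l; rewrite [LHS]mpderivE [RHS]mpderivE.
transitivity (cpderiv i (cpderiv j (fun z => F z k l)) y).
  by apply: (cpderiv_ext i oU _ Uy) => z _; rewrite mpderivE.
rewrite (cschwarz i j oU (H k l) Uy).
by apply: (cpderiv_ext j oU _ Uy) => z _; rewrite mpderivE.
Qed.

Lemma mpderivM a b c U (F : _ -> 'M[C]_(a, b)) (G : _ -> 'M[C]_(b, c)) j y :
  msmooth_on U F -> msmooth_on U G -> U y ->
  mpderiv j (fun z => F z *m G z) y = mpderiv j F y *m G y + F y *m mpderiv j G y.
Proof.
by move=> HF HG Uy; apply: is_mxderive_pderiv; apply: is_mxderiveM; exact: msmooth_is_derive Uy.
Qed.

Lemma mpderivD a b U (F G : _ -> 'M[C]_(a, b)) j y :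
  msmooth_on U F -> msmooth_on U G -> U y ->
  mpderiv j (fun z => F z + G z) y = mpderiv j F y + mpderiv j G y.
Proof.
by move=> HF HG Uy; apply: is_mxderive_pderiv; apply: is_mxderiveD; exact: msmooth_is_derive Uy.
Qed.

Lemma mpderiv_sum a b U I (r : seq I) (F : I -> _ -> 'M[C]_(a, b)) j y :
  (forall k, msmooth_on U (F k)) -> U y ->
  mpderiv j (fun z => \sum_(k <- r) F k z) y = \sum_(k <- r) mpderiv j (F k) y.
Proof.
by move=> HF Uy; apply: is_mxderive_pderiv; apply: is_mxderive_sum => k; exact: msmooth_is_derive Uy.
Qed.

Lemma mpderivZ a b U f (F : _ -> 'M[C]_(a, b)) j y :
  csmooth_on U f -> msmooth_on U F -> U y ->
  mpderiv j (fun z => f z *: F z) y = cpderiv j f y *: F y + f y *: mpderiv j F y.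
Proof.
move=> Hf HF Uy; apply: is_mxderive_pderiv; apply: is_mxderiveZ; first exact: csmooth_is_derive Uy.
exact: msmooth_is_derive Uy.
Qed.

Lemma mpderivT a b (F : _ -> 'M[C]_(a, b)) j y : mpderiv j (fun z => (F z)^T) y = (mpderiv j F y)^T.
Proof.
apply/matrixP => i k; rewrite [RHS]mxE !mpderivE; congr (cpderiv j _ y).
by apply: funext => z; rewrite mxE.
Qed.

Lemma mpderivJ a b U (F : _ -> 'M[C]_(a, b)) j y : msmooth_on U F -> U y ->
  mpderiv j (fun z => cjmx (F z)) y = cjmx (mpderiv j F y).
Proof.
by move=> HF Uy; apply: is_mxderive_pderiv; apply: is_mxderiveJ; exact: msmooth_is_derive Uy.
Qed.

Lemma mpderiv_lin a b c d U (h : {linear 'M[C]_(a, b) -> 'M[C]_(c, d)}) F j y : msmooth_on U F -> U y ->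
  mpderiv j (fun z => h (F z)) y = h (mpderiv j F y).
Proof.
by move=> HF Uy; apply: is_mxderive_pderiv; apply: is_mxderive_lin; exact: msmooth_is_derive Uy.
Qed.

Lemma mpderiv_cst a b (c : 'M[C]_(a, b)) j y : mpderiv j (fun=> c) y = 0.
Proof. by apply: is_mxderive_pderiv; exact: is_mxderive_cst. Qed.

Lemma mpderiv_toC a b (F : _ -> 'M[R]_(a, b)) j y :
  mpderiv j (fun z => toC (F z)) y = toC (\matrix_(k, l) pderiv j (fun z => F z k l) y).
Proof.
apply/matrixP => k l; rewrite mpderivE !mxE; apply: complexE => /=.
  by congr (pderiv j _ y); apply: funext => z; rewrite mxE.
rewrite [X in pderiv _ X](_ : _ = fun=> 0); first by rewrite /pderiv derive_cst.
by apply: funext => z; rewrite mxE.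
Qed.

End Smooth.

Section Composition.
Context {n l : nat} (U : set 'rV[R]_n) (W : set 'rV[R]_l) (h : 'rV[R]_n -> 'rV[R]_l).
Hypotheses (oU : open U) (oW : open W) (UW : forall y, U y -> W (h y)).
Hypothesis (hs : forall i, smooth_on U (fun y => h y 0 i)).

Lemma smooth_comp f : smooth_on W f -> smooth_on U (f \o h).
Proof. by move=> H k; apply: (Ck_on_comp oU oW UW (H k)) => i; exact: hs. Qed.

Definition jacobian_mx (y : 'rV[R]_n) : 'M[R]_(n, l) := \matrix_(j, i) pderiv j (fun z => h z 0 i) y.

Lemma mpderiv_comp a b (F : _ -> 'M[C]_(a, b)) j y : msmooth_on W F -> U y ->
  mpderiv j (F \o h) y = \sum_i toC (jacobian_mx y) j i *: mpderiv i F (h y).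
Proof.
move=> H Uy; apply/matrixP => k m; rewrite mpderivE summxE.
have [H1 H2] := H k m.
have hs1 i : Ck_on 1 U (fun y => h y 0 i) by exact: hs.
apply: complexE => /=.
- rewrite (pderiv_comp j oW (H1 1%N) Uy (UW Uy) hs1) re_sum; apply: eq_bigr => i _.
  by rewrite mxE mpderivE !mxE ReM /= mul0r subr0.
- rewrite (pderiv_comp j oW (H2 1%N) Uy (UW Uy) hs1) im_sum; apply: eq_bigr => i _.
  by rewrite mxE mpderivE !mxE ImM /= mul0r addr0.
Qed.
End Composition.

End ComplexCalculus.

(** * Charts and the Levi-Civita connection *)

Section ToC.
Context {R : realType}.
Lemma toC_mul a b c (A : 'M[R]_(a, b)) (B : 'M[R]_(b, c)) : toC (A *m B) = toC A *m toC B.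
Proof. exact: (map_mxM (real_complex R)). Qed.
Lemma toC_add a b (A B : 'M[R]_(a, b)) : toC (A + B) = toC A + toC B.
Proof. exact: (map_mxD (real_complex R)). Qed.
Lemma toC_opp a b (A : 'M[R]_(a, b)) : toC (- A) = - toC A.
Proof. exact: (map_mxN (real_complex R)). Qed.
Lemma toC1 n : toC (1%:M : 'M[R]_n) = 1%:M.
Proof. exact: (map_mx1 (real_complex R)). Qed.
Lemma toC_tr a b (A : 'M[R]_(a, b)) : toC A^T = (toC A)^T.
Proof. by apply/matrixP => i j; rewrite !mxE. Qed.
Lemma toC_inj a b : injective (@toC R a b).
Proof. by move=> A B /matrixP H; apply/matrixP => i j; have := H i j; rewrite !mxE => -[]. Qed.
Lemma toC_unit n (A : 'M[R]_n) : (toC A \in unitmx) = (A \in unitmx).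
Proof. exact: (map_unitmx (real_complex R)). Qed.
Lemma toC_inv n (A : 'M[R]_n) : toC (invmx A) = invmx (toC A).
Proof. exact: (map_invmx (real_complex R)). Qed.
Lemma cjmx_toC a b (A : 'M[R]_(a, b)) : cjmx (toC A) = toC A.
Proof. by apply/matrixP => i j; rewrite !mxE; apply: complexE; rewrite ?ReJ ?ImJ //= oppr0. Qed.
End ToC.

Section Charts.
Context {R : realType} {n : nat} (M : manifold R n).
Implicit Types (p q r x : M) (W : set M).
Local Notation C := R[i].

Definition cimage p W : set 'rV[R]_n := (cmap p @` cdom p) `&` (cinv p @^-1` W).

Lemma cimage_dom p W y : cimage p W y -> cdom p (cinv p y) /\ cmap p (cinv p y) = y.
Proof. by move=> [[x px <-] _]; rewrite man_cmapK. Qed.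

Lemma cimageP p W y : cimage p W y -> W (cinv p y).
Proof. by case. Qed.

Lemma cimage_mem p W x : cdom p x -> W x -> cimage p W (cmap p x).
Proof. by move=> px Wx; split; [exists x|rewrite /= man_cmapK]. Qed.

Lemma cimage_open p W : open W -> open (cimage p W).
Proof.
move=> oW; rewrite openE => y [[x px <-] /= Wx].
rewrite man_cmapK // in Wx.
apply: filterI; first by apply: open_nbhs_nbhs; split; [exact: man_cod_open|exists x].
apply: (man_cinv_cont px); rewrite man_cmapK //; exact: open_nbhs_nbhs.
Qed.

Lemma cimage_sub p W W' : W `<=` W' -> cimage p W `<=` cimage p W'.
Proof. by move=> s y [H /s]. Qed.

Definition transition p q (y : 'rV[R]_n) := cmap q (cinv p y).

Lemma transition_smooth p q j : smooth_on (cimage p (cdom q)) (fun y => transition p q y 0 j).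
Proof. exact: man_smooth. Qed.

Lemma jacE p q x : jac p q x = jacobian_mx (transition p q) (cmap p x).
Proof. by apply/matrixP => i j; rewrite !mxE. Qed.

Lemma smooth_on_change p q W (f : M -> R) : open W -> W `<=` cdom q ->
  smooth_on (cimage q W) (f \o cinv q) -> smooth_on (cimage p W) (f \o cinv p).
Proof.
move=> oW Wq H.
have H' : smooth_on (cimage p W) ((f \o cinv q) \o transition p q).
  apply: (@smooth_comp _ _ _ _ (cimage q W)) => //; try exact: cimage_open.
    by move=> y [_ Wy]; apply: cimage_mem => //; exact: Wq.
  by move=> j k; apply: Ck_on_sub (transition_smooth p q j k); exact: cimage_sub.
move=> k; apply: Ck_on_ext (H' k); first exact: cimage_open.
by move=> y [_ /Wq qy] /=; rewrite /transition man_cmapK.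
Qed.

Lemma csmooth_on_change p q W (f : M -> C) : open W -> W `<=` cdom q ->
  csmooth_on (cimage q W) (f \o cinv q) -> csmooth_on (cimage p W) (f \o cinv p).
Proof.
move=> oW Wq [H1 H2]; split.
- exact: (smooth_on_change p (f := fun x => complex.Re (f x)) oW Wq H1).
- exact: (smooth_on_change p (f := fun x => complex.Im (f x)) oW Wq H2).
Qed.

Lemma csmooth_funP W (f : M -> C) : csmooth_fun W f <-> forall p, csmooth_on (cimage p W) (f \o cinv p).
Proof.
split=> [[H1 H2] p|H]; first by split; [exact: H1|exact: H2].
by split=> p; have [] := H p.
Qed.

Lemma csmooth_fun_chart p W (f : M -> C) : open W -> W `<=` cdom p ->
  csmooth_on (cimage p W) (f \o cinv p) -> csmooth_fun W f.
Proof. by move=> oW Wp H; apply/csmooth_funP => q; exact: (csmooth_on_change q oW Wp H). Qed.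

Lemma csmooth_fun_sub W W' (f : M -> C) : W' `<=` W -> csmooth_fun W f -> csmooth_fun W' f.
Proof.
by move=> s /csmooth_funP H; apply/csmooth_funP => p; apply: csmooth_sub (H p); exact: cimage_sub.
Qed.

Lemma csmooth_fun_local W (f : M -> C) :
  (forall x, W x -> exists W', W' x /\ csmooth_fun W' f) -> csmooth_fun W f.
Proof.
move=> H; have H' x : exists W', W x -> W' x /\ csmooth_fun W' f.
  by have [/H[W' HW']|nW] := pselect (W x); [exists W'|exists set0].
have [w Hw] := choice H'.
pose V p (x : {x | W x}) := cimage p (w (sval x)).
have cov p y : cimage p W y -> exists i, V p i y.
  move=> [cy Wy]; exists (exist (fun x => W x) (cinv p y) Wy); split=> //; exact: (Hw _ Wy).1.
apply/csmooth_funP => p; split=> k; apply: (Ck_on_setU (V := V p)); try exact: cov.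
- by move=> [x Wx]; have [_ /csmooth_funP/(_ p)[]] := Hw x Wx.
- by move=> [x Wx]; have [_ /csmooth_funP/(_ p)[]] := Hw x Wx.
Qed.

Lemma csmooth_fun_ext W (f g : M -> C) : open W -> (forall x, W x -> f x = g x) ->
  csmooth_fun W f -> csmooth_fun W g.
Proof.
move=> oW fg /csmooth_funP H; apply/csmooth_funP => p; apply: csmooth_ext (H p); first exact: cimage_open.
by move=> y [_ Wy] /=; exact: fg.
Qed.

Lemma mpderiv_change a b (F : M -> 'M[C]_(a, b)) p q x W k : open W -> W x -> cdom p x -> cdom q x ->
  msmooth_on (cimage q W) (F \o cinv q) ->
  mpderiv k (F \o cinv p) (cmap p x) =
  \sum_i toC (jac p q x) k i *: mpderiv i (F \o cinv q) (cmap q x).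
Proof.
move=> oW Wx px qx H.
pose W' := W `&` cdom q.
have oW' : open W' by apply: openI => //; exact: man_dom_open.
have W'x : cimage p W' (cmap p x) by apply: cimage_mem.
have E : mpderiv k (F \o cinv p) (cmap p x) = mpderiv k ((F \o cinv q) \o transition p q) (cmap p x).
  apply: (mpderiv_ext k (cimage_open oW') _ W'x) => y [_ [_ qy]] /=.
  by rewrite /transition man_cmapK.
rewrite E (mpderiv_comp (cimage_open (p := q) oW) (U := cimage p W')) //.
- by rewrite jacE /transition man_cmapK.
- by move=> y [_ [Wy qy]]; exact: cimage_mem.
- by move=> j l; apply: Ck_on_sub (transition_smooth p q j l); apply: cimage_sub => z [].
Qed.

Lemma dirdermxE a b (F : M -> 'M[C]_(a, b)) x v :
  dirdermx F x v = \sum_k v 0 k *: mpderiv k (F \o cinv x) (cmap x x).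
Proof.
apply/matrixP => i j; rewrite mxE /dirder summxE; apply: eq_bigr => k _.
by rewrite [in RHS]mxE mpderivE.
Qed.

(** The map [cmap r] is itself taken as the function whose partial derivatives are transformed by
    [mpderiv_change]. *)
Lemma jac_comp p q r x : cdom p x -> cdom q x -> cdom r x ->
  jac p r x = jac p q x *m jac q r x.
Proof.
move=> px qx rx; apply: toC_inj.
pose F (z : M) := toC (cmap r z).
have H : msmooth_on (cimage q (cdom r)) (F \o cinv q).
  apply: msmooth_toC => i j; rewrite (ord1 i); exact: transition_smooth.
apply/matrixP => k j; rewrite toC_mul [RHS]mxE.
have EF q' i : mpderiv i (F \o cinv q') (cmap q' x) 0 j = toC (jac q' r x) i j.
  by rewrite -[F \o cinv q']/(fun y => toC (cmap r (cinv q' y))) mpderiv_toC !mxE.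
rewrite -EF (mpderiv_change k (man_dom_open r) rx px qx H) summxE.
by apply: eq_bigr => i _; rewrite mxE EF.
Qed.

Lemma jac_id p x : cdom p x -> jac p p x = 1%:M.
Proof.
move=> px; apply/matrixP => i j; rewrite !mxE.
rewrite (@pderiv_ext _ _ (cimage p setT) _ (fun y => y 0 j)).
- have := @Ck_on_coord R n 1 setT j openT => -[_ /(_ i)[/(_ (cmap p x) I) d _]].
  have E : (fun h : R => h^-1 *: (((fun y : 'rV[R]_n => y 0 j) \o shift (cmap p x)) (h *: (delta_mx 0 i : 'rV[R]_n)) - cmap p x 0 j))
     = (fun h : R => h^-1 * h * (j == i)%:R).
    by apply: funext => h /=; rewrite !mxE eqxx /= addrK /GRing.scale /= mulrA.
  rewrite /pderiv /derive E eq_sym; apply: cvg_lim => //.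
  have H : \forall h \near (0:R)^', ((i == j)%:R : R) = h^-1 * h * (i == j)%:R.
    near=> h; have h0 : h != 0 by near: h; exact: nbhs_dnbhs_neq.
    by rewrite mulVf // mul1r.
  exact: (cvg_trans (near_eq_cvg H) (cvg_cst _)).
- exact/cimage_open/openT.
- by move=> y /cimage_dom[_ ->].
- exact: cimage_mem.
Unshelve. all: by end_near. Qed.

Lemma jac_inv p q x : cdom p x -> cdom q x -> jac p q x *m jac q p x = 1%:M.
Proof. by move=> px qx; rewrite -jac_comp // jac_id. Qed.

Lemma jac_unit p q x : cdom p x -> cdom q x -> jac p q x \in unitmx.
Proof. by move=> px qx; have /mulmx1_unit[] := jac_inv px qx. Qed.

Lemma jac_smooth p q : msmooth_on (cimage p (cdom q)) (fun y => toC (jac p q (cinv p y))).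
Proof.
apply: msmooth_toC => i j.
have H := smooth_pderiv i (transition_smooth p q j).
move=> k; apply: Ck_on_ext (H k); first by apply: cimage_open; exact: man_dom_open.
by move=> y /cimage_dom[_ E]; rewrite mxE E.
Qed.

(** Schwarz's theorem for the transition maps. It makes the transformed connection symmetric in
    [cchris_change]. *)
Lemma jac_pderiv_sym p q x (i k j : 'I_n) : cdom p x -> cdom q x ->
  mpderiv k (fun y => toC (jac p q (cinv p y))) (cmap p x) i j =
  mpderiv i (fun y => toC (jac p q (cinv p y))) (cmap p x) k j.
Proof.
move=> px qx.
have oU : open (cimage p (cdom q)) by apply: cimage_open; exact: man_dom_open.
have Ux : cimage p (cdom q) (cmap p x) by exact: cimage_mem.
pose F (y : 'rV[R]_n) := toC (transition p q y).
have F_s : msmooth_on (cimage p (cdom q)) F.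
  by apply: msmooth_toC => a b; rewrite (ord1 a); exact: transition_smooth.
have E (a b : 'I_n) : mpderiv a (fun y => toC (jac p q (cinv p y))) (cmap p x) b j =
    mpderiv a (mpderiv b F) (cmap p x) 0 j.
  rewrite !mpderivE; apply: (cpderiv_ext a oU _ Ux) => y /cimage_dom[_ Ey].
  by rewrite [LHS]mxE mpderiv_toC !mxE Ey.
have S := congr1 (fun A : 'rV[C]_n => A 0 j) (mschwarz k i oU F_s Ux).
exact: etrans (E k i) (etrans S (esym (E i k))).
Qed.

End Charts.

Section LeviCivita.
Context {R : realType} {n : nat} (M : riemannian R n).
Implicit Types (p q r x : M) (W : set M).
Local Notation C := R[i].

Definition cgram p x : 'M[C]_n := toC (gram p x).
Definition cchris p x k : 'M[C]_n := toC (christoffel p x k).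

Lemma gram_change p q x : cdom p x -> cdom q x ->
  gram p x = jac p q x *m gram q x *m (jac p q x)^T.
Proof.
move=> px qx; rewrite /gram (jac_comp px qx (man_center x)) trmx_mul !mulmxA.
by [].
Qed.

Lemma gram_center x : gram x x = met x.
Proof. by rewrite /gram jac_id ?trmx1 ?mul1mx ?mulmx1 //; exact: man_center. Qed.

Lemma gram_sym p x : (gram p x)^T = gram p x.
Proof. by rewrite /gram !trmx_mul trmxK met_sym mulmxA. Qed.

Lemma met_unit x : met x \in unitmx.
Proof.
rewrite -row_free_unit; apply/negPn/negP => nf.
have [v v0 vm] : exists2 v : 'rV[R]_n, v != 0 & v *m met x = 0.
  have : kermx (met x) != 0 by rewrite kermx_eq0.
  move/rowV0Pn => [v /sub_kermxP vk v0]; by exists v.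
by have := met_pos x v0; rewrite vm mul0mx mxE ltxx.
Qed.

Lemma gram_unit p x : cdom p x -> gram p x \in unitmx.
Proof.
move=> px; have J := jac_unit px (man_center x).
by rewrite /gram !unitmx_mul unitmx_tr J met_unit.
Qed.

Lemma gram_smooth p : msmooth_on (cimage p setT) (fun y => cgram p (cinv p y)).
Proof. by apply: msmooth_toC => i j k; apply: Ck_on_sub (met_smooth p i j k) => y []. Qed.

Lemma dgramE p x k i j : mpderiv k (fun y => cgram p (cinv p y)) (cmap p x) i j =
  Complex (dgram p x k i j) 0.
Proof. by rewrite mpderiv_toC !mxE. Qed.

Lemma dgram_sym p x k i j : dgram p x k i j = dgram p x k j i.
Proof. by congr (pderiv k _ _); apply: funext => y; rewrite -[in LHS]gram_sym mxE. Qed.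

Lemma christoffel_sym p x (k i j : 'I_n) : christoffel p x k i j = christoffel p x i k j.
Proof.
rewrite !mxE; congr (_ * _); apply: eq_bigr => l _; congr (_ * (_ - _)); first exact: addrC.
exact: dgram_sym.
Qed.

Lemma cchris_sym p x (k i j : 'I_n) : cchris p x k i j = cchris p x i k j.
Proof. by rewrite [LHS]mxE [RHS]mxE christoffel_sym. Qed.

Lemma christoffel_gram p x k i l : cdom p x ->
  (christoffel p x k *m gram p x) i l = 2^-1 * (dgram p x k i l + dgram p x i k l - dgram p x l k i).
Proof.
move=> px.
pose B := \row_a (dgram p x k i a + dgram p x i k a - dgram p x a k i).
have E : row i (christoffel p x k) = 2^-1 *: (B *m invmx (gram p x)).
  apply/rowP => j; rewrite !mxE; congr (_ * _); apply: eq_bigr => a _.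
  by rewrite !mxE mulrC.
have -> : (christoffel p x k *m gram p x) i l = (row i (christoffel p x k) *m gram p x) 0 l.
  by rewrite -row_mul [RHS]mxE.
rewrite E -scalemxAl -mulmxA mulVmx ?gram_unit // mulmx1.
by rewrite !mxE.
Qed.

Lemma cchris_metric p x k : cdom p x ->
  mpderiv k (fun y => cgram p (cinv p y)) (cmap p x) =
  cchris p x k *m cgram p x + cgram p x *m (cchris p x k)^T.
Proof.
move=> px; apply/matrixP => i j; rewrite dgramE.
have -> : cgram p x *m (cchris p x k)^T = (cchris p x k *m cgram p x)^T.
  by rewrite trmx_mul -[in RHS]toC_tr gram_sym.
rewrite -toC_mul !mxE; apply: complexE => /=; last by rewrite addr0.
rewrite -![X in _ = _ + X]/(_).
have := christoffel_gram k i j px; rewrite mxE => ->.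
have := christoffel_gram k j i px; rewrite mxE => ->.
rewrite (dgram_sym p x k j i) (dgram_sym p x i k j) (dgram_sym p x j k i).
by rewrite (dgram_sym p x i j k) (dgram_sym p x j i k); field.
Qed.

(** Lowering an index of the difference gives t, symmetric in its first two indices and skew in its
    last two. Alternating these two symmetries six times yields t = - t. *)
Lemma levi_civita_unique p x (T T' : 'I_n -> 'M[C]_n) : cdom p x ->
  (forall k i j, T k i j = T i k j) -> (forall k i j, T' k i j = T' i k j) ->
  (forall k, T k *m cgram p x + cgram p x *m (T k)^T = T' k *m cgram p x + cgram p x *m (T' k)^T) ->
  forall k, T k = T' k.
Proof.
move=> px sT sT' E k.
pose D k : 'M[C]_n := T k - T' k.
have sD a b c : D a b c = D b a c by rewrite /D !mxE sT sT'.
pose t a b c := (D a *m cgram p x) b c.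
have st a b c : t a b c = t b a c.
  by rewrite /t !mxE; apply: eq_bigr => l _; rewrite sD.
have at_ a b c : t a b c = - t a c b.
  apply/eqP; rewrite -addr_eq0; apply/eqP.
  have -> : t a c b = (cgram p x *m (D a)^T) b c.
    have -> : cgram p x *m (D a)^T = (D a *m cgram p x)^T.
      by rewrite trmx_mul -[in RHS]toC_tr gram_sym.
    by rewrite [RHS]mxE.
  rewrite /t; have -> (A B : 'M[C]_n) : A b c + B b c = (A + B) b c by rewrite mxE.
  suff -> : D a *m cgram p x + cgram p x *m (D a)^T = 0 by rewrite mxE.
  rewrite /D linearB /= mulmxBl mulmxBr addrACA E -opprD subrr //.
have t0 a b c : t a b c = 0.
  have := at_ a b c; rewrite (st a c b) (at_ c a b) opprK (st c b a) (at_ b c a) (st b a c) => H.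
  have : t a b c *+ 2 = 0 by rewrite mulr2n {1}H addNr.
  by move/eqP; rewrite mulrn_eq0 /= => /eqP.
have : D k *m cgram p x = 0 by apply/matrixP => i j; rewrite [RHS]mxE; exact: t0.
move/(congr1 (mulmx^~ (invmx (cgram p x)))).
rewrite mul0mx mulmxK; last by rewrite toC_unit gram_unit.
by move/eqP; rewrite subr_eq0 => /eqP.
Qed.

(** The transformation law of the Christoffel symbols follows from uniqueness instead of their
    explicit formula: the connection T carried over from the chart q is symmetric and compatible
    with the metric in the chart p. *)
Lemma cchris_change p q x k : cdom p x -> cdom q x ->
  mpderiv k (fun y => toC (jac p q (cinv p y))) (cmap p x) +
  toC (jac p q x) *m \sum_l toC (jac p q x) k l *: cchris q x l =
  cchris p x k *m toC (jac p q x).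
Proof.
move=> px qx; set D := toC (jac p q x).
have Du : D \in unitmx by rewrite toC_unit jac_unit.
pose dD k := mpderiv k (fun y => toC (jac p q (cinv p y))) (cmap p x).
pose S k : 'M[C]_n := \sum_l D k l *: cchris q x l.
have [T TD] : exists T : 'I_n -> 'M[C]_n, forall a, T a *m D = dD a + D *m S a.
  by exists (fun a => (dD a + D *m S a) *m invmx D) => a; rewrite mulmxKV.
suff -> : cchris p x k = T k by rewrite TD.
have oU : open (cimage p (cdom q)) by apply: cimage_open; exact: man_dom_open.
have Ux : cimage p (cdom q) (cmap p x) by exact: cimage_mem.
(* The product rule for the change of the Gram matrix; its middle factor is differentiated through
   metric compatibility in the chart q. *)
have dG a : mpderiv a (fun y => cgram p (cinv p y)) (cmap p x) =
   dD a *m cgram q x *m D^T + D *m (S a *m cgram q x + cgram q x *m (S a)^T) *m D^T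
     + D *m cgram q x *m (dD a)^T.
  have smD := @jac_smooth _ _ M p q.
  have smG0 := gram_smooth q.
  have smG : msmooth_on (cimage p (cdom q)) (fun y => cgram q (cinv p y)).
    move=> i j; apply: (csmooth_on_change (q := q) (f := fun z => cgram q z i j) p (man_dom_open q)) => //.
    by apply: csmooth_sub (smG0 i j) => z [].
  have E1 : mpderiv a (fun y => cgram p (cinv p y)) (cmap p x) =
    mpderiv a (fun y => toC (jac p q (cinv p y)) *m cgram q (cinv p y) *m (toC (jac p q (cinv p y)))^T) (cmap p x).
    apply: (mpderiv_ext a oU _ Ux) => y Uy; have [py _] := cimage_dom Uy; have qy := cimageP Uy.
    by rewrite -toC_tr -!toC_mul; congr toC; exact: gram_change.
  have sm1 := msmooth_mul oU smD smG.
  rewrite E1 (mpderivM (U := cimage p (cdom q)) _ sm1 (msmooth_tr smD)) //.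
  rewrite (mpderivM (U := cimage p (cdom q)) _ smD smG) // mpderivT man_cmapK //.
  have -> : mpderiv a (fun y => cgram q (cinv p y)) (cmap p x) = S a *m cgram q x + cgram q x *m (S a)^T.
    rewrite (mpderiv_change (F := fun z => cgram q z) (q := q) a (man_dom_open q) qx px qx); last first.
      by move=> i j; apply: csmooth_sub (smG0 i j) => z [].
    rewrite /S linear_sum /= mulmx_suml mulmx_sumr -big_split /=; apply: eq_bigr => l _.
    by rewrite -[mpderiv _ _ _]/(mpderiv l (fun y => cgram q (cinv q y)) _) cchris_metric // scalerDr linearZ /= -scalemxAl -scalemxAr.
  by rewrite mulmxDl.
apply: (levi_civita_unique px) => //.
- move=> a b c; exact: cchris_sym.
- move=> a b c.
  have H a' b' : (T a' *m D) b' =1 (T b' *m D) a'.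
    move=> j; have J1 : dD a' b' j = dD b' a' j := jac_pderiv_sym b' a' j px qx.
    have AD (A B : 'M[C]_n) u v : (A + B) u v = A u v + B u v by rewrite mxE.
    suff J2 : (D *m S a') b' j = (D *m S b') a' j by rewrite !TD !AD J1 J2.
    rewrite [LHS]mxE [RHS]mxE.
    under eq_bigr do rewrite summxE mulr_sumr; rewrite exchange_big /=.
    under [RHS]eq_bigr do rewrite summxE mulr_sumr.
    apply: eq_bigr => l _; apply: eq_bigr => l' _.
    have ZD (c' : C) (A : 'M[C]_n) u v : (c' *: A) u v = c' * A u v by rewrite mxE.
    by rewrite !ZD mulrCA cchris_sym.
  have E : row b (T a) = row a (T b).
    rewrite -[row b _](mulmxK Du) -[row a _](mulmxK Du); congr (_ *m _).
    by rewrite -!row_mul; apply/rowP => j; rewrite [LHS]mxE [RHS]mxE; exact: H.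
  by have /rowP/(_ c) := E; rewrite !mxE.
- move=> a; rewrite -cchris_metric // dG.
  have -> : cgram p x = D *m cgram q x *m D^T.
    by rewrite -toC_tr -!toC_mul; congr toC; exact: gram_change.
  have -> : T a *m (D *m cgram q x *m D^T) + D *m cgram q x *m D^T *m (T a)^T =
     (T a *m D) *m cgram q x *m D^T + D *m cgram q x *m (T a *m D)^T.
    by rewrite trmx_mul !mulmxA.
  rewrite TD.
  have -> : (dD a + D *m S a)^T = (dD a)^T + (S a)^T *m D^T by rewrite raddfD /= trmx_mul.
  rewrite mulmxDl !mulmxDr !mulmxDl !mulmxA -!addrA; congr (_ + (_ + _)).
  by rewrite addrC.
Qed.

(* The rows of [Y] are complex vector fields, given by [vcomp] in the chart [p]. *)
Definition vcomp a p (Y : M -> 'M[C]_(a, n)) x := Y x *m toC (jac x p x).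

Definition vnabla a p (Y : M -> 'M[C]_(a, n)) x k : 'M[C]_(a, n) :=
  mpderiv k (fun y => vcomp p Y (cinv p y)) (cmap p x) + vcomp p Y x *m cchris p x k.

Lemma vcomp_change a p q (Y : M -> 'M[C]_(a, n)) x : cdom p x -> cdom q x ->
  vcomp q Y x = vcomp p Y x *m toC (jac p q x).
Proof.
by move=> px qx; rewrite /vcomp -mulmxA -toC_mul -jac_comp //; exact: man_center.
Qed.

Lemma vcomp_center a (Y : M -> 'M[C]_(a, n)) x : vcomp x Y x = Y x.
Proof. by rewrite /vcomp jac_id ?toC1 ?mulmx1 //; exact: man_center. Qed.

Lemma vcomp_smooth_change a p q (Y : M -> 'M[C]_(a, n)) W : open W ->
  W `<=` cdom p -> W `<=` cdom q ->
  msmooth_on (cimage p W) (fun y => vcomp p Y (cinv p y)) ->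
  msmooth_on (cimage q W) (fun y => vcomp q Y (cinv q y)).
Proof.
move=> oW Wp Wq H.
have H1 : msmooth_on (cimage p W) (fun y => vcomp q Y (cinv p y)).
  have smD : msmooth_on (cimage p W) (fun y => toC (jac p q (cinv p y))).
    by apply: msmooth_sub (@jac_smooth _ _ M p q); exact: cimage_sub.
  apply: msmooth_ext (msmooth_mul (cimage_open oW) H smD); first exact: cimage_open.
  by move=> y Uy; have Wy := cimageP Uy; rewrite -vcomp_change //; [exact: Wp|exact: Wq].
by move=> i j; exact: (csmooth_on_change (f := fun z => vcomp q Y z i j) q oW Wp (H1 i j)).
Qed.

(** The derivative of the Jacobian produced by the product rule is absorbed by the inhomogeneous
    term of [cchris_change]. *)
Lemma vnabla_change a p q (Y : M -> 'M[C]_(a, n)) x k W : open W -> W x ->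
  W `<=` cdom p -> W `<=` cdom q ->
  msmooth_on (cimage p W) (fun y => vcomp p Y (cinv p y)) ->
  vnabla p Y x k *m toC (jac p q x) = \sum_l toC (jac p q x) k l *: vnabla q Y x l.
Proof.
move=> oW Wx Wp Wq H; have px := Wp _ Wx; have qx := Wq _ Wx.
have H2 := vcomp_smooth_change oW Wp Wq H.
have oU := cimage_open (p := p) oW.
have Ux : cimage p W (cmap p x) by exact: cimage_mem.
have E := mpderiv_change k oW Wx px qx H2.
have smD : msmooth_on (cimage p W) (fun y => toC (jac p q (cinv p y))).
  by apply: msmooth_sub (@jac_smooth _ _ M p q); exact: cimage_sub.
have E2 : mpderiv k (vcomp q Y \o cinv p) (cmap p x) =
    mpderiv k (fun y => vcomp p Y (cinv p y)) (cmap p x) *m toC (jac p q x) +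
    vcomp p Y x *m mpderiv k (fun y => toC (jac p q (cinv p y))) (cmap p x).
  rewrite (mpderiv_ext (G := fun y => vcomp p Y (cinv p y) *m toC (jac p q (cinv p y))) k oU _ Ux); last first.
    by move=> y Uy; have Wy := cimageP Uy; rewrite /= -vcomp_change //; [exact: Wp|exact: Wq].
  by rewrite (mpderivM _ H smD Ux) man_cmapK.
rewrite /vnabla mulmxDl -mulmxA -(cchris_change k px qx) mulmxDr addrA -E2 E.
rewrite mulmxA -vcomp_change // mulmx_sumr -big_split /=; apply: eq_bigr => l _.
by rewrite scalerDr scalemxAr.
Qed.

End LeviCivita.

(** * Unitary representations and their decompositions *)

Section HermitianSpaces.
Context {R : realType}.
Local Notation C := R[i].

Lemma hdotDl d k (A B D : 'M[C]_(d, k)) : hdot (A + B) D = hdot A D + hdot B D.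
Proof. by rewrite /hdot mulmxDl mxtraceD. Qed.
Lemma hdotZl d k c (A D : 'M[C]_(d, k)) : hdot (c *: A) D = c * hdot A D.
Proof. by rewrite /hdot -scalemxAl mxtraceZ. Qed.
Lemma hdotNl d k (A D : 'M[C]_(d, k)) : hdot (- A) D = - hdot A D.
Proof. by rewrite -scaleN1r hdotZl mulN1r. Qed.
Lemma hdotBl d k (A B D : 'M[C]_(d, k)) : hdot (A - B) D = hdot A D - hdot B D.
Proof. by rewrite hdotDl hdotNl. Qed.
Lemma hdot0l d k (D : 'M[C]_(d, k)) : hdot 0 D = 0.
Proof. by rewrite /hdot mul0mx mxtrace0. Qed.
Lemma adjmxM a b c (A : 'M[C]_(a, b)) (B : 'M[C]_(b, c)) : (A *m B) ^t* = B ^t* *m A ^t*.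
Proof. by rewrite trmx_mul map_mxM. Qed.
Lemma adjmxK a b (A : 'M[C]_(a, b)) : A ^t* ^t* = A.
Proof. by apply/matrixP => i j; rewrite !mxE conjCK. Qed.
Lemma adjmxD a b (A B : 'M[C]_(a, b)) : (A + B) ^t* = A ^t* + B ^t*.
Proof. by rewrite linearD map_mxD. Qed.
Lemma adjmxZ a b c (A : 'M[C]_(a, b)) : (c *: A) ^t* = Num.conj c *: A ^t*.
Proof. by rewrite linearZ map_mxZ. Qed.
Lemma adjmx1 n : (1%:M : 'M[C]_n) ^t* = 1%:M.
Proof. by rewrite trmx1 map_mx1. Qed.
Lemma mxtrace_adj n (A : 'M[C]_n) : \tr (A ^t*) = Num.conj (\tr A).
Proof. by rewrite /mxtrace rmorph_sum; apply: eq_bigr => i _; rewrite !mxE. Qed.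
Lemma hdotC d k (A B : 'M[C]_(d, k)) : hdot A B = Num.conj (hdot B A).
Proof. by rewrite /hdot -mxtrace_adj adjmxM adjmxK. Qed.
Lemma hdotDr d k (A B D : 'M[C]_(d, k)) : hdot D (A + B) = hdot D A + hdot D B.
Proof. by rewrite !(hdotC D) hdotDl rmorphD. Qed.
Lemma hdotZr d k c (A D : 'M[C]_(d, k)) : hdot D (c *: A) = Num.conj c * hdot D A.
Proof. by rewrite !(hdotC D) hdotZl rmorphM. Qed.
Lemma hdotNr d k (A D : 'M[C]_(d, k)) : hdot D (- A) = - hdot D A.
Proof. by rewrite !(hdotC D) hdotNl rmorphN. Qed.
Lemma hdotBr d k (A B D : 'M[C]_(d, k)) : hdot D (A - B) = hdot D A - hdot D B.
Proof. by rewrite hdotDr hdotNr. Qed.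
Lemma hdot0r d k (D : 'M[C]_(d, k)) : hdot D 0 = 0.
Proof. by rewrite hdotC hdot0l rmorph0. Qed.
Lemma hdot_suml d k I (r : seq I) (P : pred I) (F : I -> 'M[C]_(d, k)) D :
  hdot (\sum_(i <- r | P i) F i) D = \sum_(i <- r | P i) hdot (F i) D.
Proof. exact: (big_morph (fun X => hdot X D) (fun A B => hdotDl A B D) (hdot0l D)). Qed.
Lemma hdot_sumr d k I (r : seq I) (P : pred I) (F : I -> 'M[C]_(d, k)) D :
  hdot D (\sum_(i <- r | P i) F i) = \sum_(i <- r | P i) hdot D (F i).
Proof. exact: (big_morph (hdot D) (fun A B => hdotDr A B D) (hdot0r D)). Qed.

Lemma hdotE d k (A B : 'M[C]_(d, k)) : hdot A B = \sum_i \sum_j A i j * Num.conj (B i j).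
Proof.
rewrite /hdot /mxtrace; apply: eq_bigr => i _; rewrite mxE.
by apply: eq_bigr => j _; rewrite !mxE.
Qed.

Lemma hdot_ge0 d k (A : 'M[C]_(d, k)) : 0 <= hdot A A.
Proof. by rewrite hdotE; apply: sumr_ge0 => i _; apply: sumr_ge0 => j _; exact: mul_conjC_ge0. Qed.

Lemma hdot_eq0 d k (A : 'M[C]_(d, k)) : hdot A A = 0 -> A = 0.
Proof.
rewrite hdotE => /eqP; rewrite psumr_eq0; last first.
  by move=> i _; apply: sumr_ge0 => j _; exact: mul_conjC_ge0.
move/allP => H; apply/matrixP => i j; rewrite mxE; apply/eqP.
have := H i (mem_index_enum _); rewrite psumr_eq0; last by move=> ? _; exact: mul_conjC_ge0.
by move/allP => /(_ j (mem_index_enum _)); rewrite /= mul_conjC_eq0.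
Qed.

Lemma hdot_mull d d' k (X : 'M[C]_(d', d)) (A : 'M[C]_(d, k)) B :
  hdot (X *m A) B = hdot A (X ^t* *m B).
Proof. by rewrite /hdot adjmxM adjmxK mulmxA -mulmxA mxtrace_mulC. Qed.

Lemma hdot_mulr d k k' (A : 'M[C]_(d, k)) (X : 'M[C]_(k, k')) B :
  hdot (A *m X) B = hdot A (B *m X ^t*).
Proof. by rewrite /hdot adjmxM adjmxK mulmxA. Qed.

Section Projections.
Context {d k : nat}.
Local Notation F := 'M[C]_(d, k).
Implicit Types (W : {vspace F}) (A B : F).

Lemma hdot_vspace_eq0 W A : A \in W -> (forall B, B \in W -> hdot A B = 0) -> A = 0.
Proof. by move=> AW H; apply: hdot_eq0; exact: H. Qed.

Definition pairing W A : 'rV[C]_(\dim W) := \row_i hdot A (vbasis W)`_i.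

Lemma pairing_is_linear W : linear (pairing W).
Proof. by move=> c A B; apply/rowP => i; rewrite !mxE hdotDl hdotZl. Qed.
HB.instance Definition _ W := GRing.isLinear.Build C F 'rV[C]_(\dim W) _ (pairing W) (pairing_is_linear W).

Lemma pairing_eq0 W A : pairing W A = 0 <-> (forall B, B \in W -> hdot A B = 0).
Proof.
split=> [/rowP H B BW|H].
- rewrite (coord_vbasis BW) hdot_sumr big1 // => i _.
  by have := H i; rewrite !mxE hdotZr => ->; rewrite mulr0.
- by apply/rowP => i; rewrite !mxE; apply: H; apply: vbasis_mem; apply: mem_nth; rewrite size_tuple.
Qed.

Definition orthospace W : {vspace F} := lker (linfun (pairing W)).

Lemma mem_orthospace W A : A \in orthospace W <-> (forall B, B \in W -> hdot A B = 0).
Proof.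
rewrite memv_ker lfunE /= -pairing_eq0; split=> [/eqP //|->]; exact: eqxx.
Qed.

(** Positivity makes [pairing W] injective on W, so by dimension it maps W onto all rows; the
    pairings of A are then those of some B in W. *)
Lemma orth_decomposition W A : exists2 B, B \in W & A - B \in orthospace W.
Proof.
pose L := linfun (pairing W).
have cap0 : (W :&: lker L)%VS = 0%VS.
  apply/eqP; rewrite -subv0; apply/subvP => B /memv_capP[BW /mem_orthospace H].
  by rewrite memv0; apply/eqP; exact: hdot_vspace_eq0 BW H.
have : (L @: W)%VS = fullv.
  apply/eqP; rewrite eqEdim subvf /= (limg_dim_eq cap0) dimvf /dim /=.
  by rewrite mul1n.
move=> full; have : L A \in (L @: W)%VS by rewrite full memvf.
case/memv_imgP => B BW E; exists B => //.
by rewrite memv_ker linearB /= E subrr.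
Qed.

Lemma orthospaceK W A : (forall B, B \in orthospace W -> hdot A B = 0) -> A \in W.
Proof.
move=> H; have [B BW ABo] := orth_decomposition W A.
suff : A - B = 0 by move/eqP; rewrite subr_eq0 => /eqP ->.
apply: hdot_eq0; rewrite hdotBl H // sub0r.
by rewrite hdotC; have /mem_orthospace -> := ABo; rewrite ?rmorph0 ?oppr0.
Qed.

Lemma orthospace_eq0 W : orthospace W = 0%VS -> W = fullv.
Proof.
move=> H; apply/eqP; rewrite eqEsubv subvf; apply/subvP => A _.
apply: orthospaceK => B; rewrite H memv0 => /eqP ->; exact: hdot0r.
Qed.

Lemma orth_projE W A B : B \in W -> (forall B', B' \in W -> hdot (A - B) B' = 0) ->
  orth_proj W A = B.
Proof.
move=> BW H; rewrite /orth_proj; case: xgetP => [B1 _ [B1W H1]|/(_ B)[]//].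
apply/eqP; rewrite -subr_eq0; apply/eqP.
apply: (@hdot_vspace_eq0 W); first exact: rpredB.
by move=> B' B'W; rewrite -[B1](subKr A) addrAC hdotBl H // H1 // subrr.
Qed.

End Projections.

(** A subspace of largest dimension on which P holds contains every u satisfying P, since otherwise
    the line of u could be added to it. *)
Lemma prop_vspace (F : vectType C) (P : F -> Prop) : P 0 ->
  (forall c u v, P u -> P v -> P (c *: u + v)) -> exists W : {vspace F}, forall u, u \in W <-> P u.
Proof.
move=> P0 PL.
pose good k := `[< exists2 W : {vspace F}, \dim W = k & forall u, u \in W -> P u >].
have ex : exists k, good k.
  exists 0%N; apply/asboolP; exists 0%VS; first exact: dimv0.
  by move=> u; rewrite memv0 => /eqP ->.
have bd k : good k -> (k <= \dim {:F})%N.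
  by move=> /asboolP[W <- _]; apply: dimvS; exact: subvf.
case: (ex_maxnP ex bd) => k /asboolP[W Wk WP] maxk.
exists W => u; split; first exact: WP.
move=> Pu; apply/negPn/negP => uW.
have : good (\dim (W + <[u]>)%VS).
  apply/asboolP; eexists => // v /memv_addP[w wW [z /vlineP[c ->] ->]].
  by rewrite addrC; apply: PL => //; exact: WP.
move=> /maxk; rewrite -Wk => le.
have : (W + <[u]>)%VS = W.
  by apply/esym/eqP; rewrite eqEdim addvSl.
move=> E; move: uW; rewrite -E => /negP; apply.
by apply: (subvP (addvSr W <[u]>)); exact: memv_line.
Qed.

End HermitianSpaces.

(** * One-parameter groups and generation of U(m) *)

Section UnitaryGroup.
Context {R : realType} {m : nat}.
Local Notation C := R[i].

Definition expi (t : R) : C := Complex (cos t) (sin t).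

Lemma expiD s t : expi (s + t) = expi s * expi t.
Proof. by apply: complexE; rewrite ?ReM ?ImM /= ?cosD ?sinD //; ring. Qed.
Lemma expi0 : expi 0 = 1.
Proof. by apply: complexE => /=; rewrite ?cos0 ?sin0. Qed.
Lemma expiJ t : Num.conj (expi t) = expi (- t).
Proof. by apply: complexE; rewrite ?ReJ ?ImJ /= ?cosN ?sinN. Qed.

Lemma expi_surj (z : C) : z * Num.conj z = 1 -> exists t, z = expi t.
Proof.
case: z => a b E.
have ab : a ^+ 2 + b ^+ 2 = 1.
  by have := congr1 (@complex.Re R) E; rewrite ReM ReJ ImJ /= => <-; ring.
have a1' : -1 <= a <= 1 by apply/andP; split; have := sqr_ge0 b; nra.
have a1 : a \in `[-1, 1] by rewrite in_itv.
have [b0|b0] := leP 0 b.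
- exists (acos a); apply: complexE; rewrite /= ?acosK // sin_acos //.
  have -> : 1 - a ^+ 2 = b ^+ 2 by rewrite -ab addrC addKr.
  by rewrite sqrtr_sqr ger0_norm.
- exists (- acos a); apply: complexE; rewrite /= ?cosN ?sinN ?acosK // sin_acos //.
  have -> : 1 - a ^+ 2 = b ^+ 2 by rewrite -ab addrC addKr.
  by rewrite sqrtr_sqr ltr0_norm // opprK.
Qed.

Lemma expi_derive : is_cderive (0 : R) (1 : R) expi 'i.
Proof.
have -> : 'i = Complex (0:R) 1 by [].
split=> /=.
- by apply: is_derive_eq; rewrite sin0 oppr0.
- by apply: is_derive_eq; rewrite cos0.
Qed.

Definition herm_idem (P : 'M[C]_m) := P *m P = P /\ P ^t* = P.

(* The one-parameter group of unitary matrices generated by ['i *: P], for an orthogonal projection [P]. *)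
Definition gam (P : 'M[C]_m) (t : R) : 'M[C]_m := 1%:M + (expi t - 1) *: P.

Lemma gamD P s t : herm_idem P -> gam P (s + t) = gam P s *m gam P t.
Proof.
move=> [PP _]; rewrite /gam mulmxDl mul1mx !mulmxDr mulmx1 -scalemxAl -scalemxAr PP scalerA -!addrA.
congr (_ + _); rewrite -!scalerDl; congr (_ *: _); rewrite expiD.
by move: (expi s) (expi t) => a b; ring.
Qed.

Lemma gam0 P : gam P 0 = 1%:M.
Proof. by rewrite /gam expi0 subrr scale0r addr0. Qed.

Lemma gam_adj P t : herm_idem P -> (gam P t) ^t* = gam P (- t).
Proof.
move=> [_ Ph]; rewrite /gam adjmxD adjmxZ adjmx1 Ph; congr (_ + _ *: _).
by rewrite rmorphB rmorph1 /= expiJ.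
Qed.

Lemma gam_unitary P t : herm_idem P -> gam P t \is unitarymx.
Proof.
by move=> hP; apply/unitarymxP; rewrite gam_adj // -gamD // subrr gam0.
Qed.

Lemma gam_derive P : is_mxderive (0 : R) (1 : R) (gam P) ('i *: P).
Proof.
apply: is_mxderive_eq.
  apply: is_mxderiveD; first exact: is_mxderive_cst.
  apply: is_mxderiveZ; last exact: is_mxderive_cst.
  by apply: is_cderiveD; [exact: expi_derive|exact: is_cderive_cst].
by rewrite /= scaler0 !addr0 add0r.
Qed.

Lemma unitarymx1 : (1%:M : 'M[C]_m) \is unitarymx.
Proof. by apply/unitarymxP; rewrite adjmx1 mul1mx. Qed.

Lemma herm_idem_delta (k : 'I_m) : herm_idem (delta_mx k k).
Proof.
split; first by rewrite mul_delta_mx.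
by apply/matrixP => i j; rewrite !mxE rmorph_nat andbC.
Qed.

(** Hermitian idempotents span gl(m, C). The rank one projection built from the row e_k + c e_l,
    with |c| = 1, gives c E_kl + conj(c) E_lk modulo diagonal units; c = 1 and c = i together
    isolate E_kl. *)
Lemma mx_proj_ind (Pr : 'M[C]_m -> Prop) :
  (forall a X Y, Pr X -> Pr Y -> Pr (a *: X + Y)) ->
  (forall P, herm_idem P -> Pr P) -> forall X, Pr X.
Proof.
move=> PL PP.
have P0 : Pr 0 by apply: PP; split; rewrite ?mul0mx // trmx0 map_mx0.
have PZ a X : Pr X -> Pr (a *: X) by move=> H; rewrite -[_ *: _]addr0; exact: PL.
have PD X Y : Pr X -> Pr Y -> Pr (X + Y) by move=> HX HY; rewrite -[X]scale1r; exact: PL.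
have PN X : Pr X -> Pr (- X) by move=> H; rewrite -scaleN1r; exact: PZ.
have Pkk k : Pr (delta_mx k k) by apply: PP; exact: herm_idem_delta.
have two : (2%:R : C) != 0 by rewrite pnatr_eq0.
have Pc (k l : 'I_m) (c : C) : k != l -> c * Num.conj c = 1 ->
    Pr (c *: delta_mx k l + Num.conj c *: delta_mx l k).
  move=> kl cc.
  pose w : 'rV[C]_m := delta_mx 0 k + c *: delta_mx 0 l.
  have T a (i : 'I_a) (j : 'I_m) : (delta_mx i j : 'M[C]_(a, m)) ^t* = delta_mx j i.
    by apply/matrixP => u v; rewrite !mxE rmorph_nat andbC.
  have wE : w ^t* = delta_mx k 0 + Num.conj c *: delta_mx l 0 by rewrite /w adjmxD adjmxZ !T.
  have ww : w *m w ^t* = 2%:M.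
    rewrite wE /w mulmxDl !mulmxDr -!(scalemxAl, scalemxAr) !mul_delta_mx mul_delta_mx_0 //.
    rewrite mul_delta_mx_0 1?eq_sym // !scaler0 addr0 add0r scalerA cc scale1r.
    by apply/matrixP => i j; rewrite !ord1 !mxE /= -natrD.
  pose Q := 2^-1 *: (w ^t* *m w).
  have hQ : herm_idem Q.
    split.
      rewrite /Q -scalemxAl -scalemxAr scalerA mulmxA -[_ *m w *m _]mulmxA ww mul_mx_scalar -scalemxAl scalerA.
      by rewrite -mulrA mulVf // mulr1.
    by rewrite /Q adjmxZ adjmxM adjmxK fmorphV rmorph_nat.
  have QE : 2%:R *: Q = delta_mx k k + delta_mx l l + (c *: delta_mx k l + Num.conj c *: delta_mx l k).
    rewrite /Q scalerA divff // scale1r wE /w mulmxDl !mulmxDr -!(scalemxAl, scalemxAr) !mul_delta_mx.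
    by rewrite scalerA [Num.conj c * c]mulrC cc scale1r [_ *: delta_mx l k + _]addrC addrACA.
  have -> : c *: delta_mx k l + Num.conj c *: delta_mx l k = 2%:R *: Q + - (delta_mx k k + delta_mx l l).
    by rewrite QE [RHS]addrC addKr.
  by apply: (PD _ _); [exact: PZ _ _ (PP _ hQ)|exact: PN _ (PD _ _ (Pkk k) (Pkk l))].
have Pkl k l : Pr (delta_mx k l).
  have [<-//|kl] := eqVneq k l.
  have -> : delta_mx k l = 2^-1 *: ((1 *: delta_mx k l + Num.conj 1 *: delta_mx l k) +
     (- 'i) *: ('i *: delta_mx k l + Num.conj 'i *: delta_mx l k)) :> 'M[C]_m.
    have i1 : - 'i * 'i = 1 :> C by rewrite mulNr -expr2 sqrCi opprK.
    have i2 : - 'i * - 'i = -1 :> C by rewrite mulrNN -expr2 sqrCi.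
    rewrite conjC1 conjCi !scale1r [- 'i *: (_ + _)]scalerDr !scalerA i1 i2 scale1r scaleN1r.
    by rewrite addrACA subrr addr0 -mulr2n -(scaler_nat 2 (delta_mx k l)) scalerA mulVf // scale1r.
  apply: (PZ _ _); apply: (PD _ _); first by apply: Pc; rewrite // conjC1 mulr1.
  by apply: (PZ _ _); apply: Pc => //; rewrite conjCi mulrN -expr2 sqrCi opprK.
move=> X; rewrite [X]matrix_sum_delta.
apply: big_ind => // i _; apply: big_ind => // j _; exact: PZ.
Qed.

(** By the spectral theorem a unitary matrix is a product of values of the groups [gam P], with P
    the projections onto an orthonormal family of eigenlines, because each eigenvalue has the form
    exp(i t). *)
Lemma unitary_ind (Pr : 'M[C]_m -> Prop) : Pr 1%:M ->
  (forall a P t, a \is unitarymx -> Pr a -> herm_idem P -> Pr (a *m gam P t)) ->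
  forall a, a \is unitarymx -> Pr a.
Proof.
move=> P1 PM a ua.
have na : a \is normalmx.
  apply/normalmxP; have /unitarymxP -> := ua.
  by apply/esym; rewrite -(mul1mx (a ^t*)) mulmxKtV // mul1mx //.
have /orthomx_spectralP := na; set U := spectralmx a; set sp := spectral_diag a => E.
have uU : U \is unitarymx by exact: spectral_unitarymx.
rewrite invmx_unitary // in E.
have UU : U *m U ^t* = 1%:M by apply/unitarymxP.
have UU' : U ^t* *m U = 1%:M by rewrite -[LHS]mul1mx mulmxA mulmxKtV.
have spn i : sp 0 i * Num.conj (sp 0 i) = 1.
  have : diag_mx sp *m (diag_mx sp) ^t* = 1%:M.
    have -> : diag_mx sp = U *m a *m U ^t* by rewrite E !mulmxA UU mul1mx -mulmxA UU mulmx1.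
    rewrite !adjmxM adjmxK !mulmxA -[U *m a *m U^t* *m U]mulmxA UU' mulmx1.
    by rewrite -[U *m a *m _]mulmxA (unitarymxP ua) mulmx1.
  move/matrixP/(_ i i); rewrite !mxE eqxx (bigD1 i) //= !mxE eqxx mulr1n big1 ?addr0; first by [].
  by move=> j ji; rewrite !mxE eq_sym (negbTE ji) mulr0n mul0r.
pose Pk k := U ^t* *m delta_mx k k *m U.
have hPk k : herm_idem (Pk k).
  have [H1 H2] := herm_idem_delta k; split; rewrite /Pk.
    by rewrite !mulmxA -[_ *m U *m U^t*]mulmxA UU mulmx1 -[_ *m delta_mx k k *m delta_mx k k]mulmxA H1.
  by rewrite !adjmxM adjmxK H2 mulmxA.
(* The partial product: the first j eigenvalues of a are kept and the others are replaced by 1. *)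
pose A (j : nat) := U ^t* *m diag_mx (\row_i (if (i < j)%N then sp 0 i else 1)) *m U.
have stepA (k : 'I_m) t : sp 0 k = expi t -> A k.+1 = A k *m gam (Pk k) t.
  move=> Et; rewrite /gam /Pk mulmxDr mulmx1 -scalemxAr /A !mulmxA -[_ *m U *m U^t*]mulmxA UU mulmx1.
  rewrite -[_ *m delta_mx k k]mulmxA scalemxAl -mulmxDl; congr (_ *m _).
  rewrite scalemxAr -mulmxDr; congr (_ *m _).
  apply/matrixP => i j; rewrite mul_diag_mx !mxE ltnS leq_eqVlt -Et.
  have -> : (i == k) && (j == k) = (i == j) && (i == k).
    by apply/andP/andP => -[/eqP -> /eqP ->]; rewrite eqxx.
  have [_|_] := eqVneq i j; last by rewrite !mulr0n !mulr0 addr0.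
  rewrite (inj_eq val_inj) !mulr1n; have [->|_] := eqVneq i k; last by rewrite /= !mulr0 addr0.
  by rewrite ltnn /= !mulr1 addrC subrK.
have A0 : A 0%N = 1%:M.
  have H : diag_mx (\row_i (if (i < 0)%N then sp 0 i else 1)) = 1%:M :> 'M[C]_m.
    by rewrite -[1%:M]diag_const_mx; congr diag_mx; apply/rowP => i; rewrite !mxE.
  by rewrite /A H mulmx1 UU'.
have Am : A m = a.
  rewrite [RHS]E /A; congr (_ *m diag_mx _ *m _).
  by apply/rowP => i; rewrite mxE ltn_ord.
clearbody A Pk; rewrite -Am; suff PA j : (j <= m)%N -> A j \is unitarymx /\ Pr (A j) by have [] := PA m (leqnn m).
elim: j => [_|j IH jm].
  by rewrite A0; split; [exact: unitarymx1|exact: P1].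
have [u1 p1] := IH (ltnW jm); have [t Et] := expi_surj (spn (Ordinal jm)).
have -> : A j.+1 = A j *m gam (Pk (Ordinal jm)) t := stepA _ _ Et.
by split; [apply: mul_unitarymx u1 _; exact: gam_unitary|exact: PM].
Qed.

End UnitaryGroup.

Section CurvesAt.
Context {R : realType}.
Local Notation C := R[i].

Lemma is_derive_translate (f : R -> R) (t l : R) :
  is_derive (0 : R) (1 : R) f l -> is_derive t (1 : R) (fun s => f (s - t)) l.
Proof.
move=> [d v].
have E : (fun h : R => h^-1 *: (((fun s => f (s - t)) \o shift t) (h *: (1:R)) - f (t - t))) =
    (fun h : R => h^-1 *: ((f \o shift 0) (h *: (1:R)) - f 0)).
  by apply: funext => h /=; rewrite addrK subrr addr0.
by apply: DeriveDef; rewrite /derivable /derive E.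
Qed.

Lemma is_mxderive_translate a b (F : R -> 'M[C]_(a, b)) t L :
  is_mxderive (0 : R) (1 : R) F L -> is_mxderive t (1 : R) (fun s => F (s - t)) L.
Proof.
move=> H i j; have [H1 H2] := H i j.
by split; [exact: (is_derive_translate t H1)|exact: (is_derive_translate t H2)].
Qed.

Lemma is_mxderive_unique (V : normedModType R) a b (x v : V) (F : V -> 'M[C]_(a, b)) L L' :
  is_mxderive x v F L -> is_mxderive x v F L' -> L = L'.
Proof.
move=> H H'; apply/matrixP => i j.
by have [[_ e1] [_ e2]] := H i j; have [[_ e1'] [_ e2']] := H' i j; apply: complexE; rewrite -?e1 -?e2.
Qed.

Lemma is_mxderive0_cst a b (F : R -> 'M[C]_(a, b)) s t :
  (forall t, is_mxderive t (1 : R) F 0) -> F s = F t.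
Proof.
move=> H; apply/matrixP => i j; apply: complexE.
- apply: (@is_derive_0_is_cst R (fun s => complex.Re (F s i j)) s t) => u.
  by have [] := H u i j; rewrite mxE.
- apply: (@is_derive_0_is_cst R (fun s => complex.Im (F s i j)) s t) => u.
  by have [_] := H u i j; rewrite mxE.
Qed.

Lemma is_mxderive_adj (V : normedModType R) a b (x v : V) (F : V -> 'M[C]_(a, b)) L :
  is_mxderive x v F L -> is_mxderive x v (fun z => (F z) ^t*) (L ^t*).
Proof.
move=> H; have := is_mxderiveJ (is_mxderiveT H).
by under [X in is_mxderive _ _ X]funext do rewrite /Defs.conjmx.
Qed.

Lemma is_mxderive_mull (V : normedModType R) a b c (x v : V) (A : 'M[C]_(c, a)) (F : V -> 'M[C]_(a, b)) L :
  is_mxderive x v F L -> is_mxderive x v (fun z => A *m F z) (A *m L).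
Proof.
move=> H; apply: is_mxderive_eq (is_mxderiveM (is_mxderive_cst _ _ A) H) _.
by rewrite mul0mx add0r.
Qed.

Lemma is_mxderive_mulr (V : normedModType R) a b c (x v : V) (A : 'M[C]_(b, c)) (F : V -> 'M[C]_(a, b)) L :
  is_mxderive x v F L -> is_mxderive x v (fun z => F z *m A) (L *m A).
Proof.
move=> H; apply: is_mxderive_eq (is_mxderiveM H (is_mxderive_cst _ _ A)) _.
by rewrite mulmx0 addr0.
Qed.

Lemma mulmx_col_ext a b (A B : 'M[C]_(a, b)) : (forall x : 'cV_b, A *m x = B *m x) -> A = B.
Proof.
by move=> H; apply/matrixP => i j; have /colP/(_ i) := H (delta_mx j 0); rewrite -!colE !mxE.
Qed.

End CurvesAt.

(** * Infinitesimal action, Schur's lemma and highest weight vectors *)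

Section UnitaryRep.
Context {R : realType} {m : nat} {rho : 'I_m -> int} (V : unirrep (R := R) rho).
Local Notation C := R[i].
Local Notation d := (rdim V).
Local Notation e k l := (pi_e V k l).
Local Notation expU P := (fun t : R => rmap V (gam P t)).

Lemma expU_derive P : herm_idem P -> is_mxderive (0 : R) (1 : R) (expU P) (rdiff V ('i *: P)).
Proof.
move=> hP.
exact: (@rdiffP _ _ _ V (gam P) ('i *: P) (fun t => gam_unitary t hP) (gam0 P) (gam_derive P)).
Qed.

Lemma rmap_adj a : a \is unitarymx -> rmap V (a ^t*) = (rmap V a) ^t*.
Proof.
move=> ua; have ur := rmap_unitary V ua; have ua' : a ^t* \is unitarymx by rewrite trmxC_unitary.
have E : rmap V a *m rmap V (a ^t*) = 1%:M by rewrite -rmapM // (unitarymxP ua) rmap1.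
have /unitarymxP E' := ur.
have ru : rmap V a \in unitmx by have /mulmx1_unit[] := E.
by rewrite -[LHS](mulKmx ru) -[RHS](mulKmx ru) E E'.
Qed.

Lemma rmap_adjK a : a \is unitarymx -> (rmap V a) ^t* *m rmap V a = 1%:M.
Proof. by move=> /(rmap_unitary V) /unitarymxP /mulmx1C. Qed.

Lemma rmapK a : a \is unitarymx -> rmap V a *m (rmap V a) ^t* = 1%:M.
Proof. by move=> /(rmap_unitary V) /unitarymxP. Qed.

(** For a projection both sides are, up to the factor i, derivatives at 0 of the image of the
    conjugated one-parameter group; linearity extends this to all X. *)
Lemma rmap_rdiff a X : a \is unitarymx ->
  rmap V a *m rdiff V X *m (rmap V a) ^t* = rdiff V (a *m X *m a ^t*).
Proof.
move=> ua; elim/(@mx_proj_ind R m): X => [c X Y HX HY|P hP].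
  rewrite (linearP (rdiff V)) mulmxDr mulmxDl -scalemxAr -scalemxAl HX HY.
  by rewrite [in RHS]mulmxDr mulmxDl -scalemxAr -scalemxAl (linearP (rdiff V)).
have hQ : herm_idem (a *m P *m a ^t*).
  have [PP Ph] := hP; have /mulmx1C aa := unitarymxP ua; split.
    by rewrite !mulmxA -[_ *m a^t* *m a]mulmxA aa mulmx1 -[_ *m P *m P]mulmxA PP.
  by rewrite !adjmxM adjmxK Ph mulmxA.
have gE t : gam (a *m P *m a ^t*) t = a *m gam P t *m a ^t*.
  by rewrite /gam mulmxDr mulmx1 mulmxDl (unitarymxP ua) -scalemxAr -scalemxAl.
have H1 := expU_derive hQ.
have H2 := is_mxderive_mulr ((rmap V a)^t*) (is_mxderive_mull (rmap V a) (expU_derive hP)).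
have E : (fun t : R => rmap V a *m rmap V (gam P t) *m (rmap V a)^t*) = expU (a *m P *m a ^t*).
  have ua' : a ^t* \is unitarymx by rewrite trmxC_unitary.
  apply: funext => t; have ug := gam_unitary t hP; have uag := mul_unitarymx ua ug.
  by rewrite gE (rmapM V uag ua') (rmapM V ua ug) (rmap_adj ua).
rewrite E in H2; have := is_mxderive_unique H2 H1.
rewrite !(linearZZ (rdiff V)) -scalemxAr -scalemxAl.
by move/(scalerI (neq0Ci _)).
Qed.

(** Differentiating the unitarity of [rmap] along [gam P] makes the image of i P skew-Hermitian. *)
Lemma rdiff_adj X : (rdiff V X) ^t* = rdiff V (X ^t*).
Proof.
elim/(@mx_proj_ind R m): X => [c X Y HX HY|P hP].
  by rewrite linearP /= adjmxD adjmxZ HX HY adjmxD adjmxZ linearP.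
have H1 := expU_derive hP; have H2 := is_mxderiveM H1 (is_mxderive_adj H1).
have E : (fun t : R => rmap V (gam P t) *m (rmap V (gam P t))^t*) = fun=> 1%:M.
  by apply: funext => t; rewrite (rmapK (gam_unitary t hP)).
rewrite E in H2; have := is_mxderive_unique H2 (is_mxderive_cst _ _ _).
rewrite !gam0 rmap1 adjmx1 mulmx1 mul1mx linearZ /= adjmxZ conjCi scaleNr -scalerBr => /eqP.
rewrite scaler_eq0 (negbTE (neq0Ci _)) /= subr_eq0 => /eqP <-.
by have [_ ->] := hP.
Qed.

(** The equivariance [rmap_rdiff] is differentiated along [gam P]. *)
Lemma rdiff_bracket X Y : rdiff V (X *m Y - Y *m X) = rdiff V X *m rdiff V Y - rdiff V Y *m rdiff V X.
Proof.
elim/(@mx_proj_ind R m): X => [c X X' HX HX'|P hP].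
  have -> : (c *: X + X') *m Y - Y *m (c *: X + X') = c *: (X *m Y - Y *m X) + (X' *m Y - Y *m X').
    by rewrite mulmxDl mulmxDr -scalemxAl -scalemxAr opprD addrACA -scalerBr.
  rewrite linearP /= HX HX' linearP /= mulmxDl mulmxDr -scalemxAl -scalemxAr opprD [RHS]addrACA.
  by rewrite -scalerBr.
have H1 := expU_derive hP.
have H2 := is_mxderiveM (is_mxderive_mulr (rdiff V Y) H1) (is_mxderive_adj H1).
have G := @gam_derive R m P.
have H3 := is_mxderive_lin (rdiff V) (is_mxderiveM (is_mxderive_mulr Y G) (is_mxderive_adj G)).
have E : (fun t : R => rmap V (gam P t) *m rdiff V Y *m (rmap V (gam P t))^t*) =
         (fun t => rdiff V (gam P t *m Y *m (gam P t)^t*)).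
  by apply: funext => t; rewrite (rmap_rdiff _ (gam_unitary t hP)).
rewrite E in H2; have := is_mxderive_unique H2 H3.
rewrite !gam0 rmap1 !adjmx1 !mulmx1 !mul1mx linearZ /= !adjmxZ rdiff_adj.
have [_ ->] := hP; rewrite conjCi !scaleNr !mulmxN -!scalemxAr -!scalemxAl -!scalerBr linearZ /=.
by move/(scalerI (neq0Ci _)) ->.
Qed.

(* [G(t)^* Q G(t)] has zero derivative along each one-parameter group. *)
Lemma commute_rdiff_rmap (Q : 'M[C]_d) : (forall X, Q *m rdiff V X = rdiff V X *m Q) ->
  forall a, a \is unitarymx -> Q *m rmap V a = rmap V a *m Q.
Proof.
move=> HQ; apply: unitary_ind => [|a P t ua Ha hP]; first by rewrite rmap1 mul1mx mulmx1.
have ug s : gam P s \is unitarymx by exact: gam_unitary.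
suff Hg : Q *m rmap V (gam P t) = rmap V (gam P t) *m Q.
  by rewrite rmapM // mulmxA Ha -!mulmxA Hg.
pose X := rdiff V ('i *: P).
have XX : X ^t* = - X.
  rewrite rdiff_adj adjmxZ conjCi; have [_ ->] := hP.
  by rewrite scaleNr linearN.
have dG s : is_mxderive s (1 : R) (expU P) (X *m rmap V (gam P s)).
  have := is_mxderive_mulr (rmap V (gam P s)) (is_mxderive_translate s (expU_derive hP)).
  have -> // : (fun u : R => rmap V (gam P (u - s)) *m rmap V (gam P s)) = expU P.
  by apply: funext => u; rewrite -(rmapM V (ug _) (ug _)) -(gamD _ _ hP) subrK.
pose F s := (rmap V (gam P s))^t* *m (Q *m rmap V (gam P s)).
have dF s : is_mxderive s (1 : R) F 0.
  apply: is_mxderive_eq (is_mxderiveM (is_mxderive_adj (dG s)) (is_mxderive_mull Q (dG s))) _.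
  rewrite adjmxM XX mulmxN mulNmx !mulmxA -[_ *m Q *m X]mulmxA HQ mulmxA addNr //.
have := is_mxderive0_cst t 0 dF; rewrite /F gam0 rmap1 adjmx1 mul1mx mulmx1.
by move/(congr1 (mulmx (rmap V (gam P t)))); rewrite mulmxA rmapK // mul1mx.
Qed.

Lemma pi_e_bracket k l i j :
  e k l *m e i j - e i j *m e k l = (l == i)%:R *: e k j - (k == j)%:R *: e i l.
Proof.
have L (b : bool) X : rdiff V (X *+ b) = b%:R *: rdiff V X.
  by case: b; rewrite ?mulr1n ?scale1r // mulr0n scale0r (linear0 (rdiff V)).
by rewrite /pi_e -rdiff_bracket !mul_delta_mx_cond (linearB (rdiff V)) !L [j == k]eq_sym.
Qed.

Lemma pi_e_adj k l : (e k l) ^t* = e l k.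
Proof.
rewrite /pi_e rdiff_adj; congr (rdiff V _).
by apply/matrixP => i j; rewrite !mxE rmorph_nat andbC.
Qed.

Lemma pi_eE X : rdiff V X = \sum_k \sum_l X k l *: e k l.
Proof.
rewrite [in LHS](matrix_sum_delta X) linear_sum; apply: eq_bigr => k _.
by rewrite linear_sum; apply: eq_bigr => l _; rewrite linearZ.
Qed.

Lemma rdim_gt0 : (0 < d)%N.
Proof.
have [nz _ _] := rirr V; rewrite lt0n; apply/eqP => d0; apply: nz.
by apply/eqP; rewrite -dimv_eq0 dimvf /dim /= d0.
Qed.

Lemma schur (A : 'M[C]_d) : (forall a, a \is unitarymx -> A *m rmap V a = rmap V a *m A) ->
  exists c, A = c%:M.
Proof.
(* Eigenvectors are rows here; passing to the transpose yields a column eigenvector of A. *)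
move=> HA; have [c] := @eigenvalue_closed C d A^T rdim_gt0.
move/eigenvalueP => [v /(congr1 trmx)]; rewrite trmx_mul trmxK linearZ /= => Ev v0.
have [W HW] : exists W : {vspace 'cV[C]_d}, forall u, u \in W <-> A *m u = c *: u.
  apply: prop_vspace; first by rewrite mulmx0 scaler0.
  move=> b u w Hu Hw; rewrite mulmxDr -scalemxAr Hu Hw scalerDr !scalerA.
  by rewrite [b * c]mulrC.
have [nz _ irr] := rirr V.
have Wi : invariant_sub (fun a (v : 'cV[C]_d) => rmap V a *m v) W.
  by move=> a ua u /HW Hu; apply/HW; rewrite mulmxA (HA _ ua) -mulmxA Hu scalemxAr.
have [W0|Wf] := irr W (subvf W) Wi.
- have : v^T \in W by apply/HW.
  rewrite W0 memv0 => /eqP /(congr1 trmx); rewrite trmxK trmx0 => v00.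
  by rewrite v00 eqxx in v0.
- exists c; apply/matrixP => i j.
  have : (delta_mx j 0 : 'cV[C]_d) \in W by rewrite Wf memvf.
  move/HW.
  move/matrixP/(_ i 0); rewrite -colE !mxE eqxx andbT => ->.
  by rewrite mulr_natr.
Qed.

Definition hw_vector : 'cV[C]_d := sval (cid (rhw V)).

Lemma hw_vectorP : [/\ hw_vector != 0, forall k, e k k *m hw_vector = (rho k)%:~R *: hw_vector &
  forall k l : 'I_m, (k < l)%N -> e k l *m hw_vector = 0].
Proof. by rewrite /hw_vector; case: cid => v /= [_]. Qed.

(** The subspace generated from the highest weight vector by lowering operators, as an inductive
    predicate so that stability is proved by induction on how a vector was built. *)
Inductive lowering_span : 'cV[C]_d -> Prop :=
| lowering_hw : lowering_span hw_vector
| lowering_lin c u v : lowering_span u -> lowering_span v -> lowering_span (c *: u + v)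
| lowering_step (k l : 'I_m) u : (l < k)%N -> lowering_span u -> lowering_span (e k l *m u).

Lemma lowering_span0 : lowering_span 0.
Proof. by rewrite -[0](addNr hw_vector) -scaleN1r; apply: lowering_lin; exact: lowering_hw. Qed.

(** An operator e_ij is commuted through the lowering operators until it reaches the highest weight
    vector, which raising operators kill and diagonal ones scale. *)
Lemma lowering_span_stable u i j : lowering_span u -> lowering_span (e i j *m u).
Proof.
have SZ c w : lowering_span w -> lowering_span (c *: w).
  by move=> H; rewrite -[_ *: _]addr0; apply: lowering_lin => //; exact: lowering_span0.
move=> H; elim: H i j => {u} [|c u v _ IHu _ IHv|k l u lk Hu IH] i j.
- have [_ Hd Hr] := hw_vectorP; have [ij|ji|ij] := ltngtP i j.
  + by rewrite Hr //; exact: lowering_span0.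
  + by apply: lowering_step => //; exact: lowering_hw.
  + by have -> : i = j by [exact: val_inj]; rewrite Hd; apply: SZ; exact: lowering_hw.
- by rewrite mulmxDr -scalemxAr; exact: lowering_lin.
- have -> : e i j *m (e k l *m u) = e k l *m (e i j *m u) +
      ((j == k)%:R *: (e i l *m u) + (- (i == l)%:R) *: (e k j *m u)).
    have := congr1 (mulmx^~ u) (pi_e_bracket i j k l).
    rewrite !mulmxBl -!scalemxAl -!mulmxA scaleNr => /(canRL (subrK _)) ->.
    by rewrite addrC.
  rewrite -[X in lowering_span (X + _)]scale1r; apply: lowering_lin.
    exact: lowering_step.
  apply: lowering_lin => //; exact: SZ.
Qed.

(** After subtraction of its projection onto [hw_vector], w is orthogonal to everything lowered from
    that vector, since the adjoint of a lowering operator is a raising one and kills w. The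
    orthogonal complement K of the lowering span is invariant and misses the highest weight vector,
    so irreducibility gives K = 0. *)
Lemma hw_vector_unique w : (forall k l : 'I_m, (k < l)%N -> e k l *m w = 0) ->
  exists c, w = c *: hw_vector.
Proof.
move=> Hw; have [v0 Hd Hr] := hw_vectorP; set v := hw_vector in v0 Hd Hr *.
have vv : hdot v v != 0 by apply: contra_neq v0; exact: hdot_eq0.
pose c := hdot w v / hdot v v; exists c.
pose w' := w - c *: v.
have w'v : hdot v w' = 0.
  rewrite hdotC /w' hdotBl hdotZl /c divfK // subrr rmorph0 //.
have Hw' (k l : 'I_m) : (k < l)%N -> e k l *m w' = 0.
  by move=> kl; rewrite /w' mulmxBr -scalemxAr Hw // Hr // scaler0 subrr.
have [K HK] : exists K : {vspace 'cV[C]_d}, forall x, x \in K <-> (forall y, lowering_span y -> hdot x y = 0).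
  apply: prop_vspace; first by move=> y _; rewrite hdot0l.
  by move=> b x x' Hx Hx' y Hy; rewrite hdotDl hdotZl Hx // Hx' // mulr0 addr0.
have Kinv x X : x \in K -> rdiff V X *m x \in K.
  move=> /HK Hx; apply/HK => y Hy; rewrite hdot_mull rdiff_adj pi_eE mulmx_suml hdot_sumr big1 // => i _.
  rewrite mulmx_suml hdot_sumr big1 // => j _; rewrite -scalemxAl hdotZr Hx ?mulr0 //.
  exact: lowering_span_stable.
have Kinvo x X : x \in orthospace K -> rdiff V X *m x \in orthospace K.
  move=> /mem_orthospace Hx; apply/mem_orthospace => y Hy; rewrite hdot_mull rdiff_adj.
  by apply: Hx; exact: Kinv.
have w'K : w' \in K.
  apply/HK => y Hy; rewrite hdotC; suff -> : hdot y w' = 0 by rewrite rmorph0.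
  elim: Hy => {y} [//|b x x' _ Hx _ Hx'|k l x kl _ _].
    by rewrite hdotDl hdotZl Hx Hx' mulr0 addr0.
  by rewrite hdot_mull pi_e_adj Hw' // hdot0r.
(* Irreducibility concerns U(m), whereas K is so far stable under gl(m, C). The orthogonal
   projection onto K commutes with [rdiff], hence with [rmap], which gives invariance under the
   group. *)
pose pr (x : 'cV[C]_d) := s2val (cid2 (orth_decomposition K x)).
have prK x : pr x \in K := s2valP (cid2 (orth_decomposition K x)).
have prO x : x - pr x \in orthospace K := s2valP' (cid2 (orth_decomposition K x)).
have prU x y : y \in K -> x - y \in orthospace K -> pr x = y.
  move=> yK /mem_orthospace xy; have /mem_orthospace xp := prO x.
  apply/eqP; rewrite -subr_eq0; apply/eqP; apply: (@hdot_vspace_eq0 _ _ _ K); first exact: rpredB.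
  by move=> z zK; rewrite -(subrKA x) addrC hdotDl xy // add0r -opprB hdotNl xp // oppr0.
have prlin : linear pr.
  move=> b x y; apply: prU; first by rewrite rpredD // rpredZ.
  rewrite opprD addrACA -scalerBr; apply: rpredD; [apply: rpredZ|]; exact: prO.
have pr0 : pr 0 = 0 by apply: prU; rewrite ?subrr rpred0.
have prS I (r : seq I) (b : I -> C) f : pr (\sum_(i <- r) b i *: f i) = \sum_(i <- r) b i *: pr (f i).
  by elim: r => [|i r IH]; rewrite ?big_nil // !big_cons prlin IH.
pose Q : 'M[C]_d := \matrix_(i, j) pr (delta_mx j 0) i 0.
have QE x : Q *m x = pr x.
  have xE : x = \sum_j x j 0 *: delta_mx j 0.
    by rewrite {1}[x]matrix_sum_delta; apply: eq_bigr => j _; rewrite big_ord1.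
  rewrite [in RHS]xE prS; apply/colP => i; rewrite !mxE summxE; apply: eq_bigr => j _.
  by rewrite !mxE mulrC.
have QX X : Q *m rdiff V X = rdiff V X *m Q.
  apply: mulmx_col_ext => x; rewrite -!mulmxA !QE; apply: prU; first exact: Kinv.
  by rewrite -mulmxBr; exact: Kinvo.
have QG := commute_rdiff_rmap QX.
have [nz _ irr] := rirr V.
have Ki : invariant_sub (fun a (v : 'cV[C]_d) => rmap V a *m v) K.
  move=> a ua x xK; have : Q *m (rmap V a *m x) = rmap V a *m x.
    rewrite mulmxA QG // -mulmxA QE (prU x x) //.
    by rewrite subrr rpred0.
  by rewrite QE => <-; exact: prK.
have [K0|Kf] := irr K (subvf K) Ki.
- by apply/eqP; rewrite -subr_eq0; move: w'K; rewrite K0 memv0.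
- have : v \in K by rewrite Kf memvf.
  by move/HK => /(_ v lowering_hw) /hdot_eq0 v00; rewrite v00 eqxx in v0.
Qed.

End UnitaryRep.

Section Eigenvectors.
Context {R : realType}.
Local Notation C := R[i].
Context {F : vectType C} (f : 'End(F)) (W : {vspace F}).
Hypothesis fW : forall v, v \in W -> f v \in W.

Let b := vbasis W.
Let Mx : 'M[C]_(\dim W) := \matrix_(i, j) coord b j (f b`_i).
Let vec (u : 'rV[C]_(\dim W)) : F := \sum_i u 0 i *: b`_i.

Let vecW u : vec u \in W.
Proof.
apply: rpred_sum => i _; apply: rpredZ; apply: vbasis_mem; apply: mem_nth.
by rewrite size_tuple.
Qed.

Let vec_inj u : vec u = 0 -> u = 0.
Proof.
move=> H; apply/rowP => i; rewrite mxE.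
have := coord_sum_free (u 0) i (basis_free (vbasisP W)).
by rewrite -/(vec u) H linear0 => <-.
Qed.

Let vec_f u : f (vec u) = vec (u *m Mx).
Proof.
rewrite /vec linear_sum /=.
under eq_bigr => i _.
  rewrite linearZ /= (coord_vbasis (v := f b`_i) (fW (vbasis_mem (mem_nth 0 _)))) ?size_tuple //.
  rewrite scaler_sumr; over.
rewrite exchange_big; apply: eq_bigr => j _; rewrite mxE scaler_suml.
by apply: eq_bigr => i _; rewrite scalerA mxE.
Qed.

Let vec_surj v : v \in W -> exists u, v = vec u.
Proof.
move=> vW; exists (\row_i coord b i v); rewrite [LHS](coord_vbasis vW).
by apply: eq_bigr => i _; rewrite mxE.
Qed.

Lemma eigenvector_exists : W <> 0%VS -> exists c v, [/\ v \in W, v != 0 & f v = c *: v].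
Proof.
move=> W0; have dW : (0 < \dim W)%N by rewrite lt0n dimv_eq0; apply/eqP.
have [c /eigenvalueP[u Eu u0]] := eigenvalue_closed Mx dW.
exists c, (vec u); split; first exact: vecW.
  by apply: contra_neq u0; exact: vec_inj.
rewrite vec_f Eu /vec scaler_sumr; apply: eq_bigr => i _.
by rewrite mxE scalerA.
Qed.

Lemma eigenvalues_finite : exists rs : seq C, forall c v, v \in W -> v != 0 -> f v = c *: v -> c \in rs.
Proof.
have [rs Ers] := closed_field_poly_normal (char_poly Mx); exists rs => c v vW v0 fv.
have [u vu] := vec_surj vW.
have : eigenvalue Mx c.
  apply/eigenvalueP; exists u; last by apply: contra_neq v0 => u0; rewrite vu u0 /vec big1 // => i _; rewrite mxE scale0r.
  apply/eqP; rewrite -subr_eq0; apply/eqP; apply: vec_inj.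
  have vecB u1 u2 : vec (u1 - u2) = vec u1 - vec u2.
    by rewrite /vec -sumrB; apply: eq_bigr => i _; rewrite !mxE scalerBl.
  rewrite vecB -vec_f -vu fv vu /vec scaler_sumr -sumrB big1 // => i _.
  by rewrite mxE scalerA subrr.
rewrite eigenvalue_root_char Ers rootZ ?root_prod_XsubC //.
by rewrite lead_coef_eq0 -size_poly_eq0 size_char_poly.
Qed.

End Eigenvectors.

Lemma sum_lt_nat (A : pzSemiRingType) m (k : 'I_m) : \sum_(x < m) ((x < k)%N)%:R = (k : nat)%:R :> A.
Proof.
rewrite -natr_sum; congr (_%:R).
rewrite (eq_bigr (fun x : 'I_m => if (x < k)%N then 1%N else 0%N)); last by move=> x _; case: ltnP.
by rewrite -big_mkcond -(big_ord_widen m (fun=> 1%N)) ?sum_nat_const ?card_ord ?muln1 // ltnW.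
Qed.

Lemma sum_gt_nat (A : pzRingType) m (k : 'I_m) : \sum_(x < m) ((k < x)%N)%:R = (m - k.+1)%:R :> A.
Proof.
rewrite -natr_sum; congr (_%:R).
have E : (\sum_(x < m) ((k < x) + (x < k.+1)) = m)%N.
  rewrite (eq_bigr (fun=> 1%N)) ?sum_nat_const ?card_ord ?muln1 // => x _.
  by rewrite ltnS; case: leqP.
rewrite big_split /= in E.
have F : (\sum_(x < m) (x < k.+1) = k.+1)%N.
  rewrite (eq_bigr (fun x : 'I_m => if (x < k.+1)%N then 1%N else 0%N)); last by move=> x _; case: ltnP.
  by rewrite -big_mkcond -(big_ord_widen m (fun=> 1%N)) ?sum_nat_const ?card_ord ?muln1.
rewrite F in E; have := addnK k.+1 (\sum_(x < m) (k < x))%N; by rewrite E => <-.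
Qed.

Lemma is_cderive_hdot (R : realType) (T : normedModType R) (x v : T) n1 n2 (G : T -> 'M[R[i]]_(n1, n2)) L B :
  is_mxderive x v G L -> is_cderive x v (fun z => hdot (G z) B) (hdot L B).
Proof.
move=> H; rewrite hdotE; under [X in is_cderive _ _ X]funext do rewrite hdotE.
apply: is_cderive_sum => i; apply: is_cderive_sum => j.
apply: is_cderive_eq (is_cderiveM (H i j) (is_cderive_cst _ _ _)) _.
by rewrite mulr0 addr0.
Qed.

(** * Decomposition of the tensor products by conformal weights *)

Section TensorRep.
Context {R : realType} {m : nat} {rho : 'I_m -> int} (V : unirrep (R := R) rho) (pos : bool).
Local Notation C := R[i].
Local Notation d := (rdim V).
Local Notation e k l := (pi_e V k l).
Implicit Types (A B : 'M[C]_(d, m)) (a X : 'M[C]_m).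

(* [pos] selects V (x) C^m; otherwise the second factor is the conjugate of C^m. *)
Definition grpR a : 'M[C]_m := if pos then a^T else a ^t*.
Definition lieR X : 'M[C]_m := if pos then X^T else - X.
Definition actR a A := rmap V a *m A *m grpR a.
Definition dactR X A := rdiff V X *m A + A *m lieR X.
Definition shift_weight i := if pos then addmu rho i else submu rho i.
Definition conf_weight i : int := if pos then wplus rho i else wminus rho i.
Lemma lieR_is_linear : linear lieR.
Proof.
rewrite /lieR; case: pos => c X Y; first by rewrite linearP.
by rewrite opprD scalerN.
Qed.
HB.instance Definition _ := GRing.isLinear.Build C 'M[C]_m 'M[C]_m _ lieR lieR_is_linear.

Lemma grpR_unitary a : a \is unitarymx -> grpR a \is unitarymx.
Proof. by rewrite /grpR; case: pos; rewrite ?trmx_unitary ?trmxC_unitary. Qed.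

Lemma grpR_adj a : grpR (a ^t*) = (grpR a) ^t*.
Proof. by rewrite /grpR; case: pos => //; rewrite map_trmx. Qed.

Lemma grpR_derive P : herm_idem P -> is_mxderive (0 : R) (1 : R) (fun t => grpR (gam P t)) (lieR ('i *: P)).
Proof.
move=> [_ Ph]; rewrite /grpR /lieR; case: pos; first by apply: is_mxderiveT; exact: gam_derive.
have -> : - ('i *: P) = ('i *: P) ^t* by rewrite adjmxZ conjCi Ph scaleNr.
by apply: is_mxderive_adj; exact: gam_derive.
Qed.

Lemma grpR_lieR a X : a \is unitarymx -> (grpR a) ^t* *m lieR X *m grpR a = lieR (a *m X *m a ^t*).
Proof.
move=> ua; rewrite /grpR /lieR; case: pos.
  by rewrite !trmx_mul !mulmxA map_trmx trmxK.
by rewrite adjmxK mulmxN mulNmx.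
Qed.

Lemma lieR_adj X : (lieR X) ^t* = lieR (X ^t*).
Proof.
rewrite /lieR; case: pos; first by rewrite map_trmx.
by rewrite -scaleN1r adjmxZ rmorphN1 scaleN1r.
Qed.

Lemma lieR_bracket X Y : lieR (X *m Y - Y *m X) = lieR Y *m lieR X - lieR X *m lieR Y.
Proof.
rewrite /lieR; case: pos; first by rewrite raddfB /= !trmx_mul.
by rewrite !mulNmx !mulmxN !opprK opprB.
Qed.

Lemma dactR_is_linear X : linear (dactR X).
Proof.
move=> c A B; rewrite /dactR mulmxDr mulmxDl -scalemxAr -scalemxAl scalerDr.
exact: addrACA.
Qed.
HB.instance Definition _ X := GRing.isLinear.Build C 'M[C]_(d, m) 'M[C]_(d, m) _ (dactR X) (dactR_is_linear X).

Lemma dactR0r X : dactR X 0 = 0.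
Proof. by rewrite /dactR mulmx0 mul0mx addr0. Qed.

Lemma dactRZr X c A : dactR X (c *: A) = c *: dactR X A.
Proof. by have := dactR_is_linear X c A 0; rewrite dactR0r !addr0. Qed.

Lemma dactR_linearl A : linear (dactR^~ A).
Proof.
move=> c X Y; rewrite /dactR (linearP (rdiff V)) (linearP lieR) mulmxDr mulmxDl -scalemxAr -scalemxAl scalerDr.
exact: addrACA.
Qed.

Lemma dactR0l A : dactR 0 A = 0.
Proof.
have -> : dactR 0 A = rdiff V 0 *m A + A *m lieR 0 by [].
have -> : lieR 0 = 0 by rewrite /lieR; case: pos; rewrite ?trmx0 ?oppr0.
by rewrite (linear0 (rdiff V)) mul0mx mulmx0 addr0.
Qed.

Lemma dactRZl c X A : dactR (c *: X) A = c *: dactR X A.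
Proof. by have := dactR_linearl A c X 0; rewrite dactR0l !addr0. Qed.

Lemma dactR_bracket X Y A : dactR (X *m Y - Y *m X) A = dactR X (dactR Y A) - dactR Y (dactR X A).
Proof.
rewrite /dactR rdiff_bracket lieR_bracket mulmxBl mulmxBr !mulmxDr !mulmxDl !mulmxA.
move: (rdiff V X *m rdiff V Y *m A) (rdiff V Y *m rdiff V X *m A) => p q.
move: (rdiff V X *m A *m lieR Y) (rdiff V Y *m A *m lieR X) => s t.
move: (A *m lieR Y *m lieR X) (A *m lieR X *m lieR Y) => u v.
rewrite [t + u]addrC [s + v]addrC (addrACA p s u t) (addrACA q t v s) [t + s]addrC.
have S (x y z : 'M[C]_(d, m)) : (x + z) - (y + z) = x - y by rewrite opprD addrACA subrr addr0.
by rewrite S opprD addrACA.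
Qed.

Lemma actR_unitary a A B : a \is unitarymx -> hdot (actR a A) (actR a B) = hdot A B.
Proof.
move=> ua; rewrite /actR hdot_mulr mulmxtVK ?grpR_unitary //.
by rewrite hdot_mull mulmxA (rmap_adjK V ua) mul1mx.
Qed.

Lemma actRK a A : a \is unitarymx -> actR a (actR (a ^t*) A) = A.
Proof.
move=> ua; rewrite /actR grpR_adj (rmap_adj V ua) !mulmxA (rmapK V ua) mul1mx -mulmxA.
have /unitarymxP/mulmx1C -> := grpR_unitary ua; exact: mulmx1.
Qed.

Lemma actR_derive P A : herm_idem P ->
  is_mxderive (0 : R) (1 : R) (fun t => actR (gam P t) A) (dactR ('i *: P) A).
Proof.
move=> hP; have H := is_mxderiveM (is_mxderive_mulr A (@expU_derive _ _ _ V P hP)) (grpR_derive hP).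
apply: (is_mxderive_eq (F := fun t => actR (gam P t) A)) H _.
have G1 : grpR 1%:M = 1%:M by rewrite /grpR; case: pos; rewrite ?adjmx1 ?trmx1.
by rewrite !gam0 G1 mulmx1 rmap1 mul1mx.
Qed.

(** The pairing of an orbit in W with a vector of the orthogonal complement is constantly 0, so its
    derivative is 0 as well. *)
Lemma invariant_dactR (W : {vspace 'M[C]_(d, m)}) : invariant_sub actR W ->
  forall X A, A \in W -> dactR X A \in W.
Proof.
move=> HW X A AW; elim/(@mx_proj_ind R m): X => [c X Y HX HY|P hP].
  by rewrite dactR_linearl rpredD // rpredZ.
apply: orthospaceK => B /mem_orthospace HB.
have H := is_cderive_hdot B (actR_derive A hP).
have E : (fun t : R => hdot (actR (gam P t) A) B) = fun=> 0.
  apply: funext => t; rewrite hdotC HB ?rmorph0 //; apply: HW => //; exact: gam_unitary.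
rewrite E in H; have [[_ h1] [_ h2]] := H; have [[_ k1] [_ k2]] := is_cderive_cst (0:R) (1:R) (0 : C).
have H0 : hdot (dactR ('i *: P) A) B = 0 by apply: complexE; rewrite -?h1 -?h2 ?k1 ?k2.
have -> : dactR P A = - 'i *: dactR ('i *: P) A.
  by rewrite dactRZl scalerA mulNr -expr2 sqrCi opprK scale1r.
by rewrite hdotZl H0 mulr0.
Qed.

(** The mixed part of the Casimir operator of a tensor product, with the sign for which the summands
    have the conformal weights as eigenvalues. On V (x) conj(C^m) it is the block matrix e, on V (x)
    C^m minus its transpose. *)
Definition Bop A : 'M[C]_(d, m) := - \sum_k \sum_l e k l *m A *m lieR (delta_mx l k).

Lemma Bop_is_linear : linear Bop.
Proof.
move=> c A B; rewrite /Bop scalerN -opprD; congr (- _).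
rewrite scaler_sumr -big_split; apply: eq_bigr => k _ /=.
rewrite scaler_sumr -big_split; apply: eq_bigr => l _ /=.
by rewrite mulmxDr mulmxDl -scalemxAr -scalemxAl.
Qed.
HB.instance Definition _ := GRing.isLinear.Build C 'M[C]_(d, m) 'M[C]_(d, m) _ Bop Bop_is_linear.

Lemma Bop0 : Bop 0 = 0.
Proof. by rewrite /Bop big1 ?oppr0 // => k _; rewrite big1 // => l _; rewrite mulmx0 mul0mx. Qed.

Lemma BopZ c A : Bop (c *: A) = c *: Bop A.
Proof. by have := Bop_is_linear c A 0; rewrite Bop0 !addr0. Qed.

Lemma Bop_sum I (r : seq I) (F : I -> 'M[C]_(d, m)) : Bop (\sum_(i <- r) F i) = \sum_(i <- r) Bop (F i).
Proof.
elim: r => [|i r IH]; first by rewrite !big_nil Bop0.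
by rewrite !big_cons -IH; have := Bop_is_linear 1 (F i) (\sum_(j <- r) F j); rewrite !scale1r.
Qed.

Lemma Bop_herm A B : hdot (Bop A) B = hdot A (Bop B).
Proof.
rewrite /Bop hdotNl hdotNr; congr (- _).
rewrite hdot_suml hdot_sumr; under eq_bigr do rewrite hdot_suml.
under [RHS]eq_bigr do rewrite hdot_sumr.
rewrite exchange_big; apply: eq_bigr => k _; apply: eq_bigr => l _.
rewrite hdot_mulr hdot_mull pi_e_adj lieR_adj -mulmxA.
have -> : (delta_mx k l : 'M[C]_m) ^t* = delta_mx l k; last by rewrite !mulmxA.
by apply/matrixP => i j; rewrite !mxE rmorph_nat andbC.
Qed.

(** Conjugation by a expands E_kl and E_lk in matrix units with coefficients from the entries of a;
    after summation over k and l, orthonormality of the rows of a leaves the original expression. *)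
Lemma Bop_act a A : a \is unitarymx -> Bop (actR a A) = actR a (Bop A).
Proof.
move=> ua; set A' := actR a A.
have E k l : rmap V a *m (e k l *m A *m lieR (delta_mx l k)) *m grpR a =
   rdiff V (a *m delta_mx k l *m a ^t*) *m A' *m lieR (a *m delta_mx l k *m a ^t*).
  rewrite -(rmap_rdiff V _ ua) -(grpR_lieR _ ua) /A' /actR !mulmxA.
  rewrite -[_ *m (rmap V a)^t* *m rmap V a]mulmxA (rmap_adjK V ua) mulmx1.
  by rewrite -[_ *m grpR a *m (grpR a)^t*]mulmxA (unitarymxP (grpR_unitary ua)) mulmx1.
have -> : actR a (Bop A) = - \sum_k \sum_l
    rdiff V (a *m delta_mx k l *m a ^t*) *m A' *m lieR (a *m delta_mx l k *m a ^t*).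
  rewrite /actR /Bop mulmxN mulNmx mulmx_sumr mulmx_suml; congr (- _); apply: eq_bigr => k _.
  by rewrite mulmx_sumr mulmx_suml; apply: eq_bigr => l _.
rewrite /Bop; congr (- _).
have F k l : a *m delta_mx k l *m a ^t* = \sum_p \sum_q (a p k * Num.conj (a q l)) *: delta_mx p q.
  rewrite [LHS]matrix_sum_delta; apply: eq_bigr => p _; apply: eq_bigr => q _; congr (_ *: _).
  rewrite mxE (bigD1 l) //= big1 ?addr0 => [|j jl].
    rewrite mxE (bigD1 k) //= big1 ?addr0 => [|j jk]; last by rewrite mxE (negbTE jk) mulr0.
    by rewrite !mxE !eqxx mulr1.
  by rewrite mxE big1 ?mul0r // => i _; rewrite mxE (negbTE jl) andbF mulr0.
have G k l : rdiff V (a *m delta_mx k l *m a ^t*) *m A' *m lieR (a *m delta_mx l k *m a ^t*) =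
   \sum_p \sum_q \sum_r \sum_s ((a p k * Num.conj (a s k)) * (a r l * Num.conj (a q l))) *:
        (e p q *m A' *m lieR (delta_mx r s)).
  rewrite !F linear_sum !mulmx_suml; apply: eq_bigr => p _.
  rewrite linear_sum !mulmx_suml; apply: eq_bigr => q _.
  rewrite linear_sum mulmx_sumr; apply: eq_bigr => r _.
  rewrite linear_sum mulmx_sumr; apply: eq_bigr => s _.
  rewrite (linearZZ (rdiff V)) (linearZZ lieR) -!scalemxAl -scalemxAr scalerA; congr (_ *: _).
  by rewrite mulrACA [Num.conj _ * _]mulrC mulrACA.
have row_orth p s : \sum_k a p k * Num.conj (a s k) = (p == s)%:R.
  have /matrixP/(_ p s) := unitarymxP ua; rewrite !mxE => <-.
  by apply: eq_bigr => k _; rewrite !mxE.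
under [RHS]eq_bigr do under eq_bigr do rewrite G.
have -> : \sum_k \sum_l \sum_p \sum_q \sum_r \sum_s
    ((a p k * Num.conj (a s k)) * (a r l * Num.conj (a q l))) *: (e p q *m A' *m lieR (delta_mx r s))
  = \sum_p \sum_q \sum_r \sum_s ((p == s)%:R * (r == q)%:R) *: (e p q *m A' *m lieR (delta_mx r s)).
  under eq_bigr do rewrite exchange_big; rewrite exchange_big; apply: eq_bigr => p _.
  under eq_bigr do rewrite exchange_big; rewrite exchange_big; apply: eq_bigr => q _.
  under eq_bigr do rewrite exchange_big; rewrite exchange_big; apply: eq_bigr => r _.
  under eq_bigr do rewrite exchange_big; rewrite exchange_big; apply: eq_bigr => s _.
  rewrite -!row_orth big_distrl /= scaler_suml; apply: eq_bigr => k _.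
  by rewrite big_distrr /= scaler_suml; apply: eq_bigr => l _.
apply: eq_bigr => p _; apply: eq_bigr => q _.
rewrite (bigD1 q) //= (bigD1 p) //= !eqxx mulr1 scale1r.
rewrite !big1 ?addr0 // => [r rq|s sp].
  by rewrite big1 // => s _; rewrite (negbTE rq) mulr0 scale0r.
by rewrite eq_sym (negbTE sp) mul0r scale0r.
Qed.

Lemma Bop_dact X A : Bop (dactR X A) = dactR X (Bop A).
Proof.
elim/(@mx_proj_ind R m): X => [c X Y HX HY|P hP].
  by rewrite !dactR_linearl Bop_is_linear HX HY.
have H1 : is_mxderive (0 : R) (1 : R) (fun t => Bop (actR (gam P t) A)) (Bop (dactR ('i *: P) A)).
  exact: is_mxderive_lin (actR_derive A hP).
have H2 := actR_derive (Bop A) hP.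
have E : (fun t : R => Bop (actR (gam P t) A)) = (fun t => actR (gam P t) (Bop A)).
  by apply: funext => t; rewrite (Bop_act _ (gam_unitary t hP)).
rewrite E in H1; have := is_mxderive_unique H1 H2.
rewrite !dactRZl BopZ; exact: (scalerI (neq0Ci _)).
Qed.

Definition raised A := forall k l : 'I_m, (k < l)%N -> dactR (delta_mx k l) A = 0.

(** For a suitable diagonal D, a raising operator sends an eigenvector of D to 0 or to one whose
    eigenvalue is larger by a positive integer. D has finitely many eigenvalues on W, so the process
    stops at a raised vector. *)
Lemma raised_exists (W : {vspace 'M[C]_(d, m)}) : W <> 0%VS ->
  (forall X A, A \in W -> dactR X A \in W) -> exists A, [/\ A \in W, A != 0 & raised A].
Proof.
move=> W0 HW; apply: contrapT => NR.
(* The decreasing diagonal entries m - k make E_kl, for k < l, increase the eigenvalue by l - k. *)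
pose D : 'M[C]_m := \sum_(k < m) (m - k)%:R *: delta_mx k k.
pose f := linfun (dactR D).
have fE A : f A = dactR D A by rewrite lfunE.
have fW A : A \in W -> f A \in W by move=> AW; rewrite fE; exact: HW.
have [c [A0 [A0W A00 fA0]]] := eigenvector_exists fW W0.
have [rs Hrs] := eigenvalues_finite fW.
pose Pn n := `[< exists A, [/\ A \in W, A != 0 & dactR D A = (c + n%:R) *: A] >].
have ex0 : exists n, Pn n.
  by exists 0%N; apply/asboolP; exists A0; split=> //; rewrite -fE fA0 addr0.
(* The step at which r occurs in the progression c + n; its maximum over the eigenvalues bounds all
   steps. *)
pose g (r : C) : nat := xget 0%N [set n | r = c + n%:R].
have bd n : Pn n -> (n <= \max_(r <- rs) g r)%N.
  move=> /asboolP[A [AW An DA]].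
  have inr : c + n%:R \in rs by apply: (Hrs _ A) => //; rewrite fE.
  apply: leq_trans (leq_bigmax_seq _ inr _) => //.
  rewrite /g; case: xgetP => [k _ /addrI/eqP|/(_ n)/=]; last by move/(_ erefl).
  by rewrite eqr_nat => /eqP ->.
case: (ex_maxnP ex0 bd) => n /asboolP[A [AW An DA]] maxn.
apply: NR; exists A; split=> // k l kl.
apply: contrapT => /eqP nz.
have DE : D *m delta_mx k l - delta_mx k l *m D = (l - k)%:R *: delta_mx k l.
  rewrite /D mulmx_suml mulmx_sumr (bigD1 k) //= big1 ?addr0 => [|j jk]; last first.
    by rewrite -scalemxAl mul_delta_mx_0 // scaler0.
  rewrite (bigD1 l) //= big1 ?addr0 => [|j jk]; last first.
    by rewrite -scalemxAr mul_delta_mx_0 1?eq_sym // scaler0.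
  rewrite -scalemxAl -scalemxAr !mul_delta_mx -scalerBl; congr (_ *: _).
  have -> : (m - k)%N = (m - l + (l - k))%N by have := ltn_ord l; lia.
  by rewrite natrD addrC addKr.
have : Pn (n + (l - k))%N.
  apply/asboolP; exists (dactR (delta_mx k l) A); split=> //; first exact: HW.
  have := dactR_bracket D (delta_mx k l) A; rewrite DE DA.
  rewrite dactRZl dactRZr => /eqP; rewrite eq_sym subr_eq => /eqP ->.
  by rewrite -scalerDl natrD addrC -addrA.
by move/maxn; lia.
Qed.

(** Columns are ordered so that raising operators move them to earlier positions; the order is
    reversed on the conjugate of C^m. *)
Definition pos_of (j : 'I_m) : nat := if pos then nat_of_ord j else (m - j)%N.
Definition top k A := forall j, (pos_of k < pos_of j)%N -> col j A = 0.

Lemma pos_of_inj : injective pos_of.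
Proof.
move=> i j; rewrite /pos_of; case: pos => H; apply: val_inj => //=.
by move: H; have := ltn_ord i; have := ltn_ord j; lia.
Qed.

Lemma col_inj A : (forall j, col j A = 0) -> A = 0.
Proof. by move=> H; apply/matrixP => i j; have /colP/(_ i) := H j; rewrite !mxE. Qed.

Lemma top_exists A : A != 0 -> exists k, top k A /\ col k A != 0.
Proof.
move=> A0; have [k0 Hk0] : exists k, col k A != 0.
  apply: contrapT => H; move/eqP: A0; apply; apply: col_inj => j.
  by apply/eqP/negPn/negP => nz; apply: H; exists j.
case: (@arg_maxnP _ k0 (fun k => col k A != 0) pos_of Hk0) => k Hk kmax.
exists k; split=> // j; rewrite ltnNge => jk; apply/eqP/negPn/negP => nz.
by move/negP: jk; apply; exact: kmax.
Qed.

Lemma col_lieR A (j x y : 'I_m) : col j (A *m lieR (delta_mx x y)) =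
  if pos then (j == x)%:R *: col y A else - (j == y)%:R *: col x A.
Proof.
rewrite /lieR; case: pos.
  rewrite trmx_delta; apply/colP => i; rewrite !mxE (bigD1 y) //= big1 ?addr0 => [|l ly].
    by rewrite mxE eqxx mulrC.
  by rewrite mxE (negbTE ly) mulr0.
rewrite mulmxN; apply/colP => i; rewrite !mxE (bigD1 x) //= big1 ?addr0 => [|l ly].
  by rewrite mxE eqxx mulNr mulrC.
by rewrite mxE (negbTE ly) mulr0.
Qed.

Lemma col_dactR A (j x y : 'I_m) : col j (dactR (delta_mx x y) A) =
  e x y *m col j A + if pos then (j == x)%:R *: col y A else - (j == y)%:R *: col x A.
Proof. by rewrite /dactR raddfD /= col_lieR !colE mulmxA. Qed.

(** What a raising operator adds to column k comes from later positions, which are 0; so the raising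
    operators of V alone kill this column. *)
Lemma raised_col A k : raised A -> top k A -> exists c, col k A = c *: hw_vector V.
Proof.
move=> rA tA; apply: hw_vector_unique => x y xy.
have := congr1 (col k) (rA x y xy); rewrite col_dactR.
rewrite (_ : col k 0 = 0); last by apply/colP => i; rewrite !mxE.
suff -> : (if pos then (k == x)%:R *: col y A else - (k == y)%:R *: col x A) = 0 by rewrite addr0.
move: tA; rewrite /top /pos_of; case: pos => tA.
  by have [kx|] := eqVneq k x; rewrite ?scale0r // tA ?scaler0 // kx.
have [ky|] := eqVneq k y; rewrite ?oppr0 ?scale0r // tA ?scaler0 //.
by rewrite ky; have := ltn_ord y; move: xy; lia.
Qed.

Definition weight_vector (k : 'I_m) A :=
  forall j, dactR (delta_mx j j) A = (shift_weight k j)%:~R *: A.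

Lemma col_weight A k j : raised A -> top k A ->
  col k (dactR (delta_mx j j) A) = (shift_weight k j)%:~R *: col k A.
Proof.
move=> rA tA; have [c Ec] := raised_col rA tA; have [_ Hd _] := hw_vectorP V.
rewrite col_dactR Ec -scalemxAr Hd scalerA mulrC -scalerA -Ec /shift_weight.
case: pos; rewrite /addmu /submu eq_sym.
  rewrite rmorphD /= scalerDl; congr (_ + _).
  by have [->|] := eqVneq; rewrite ?scale1r ?scale0r.
rewrite rmorphB /= scalerBl; congr (_ + _).
have [->|_] := eqVneq j k; first by rewrite scaleN1r scale1r.
by rewrite mulr0n oppr0 !scale0r oppr0.
Qed.

Lemma shift_weight_inj k k' : (forall j, shift_weight k j = shift_weight k' j) -> k = k'.
Proof.
move=> /(_ k); rewrite /shift_weight /addmu /submu; case: pos; rewrite eqxx.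
  by move/addrI; have [->|] := eqVneq k k'.
by move/addrI/oppr_inj; have [->|] := eqVneq k k'.
Qed.

Lemma weight_vector_top A k : raised A -> weight_vector k A -> A != 0 -> top k A /\ col k A != 0.
Proof.
move=> rA wA A0; have [k' [tk ck]] := top_exists A0.
suff -> : k = k' by [].
apply: shift_weight_inj => j; apply/eqP.
have := col_weight j rA tk; rewrite wA linearZ /= => /eqP.
by rewrite -subr_eq0 -scalerBl scaler_eq0 (negbTE ck) orbF subr_eq0 eqr_int.
Qed.

Lemma raised_lin c A B : raised A -> raised B -> raised (c *: A + B).
Proof. by move=> HA HB x y xy; rewrite dactR_is_linear HA // HB // scaler0 addr0. Qed.

Lemma weight_vector_lin k c A B : weight_vector k A -> weight_vector k B -> weight_vector k (c *: A + B).
Proof.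
by move=> HA HB j; rewrite dactR_is_linear HA HB scalerDr !scalerA mulrC.
Qed.

Lemma raised_diag A j : raised A -> raised (dactR (delta_mx j j) A).
Proof.
move=> rA x y xy; have := dactR_bracket (delta_mx x y) (delta_mx j j) A.
rewrite (rA x y xy) dactR0r subr0 => <-.
rewrite !mul_delta_mx_cond.
have -> : delta_mx x j *+ (y == j) - delta_mx j y *+ (j == x) = ((y == j)%:R - (j == x)%:R) *: delta_mx x y :> 'M[C]_m.
  rewrite scalerBl !scaler_nat; congr (_ - _); first by have [->|] := eqVneq y j.
  by have [->|] := eqVneq j x.
by rewrite dactRZl (rA x y xy) scaler0.
Qed.

(** If A is not yet a weight vector, subtracting the expected multiple of A from E_jj A gives, for
    some j, a nonzero vector that is still raised and whose last column is earlier, because column k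
    already has the expected weight. The induction is on the position of the last column. *)
Lemma weight_vector_exists (W : {vspace 'M[C]_(d, m)}) : W <> 0%VS ->
  (forall X A, A \in W -> dactR X A \in W) ->
  exists k A, [/\ A \in W, A != 0, raised A & weight_vector k A].
Proof.
move=> W0 HW; have [A [AW A0 rA]] := raised_exists W0 HW.
have [k [tk ck]] := top_exists A0.
have [n] := ubnP (pos_of k); elim: n => // n IH in k A AW A0 rA tk ck *.
rewrite ltnS => kn.
have [wA|nw] := pselect (weight_vector k A); first by exists k, A.
have [j nj] : exists j, dactR (delta_mx j j) A - (shift_weight k j)%:~R *: A != 0.
  apply: contrapT => H; apply: nw => j; apply/eqP; rewrite -subr_eq0.
  by apply/negPn/negP => nz; apply: H; exists j.
pose A' := dactR (delta_mx j j) A - (shift_weight k j)%:~R *: A.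
have rA' : raised A'.
  rewrite /A' addrC -scaleNr; apply: raised_lin => //; exact: raised_diag.
have [k' [tk' ck']] := top_exists nj.
have A'W : A' \in W by rewrite rpredB // ?rpredZ // HW.
have ckA' : col k A' = 0 by rewrite /A' raddfB /= linearZ /= col_weight // subrr.
have colA' i : (pos_of k < pos_of i)%N -> col i A' = 0.
  move=> ki; rewrite /A' raddfB /= linearZ /= tk // scaler0 subr0 col_dactR tk // mulmx0 add0r.
  have tki := tk i ki; case: pos.
    by case: (eqVneq i j) => [<-|_]; [rewrite tki scaler0|rewrite scale0r].
  case: (eqVneq i j) => [<-|_]; first by rewrite tki scaler0.
  by rewrite mulr0n oppr0 scale0r.
apply: (IH k' A') => //; apply: leq_trans kn.
rewrite ltnNge leq_eqVlt negb_or; apply/andP; split.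
  by apply/eqP => /pos_of_inj kk; rewrite -kk ckA' eqxx in ck'.
by apply/negP => /colA' c0; rewrite c0 eqxx in ck'.
Qed.

(** A combination of A and B with vanishing column k must be 0, because a nonzero raised vector of
    this weight has a nonzero column k. *)
Lemma weight_vector_unique k A B : raised A -> weight_vector k A -> A != 0 ->
  raised B -> weight_vector k B -> exists c, B = c *: A.
Proof.
move=> rA wA A0 rB wB; have [tA cA] := weight_vector_top rA wA A0.
have [B0|B0] := eqVneq B 0; first by exists 0; rewrite B0 scale0r.
have [tB cB] := weight_vector_top rB wB B0.
have [c Ec] := raised_col rA tA; have [c' Ec'] := raised_col rB tB.
have c0 : c != 0 by apply: contra_neq cA => c0; rewrite Ec c0 scale0r.
exists (c' / c); apply/eqP; rewrite -subr_eq0; apply/negPn/negP => nz.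
have E : B - (c' / c) *: A = (- (c' / c)) *: A + B by rewrite addrC scaleNr.
rewrite E in nz.
have [_] := weight_vector_top (raised_lin (- (c' / c)) rA rB) (weight_vector_lin (- (c' / c)) wA wB) nz.
rewrite -E raddfB /= linearZ /= Ec Ec' scalerA divfK // subrr eqxx //.
Qed.

(** The conformal weight is read off on the last nonzero column k. The diagonal unit contributes
    rho_k. The relations expressing that A is raised turn each surviving off-diagonal term into
    column k up to sign; there is one for each index before k, respectively after k on the conjugate
    of C^m. *)
Lemma col_Bop k A : raised A -> weight_vector k A -> top k A ->
  col k (Bop A) = (conf_weight k)%:~R *: col k A.
Proof.
move=> rA wA tA; have [c Ec] := raised_col rA tA; have [_ Hd _] := hw_vectorP V.
have dk : e k k *m col k A = (rho k)%:~R *: col k A.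
  by rewrite Ec -scalemxAr Hd scalerA mulrC -scalerA.
have col0 j : col j (0 : 'M[C]_(d, m)) = 0 by apply/colP => i; rewrite !mxE.
have colS (F : 'I_m -> 'M[C]_(d, m)) : col k (\sum_x F x) = \sum_x col k (F x) by exact: raddf_sum.
have H1 (x y j : 'I_m) : (x < y)%N -> e x y *m col j A +
    (if pos then (j == x)%:R *: col y A else - (j == y)%:R *: col x A) = 0.
  by move=> xy; rewrite -col_dactR rA.
rewrite /Bop raddfN /= colS.
under eq_bigr do rewrite colS; under eq_bigr do under eq_bigr do rewrite col_lieR.
move: H1 tA; rewrite /top /pos_of /conf_weight; case: pos => H1 tA.
- have -> : \sum_(x < m) \sum_(y < m) (k == y)%:R *: col x (e x y *m A) =
     \sum_(x < m) ((x < k)%N%:R * (-1) + (x == k)%:R * (rho k)%:~R) *: col k A.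
    apply: eq_bigr => x _; rewrite (bigD1 k) //= eqxx scale1r big1 ?addr0; last first.
      by move=> y yk; rewrite eq_sym (negbTE yk) scale0r.
    rewrite colE -mulmxA -colE; have [xk|kx|/val_inj xk] := ltngtP x k.
    + have := H1 x k x xk; rewrite eqxx scale1r => /eqP; rewrite addr_eq0 => /eqP ->.
      by rewrite (negbTE (_ : x != k)) ?mul0r ?addr0 ?mul1r ?scaleN1r // -val_eqE /= ltn_eqF.
    + by rewrite (tA x kx) mulmx0 (negbTE (_ : x != k)) ?mul0r ?addr0 ?scale0r // -val_eqE /= gtn_eqF.
    + by rewrite xk eqxx dk mul0r add0r mul1r.
  rewrite -scaler_suml -scaleNr; congr (_ *: _).
  rewrite big_split /= -!big_distrl /= sum_lt_nat.
  rewrite (bigD1 k) //= eqxx big1 ?addr0 => [|x xk]; last by rewrite (negbTE xk).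
  have -> : wplus rho k = k%:Z - rho k by rewrite /wplus; lia.
  rewrite rmorphB /= -pmulrn mulr1n mul1r; ring.
- have -> : \sum_(x < m) \sum_(y < m) (- (k == x)%:R) *: col y (e x y *m A) =
     - \sum_(y < m) ((k < y)%N%:R + (y == k)%:R * (rho k)%:~R) *: col k A.
    rewrite (bigD1 k) //= [X in _ + X]big1 ?addr0; last first.
      by move=> x xk; rewrite big1 // => y _; rewrite eq_sym (negbTE xk) oppr0 scale0r.
    rewrite -sumrN; apply: eq_bigr => y _; rewrite eqxx scaleN1r; congr (- _).
    rewrite colE -mulmxA -colE; have [yk|ky|/val_inj yk] := ltngtP y k.
    + rewrite (tA y) ?mulmx0; last by have := ltn_ord k; move: yk => /=; lia.
      by rewrite (negbTE (_ : y != k)) ?mul0r ?addr0 ?scale0r // -val_eqE /= ltn_eqF.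
    + have := H1 k y y ky; rewrite eqxx scaleN1r => /eqP; rewrite subr_eq0 => /eqP ->.
      by rewrite (negbTE (_ : y != k)) ?mul0r ?addr0 ?scale1r // -val_eqE /= gtn_eqF.
    + by rewrite yk eqxx dk add0r mul1r.
  rewrite opprK -scaler_suml; congr (_ *: _).
  rewrite big_split /= -!big_distrl /= sum_gt_nat.
  rewrite (bigD1 k) //= eqxx big1 ?addr0 => [|x xk]; last by rewrite (negbTE xk).
  have -> : wminus rho k = (m - k.+1)%:Z + rho k by rewrite /wminus; have := ltn_ord k; lia.
  by rewrite rmorphD /= -pmulrn mulr1n mul1r.
Qed.

(** [Bop] commutes with the action, so by uniqueness of raised weight vectors A is an eigenvector;
    column k gives the eigenvalue. *)
Lemma Bop_weight_vector k A : raised A -> weight_vector k A -> Bop A = (conf_weight k)%:~R *: A.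
Proof.
move=> rA wA; have [->|A0] := eqVneq A 0; first by rewrite Bop0 scaler0.
have [tA cA] := weight_vector_top rA wA A0.
have rB : raised (Bop A) by move=> x y xy; rewrite -Bop_dact rA // Bop0.
have wB : weight_vector k (Bop A) by move=> j; rewrite -Bop_dact wA BopZ.
have [c Ec] := weight_vector_unique rA wA A0 rB wB.
rewrite Ec; congr (_ *: _); apply/eqP; rewrite -subr_eq0.
have := col_Bop rA wA tA; rewrite Ec linearZ /= => /eqP.
by rewrite -subr_eq0 -scalerBl scaler_eq0 (negbTE cA) orbF.
Qed.

Definition piece i : {vspace 'M[C]_(d, m)} := summand actR dactR (shift_weight i).

(** The first alternative is the default value of [summand] when no irreducible subspace has this
    highest weight. *)
Lemma pieceP i : piece i = 0%VS \/ irreducible_sub actR (piece i) /\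
  exists A, [/\ A \in piece i, A != 0, raised A & weight_vector i A].
Proof.
rewrite /piece /summand; case: xgetP => [W _ [irr [A [AW A0 wA rA]]]|_]; last by left.
by right; split=> //; exists A.
Qed.

Lemma piece_invariant i : invariant_sub actR (piece i).
Proof.
have [->|[[]//]] := pieceP i; move=> a ua A; rewrite !memv0 => /eqP ->.
by rewrite /actR mulmx0 mul0mx.
Qed.

(** The eigenspace of [Bop] inside an irreducible piece is invariant and contains the highest weight
    vector, so it is the whole piece. *)
Lemma piece_eigen i A : A \in piece i -> Bop A = (conf_weight i)%:~R *: A.
Proof.
have [->|[[nz inv irr] [A1 [A1W A10 rA wA]]]] := pieceP i.
  by rewrite memv0 => /eqP ->; rewrite Bop0 scaler0.
have [K HK] : exists K : {vspace 'M[C]_(d, m)}, forall B, B \in K <->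
    (B \in piece i /\ Bop B = (conf_weight i)%:~R *: B).
  apply: prop_vspace; first by rewrite mem0v Bop0 scaler0.
  move=> c u v [uW Eu] [vW Ev]; split; first by rewrite rpredD // rpredZ.
  by rewrite Bop_is_linear Eu Ev scalerDr !scalerA mulrC.
have sub : (K <= piece i)%VS by apply/subvP => B /HK[].
have Kinv : invariant_sub actR K.
  move=> a ua B /HK[BW EB]; apply/HK; split; first exact: inv.
  by rewrite (Bop_act _ ua) EB /actR -scalemxAr -scalemxAl.
have [K0|KW] := irr K sub Kinv; last by rewrite -KW => /HK[].
have : A1 \in K by apply/HK; split=> //; exact: Bop_weight_vector.
by rewrite K0 memv0 (negbTE A10).
Qed.

(** By dominance rho_i - i is strictly decreasing in i. *)
Lemma conf_weight_inj : dominant rho -> injective conf_weight.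
Proof.
move=> dom i j; rewrite /conf_weight => E; apply: val_inj => /=.
have [ij|ji|//] := ltngtP i j; exfalso; move: E.
- by have := dom i j (ltnW ij); rewrite /wplus /wminus; case: pos; move: ij => /=; lia.
- by have := dom j i (ltnW ji); rewrite /wplus /wminus; case: pos; move: ji => /=; lia.
Qed.

Section Dominant.
Hypothesis dom : dominant rho.

(** Eigenvectors of the self-adjoint [Bop] for distinct real eigenvalues. *)
Lemma piece_orth i j A B : i != j -> A \in piece i -> B \in piece j -> hdot A B = 0.
Proof.
move=> ij AW BW; have := Bop_herm A B.
rewrite (piece_eigen AW) (piece_eigen BW) hdotZl hdotZr rmorph_int => /eqP.
rewrite -subr_eq0 -mulrBl mulf_eq0 subr_eq0 eqr_int => /orP[/eqP/(conf_weight_inj dom) E|/eqP //].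
by rewrite E eqxx in ij.
Qed.

Lemma minimal_invariant (W : {vspace 'M[C]_(d, m)}) : W <> 0%VS -> invariant_sub actR W ->
  exists W', (W' <= W)%VS /\ irreducible_sub actR W'.
Proof.
have [n] := ubnP (\dim W); elim: n W => // n IH W dn W0 inv.
have [irr|nirr] := pselect (forall W', (W' <= W)%VS -> invariant_sub actR W' -> W' = 0%VS \/ W' = W).
  by exists W; split=> //; exact: subvv.
have [W' [sW iW [nW0 nWW]]] : exists W', [/\ (W' <= W)%VS, invariant_sub actR W' & (W' <> 0%VS /\ W' <> W)].
  apply: contrapT => H; apply: nirr => W' sW iW.
  have [|n0] := pselect (W' = 0%VS); first by left.
  have [|n1] := pselect (W' = W); first by right.
  by exfalso; apply: H; exists W'.
have [|W1 [sW1 irr1]] := IH W' _ nW0 iW.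
  have lt : (\dim W' < \dim W)%N.
    rewrite ltn_neqAle dimvS // andbT.
    by apply/eqP => E; apply: nWW; apply/eqP; rewrite eqEdim sW E leqnn.
  exact: leq_trans lt dn.
by exists W1; split=> //; exact: subv_trans sW.
Qed.

(** A minimal invariant subspace of the complement would contain a raised vector of some weight rho
    +- mu_k. It would qualify for the choice of the k-th piece, which is then nonzero and, by
    uniqueness, contains the same vector; the vector would be orthogonal to itself. *)
Lemma piece_sum_full : (\sum_i piece i)%VS = fullv.
Proof.
set S := (\sum_i piece i)%VS; apply: orthospace_eq0; apply: contrapT => /eqP nz0.
have nz : orthospace S <> 0%VS by apply/eqP.
have Sinv : invariant_sub actR S.
  move=> a ua A /memv_sumP[f fP ->]; rewrite /actR mulmx_sumr mulmx_suml.
  by apply: memv_sumr => i _; apply: piece_invariant => //; exact: fP.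
have Oinv : invariant_sub actR (orthospace S).
  move=> a ua A /mem_orthospace HA; apply/mem_orthospace => B BS.
  have ua' : a ^t* \is unitarymx by rewrite trmxC_unitary.
  rewrite -[B](actRK _ ua) (actR_unitary _ _ ua); exact: HA _ (Sinv _ ua' _ BS).
have [W [sW irr]] := minimal_invariant nz Oinv.
have [W0 Winv Wirr] := irr.
have [k [A [AW A0 rA wA]]] := weight_vector_exists W0 (invariant_dactR Winv).
have [A1 [A1W A10 rA1 wA1]] : exists A1, [/\ A1 \in piece k, A1 != 0, raised A1 & weight_vector k A1].
  rewrite /piece /summand; case: xgetP => [W1 _ [_ [A1 [? ? ? ?]]]|/(_ W) nW]; first by exists A1.
  by exfalso; apply: nW; split=> //; exists A.
have [c Ec] := weight_vector_unique rA1 wA1 A10 rA wA.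
have AS : A \in S.
  by rewrite Ec rpredZ //; apply: (subvP (sumv_sup k isT (subvv _))).
have /mem_orthospace/(_ A AS)/hdot_eq0 := subvP sW _ AW.
by move=> A00; rewrite A00 eqxx in A0.
Qed.

Notation proj i := (orth_proj (piece i)).

Lemma piece_decomposition A : exists f : 'I_m -> 'M[C]_(d, m),
  [/\ forall i, f i \in piece i, A = \sum_i f i & forall i, proj i A = f i].
Proof.
have : A \in (\sum_i piece i)%VS by rewrite piece_sum_full memvf.
case/memv_sumP => f fP EA; exists f; split=> [i||i]; [exact: fP|by []|].
apply: orth_projE; first exact: fP.
move=> B BW; rewrite EA (bigD1 i) //= addrAC subrr add0r.
rewrite hdot_suml big1 // => j ji; exact: (piece_orth ji (fP j isT) BW).
Qed.

Lemma proj_in i A : proj i A \in piece i.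
Proof. by have [f [fP _ ->]] := piece_decomposition A. Qed.

Lemma proj_sum A : \sum_i proj i A = A.
Proof. by have [f [_ -> fE]] := piece_decomposition A; apply: eq_bigr. Qed.

Lemma proj_hdot i A B : hdot (proj i A) (proj i B) = hdot A (proj i B).
Proof.
rewrite -[in RHS](proj_sum A) hdot_suml (bigD1 i) //= big1 ?addr0 // => j ji.
by apply: (piece_orth ji); exact: proj_in.
Qed.

Lemma proj_linear i c A B : proj i (c *: A + B) = c *: proj i A + proj i B.
Proof.
apply: orth_projE => [|D DW]; first by rewrite rpredD ?rpredZ ?proj_in.
rewrite -[in X in hdot (X - _) _](proj_sum A) -[in X in hdot (X - _) _](proj_sum B).
rewrite scaler_sumr -big_split /= (bigD1 i) //= addrAC subrr add0r hdot_suml big1 // => j ji.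
by rewrite hdotDl hdotZl !(piece_orth ji) ?proj_in // mulr0 addr0.
Qed.

Lemma proj_act i a A : a \is unitarymx -> proj i (actR a A) = actR a (proj i A).
Proof.
move=> ua; apply: orth_projE => [|B BW]; first exact: (piece_invariant ua (proj_in i A)).
have -> : actR a A - actR a (proj i A) = actR a (A - proj i A).
  by rewrite /actR mulmxBr mulmxBl.
have ua' : a ^t* \is unitarymx by rewrite trmxC_unitary.
rewrite -[B](actRK _ ua) (actR_unitary _ _ ua) -[X in hdot (X - _)](proj_sum A) (bigD1 i) //= addrAC subrr add0r.
rewrite hdot_suml big1 // => j ji; exact: (piece_orth ji (proj_in j A) (piece_invariant ua' BW)).
Qed.

Lemma proj_Bop i A : Bop (proj i A) = (conf_weight i)%:~R *: proj i A.
Proof. exact: piece_eigen (proj_in i A). Qed.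

Lemma iter_Bop q A : iter q Bop A = \sum_i (conf_weight i)%:~R ^+ q *: proj i A.
Proof.
elim: q => [|q IH].
  by rewrite /= -[LHS](proj_sum A); apply: eq_bigr => i _; rewrite expr0 scale1r.
rewrite iterS IH Bop_sum; apply: eq_bigr => i _.
by rewrite BopZ proj_Bop scalerA exprSr.
Qed.

End Dominant.

End TensorRep.

(** * The conformal weight operators and the polynomials K *)

Section Multinomials.
Context {F : numFieldType}.

Section Fixed.
Variables (N : nat) (g : nat -> F).
Local Notation idx := {ffun 'I_N -> 'I_N.+1}.
Implicit Types (t : {ffun 'I_N -> nat}).

Definition tsum t := (\sum_(j < N) t j)%N.
Definition wdeg t := (\sum_(j < N) j.+1 * t j)%N.
Definition multin t : F := (tsum t)`!%:R / (\prod_(j < N) (t j)`!)%:R.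
Definition dec t (j : 'I_N) : {ffun 'I_N -> nat} := [ffun i => (t i - (i == j))%N].
Definition inc t (j : 'I_N) : {ffun 'I_N -> nat} := [ffun i => (t i + (i == j))%N].

Lemma prod_fact_neq0 t : ((\prod_(j < N) (t j)`!)%:R : F) != 0.
Proof. by rewrite pnatr_eq0 -lt0n prodn_gt0 // => j; exact: fact_gt0. Qed.

Lemma tsum_dec t j : (0 < t j)%N -> tsum t = (tsum (dec t j)).+1.
Proof.
move=> tj; rewrite /tsum (bigD1 j) //= [in RHS](bigD1 j) //= !ffunE eqxx subn1 -addSn prednK //.
by congr (_ + _)%N; apply: eq_bigr => i ij; rewrite ffunE (negbTE ij) subn0.
Qed.

Lemma wdeg_dec t j : (0 < t j)%N -> wdeg t = (wdeg (dec t j) + j.+1)%N.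
Proof.
move=> tj; rewrite /wdeg (bigD1 j) //= [in RHS](bigD1 j) //= !ffunE eqxx subn1 addnAC.
congr (_ + _)%N; last by apply: eq_bigr => i ij; rewrite ffunE (negbTE ij) subn0.
by rewrite -{1}(prednK tj) mulnS addnC.
Qed.

Lemma fact_dec t j : (0 < t j)%N ->
  (\prod_(i < N) (t i)`! = t j * \prod_(i < N) (dec t j i)`!)%N.
Proof.
move=> tj; rewrite (bigD1 j) //= [in RHS](bigD1 j) //= !ffunE eqxx subn1 mulnA.
congr (_ * _)%N; last by apply: eq_bigr => i ij; rewrite ffunE (negbTE ij) subn0.
by rewrite -{1 2}(prednK tj) factS prednK.
Qed.

(** Pascal's rule for multinomial coefficients: the j-th term is the coefficient of t times t_j /
    |t|. *)
Lemma multin_rec t : (0 < tsum t)%N -> multin t = \sum_(j < N | (0 < t j)%N) multin (dec t j).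
Proof.
move=> t0.
have E j : (0 < t j)%N -> multin (dec t j) = (t j)%:R * ((tsum t).-1)`!%:R / (\prod_(i < N) (t i)`!)%:R.
  move=> tj; rewrite /multin (fact_dec tj) (tsum_dec tj) /= natrM invfM mulrA.
  have tn : ((t j)%:R : F) != 0 by rewrite pnatr_eq0 -lt0n.
  by rewrite -[(t j)%:R * _ / _]mulrAC divff // mul1r.
rewrite (eq_bigr _ E) -mulr_suml -mulr_suml -natr_sum.
have -> : (\sum_(j < N | (0 < t j)%N) t j = tsum t)%N.
  rewrite /tsum [RHS](bigID (fun j => (0 < t j)%N)) /= [X in (_ + X)%N]big1 ?addn0 // => j.
  by rewrite -eqn0Ngt => /eqP.
by rewrite -natrM /multin -{1}(prednK t0) factS prednK.
Qed.

(** Integrality, from Pascal's rule; it makes the Euclidean division in [Kpoly] exact. *)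
Lemma multin_nat t : exists k : nat, multin t = k%:R.
Proof.
have [n] := ubnP (tsum t); elim: n t => // n IH t tn.
have [t0|t0] := posnP (tsum t).
  exists 1%N; rewrite /multin t0; have E j : t j = 0%N.
    by move: t0; rewrite /tsum (bigD1 j) //= => /eqP; rewrite addn_eq0 => /andP[/eqP].
  by rewrite big1 ?divff ?oner_eq0 // => j _; rewrite E.
rewrite multin_rec //.
have H j : exists k : nat, (0 < t j)%N -> multin (dec t j) = k%:R.
  have [tj|tj] := posnP (t j); first by exists 0%N.
  by have [|k Ek] := IH (dec t j); [move: tn; rewrite (tsum_dec tj)|exists k].
have [k Hk] := choice H; exists (\sum_(j < N | (0 < t j)%N) k j)%N.
by rewrite natr_sum; apply: eq_bigr => j /Hk.
Qed.

Lemma multin_div t : multin t = ((tsum t)`! %/ \prod_(j < N) (t j)`!)%N%:R.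
Proof.
have [k Ek] := multin_nat t; rewrite Ek; congr (_%:R).
have P0 := prod_fact_neq0 t.
have : ((tsum t)`! = k * \prod_(j < N) (t j)`!)%N.
  apply/eqP; rewrite -(eqr_nat F) natrM -Ek /multin divfK //.
by move=> ->; rewrite mulnK // prodn_gt0 // => j; exact: fact_gt0.
Qed.

Definition nat_of (t : idx) : {ffun 'I_N -> nat} := [ffun j => nat_of_ord (t j)].

Definition monom t : F := \prod_(j < N) g j ^+ t j.

Lemma monom_dec t j : (0 < t j)%N -> monom t = g j * monom (dec t j).
Proof.
move=> tj; rewrite /monom (bigD1 j) //= [in RHS](bigD1 j) //= !ffunE eqxx subn1 mulrA -exprS prednK //.
by congr (_ * _); apply: eq_bigr => i ij; rewrite ffunE (negbTE ij) subn0.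
Qed.

(** K_n with the number N of variables kept apart from n. In [Kpoly] the index type of the sum
    changes with n, so the terms of a recursion could not be compared directly. *)
Definition Kfix n : F := \sum_(t : idx | wdeg (nat_of t) == n) multin (nat_of t) * monom (nat_of t).

Lemma wdeg_coord t (j : 'I_N) : (j.+1 * t j <= wdeg t)%N.
Proof. by rewrite /wdeg (bigD1 j) //= leq_addr. Qed.

Lemma Kfix0 : Kfix 0 = 1.
Proof.
rewrite /Kfix (big_pred1 [ffun=> ord0]).
  have E : nat_of [ffun=> ord0] = [ffun=> 0%N] by apply/ffunP => j; rewrite !ffunE.
  rewrite E /multin /monom /tsum.
  rewrite !big1 ?divr1 ?mulr1 // => j _; rewrite ffunE //; by rewrite ?fact0 ?expr0.
move=> t /=; apply/eqP/eqP => [H|->].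
  apply/ffunP => j; apply: val_inj; rewrite ffunE /=.
  by have := wdeg_coord (nat_of t) j; rewrite H leqn0 muln_eq0 /= ffunE => /eqP.
by rewrite /wdeg big1 // => j _; rewrite !ffunE muln0.
Qed.

(** The generating function of K is 1 / (1 - sum_j g_j x^(j+1)). Pascal's rule extracts one factor
    g_j from each monomial, and the exponents of weight n + 1 with t_j > 0 correspond to all
    exponents of weight n - j. *)
Lemma KfixS n : (n < N)%N -> Kfix n.+1 = \sum_(j < n.+1) g j * Kfix (n - j)%N.
Proof.
move=> nN; rewrite /Kfix.
have step (t : idx) : wdeg (nat_of t) == n.+1 -> multin (nat_of t) * monom (nat_of t) =
    \sum_(j < N | (0 < t j)%N) g j * (multin (dec (nat_of t) j) * monom (dec (nat_of t) j)).
  move=> /eqP Ht.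
  have t0 : (0 < tsum (nat_of t))%N.
    rewrite lt0n; apply/eqP => t0; suff : wdeg (nat_of t) = 0%N by rewrite Ht.
    rewrite /wdeg big1 // => j _; move/eqP: t0; rewrite /tsum (bigD1 j) //= addn_eq0 => /andP[/eqP -> _].
    by rewrite muln0.
  rewrite multin_rec // mulr_suml; apply: eq_big => [j|j tj]; first by rewrite ffunE.
  by rewrite mulrCA -(monom_dec tj).
rewrite (eq_bigr _ step) (exchange_big_dep xpredT) //=.
rewrite (bigID (fun j : 'I_N => (j < n.+1)%N)) /= [X in _ + X]big1 ?addr0; last first.
  move=> j jn; rewrite big1 // => t /andP[/eqP Ht tj].
  have := wdeg_coord (nat_of t) j; rewrite Ht ffunE => H.
  by exfalso; move: jn; rewrite -leqNgt => jn; have := leq_trans (leq_pmulr j.+1 tj) H; lia.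
rewrite (big_ord_widen_cond N xpredT (fun j => g j * \sum_(t : idx | wdeg (nat_of t) == (n - j)%N) multin (nat_of t) * monom (nat_of t)) nN) /=.
apply: eq_bigr => j jn; rewrite -mulr_sumr; congr (_ * _).
(* [inord] would spoil an exponent beyond N; the bound [small] excludes this for the weights
   considered. *)
pose up (t : idx) : idx := [ffun i => inord (t i + (i == j))].
pose dn (t : idx) : idx := [ffun i => inord (t i - (i == j))].
have dnE (t : idx) : nat_of (dn t) = dec (nat_of t) j.
  apply/ffunP => i; rewrite !ffunE inordK // ltnS; have := ltn_ord (t i); lia.
have small (t : idx) : wdeg (nat_of t) = (n - j)%N -> (t j < N)%N.
  move=> Ht; have := wdeg_coord (nat_of t) j; rewrite Ht ffunE; move: jn; lia.
have upE (t : idx) : wdeg (nat_of t) = (n - j)%N -> nat_of (up t) = inc (nat_of t) j.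
  move=> Ht; apply/ffunP => i; rewrite !ffunE inordK // ltnS.
  have [->|ij] := eqVneq i j; first by rewrite addn1; exact: small.
  by rewrite addn0 -ltnS.
have incK t : dec (inc t j) j = t by apply/ffunP => i; rewrite !ffunE addnK.
have nat_of_inj : injective nat_of.
  by move=> t t' /ffunP H; apply/ffunP => i; apply: val_inj; have := H i; rewrite !ffunE.
rewrite (reindex_onto up dn) /=; last first.
  move=> t /andP[/eqP Ht tj]; apply: nat_of_inj; apply/ffunP => i; rewrite !ffunE !inordK.
  - by have [->|_] := eqVneq i j; rewrite ?subnK // subn0 addn0.
  - by have := ltn_ord (t i); lia.
  - by have [->|_] := eqVneq i j; rewrite ?subnK ?ltn_ord // subn0 addn0 ltn_ord.
  - by have := ltn_ord (t i); lia.
have cond (t : idx) : ((wdeg (nat_of (up t)) == n.+1) && (0 < up t j)%N && (dn (up t) == t)) =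
    (wdeg (nat_of t) == (n - j)%N).
  apply/andP/eqP => [[/andP[/eqP Hu uj] /eqP Hd]|Ht].
    have uj' : (0 < nat_of (up t) j)%N by rewrite ffunE.
    have := wdeg_dec uj'; rewrite Hu -dnE Hd => E; move: jn E; lia.
  have E := upE t Ht; have ij : (0 < nat_of (up t) j)%N by rewrite E ffunE eqxx addn1.
  split; last by apply/eqP; apply: nat_of_inj; rewrite dnE E incK.
  apply/andP; split; last by move: ij; rewrite ffunE.
  by rewrite (wdeg_dec ij) E incK Ht; apply/eqP; move: jn; lia.
apply: eq_big => [t|t /andP[/andP[H1 H2] H3]]; first exact: cond.
have Ht : wdeg (nat_of t) = (n - j)%N by apply/eqP; rewrite -cond H1 H2 H3.
by rewrite (upE t Ht) incK.
Qed.

End Fixed.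

(** In weighted degree n no variable of index at least n occurs, and no exponent exceeds n. *)
Lemma Kfix_widen n N g : (n <= N)%N -> Kfix N g n = Kfix n g n.
Proof.
move=> nN.
pose up (t : {ffun 'I_n -> 'I_n.+1}) : {ffun 'I_N -> 'I_N.+1} :=
  [ffun i => if insub (nat_of_ord i) is Some i' then inord (t i') else ord0].
pose dn (t : {ffun 'I_N -> 'I_N.+1}) : {ffun 'I_n -> 'I_n.+1} := [ffun i => inord (t (widen_ord nN i))].
have upE t (i : 'I_N) : nat_of (up t) i = if insub (nat_of_ord i) is Some i' then nat_of t i' else 0%N.
  rewrite !ffunE; case: insubP => [i' _ _|//].
  by rewrite ffunE inordK // ltnS; have := ltn_ord (t i'); lia.
have upw t (i : 'I_n) : nat_of (up t) (widen_ord nN i) = nat_of t i.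
  rewrite upE; case: insubP => [i' _ /= E|/=]; last by rewrite ltn_ord.
  by congr (nat_of t _); apply: val_inj.
have up0 t (i : 'I_N) : (n <= i)%N -> nat_of (up t) i = 0%N.
  by move=> ni; rewrite upE insubN // -leqNgt.
have sumup t (f : nat -> nat -> nat) : (forall i, f i 0%N = 0%N) ->
    (\sum_(i < N) f i (nat_of (up t) i) = \sum_(i < n) f i (nat_of t i))%N.
  move=> f0; rewrite (bigID (fun i : 'I_N => (i < n)%N)) /= [X in (_ + X)%N]big1 ?addn0; last first.
    by move=> i; rewrite -leqNgt => /up0 ->.
  pose G (i : nat) : nat := f i (if insub i is Some i' then nat_of t i' else 0%N).
  rewrite (eq_bigr (fun i : 'I_N => G i)); last by move=> i _; rewrite upE.
  rewrite -(big_ord_widen N G nN); apply: eq_bigr => i _; rewrite /G.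
  by case: insubP => [i' _ E|]; [congr (f _ (nat_of t _)); apply: val_inj|rewrite ltn_ord].
have produp (T : pzSemiRingType) t (f : nat -> nat -> T) : (forall i, f i 0%N = 1) ->
    \prod_(i < N) f i (nat_of (up t) i) = \prod_(i < n) f i (nat_of t i).
  move=> f0; pose G (i : nat) : T := f i (if insub i is Some i' then nat_of t i' else 0%N).
  rewrite (eq_bigr (fun i : 'I_N => G i)); last by move=> i _; rewrite upE.
  rewrite [RHS](eq_bigr (fun i : 'I_n => G i)); last first.
    move=> i _; rewrite /G; case: insubP => [i' _ E|]; last by rewrite ltn_ord.
    by congr (f _ (nat_of t _)); apply: val_inj.
  rewrite -!(big_mkord xpredT G) (big_cat_nat (leq0n n) nN) //= [X in _ * X]big_nat [X in _ * X]big1 ?mulr1 // => i /andP[ni iN].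
  by rewrite /G insubN -?leqNgt // f0.
have nat_of_inj : injective (@nat_of N).
  by move=> t t' /ffunP H; apply/ffunP => i; apply: val_inj; have := H i; rewrite !ffunE.
have nat_of_inj' : injective (@nat_of n).
  by move=> t t' /ffunP H; apply/ffunP => i; apply: val_inj; have := H i; rewrite !ffunE.
have wup t : wdeg (nat_of (up t)) = wdeg (nat_of t).
  by apply: (sumup t (fun i x => i.+1 * x)%N) => i; rewrite muln0.
have sup t : tsum (nat_of (up t)) = tsum (nat_of t) by apply: (sumup t (fun _ x => x)).
rewrite /Kfix (reindex_onto up dn) /=.
  apply: eq_big => [t|t _].
    rewrite wup (_ : dn (up t) == t) ?andbT //; apply/eqP; apply: nat_of_inj'; apply/ffunP => i.
    have := upw t i; rewrite !ffunE => E; rewrite inordK E //.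
  rewrite /multin sup; congr (_ / _ * _).
    have H := @produp F t (fun _ x => x`!%:R) (fun _ => erefl).
    by rewrite !natr_prod.
  by apply: (@produp F t (fun i x => g i ^+ x)) => i; rewrite expr0.
move=> t /eqP Ht; apply: nat_of_inj; apply/ffunP => i; rewrite upE.
have ti := wdeg_coord (nat_of t) i; rewrite Ht in ti.
case: insubP => [i' _ E|].
  rewrite !ffunE inordK; last first.
    have := wdeg_coord (nat_of t) (widen_ord nN i'); rewrite Ht ffunE ltnS; nia.
  by congr (nat_of_ord (t _)); apply: val_inj.
by rewrite -leqNgt => ni; move: ti; rewrite ffunE; case: (nat_of_ord (t i)) => // k; nia.
Qed.

Definition Kscal (g : nat -> F) n : F := Kfix n g n.

Lemma Kscal0 g : Kscal g 0 = 1.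
Proof. exact: Kfix0. Qed.

Lemma KscalS g n : Kscal g n.+1 = \sum_(j < n.+1) g j * Kscal g (n - j)%N.
Proof.
rewrite /Kscal KfixS //; apply: eq_bigr => j _; congr (_ * _).
by rewrite Kfix_widen //; have := ltn_ord j; lia.
Qed.

End Multinomials.

(** * Powers of e and of minus its transpose *)

Section CasimirAlgebra.
Context {R : realType} {m : nat} {rho : 'I_m -> int} (V : unirrep (R := R) rho).
Local Notation C := R[i].
Local Notation d := (rdim V).
Local Notation e k l := (pi_e V k l).

(** The powers of minus the transpose of e, whose entries do not commute. The sign (-1)^q of
    ctilde_q is absorbed, so that ctilde_q is simply the trace. *)
Fixpoint bpow (q : nat) (k l : 'I_m) : 'M[C]_d :=
  if q is q'.+1 then \sum_i (- e i k) *m bpow q' i l else (k == l)%:R%:M.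

Lemma epow_revE q k l : epow_rev (pi_e V) q k l = (-1) ^+ q *: bpow q k l.
Proof.
elim: q k l => [|q IH] k l /=; first by rewrite expr0 scale1r; case: (k == l); rewrite //= ?mulr0n ?raddf0.
rewrite scaler_sumr; apply: eq_bigr => i _; rewrite IH -mulmxE -scalemxAr mulNmx exprS -scalerA scaleN1r.
by rewrite scalerN opprK.
Qed.

Definition ctrace q : 'M[C]_d := \sum_k bpow q k k.

Lemma ctildeE q : ctilde (pi_e V) q = ctrace q.
Proof.
rewrite /ctilde /ctrace; under eq_bigr do rewrite epow_revE.
rewrite -scaler_sumr -mulmxE -scalemxAr mulmxE.
have -> (x : 'M[C]_d) : (-1) ^+ q * x = (-1) ^+ q *: x.
  by elim: q => [|q IH]; rewrite ?expr0 ?mul1r ?scale1r // !exprS -mulrA IH mulN1r -scalerA scaleN1r.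
by rewrite scalerA -exprMn mulN1r opprK expr1n scale1r.
Qed.

(** Each power transforms under gl(m, C) as a tensor in its two indices; in the induction the terms
    that act on the summed index cancel. *)
Lemma bpow_bracket q (a b k j : 'I_m) : e a b *m bpow q k j - bpow q k j *m e a b =
  (b == j)%:R *: bpow q k a - (k == a)%:R *: bpow q b j.
Proof.
have gen (x p B y z B1 B2 : 'M[C]_d) (s t u v : C) : x *m p - p *m x = s *: y - t *: z ->
    x *m B - B *m x = u *: B1 - v *: B2 ->
    x *m (- p *m B) - - p *m B *m x =
    s *: (- y *m B) - t *: (- z *m B) + (u *: (- p *m B1) - v *: (- p *m B2)).
  move=> H1 H2.
  have -> : x *m (- p *m B) - - p *m B *m x = - ((x *m p - p *m x) *m B + p *m (x *m B - B *m x)).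
    rewrite !mulNmx mulmxN opprK mulmxBl mulmxBr !mulmxA addrA subrK opprB addrC.
    by rewrite addrC.
  rewrite H1 H2 mulmxBl mulmxBr -!scalemxAl -!scalemxAr !mulNmx !scalerN !opprK !opprD !opprK.
  by rewrite -!addrA.
elim: q k j => [|q IH] k j /=.
  rewrite mul_mx_scalar mul_scalar_mx subrr !scale_scalar_mx.
  by rewrite [X in _ - X%:M]mulrC subrr.
rewrite mulmx_sumr mulmx_suml -sumrB.
have step i : e a b *m (- e i k *m bpow q i j) - - e i k *m bpow q i j *m e a b =
  (b == i)%:R *: (- e a k *m bpow q i j) - (k == a)%:R *: (- e i b *m bpow q i j)
   + ((b == j)%:R *: (- e i k *m bpow q i a) - (i == a)%:R *: (- e i k *m bpow q b j)).
  by apply: gen (IH i j); rewrite pi_e_bracket [a == k]eq_sym.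
transitivity (\sum_i ((b == i)%:R *: (- e a k *m bpow q i j) - (k == a)%:R *: (- e i b *m bpow q i j)
   + ((b == j)%:R *: (- e i k *m bpow q i a) - (i == a)%:R *: (- e i k *m bpow q b j)))).
  by apply: eq_bigr => i _; exact: step.
rewrite big_split /= !sumrB.
rewrite (bigD1 b) //= eqxx scale1r big1 ?addr0; last by move=> i ib; rewrite eq_sym (negbTE ib) scale0r.
rewrite -!scaler_sumr.
rewrite [X in _ + (_ - X)](bigD1 a) //= eqxx scale1r [X in _ + (_ - (_ + X))]big1 ?addr0; last first.
  by move=> i ia; rewrite (negbTE ia) scale0r.
by rewrite addrC addrA subrK.
Qed.

Lemma bpowSr q k l : bpow q.+1 k l = \sum_j bpow q k j *m (- e l j).
Proof.
elim: q k l => [|q IH] k l.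
  rewrite /= (bigD1 l) //= eqxx mulmx1 big1 ?addr0; last by move=> i /negbTE ->; rewrite raddf0 mulmx0.
  rewrite (bigD1 k) //= eqxx mul1mx big1 ?addr0 // => i /negbTE; rewrite eq_sym => ->.
  by rewrite raddf0 mul0mx.
rewrite -[LHS]/(\sum_i (- e i k) *m bpow q.+1 i l) (eq_bigr _ (fun i _ => congr1 _ (IH i l))).
under eq_bigr do rewrite mulmx_sumr; rewrite exchange_big; apply: eq_bigr => j _ /=.
by rewrite mulmx_suml; apply: eq_bigr => i _; rewrite mulmxA.
Qed.

Lemma ctrace_central q a b : e a b *m ctrace q = ctrace q *m e a b.
Proof.
apply/eqP; rewrite -subr_eq0 /ctrace mulmx_sumr mulmx_suml -sumrB.
under eq_bigr do rewrite bpow_bracket; rewrite sumrB.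
rewrite (bigD1 b) //= eqxx scale1r big1 ?addr0; last by move=> i /negbTE; rewrite eq_sym => ->; rewrite scale0r.
rewrite (bigD1 a) //= eqxx scale1r big1 ?addr0; last by move=> i /negbTE ->; rewrite scale0r.
by rewrite subrr.
Qed.

Lemma ctrace_scalar q : exists c, ctrace q = c%:M.
Proof.
apply: (schur (V := V)); apply: commute_rdiff_rmap => X.
rewrite pi_eE mulmx_sumr mulmx_suml; apply: eq_bigr => k _.
rewrite mulmx_sumr mulmx_suml; apply: eq_bigr => l _.
by rewrite -scalemxAr -scalemxAl ctrace_central.
Qed.

Definition cscal q : C := sval (cid (ctrace_scalar q)).

Lemma cscalE q : ctrace q = (cscal q)%:M.
Proof. exact: svalP (cid (ctrace_scalar q)). Qed.

Definition Kcoef n : C := Kscal cscal n.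

Lemma KpolyE n : Kpoly (pi_e V) n = (Kcoef n)%:M.
Proof.
rewrite /Kpoly /Kcoef /Kscal /Kfix raddf_sum /=; apply: eq_big => [t|t _].
  by rewrite /wdeg; congr (_ == n); apply: eq_bigr => j _; rewrite ffunE.
rewrite scalar_mxM mulmxE multin_div; congr (_ * _).
  rewrite raddfMn /=; congr (_ *+ _); rewrite /tsum; congr (_`! %/ _)%N.
    by apply: eq_bigr => j _; rewrite ffunE.
  by apply: eq_bigr => j _; rewrite ffunE.
rewrite /monom (big_morph (fun c : C => c%:M : 'M[C]_d) (@scalar_mxM _ d) (erefl _)).
apply: eq_bigr => j _; rewrite ffunE ctildeE cscalE.
by elim: (nat_of_ord (t j)) => [|r IH]; rewrite ?expr0 // !exprS scalar_mxM mulmxE IH.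
Qed.

(** Moving e to the right of the power costs commutators. They produce the factor m and the trace
    ctilde_p, which is the source of the recursion for K. *)
Lemma sum_e_bpow p k l : \sum_j e l j *m bpow p k j =
  - bpow p.+1 k l + m%:R *: bpow p k l - (k == l)%:R *: (cscal p)%:M.
Proof.
have E j : e l j *m bpow p k j = bpow p k j *m e l j + (bpow p k l - (k == l)%:R *: bpow p j j).
  have := bpow_bracket p l j k j; rewrite eqxx scale1r => /eqP; rewrite subr_eq => /eqP ->.
  by rewrite addrC.
under eq_bigr do rewrite E; rewrite big_split /= sumrB -scaler_sumr -/(ctrace p) cscalE addrA.
congr (_ + _ - _); last by rewrite sumr_const card_ord scaler_nat.
by rewrite -[X in _ = - X]/(bpow p.+1 k l) bpowSr -sumrN; apply: eq_bigr => j _; rewrite mulmxN opprK.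
Qed.

(** A matrix over the noncommutative ring of endomorphisms of V, so that [epow] becomes a matrix
    power and the binomial formula applies to m - e. *)
Let EE : 'M['M[C]_d]_m := \matrix_(k, l) e k l.

Let EE_exp q k l : (EE ^+ q) k l = epow (pi_e V) q k l.
Proof.
elim: q k l => [|q IH] k l; first by rewrite expr0 mxE.
by rewrite exprS mxE /=; apply: eq_bigr => i _; rewrite IH mxE.
Qed.

(** Induction on q: by [sum_e_bpow] the factor m cancels, the power of minus the transpose goes up
    by one, and a term ctilde_p K_(q-p) appears on the diagonal; these terms add up to K_(q+1). *)
Lemma shifted_power q k l : ((m%:R - EE) ^+ q) l k = \sum_(p < q.+1) Kcoef (q - p)%N *: bpow p k l.
Proof.
elim: q k l => [|q IH] k l.
  rewrite big_ord1 expr0 subnn /Kcoef Kscal0 scale1r [LHS]mxE /= eq_sym.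
  by case: (k == l); rewrite //= ?mulr0n ?raddf0.
have -> : ((m%:R - EE) ^+ q.+1) l k = ((m%:R - EE) ^+ q) l k *+ m - \sum_j e l j *m ((m%:R - EE) ^+ q) j k.
  rewrite exprS mulrBl mulr_natl [LHS]mxE mulmxnE [X in _ + X]mxE; congr (_ - _).
  by rewrite -mulmxE [LHS]mxE; apply: eq_bigr => j _; rewrite [EE _ _]mxE.
rewrite IH; under [X in _ - X]eq_bigr do rewrite IH mulmx_sumr.
rewrite [X in _ - X]exchange_big /=.
under [X in _ - X]eq_bigr => p _.
  under eq_bigr do rewrite -scalemxAr.
  rewrite -scaler_sumr sum_e_bpow; over.
rewrite -sumrMnl -sumrB.
rewrite (eq_bigr (fun p : 'I_q.+1 => Kcoef (q - p)%N *: bpow p.+1 k l + (cscal p * Kcoef (q - p)%N) *: ((k == l)%:R *: 1%:M))); last first.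
  move=> p _; rewrite scaler_nat scalerMnr -scalerBr opprB opprD opprK addrC -addrA subrK scalerDr addrC.
  by congr (_ + _); rewrite -[(cscal p)%:M]scalemx1 !scalerA; congr (_ *: _); ring.
rewrite big_split -scaler_suml [RHS]big_ord_recl subn0 addrC.
transitivity (Kcoef q.+1 *: bpow 0 k l + \sum_(p < q.+1) Kcoef (q - p)%N *: bpow p.+1 k l); last first.
  by rewrite addrC; congr (_ + _); apply: eq_bigr => p _; rewrite lift0 subSS.
rewrite [LHS]addrC; congr (_ + _).
by rewrite /Kcoef KscalS; congr (_ *: _) => /=; case: (k == l); rewrite //= ?scale1r ?scale0r ?raddf0.
Qed.

Lemma shifted_epow q k l :
  \sum_(p < q.+1) ('C(q, p)%:R * (- m%:R) ^+ (q - p)) *: epow (pi_e V) p l k =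
  (-1) ^+ q *: \sum_(p < q.+1) Kcoef (q - p)%N *: bpow p k l.
Proof.
rewrite -shifted_power.
have S r (Y : 'M['M[C]_d]_m) : ((- m%:R) ^+ r * Y) l k = (- m%:R : C) ^+ r *: Y l k.
  elim: r => [|r IH]; first by rewrite !expr0 mul1r scale1r.
  rewrite !exprS -mulrA mulNr mulr_natl [LHS]mxE mulmxnE IH -scalerA scaleNr scaler_nat //.
have S1 r (Y : 'M['M[C]_d]_m) : ((-1) ^+ r * Y) l k = (- 1 : C) ^+ r *: Y l k.
  elim: r => [|r IH]; first by rewrite !expr0 mul1r scale1r.
  by rewrite !exprS -mulrA mulN1r [LHS]mxE IH -scalerA scaleN1r.
rewrite -S1 -exprNn opprB addrC exprDn_comm; last by apply/commr_sym/commrN/commr_nat.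
rewrite summxE; apply: eq_bigr => p _.
by rewrite mulmxnE S EE_exp -(scaler_nat 'C(q, p) (_ *: _)) scalerA.
Qed.

(** A block matrix F acting on V (x) C^m: column k of the result is the sum over l of F_kl applied
    to column l. *)
Definition blockop (F : 'I_m -> 'I_m -> 'M[C]_d) (A : 'M[C]_(d, m)) : 'M[C]_(d, m) :=
  \sum_k \sum_l F k l *m A *m delta_mx l k.

Lemma blockop_comp F G A : blockop F (blockop G A) = blockop (fun k l => \sum_i F k i *m G i l) A.
Proof.
rewrite /blockop; apply: eq_bigr => k _.
under eq_bigr => i _.
  rewrite mulmx_sumr mulmx_suml.
  rewrite (bigD1 i) //= [X in _ + X]big1 ?addr0; last first.
    move=> j ji; rewrite mulmx_sumr mulmx_suml big1 // => l _.
    by rewrite -!mulmxA mul_delta_mx_0 ?mulmx0 // .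
  rewrite mulmx_sumr mulmx_suml; over.
rewrite exchange_big /=; apply: eq_bigr => l _.
rewrite !mulmx_suml; apply: eq_bigr => i _.
by rewrite -!mulmxA mul_delta_mx.
Qed.

Lemma blockop_ext F G A : (forall k l, F k l = G k l) -> blockop F A = blockop G A.
Proof. by move=> H; apply: eq_bigr => k _; apply: eq_bigr => l _; rewrite H. Qed.

Lemma blockop1 A : blockop (fun k l => (k == l)%:R%:M) A = A.
Proof.
rewrite /blockop; transitivity (A *m \sum_k delta_mx k k); last first.
  rewrite -[X in _ *m X](_ : 1%:M = _) ?mulmx1 //.
  apply/matrixP => i j; rewrite summxE mxE (bigD1 i) //= big1 ?addr0.
    by rewrite !mxE eqxx eq_sym.
  by move=> k ki; rewrite mxE [i == k]eq_sym (negbTE ki).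
rewrite mulmx_sumr; apply: eq_bigr => k _; rewrite (bigD1 k) //= eqxx mul1mx big1 ?addr0 // => l lk.
by rewrite eq_sym (negbTE lk) raddf0 !mul0mx.
Qed.

Lemma blockop_scale c F A : blockop (fun k l => c *: F k l) A = c *: blockop F A.
Proof.
rewrite /blockop scaler_sumr; apply: eq_bigr => k _; rewrite scaler_sumr; apply: eq_bigr => l _.
by rewrite -!scalemxAl.
Qed.

Lemma blockop_sum I (r : seq I) F A :
  blockop (fun k l => \sum_(i <- r) F i k l) A = \sum_(i <- r) blockop (F i) A.
Proof.
rewrite /blockop [RHS]exchange_big; apply: eq_bigr => k _; rewrite [RHS]exchange_big; apply: eq_bigr => l _.
by rewrite !mulmx_suml.
Qed.

Lemma iter_Bop_neg q A : iter q (@Bop _ _ _ V false) A = blockop (epow (pi_e V) q) A.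
Proof.
elim: q => [|q IH].
  rewrite /= -[LHS]blockop1; apply: blockop_ext => k l.
  by case: (k == l); rewrite //= ?mulr0n ?raddf0.
have BE B : @Bop _ _ _ V false B = blockop (fun k l => e k l) B.
  rewrite /Bop /lieR /blockop -sumrN; apply: eq_bigr => k _; rewrite -sumrN; apply: eq_bigr => l _.
  by rewrite mulmxN opprK.
by rewrite iterS IH BE blockop_comp; apply: blockop_ext => k l.
Qed.

Lemma iter_Bop_pos q A : iter q (@Bop _ _ _ V true) A = blockop (bpow q) A.
Proof.
elim: q => [|q IH]; first by rewrite /= -[LHS]blockop1.
have BE B : @Bop _ _ _ V true B = blockop (fun k l => - e l k) B.
  rewrite /Bop /lieR /blockop -sumrN exchange_big; apply: eq_bigr => k _; rewrite -sumrN; apply: eq_bigr => l _.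
  by rewrite trmx_delta !mulNmx.
by rewrite iterS IH BE blockop_comp; apply: blockop_ext => k l.
Qed.

End CasimirAlgebra.

(** * Unitary frames *)

Section ScalarComposition.
Context {R : realType}.

Lemma is_derive_line (V : normedModType R) (f : V -> R) (x v : V) (l : R) :
  is_derive x v f l <-> is_derive (0 : R) (1 : R) (fun h : R => f (h *: v + x)) l.
Proof.
have E : (fun h : R => h^-1 *: ((f \o shift x) (h *: v) - f x)) =
    (fun h : R => h^-1 *: (((fun h : R => f (h *: v + x)) \o shift (0 : R)) (h *: (1 : R)) - f (0 *: v + x))).
  by apply: funext => h /=; rewrite addr0 scale0r add0r [_%:A]mulr1.
split=> -[d1 d2]; apply: DeriveDef.
- by move: d1; rewrite /derivable E.
- by rewrite -d2 /derive E.
- by move: d1; rewrite /derivable E.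
- by rewrite -d2 /derive E.
Qed.

Lemma is_derive_comp1 (V : normedModType R) (f : V -> R) (phi : R -> R) (x v : V) (l l' : R) :
  is_derive x v f l -> is_derive (f x) (1 : R) phi l' -> is_derive x v (phi \o f) (l * l').
Proof.
move=> /is_derive_line Hf Hp; apply/is_derive_line.
have Hp' : is_derive ((fun h : R => f (h *: v + x)) 0) (1 : R) phi l' by rewrite /= scale0r add0r.
have := @is_derive1_comp _ phi (fun h : R => f (h *: v + x)) 0 l' l Hp' Hf.
by rewrite /= mulrC.
Qed.

(** The outer function comes with a family closed under derivation, so that the induction on k can
    pass from [phi i] to its successor. *)
Lemma Ck_on_comp1 n (U : set 'rV[R]_n) (f : 'rV[R]_n -> R) (P : R -> Prop) (phi : nat -> R -> R) k i :
  open U -> (forall j t, P t -> is_derive t (1 : R) (phi j) (phi j.+1 t)) ->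
  (forall y, U y -> P (f y)) -> Ck_on k U f -> Ck_on k U (phi i \o f).
Proof.
move=> oU Hphi Pf; elim: k i => [|k IH] i Hf0.
  split=> // y Uy; apply: continuous_comp; first exact: (proj1 Hf0 y Uy).
  apply: differentiable_continuous; apply/derivable1_diffP.
  by have [] := Hphi i _ (Pf y Uy).
have [cf Hf] := Hf0; split.
  exact: (proj1 (Ck_on_leq (leq0n k) (IH i (Ck_on_pred Hf0)))).
move=> j; have [f1 f2] := Hf j.
have D y : U y -> is_derive y (delta_mx 0 j : 'rV[R]_n) (phi i \o f) (pderiv j f y * phi i.+1 (f y)).
  move=> Uy; apply: is_derive_comp1; last exact: Hphi (Pf y Uy).
  by apply: DeriveDef; first exact: f1.
split; first by move=> y Uy; have [] := D y Uy.
apply: Ck_on_ext (Ck_on_mul oU f2 (IH i.+1 (Ck_on_pred Hf0))) => // y Uy.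
by have [_ <-] := D y Uy.
Qed.

(** The coefficient of t^(-(2k+1)/2) in the k-th derivative of t^(-1/2). *)
Fixpoint rsqrt_coef (k : nat) : R := if k is k'.+1 then - (k'.*2.+1%:R / 2) * rsqrt_coef k' else 1.

Lemma rsqrt_derive k (t : R) : 0 < t ->
  is_derive t (1 : R) (fun s => rsqrt_coef k * (Num.sqrt s)^-1 ^+ k.*2.+1)
    (rsqrt_coef k.+1 * (Num.sqrt t)^-1 ^+ k.+1.*2.+1).
Proof.
move=> t0; have s0 : Num.sqrt t != 0 by rewrite gt_eqF // sqrtr_gt0.
have D1 := is_derive1_sqrt t0.
have D2 : is_derive t (1 : R) (fun s => (Num.sqrt s)^-1) (- 2^-1 * (Num.sqrt t)^-1 ^+ 3).
  apply: is_derive_eq; rewrite /GRing.scale /=; field.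
  by rewrite s0.
have D3 := is_deriveX k.*2.+1 D2.
have -> : (fun s => rsqrt_coef k * (Num.sqrt s)^-1 ^+ k.*2.+1) =
    rsqrt_coef k \*: ((fun s : R => (Num.sqrt s)^-1) ^+ k.*2.+1).
  by apply: funext => s; rewrite /= exprfctE.
apply: is_derive_eq; rewrite /GRing.scale /= !exprS; field.
by rewrite s0.
Qed.

Lemma smooth_rsqrt n (U : set 'rV[R]_n) (f : 'rV[R]_n -> R) : open U -> smooth_on U f ->
  (forall y, U y -> 0 < f y) -> smooth_on U (fun y => (Num.sqrt (f y))^-1).
Proof.
move=> oU sf f0 k.
have := @Ck_on_comp1 n U f (fun t => 0 < t) (fun k s => rsqrt_coef k * (Num.sqrt s)^-1 ^+ k.*2.+1) k 0 oU
  (fun j t => @rsqrt_derive j t) f0 (sf k).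
by apply: Ck_on_ext => // y _ /=; rewrite mul1r expr1.
Qed.

End ScalarComposition.

Section FrameAlgebra.
Context {R : realType}.
Local Notation C := R[i].

Lemma adjmxE a b (A : 'M[C]_(a, b)) : A ^t* = cjmx A^T.
Proof. by apply/matrixP => i j; rewrite !mxE. Qed.

Lemma cjmxM a b c (A : 'M[C]_(a, b)) (B : 'M[C]_(b, c)) : cjmx (A *m B) = cjmx A *m cjmx B.
Proof. exact: map_mxM. Qed.

Lemma cjmxK a b (A : 'M[C]_(a, b)) : cjmx (cjmx A) = A.
Proof. by apply/matrixP => i j; rewrite !mxE conjCK. Qed.

Lemma cjmxT a b (A : 'M[C]_(a, b)) : cjmx A^T = (cjmx A)^T.
Proof. by rewrite /Defs.conjmx map_trmx. Qed.

Lemma cjmx0 a b : cjmx (0 : 'M[C]_(a, b)) = 0.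
Proof. exact: map_mx0. Qed.

Lemma cjmx1 n : cjmx (1%:M : 'M[C]_n) = 1%:M.
Proof. exact: map_mx1. Qed.

Lemma adjmx_toC a b (A : 'M[R]_(a, b)) : (toC A) ^t* = toC A^T.
Proof. by rewrite adjmxE -toC_tr cjmx_toC. Qed.

Lemma adjmx_tr a b (A : 'M[C]_(a, b)) : (A^T) ^t* = cjmx A.
Proof. by rewrite adjmxE trmxK. Qed.

Lemma adjmx_cj a b (A : 'M[C]_(a, b)) : (cjmx A) ^t* = A^T.
Proof. by rewrite adjmxE cjmxT cjmxK. Qed.

Lemma adjmx0 a b : (0 : 'M[C]_(a, b)) ^t* = 0.
Proof. by rewrite adjmxE trmx0 cjmx0. Qed.

Lemma adjmx_scalar a (c : C) : (c%:M : 'M[C]_a) ^t* = (Num.conj c)%:M.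
Proof. by rewrite adjmxE tr_scalar_mx /Defs.conjmx map_scalar_mx. Qed.

Lemma adjmx_block a b c d (A : 'M[C]_(a, b)) (B : 'M[C]_(a, c)) (A' : 'M[C]_(d, b)) (B' : 'M[C]_(d, c)) :
  (block_mx A B A' B') ^t* = block_mx (A ^t*) (A' ^t*) (B ^t*) (B' ^t*).
Proof. by rewrite adjmxE tr_block_mx /Defs.conjmx map_block_mx. Qed.

(** The sizes are only propositionally equal: a frame stacked on its conjugate has m + m rows and
    [m.*2] columns. *)
Lemma mulmx_eq1_comm p q (A : 'M[C]_(p, q)) (B : 'M[C]_(q, p)) : p = q ->
  A *m B = 1%:M -> B *m A = 1%:M.
Proof. by move=> pq; case: q / pq A B => A B; exact: mulmx1C. Qed.

Section Frames.
Context {m : nat} (J G : 'M[R]_(m.*2)).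
Hypotheses (JG : J *m G *m J^T = G) (Gsym : G^T = G) (Gunit : G \in unitmx).
Local Notation n := (m.*2).
Local Notation J' := (toC J).
Local Notation G' := (toC G).

Definition frame_for (S : 'M[C]_(m, n)) : Prop :=
  S *m J' = 'i *: S /\ S *m G' *m S ^t* = 1%:M.

(** J preserves G and acts on both factors by i, so the bilinear pairing equals i^2 times itself. *)
Lemma holomorphic_isotropic a b (S : 'M[C]_(a, n)) (T : 'M[C]_(b, n)) :
  S *m J' = 'i *: S -> T *m J' = 'i *: T -> S *m G' *m T^T = 0.
Proof.
move=> SJ TJ; have E : S *m G' *m T^T = (-1) *: (S *m G' *m T^T).
  rewrite -{1}JG !toC_mul toC_tr !mulmxA SJ -mulmxA -trmx_mul TJ linearZ /= -!scalemxAl -scalemxAr scalerA.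
  by rewrite -expr2 sqrCi.
have : S *m G' *m T^T + S *m G' *m T^T = 0 by rewrite {2}E scaleN1r subrr.
by rewrite -mulr2n -scaler_nat => /eqP; rewrite scaler_eq0 pnatr_eq0 => /eqP.
Qed.

(** The frame stacked on its conjugate is orthonormal for the metric. A one-sided inverse of a
    square matrix is two-sided, and the product in the other order is the claim. *)
Lemma frame_inv_gram S : frame_for S -> S ^t* *m S + S^T *m cjmx S = invmx G'.
Proof.
move=> [SJ SG]; have iso := holomorphic_isotropic SJ SJ.
have Gu : G' \in unitmx by rewrite toC_unit.
pose P := col_mx S (cjmx S).
have E : P *m (G' *m row_mx (S ^t*) S^T) = 1%:M.
  rewrite mulmxA mul_col_mx mul_col_row iso SG.
  have -> : cjmx S *m G' *m S^T = 1%:M by rewrite -[RHS]cjmx1 -SG !cjmxM cjmx_toC adjmxE cjmxK.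
  have -> : cjmx S *m G' *m S ^t* = 0 by rewrite -[RHS]cjmx0 -iso !cjmxM cjmx_toC adjmxE.
  by rewrite -scalar_mx_block.
have := mulmx_eq1_comm (addnn m) E; rewrite -mulmxA mul_row_col => H.
by rewrite -[LHS](mulKmx Gu) H mulmx1.
Qed.

(** Isotropy removes the component of T along the conjugate frame. *)
Lemma frame_expand a S (T : 'M[C]_(a, n)) : frame_for S -> T *m J' = 'i *: T ->
  T = T *m G' *m S ^t* *m S.
Proof.
move=> Sf TJ; have Gu : G' \in unitmx by rewrite toC_unit.
have := frame_inv_gram Sf => /(congr1 (mulmx (T *m G'))).
rewrite mulmxDr !mulmxA (holomorphic_isotropic TJ (proj1 Sf)) mul0mx addr0 => ->.
by rewrite -mulmxA mulmxV // mulmx1.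
Qed.

Lemma adj_gram_form a b (S : 'M[C]_(a, n)) (T : 'M[C]_(b, n)) : (S *m G' *m T ^t*) ^t* = T *m G' *m S ^t*.
Proof. by rewrite !adjmxM adjmxK adjmx_toC Gsym mulmxA. Qed.

Lemma frame_gauge S S' : frame_for S -> frame_for S' ->
  exists2 a, a \is unitarymx & S' = a *m S.
Proof.
move=> Sf Sf'; exists (S' *m G' *m S ^t*); last exact: frame_expand (proj1 Sf').
apply/unitarymxP; rewrite adj_gram_form !mulmxA -(frame_expand Sf (proj1 Sf')).
exact: proj2 Sf'.
Qed.

Lemma frame_rotate S a : frame_for S -> a \is unitarymx -> frame_for (a *m S).
Proof.
move=> [SJ SG] /unitarymxP au; split; first by rewrite -mulmxA SJ -scalemxAr.
by rewrite adjmxM -!mulmxA [S *m _]mulmxA [_ *m (S ^t* *m _)]mulmxA SG mul1mx.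
Qed.

End Frames.

Lemma frame_change m (J G J1 G1 D : 'M[R]_(m.*2)) (S : 'M[C]_(m, m.*2)) :
  D *m J1 = J *m D -> D *m G1 *m D^T = G -> frame_for J G S -> frame_for J1 G1 (S *m toC D).
Proof.
move=> DJ DG [SJ SG]; split.
  by rewrite -mulmxA -toC_mul DJ toC_mul mulmxA SJ -scalemxAl.
rewrite adjmxM adjmx_toC mulmxA -[RHS]SG; congr (_ *m _).
by rewrite -DG !toC_mul !mulmxA.
Qed.

End FrameAlgebra.

(** * Smooth local unitary frames *)

Section GramSchmidt.
Context {R : realType} {n0 : nat}.
Local Notation C := R[i].
Implicit Types (U : set 'rV[R]_n0) (y : 'rV[R]_n0).

Lemma msmooth_block U a b c d (A : _ -> 'M[C]_(a, b)) (B : _ -> 'M[C]_(a, c))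
    (A' : _ -> 'M[C]_(d, b)) (B' : _ -> 'M[C]_(d, c)) : open U ->
  msmooth_on U A -> msmooth_on U B -> msmooth_on U A' -> msmooth_on U B' ->
  msmooth_on U (fun y => block_mx (A y) (B y) (A' y) (B' y)).
Proof.
move=> oU sA sB sA' sB' i j; case: (split_ordP i) => i' ->; case: (split_ordP j) => j' ->.
- by apply: csmooth_ext oU _ (sA i' j') => y _; rewrite block_mxEul.
- by apply: csmooth_ext oU _ (sB i' j') => y _; rewrite block_mxEur.
- by apply: csmooth_ext oU _ (sA' i' j') => y _; rewrite block_mxEdl.
- by apply: csmooth_ext oU _ (sB' i' j') => y _; rewrite block_mxEdr.
Qed.

Lemma msmooth_adj U a b (A : _ -> 'M[C]_(a, b)) : open U -> msmooth_on U A -> msmooth_on U (fun y => (A y) ^t*).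
Proof.
by move=> oU sA; exact: msmooth_conj oU (msmooth_tr sA).
Qed.

(** Smooth Gram-Schmidt reduction near a point where H is the identity. One step clears the first
    row and column and passes to the Schur complement, on a smaller open set where the pivot stays
    positive. *)
Lemma gram_schmidt m U y0 (H : 'rV[R]_n0 -> 'M[C]_m) : open U -> U y0 -> msmooth_on U H ->
  (forall y, U y -> (H y) ^t* = H y) -> H y0 = 1%:M ->
  exists U' L, [/\ open U', U' y0, U' `<=` U, msmooth_on U' L &
    (forall y, U' y -> L y *m H y *m (L y) ^t* = 1%:M) /\ L y0 = 1%:M].
Proof.
elim: m U H => [|m IH] U H oU Uy0 sH Hh H0.
  exists U, (fun=> 1%:M); split => //; first exact: msmooth_cst.
  by split=> // y _; rewrite [LHS]flatmx0 [RHS]flatmx0.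
change ('M[C]_m.+1) with 'M[C]_(1 + m)%N in H, sH, Hh, H0.
pose h y : R := complex.Re (H y 0 0).
have Hh00 y : U y -> H y 0 0 = Complex (h y) 0.
  move=> Uy; have := congr1 (fun A : 'M[C]_(1 + m)%N => A 0 0) (Hh y Uy); rewrite !mxE => E.
  by apply: complexE => //=; move/(congr1 (@complex.Im R)): E; rewrite ImJ; lra.
pose U1 := U `&` [set y | 0 < h y].
have sh : smooth_on U h by exact: (proj1 (sH 0 0)).
have oU1 : open U1.
  rewrite openE => y [Uy hy]; apply: filterI; first exact: open_nbhs_nbhs.
  have ch := proj1 (sh 0%N) y Uy; exact: (cvgr_gt (h y) ch).
have U1y0 : U1 y0 by split=> //=; rewrite /h H0 mxE eqxx.
have U1U : U1 `<=` U by move=> y [].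
pose w y := (Num.sqrt (h y))^-1.
have sw : csmooth_on U1 (fun y => Complex (w y) 0).
  apply: csmooth_real; apply: smooth_rsqrt => //; last by move=> y [].
  by move=> k; apply: Ck_on_sub (sh k).
have wh y : U1 y -> w y * w y * h y = 1.
  move=> [_ /= hy]; rewrite -invfM -expr2 sqr_sqrtr ?ltW // mulVf // gt_eqF //.
pose wc y : C := Complex (w y) 0.
have wcJ y : Num.conj (wc y) = wc y by apply: complexE; rewrite ?ReJ ?ImJ //= oppr0.
have wch y : U1 y -> wc y * wc y * H y 0 0 = 1.
  move=> Uy; rewrite Hh00; last exact: U1U.
  by apply: complexE; rewrite /= !(mulr0, mul0r, subr0, addr0) ?wh.
pose b y : 'M[C]_(1, m) := ursubmx (H y).
pose D y : 'M[C]_m := drsubmx (H y).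
have sb : msmooth_on U1 b.
  move=> i j; apply: csmooth_ext oU1 _ (csmooth_sub U1U (sH (lshift m i) (rshift 1 j))) => y _.
  by rewrite !mxE.
have sD : msmooth_on U1 D.
  move=> i j; apply: csmooth_ext oU1 _ (csmooth_sub U1U (sH (rshift 1 i) (rshift 1 j))) => y _.
  by rewrite !mxE.
have HE y : U1 y -> H y = block_mx (H y 0 0)%:M (b y) ((b y) ^t*) (D y).
  move=> Uy; rewrite -{1}[H y]submxK; congr block_mx.
    by rewrite [LHS]mx11_scalar; congr (_%:M); rewrite [LHS]mxE [LHS]mxE; congr (H y _ _); apply: val_inj.
  apply/matrixP => i j; have := congr1 (fun A : 'M[C]_(1 + m)%N => A (rshift 1 i) (lshift m j)) (Hh y (U1U _ Uy)).
  by rewrite !mxE => <-.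
(* Normalises the pivot and subtracts the multiple of the first row that clears the first column;
   [D'] is the Schur complement. *)
pose L1 y : 'M[C]_(1 + m) := block_mx (wc y)%:M 0 (- (wc y * wc y) *: (b y) ^t*) 1%:M.
pose D' y : 'M[C]_m := D y - (wc y * wc y) *: ((b y) ^t* *m b y).
have sw2 : csmooth_on U1 (fun y => - (wc y * wc y)).
  have := csmooth_mul oU1 (csmooth_mul oU1 sw sw) (@csmooth_cst _ _ U1 (- 1)).
  by apply: csmooth_ext => // y _; rewrite mulrN1.
have sL1 : msmooth_on U1 L1.
  apply: msmooth_block => //; [|exact: msmooth_cst| |exact: msmooth_cst].
    apply: msmooth_ext (msmooth_scale oU1 sw (@msmooth_cst _ _ 1 1 U1 1%:M)) => // y _.
    by rewrite scalemx1.
  exact: msmooth_scale oU1 sw2 (msmooth_adj oU1 sb).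
have sD' : msmooth_on U1 D'.
  apply: msmooth_ext (msmooth_add oU1 sD (msmooth_scale oU1 sw2 (msmooth_mul oU1 (msmooth_adj oU1 sb) sb))) => // y _.
  by rewrite scaleNr.
have Dh y : U1 y -> (D y) ^t* = D y.
  move=> Uy; apply/matrixP => i j.
  have := congr1 (fun A : 'M[C]_(1 + m)%N => A (rshift 1 i) (rshift 1 j)) (Hh y (U1U _ Uy)).
  by rewrite !mxE => <-.
have D'h y : U1 y -> (D' y) ^t* = D' y.
  move=> Uy; rewrite /D' adjmxD -scaleNr adjmxZ adjmxM adjmxK Dh // rmorphN rmorphM /= wcJ.
  by rewrite scaleNr.
have L1H y : U1 y -> L1 y *m H y *m (L1 y) ^t* = block_mx 1%:M 0 0 (D' y).
  move=> Uy; have -> : (L1 y) ^t* = block_mx (wc y)%:M (- (wc y * wc y) *: b y) 0 1%:M.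
    by rewrite /L1 adjmx_block adjmx_scalar adjmx0 adjmxZ adjmxK adjmx1 rmorphN rmorphM /= wcJ.
  rewrite (HE y Uy) /L1 !mulmx_block !(mul0mx, mulmx0, addr0, add0r, mul1mx, mulmx1).
  have E := wch _ Uy; have Z : - (wc y * wc y) *: (b y) ^t* *m (H y 0 0)%:M + (b y) ^t* = 0.
    by rewrite mul_mx_scalar scalerA mulrN mulrC E scaleN1r addNr.
  rewrite Z !mul0mx add0r; congr block_mx.
  - by rewrite -!scalar_mxM mulrAC E.
  - rewrite -!scalar_mxM !mul_scalar_mx scalerA -scalerDl.
    have -> : wc y * H y 0 0 * - (wc y * wc y) + wc y = wc y * (1 - wc y * wc y * H y 0 0).
      by move: (wc y) (H y 0 0) => x z; ring.
    by rewrite E subrr mulr0 scale0r.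
  - by rewrite -scalemxAl scaleNr addrC.
have b0 : b y0 = 0.
  by apply/matrixP => i j; rewrite !mxE H0 !mxE -val_eqE /= (ord1 i).
have D'0 : D' y0 = 1%:M.
  rewrite /D' b0 mulmx0 scaler0 subr0; apply/matrixP => i j; rewrite !mxE H0 !mxE -!val_eqE /= eqn_add2l //.
have [U' [L' [oU' U'y0 U'U sL' [HL' L'0]]]] := IH U1 D' oU1 U1y0 sD' D'h D'0.
exists U', (fun y => block_mx 1%:M 0 0 (L' y) *m L1 y); split=> //.
- by move=> y /U'U/U1U.
- apply: msmooth_mul => //; last exact: msmooth_sub U'U sL1.
  by apply: (@msmooth_block U' 1 1 m m (fun=> 1%:M) (fun=> 0) (fun=> 0) L') => //; exact: msmooth_cst.
split.
- move=> y Uy; rewrite adjmxM.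
  have -> : (block_mx 1%:M 0 0 (L' y) : 'M[C]_(1 + m)) ^t* = block_mx 1%:M 0 0 ((L' y) ^t*).
    by rewrite adjmx_block adjmx1 !adjmx0.
  have := L1H y (U'U y Uy); move: (L1 y) => X; rewrite !mulmxA -[_ *m X *m _ *m _ *m _]mulmxA.
  move=> XE; rewrite -!mulmxA [X *m (_ *m (_ *m _))]mulmxA [X *m _ *m (_ *m _)]mulmxA XE.
  suff K : (block_mx 1%:M 0 0 (L' y) : 'M[C]_(1 + m)) *m ((block_mx 1%:M 0 0 (D' y) : 'M[C]_(1 + m)) *m
      (block_mx 1%:M 0 0 (L' y ^t*) : 'M[C]_(1 + m))) = 1%:M by exact: K.
  rewrite !mulmx_block !(mul0mx, mulmx0, addr0, add0r, mul1mx, mulmx1) mulmxA HL' //.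
  by rewrite -scalar_mx_block.
- rewrite L'0 -scalar_mx_block mul1mx /L1 b0 adjmxE trmx0 cjmx0 scaler0.
  have -> : wc y0 = 1 by rewrite /wc /w /h H0 mxE eqxx /= sqrtr1 invr1.
  by rewrite -scalar_mx_block.
Qed.

End GramSchmidt.
Section LocalFrames.
Context {R : realType} {m : nat} (M : kahler R m).
Implicit Types (p q x : M) (W : set M).
Local Notation C := R[i].
Local Notation n := (m.*2).

Lemma cpx_met_orth p x : cdom p x ->
  cpx_in_chart p x *m gram p x *m (cpx_in_chart p x)^T = gram p x.
Proof.
move=> px; have cx := man_center x.
rewrite /gram /cpx_in_chart !trmx_mul !mulmxA -[_ *m jac x p x *m jac p x x]mulmxA (jac_inv cx px) mulmx1.
rewrite -[_ *m (jac p x x)^T *m (jac x p x)^T]mulmxA -trmx_mul (jac_inv cx px) trmx1 mulmx1.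
by rewrite -[in RHS](cpx_orth x) !mulmxA.
Qed.

Lemma cpx_in_chart_sqr p x : cdom p x -> cpx_in_chart p x *m cpx_in_chart p x = - 1%:M.
Proof.
move=> px; have cx := man_center x.
rewrite /cpx_in_chart !mulmxA -[_ *m jac x p x *m jac p x x]mulmxA (jac_inv cx px) mulmx1.
by rewrite -[_ *m cpx x *m cpx x]mulmxA cpx_sqr mulmxN mulmx1 mulNmx (jac_inv px cx).
Qed.

Lemma frame_in_chart p x (u : 'M[C]_(m, n)) : cdom p x -> unitary_frame x u ->
  frame_for (cpx_in_chart p x) (gram p x) (u *m toC (jac x p x)).
Proof.
move=> px uf; have cx := man_center x; apply: (frame_change (J := cpx x) (G := met x)) uf.
  by rewrite /cpx_in_chart !mulmxA (jac_inv cx px) mul1mx.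
by rewrite -(gram_change cx px) gram_center.
Qed.

Lemma unitary_frame_of_chart p x (S : 'M[C]_(m, n)) : cdom p x ->
  frame_for (cpx_in_chart p x) (gram p x) S -> unitary_frame x (S *m toC (jac p x x)).
Proof.
move=> px Sf; have cx := man_center x; have := Sf; apply: frame_change => //.
by rewrite /cpx_in_chart -!mulmxA (jac_inv cx px) mulmx1.
Qed.

Lemma unitary_gauge x (u u' : 'M[C]_(m, n)) : unitary_frame x u -> unitary_frame x u' ->
  exists2 a, a \is unitarymx & u' = a *m u.
Proof. exact: (frame_gauge (cpx_orth x) (met_sym x) (met_unit x)). Qed.

Lemma local_frame_chart p0 W (s : M -> 'M[C]_(m, n)) : open W -> W `<=` cdom p0 ->
  (forall x, W x -> unitary_frame x (s x)) ->
  msmooth_on (cimage p0 W) (fun y => vcomp p0 s (cinv p0 y)) -> local_frame W s.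
Proof.
move=> oW Wp us ss; split=> // p k j; have oWp : open (W `&` cdom p) by apply: openI => //; exact: man_dom_open.
apply: (csmooth_fun_chart (p := p) oWp); first by move=> z [].
have H := vcomp_smooth_change (p := p0) (q := p) (Y := s) oWp _ _ (msmooth_sub _ ss).
by apply: H k j => [z [/Wp]|z []|y [? [? ?]]] //.
Qed.

Lemma local_frame_smooth p W (s : M -> 'M[C]_(m, n)) : local_frame W s ->
  msmooth_on (cimage p (W `&` cdom p)) (fun y => vcomp p s (cinv p y)).
Proof. by move=> [_ H] k j; have /csmooth_funP := H p k j; exact. Qed.

Lemma local_frame_sub W W' (s : M -> 'M[C]_(m, n)) : W' `<=` W -> local_frame W s -> local_frame W' s.
Proof.
move=> sW [H1 H2]; split=> [x /sW|p k j]; first exact: H1.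
by apply: csmooth_fun_sub (H2 p k j) => z [/sW].
Qed.

(** The components of u in the chart are kept constant, projected to type (1,0) at each nearby point
    by (1 - i J)/2, and orthonormalised. At x both corrections are the identity on u. *)
Lemma local_frame_exists x (u : 'M[C]_(m, n)) : unitary_frame x u ->
  exists W s, [/\ open W, W x, W `<=` cdom x, local_frame W s & s x = u].
Proof.
move=> uf; have cx := man_center x.
pose U := cimage x setT; have oU : open U by apply: cimage_open; exact: openT.
pose Jy y := toC (cpx_in_chart x (cinv x y)); pose Gy y := toC (gram x (cinv x y)).
have sJ : msmooth_on U Jy by apply: msmooth_toC => i j k; apply: Ck_on_sub (cpx_smooth x i j k) => y [].
have sG : msmooth_on U Gy by exact: gram_smooth.
pose P y : 'M[C]_(m, n) := u *m (2^-1 *: (1%:M + (- 'i) *: Jy y)).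
have sP : msmooth_on U P.
  apply: msmooth_mul => //; first exact: msmooth_cst.
  apply: msmooth_scale => //; first exact: csmooth_cst.
  apply: msmooth_add => //; first exact: msmooth_cst.
  by apply: msmooth_scale => //; exact: csmooth_cst.
have PJ y : U y -> P y *m Jy y = 'i *: P y.
  move=> Uy; have [dy _] := cimage_dom Uy.
  rewrite /P -mulmxA [RHS]scalemxAr; congr (_ *m _); rewrite -scalemxAl scalerA mulrC -scalerA; congr (_ *: _).
  rewrite mulmxDl mul1mx -scalemxAl /Jy -toC_mul (cpx_in_chart_sqr dy) toC_opp toC1 scalerDr.
  by rewrite scalerA mulrN -expr2 sqrCi opprK scale1r scalerN scaleNr opprK addrC.
pose y0 := cmap x x; have Uy0 : U y0 by exact: cimage_mem.
have P0 : P y0 = u.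
  rewrite /P /Jy /y0 man_cmapK // /cpx_in_chart (jac_id cx) mul1mx mulmx1 -scalemxAr mulmxDr mulmx1 -scalemxAr.
  have uJ : u *m toC (cpx x) = 'i *: u by exact: (proj1 uf).
  rewrite uJ scalerA mulNr -expr2 sqrCi opprK scale1r -mulr2n -(scaler_nat 2 u) scalerA.
  by rewrite mulVf ?scale1r // pnatr_eq0.
pose H y := P y *m Gy y *m (P y) ^t*.
have sH : msmooth_on U H.
  by apply: msmooth_mul => //; [apply: msmooth_mul|apply: msmooth_adj].
have [||U' [L [oU' U'y0 U'U sL [HL L0]]]] := gram_schmidt oU Uy0 sH.
- by move=> y _; rewrite /H adj_gram_form // gram_sym.
- by rewrite /H P0 /Gy /y0 man_cmapK // gram_center (proj2 uf).
pose W := cdom x `&` (cmap x @^-1` U').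
have oW : open W.
  rewrite openE => z [dz Uz]; apply: filterI; first by apply: open_nbhs_nbhs; split; [exact: man_dom_open|].
  by apply: (man_cmap_cont dz); apply: open_nbhs_nbhs.
pose s z := (L (cmap x z) *m P (cmap x z)) *m toC (jac x z z).
exists W, s; split=> //.
- by move=> z [].
- apply: (local_frame_chart (p0 := x)) => //; first by move=> z [].
    move=> z [dz Uz]; apply: unitary_frame_of_chart => //.
    have Uz' := U'U _ Uz; have E := HL _ Uz; have := PJ _ Uz'; move: E; rewrite /H /Jy /Gy man_cmapK // => E E'.
    split; first by rewrite -mulmxA E' -scalemxAr.
    by rewrite adjmxM -[RHS]E !mulmxA.
  have sLP : msmooth_on (cimage x W) (fun y => L y *m P y).
    have sub : cimage x W `<=` U' by move=> y [[z dz <-] [/= _]]; rewrite man_cmapK.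
    apply: msmooth_mul; first exact: cimage_open.
      exact: msmooth_sub sL.
    by apply: msmooth_sub sP => y /sub /U'U.
  apply: msmooth_ext sLP; first exact: cimage_open.
  move=> y Wy; have [dy yE] := cimage_dom Wy; rewrite /vcomp /s yE -mulmxA -toC_mul.
  by rewrite (jac_inv dy) // ?toC1 ?mulmx1 //; exact: man_center.
- by rewrite /s -/y0 L0 P0 mul1mx (jac_id cx) toC1 mulmx1.
Qed.

Lemma frame_throughP x (u : 'M[C]_(m, n)) : unitary_frame x u ->
  frame_through x u x = u /\
  exists W, [/\ open W, W x, W `<=` cdom x & local_frame W (frame_through x u)].
Proof.
move=> uf; have [W0 [s0 [oW Wx Wd ls sx]]] := local_frame_exists uf.
have H : exists s : M -> 'M[C]_(m, n), [set s | s x = u /\ exists W, [/\ open W, W x & local_frame W s]] s.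
  by exists s0; split=> //; exists W0.
rewrite /frame_through; case: (cid H) => s1 s1P.
have [E [W [oW' W'x lW]]] : [set s | s x = u /\ exists W, [/\ open W, W x & local_frame W s]]
    (xget (fun=> 0) [set s | s x = u /\ exists W, [/\ open W, W x & local_frame W s]]).
  by case: xgetP => [s -> //|/(_ s1)].
split=> //; exists (W `&` cdom x); split=> //.
- by apply: openI => //; exact: man_dom_open.
- by split=> //; exact: man_center.
- by apply: local_frame_sub lW => z [].
Qed.

End LocalFrames.

(** * Covariant derivatives in a local frame *)

Section MatrixMisc.
Context {R : realType}.
Local Notation C := R[i].

Lemma adjmx_skewT a (X : 'M[C]_a) : X = - X ^t* -> X^T ^t* = - X^T.
Proof.
move=> E; apply/matrixP => i j; have := congr1 (fun Y : 'M[C]_a => Y j i) E.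
by rewrite !mxE => ->; rewrite opprK.
Qed.

Lemma mpderiv_adj n a b (U : set 'rV[R]_n) (F : _ -> 'M[C]_(a, b)) j y : msmooth_on U F -> U y ->
  mpderiv j (fun z => (F z) ^t*) y = (mpderiv j F y) ^t*.
Proof.
move=> sF Uy; rewrite adjmxE -mpderivT -(mpderivJ j (msmooth_tr sF) Uy).
by congr (mpderiv _ _ _); apply: funext => z; rewrite adjmxE.
Qed.

Lemma sum_change_basis n a b (A B : 'I_n -> 'M[C]_(a, b)) (D : 'M[C]_n) (w : 'rV[C]_n) :
  (forall k, A k = \sum_l D k l *: B l) ->
  \sum_k w 0 k *: A k = \sum_l (w *m D) 0 l *: B l.
Proof.
move=> E; under eq_bigr do rewrite E scaler_sumr.
rewrite exchange_big; apply: eq_bigr => l _; rewrite mxE scaler_suml; apply: eq_bigr => k _.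
by rewrite scalerA.
Qed.

End MatrixMisc.

Section Connection.
Context {R : realType} {m : nat} (M : kahler R m).
Implicit Types (p q x : M) (W : set M) (s : M -> 'M[R[i]]_(m, m.*2)).
Local Notation C := R[i].
Local Notation n := (m.*2).

Lemma frame_smooth p W s : open W -> W `<=` cdom p -> local_frame W s ->
  msmooth_on (cimage p W) (fun y => vcomp p s (cinv p y)).
Proof.
move=> oW Wp ls; apply: msmooth_sub (local_frame_smooth p ls).
by apply: cimage_sub => z Wz; split=> //; exact: Wp.
Qed.

Definition frame_form p s x k : 'M[C]_m := (vnabla p s x k *m cgram p x *m (vcomp p s x) ^t*)^T.

Lemma frame_formE p s x k : frame_form p s x k = (vnabla p s x k *m cgram p x *m (vcomp p s x) ^t*)^T.
Proof. by []. Qed.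

Lemma vnablaE a p (s : M -> 'M[C]_(a, n)) x k :
  vnabla p s x k = mpderiv k (fun y => vcomp p s (cinv p y)) (cmap p x) + vcomp p s x *m cchris p x k.
Proof. by []. Qed.

Lemma vcompE a p (s : M -> 'M[C]_(a, n)) x : vcomp p s x = s x *m toC (jac x p x).
Proof. by []. Qed.

Lemma connection_formE s x (v : 'rV[C]_n) :
  connection_form s x v = \sum_k v 0 k *: frame_form x s x k.
Proof.
rewrite /connection_form dirdermxE.
have E y : y = cmap x x -> cinv x y = x by move=> ->; rewrite man_cmapK //; exact: man_center.
have -> : \sum_k v 0 k *: mpderiv k ((fun y => s y *m toC (jac y x y)) \o cinv x) (cmap x x) +
    s x *m \sum_k v 0 k *: toC (christoffel x x k) = \sum_k v 0 k *: vnabla x s x k.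
  rewrite mulmx_sumr -big_split /=; apply: eq_bigr => k _.
  by rewrite -scalemxAr -scalerDr /vnabla vcomp_center.
rewrite !mulmx_suml linear_sum /=; apply: eq_bigr => k _.
by rewrite -!scalemxAl linearZ /= /frame_form vcomp_center /cgram gram_center.
Qed.

Local Opaque frame_form vnabla vcomp cgram cchris gram christoffel jac.

Lemma frame_form_change p q s x W (w : 'rV[C]_n) : open W -> W x -> W `<=` cdom p -> W `<=` cdom q ->
  local_frame W s ->
  \sum_k w 0 k *: frame_form p s x k = \sum_l (w *m toC (jac p q x)) 0 l *: frame_form q s x l.
Proof.
move=> oW Wx Wp Wq ls; have px := Wp _ Wx; have qx := Wq _ Wx.
have E k : frame_form p s x k = \sum_l toC (jac p q x) k l *: frame_form q s x l.
  have gen (N S : 'M[C]_(m, n)) (D G : 'M[R]_n) : N *m toC (D *m G *m D^T) *m S ^t* =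
      (N *m toC D) *m toC G *m (S *m toC D) ^t*.
    by rewrite adjmxM adjmx_toC !toC_mul !mulmxA.
  rewrite !frame_formE -[cgram p x]/(toC (gram p x)) (gram_change px qx) gen.
  rewrite (vnabla_change _ oW Wx Wp Wq (frame_smooth oW Wp ls)) -vcomp_change //.
  rewrite !mulmx_suml linear_sum; apply: eq_bigr => l _.
  by rewrite frame_formE -!scalemxAl -[RHS]linearZ.
exact: sum_change_basis.
Qed.

(** Here the Kaehler condition enters: as J is parallel, the covariant derivative of a (1,0) frame
    is again of type (1,0), and the connection form takes values in gl(m, C). *)
Lemma vnabla_holomorphic p s x k W : open W -> W x -> W `<=` cdom p -> local_frame W s ->
  vnabla p s x k *m toC (cpx_in_chart p x) = 'i *: vnabla p s x k.
Proof.
move=> oW Wx Wp ls; have px := Wp _ Wx.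
have sS := frame_smooth oW Wp ls; have oU := cimage_open (p := p) oW.
have Ux : cimage p W (cmap p x) by exact: cimage_mem.
pose Jy y := toC (cpx_in_chart p (cinv p y)).
have sJ : msmooth_on (cimage p W) Jy by apply: msmooth_toC => i j l; apply: Ck_on_sub (cpx_smooth p i j l) => y [].
have SJ y : cimage p W y -> vcomp p s (cinv p y) *m Jy y = 'i *: vcomp p s (cinv p y).
  by move=> Uy; have Wy := cimageP Uy; have [] := frame_in_chart (Wp _ Wy) (proj1 ls _ Wy).
have dJE : mpderiv k Jy (cmap p x) =
    cchris p x k *m Jy (cmap p x) - Jy (cmap p x) *m cchris p x k.
  rewrite /Jy (mpderiv_toC (fun y => cpx_in_chart p (cinv p y))) man_cmapK //.
  have := cpx_parallel k px; set dJ := \matrix_(i, j) _; rewrite -addrA => /eqP; rewrite addr_eq0 => /eqP ->.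
  by rewrite opprB -[cchris p x k]/(toC (christoffel p x k)) -!toC_mul -toC_opp -toC_add.
have E : 'i *: mpderiv k (fun y => vcomp p s (cinv p y)) (cmap p x) =
    mpderiv k (fun y => vcomp p s (cinv p y)) (cmap p x) *m Jy (cmap p x) +
    vcomp p s x *m mpderiv k Jy (cmap p x).
  have := mpderivM k sS sJ Ux; rewrite (mpderiv_ext k oU SJ Ux) (mpderivZ k (csmooth_cst _ 'i) sS Ux) man_cmapK //.
  have -> : cpderiv k (fun=> 'i : C) (cmap p x) = 0.
    by apply: is_cderive_pderiv; exact: is_cderive_cst.
  by rewrite scale0r add0r.
have SJx := SJ _ Ux; rewrite man_cmapK // in SJx.
have -> : toC (cpx_in_chart p x) = Jy (cmap p x) by rewrite /Jy man_cmapK.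
rewrite vnablaE; move: E SJx; rewrite dJE.
move: (mpderiv k _ _) (vcomp p s x) (cchris p x k) (Jy (cmap p x)) => dS S Ch J E SJx.
by rewrite mulmxDl scalerDr E mulmxBr !mulmxA SJx -scalemxAl addrA subrK.
Qed.

Lemma frame_formK p s x k W : open W -> W x -> W `<=` cdom p -> local_frame W s ->
  (frame_form p s x k)^T *m vcomp p s x = vnabla p s x k.
Proof.
move=> oW Wx Wp ls; have px := Wp _ Wx; rewrite frame_formE trmxK; apply/esym.
apply: (frame_expand (cpx_met_orth px) (gram_unit px)); first exact: frame_in_chart (proj1 ls _ Wx).
exact: (vnabla_holomorphic k oW Wx Wp ls).
Qed.

(** The relation expressing that the frame is unitary is differentiated, using metric
    compatibility. *)
Lemma frame_form_skew p s x k W : open W -> W x -> W `<=` cdom p -> local_frame W s ->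
  (frame_form p s x k) ^t* = - frame_form p s x k.
Proof.
move=> oW Wx Wp ls; have px := Wp _ Wx.
have sS := frame_smooth oW Wp ls; have oU := cimage_open (p := p) oW.
have Ux : cimage p W (cmap p x) by exact: cimage_mem.
pose Gy y := cgram p (cinv p y).
have sG : msmooth_on (cimage p W) Gy by apply: msmooth_sub (gram_smooth p); exact: cimage_sub.
pose S y := vcomp p s (cinv p y).
have sA : msmooth_on (cimage p W) (fun y => (S y) ^t*) by exact: msmooth_adj.
have SG y : cimage p W y -> S y *m Gy y *m (S y) ^t* = 1%:M.
  by move=> Uy; have Wy := cimageP Uy; have [] := frame_in_chart (Wp _ Wy) (proj1 ls _ Wy).
have := mpderivM k (msmooth_mul oU sS sG) sA Ux; rewrite (mpderiv_ext k oU SG Ux) mpderiv_cst.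
rewrite (mpderivM k sS sG Ux) /S /Gy (cchris_metric k px) man_cmapK //.
rewrite (mpderiv_adj k sS Ux).
rewrite frame_formE vnablaE; have Gs : (cgram p x) ^t* = cgram p x by rewrite adjmx_toC gram_sym.
have Cs : (cchris p x k) ^t* = (cchris p x k)^T by rewrite adjmx_toC toC_tr.
move: (mpderiv k _ _) (vcomp p s x) (cchris p x k) (cgram p x) Gs Cs => dS S0 Ch G Gs Cs E.
have Et : (dS + S0 *m Ch) *m G *m S0 ^t* + ((dS + S0 *m Ch) *m G *m S0 ^t*) ^t* = 0.
  rewrite [RHS]E !(adjmxM, adjmxD) adjmxK Gs Cs !(mulmxDl, mulmxDr, mulmxA) -!addrA.
  by rewrite [X in _ = _ + (_ + X)]addrC.
move/eqP: Et; rewrite addr_eq0 => /eqP Et.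
exact: adjmx_skewT.
Qed.

(** By [frame_inv_gram] the inverse metric is a polynomial in a smooth frame and its conjugate. *)
Lemma inv_gram_smooth p s W : open W -> W `<=` cdom p -> local_frame W s ->
  msmooth_on (cimage p W) (fun y => invmx (cgram p (cinv p y))).
Proof.
move=> oW Wp ls; have sS := frame_smooth oW Wp ls; have oU := cimage_open (p := p) oW.
apply: msmooth_ext (msmooth_add oU (msmooth_mul oU (msmooth_adj oU sS) sS)
  (msmooth_mul oU (msmooth_tr sS) (msmooth_conj oU sS))) => // y Uy.
have Wy := cimageP Uy; have px := Wp _ Wy.
exact: (frame_inv_gram (cpx_met_orth px) (gram_unit px) (frame_in_chart px (proj1 ls _ Wy))).
Qed.

Lemma cchris_smooth p s k W : open W -> W `<=` cdom p -> local_frame W s ->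
  msmooth_on (cimage p W) (fun y => cchris p (cinv p y) k).
Proof.
move=> oW Wp ls; have oU := cimage_open (p := p) oW; have sI := inv_gram_smooth oW Wp ls.
have sG : msmooth_on (cimage p W) (fun y => cgram p (cinv p y)).
  by apply: msmooth_sub (gram_smooth p); exact: cimage_sub.
have sd i : msmooth_on (cimage p W) (mpderiv i (fun y => cgram p (cinv p y))) by exact: msmooth_pderiv.
pose dG i := mpderiv i (fun y => cgram p (cinv p y)).
move=> i j; apply: (csmooth_ext (f := fun y => 2^-1 * \sum_l invmx (cgram p (cinv p y)) l j *
   (dG k y i l + dG i y k l + (- 1) * dG l y k i))) => //; last first.
  apply: csmooth_mul => //; first exact: csmooth_cst.
  apply: csmooth_sum => // l; apply: csmooth_mul => //; apply: csmooth_add => //.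
    by apply: csmooth_add => //; exact: sd.
  by apply: csmooth_mul => //; [exact: csmooth_cst|exact: sd].
move=> y Uy; have [py yE] := cimage_dom Uy.
have E a b c : dG a y b c = Complex (dgram p (cinv p y) a b c) 0 by rewrite -dgramE yE.
have rE (a : R) : Complex a 0 = real_complex R a by [].
rewrite -[cchris _ _ _]/(toC (christoffel p (cinv p y) k)) -[cgram _ _]/(toC (gram p (cinv p y))) -toC_inv.
rewrite [RHS]mxE [X in Complex X]mxE rE rmorphM fmorphV rmorph_nat rmorph_sum; congr (_ * _).
apply: eq_bigr => l _; rewrite !E rmorphM rmorphB rmorphD [toC _ _ _]mxE mulN1r; congr (_ * _).
Qed.

Lemma frame_form_smooth p s k W : open W -> W `<=` cdom p -> local_frame W s ->
  msmooth_on (cimage p W) (fun y => frame_form p s (cinv p y) k).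
Proof.
move=> oW Wp ls; have sS := frame_smooth oW Wp ls; have oU := cimage_open (p := p) oW.
have sG : msmooth_on (cimage p W) (fun y => cgram p (cinv p y)).
  by apply: msmooth_sub (gram_smooth p); exact: cimage_sub.
have sN : msmooth_on (cimage p W) (fun y => vnabla p s (cinv p y) k).
  apply: msmooth_ext (msmooth_add oU (msmooth_pderiv k sS) (msmooth_mul oU sS (cchris_smooth k oW Wp ls))) => // y Uy.
  by have [_ E] := cimage_dom Uy; rewrite vnablaE E.
apply: msmooth_ext (msmooth_tr (msmooth_mul oU (msmooth_mul oU sN sG) (msmooth_adj oU sS))) => // y _.
Qed.

End Connection.

Section CovariantDerivative.
Context {R : realType} {m : nat} (M : kahler R m) {rho : 'I_m -> int} (V : unirrep (R := R) rho).
Implicit Types (p q x : M) (W : set M) (s : M -> 'M[R[i]]_(m, m.*2)).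
Local Notation C := R[i].
Local Notation n := (m.*2).
Local Notation d := (rdim V).
Implicit Types (phi : sect M d 1).

Lemma is_mxderive_line (T : normedModType R) a b (F : T -> 'M[C]_(a, b)) (x v : T) L :
  is_mxderive x v F L <-> is_mxderive (0 : R) (1 : R) (fun h : R => F (h *: v + x)) L.
Proof.
split=> H i j; have [H1 H2] := H i j; split.
- exact: (is_derive_line (fun z => complex.Re (F z i j)) x v _).1.
- exact: (is_derive_line (fun z => complex.Im (F z i j)) x v _).1.
- exact: (is_derive_line (fun z => complex.Re (F z i j)) x v _).2.
- exact: (is_derive_line (fun z => complex.Im (F z i j)) x v _).2.
Qed.

Lemma near_line k (U : set 'rV[R]_k) (y v : 'rV[R]_k) : open U -> U y ->
  \forall h \near (0 : R), U (h *: v + y).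
Proof.
move=> oU Uy; have c : {for 0, continuous (fun h : R => h *: v + y)}.
  by apply: continuousD; [apply: scalel_continuous|exact: cst_continuous].
by apply: c; rewrite scale0r add0r; exact: open_nbhs_nbhs.
Qed.

(** [rdiffP] concerns curves of unitary matrices through 1, so b is restricted to a coordinate line
    and multiplied by the inverse of b y. *)
Lemma rmap_derive k (U : set 'rV[R]_k) (b : 'rV[R]_k -> 'M[C]_m) y j : open U -> U y ->
  msmooth_on U b -> (forall z, U z -> b z \is unitarymx) ->
  is_mxderive y (delta_mx 0 j : 'rV[R]_k) (fun z => rmap V (b z))
    (rdiff V (mpderiv j b y *m (b y) ^t*) *m rmap V (b y)).
Proof.
move=> oU Uy sb ub; set v : 'rV[R]_k := delta_mx 0 j.
have uby := ub y Uy; have ubt : (b y) ^t* \is unitarymx by rewrite trmxC_unitary.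
have bK : (b y) ^t* *m b y = 1%:M by apply: mulmx1C; apply/unitarymxP.
(* [rdiffP] asks for unitary values at all times; the value 1 is used where the line has left U,
   which does not affect the derivative at 0. *)
pose c (h : R) := if `[< U (h *: v + y) >] then b (h *: v + y) *m (b y) ^t* else 1%:M.
have uc t : c t \is unitarymx.
  rewrite /c; case: asboolP => [Ut|_]; last exact: unitarymx1.
  exact: mul_unitarymx (ub _ Ut) ubt.
have c0 : c 0 = 1%:M.
  by rewrite /c scale0r add0r; case: asboolP => // _; apply/unitarymxP.
have dc : mx_derive0 c (mpderiv j b y *m (b y) ^t*).
  have H := (is_mxderive_line _ _ _ _).1 (is_mxderive_mulr ((b y) ^t*) (msmooth_is_derive j sb Uy)).
  apply: is_mxderive_ext H; apply: filterS (near_line v oU Uy) => h Uh.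
  by rewrite /c; case: asboolP.
have dR := rdiffP (u := V) uc c0 dc.
apply/is_mxderive_line; apply: is_mxderive_ext (is_mxderive_mulr (rmap V (b y)) dR).
apply: filterS (near_line v oU Uy) => h Uh /=.
rewrite -(rmapM V (uc h) uby); congr (rmap V _); rewrite /c; case: asboolP => // _.
by rewrite -mulmxA bK mulmx1.
Qed.

Definition loc s phi p : 'rV[R]_n -> 'cV[C]_d := fun y => phi (cinv p y) (s (cinv p y)).

Definition cov p s phi x k : 'cV[C]_d :=
  mpderiv k (loc s phi p) (cmap p x) + rdiff V (frame_form p s x k) *m phi x (s x).

Lemma covE p s phi x k :
  cov p s phi x k = mpderiv k (loc s phi p) (cmap p x) + rdiff V (frame_form p s x k) *m phi x (s x).
Proof. by []. Qed.

Lemma locE s phi p y : loc s phi p y = phi (cinv p y) (s (cinv p y)).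
Proof. by []. Qed.

Lemma vcompK a p (s : M -> 'M[C]_(a, n)) x : cdom p x -> vcomp p s x *m toC (jac p x x) = s x.
Proof. by move=> px; rewrite /vcomp -mulmxA -toC_mul (jac_inv _ px) ?toC1 ?mulmx1 //; exact: man_center. Qed.

(** The local form of [Gamma_S]: derivatives along vector fields that are smooth only near a point
    are sections only there. *)
Definition Gamma_on W phi : Prop :=
  (forall x u a, W x -> unitary_frame x u -> a \is unitarymx -> rmap V a *m phi x (a^T *m u) = phi x u) /\
  (forall W' s p, W' `<=` W -> open W' -> local_frame W' s -> W' `<=` cdom p ->
     msmooth_on (cimage p W') (loc s phi p)).

Lemma Gamma_on_sub W W' phi : W' `<=` W -> Gamma_on W phi -> Gamma_on W' phi.
Proof.
move=> sW [H1 H2]; split=> [x u a /sW|W1 s p sW1]; first exact: H1.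
by apply: H2 => z /sW1 /sW.
Qed.

Lemma Gamma_S_on W phi : Gamma_S M V phi -> Gamma_on W phi.
Proof.
move=> [H1 H]; split=> [x u a _|W1 s p _ oW ls Wp i j]; first exact: H1.
have /csmooth_funP/(_ p) := H W1 s oW ls p i j.
by apply: csmooth_sub; apply: cimage_sub => z Wz; split=> //; exact: Wp.
Qed.

Lemma loc_smooth p W s phi : Gamma_on W phi -> open W -> W `<=` cdom p -> local_frame W s ->
  msmooth_on (cimage p W) (loc s phi p).
Proof. by move=> [_ H] oW Wp ls; exact: H. Qed.

Local Opaque frame_form vnabla vcomp cgram cchris gram christoffel jac cov loc.

(** Multiplying a frame by a on the left is the right action of a^T, whose inverse is the conjugate
    of a. *)
Lemma section_gauge W phi x u a : Gamma_on W phi -> W x -> unitary_frame x u -> a \is unitarymx ->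
  phi x (a *m u) = rmap V (cjmx a) *m phi x u.
Proof.
move=> [H _] Wx uf ua; have ut : a^T \is unitarymx by rewrite trmx_unitary.
have := H x u a^T Wx uf ut; rewrite trmxK /= => <-.
by rewrite mulmxA -[cjmx a]adjmx_tr (rmap_adj V ut) rmap_adjK // mul1mx.
Qed.

Lemma cov_change p q s phi x W (w : 'rV[C]_n) : Gamma_on W phi -> open W -> W x ->
  W `<=` cdom p -> W `<=` cdom q -> local_frame W s ->
  \sum_k w 0 k *: cov p s phi x k = \sum_l (w *m toC (jac p q x)) 0 l *: cov q s phi x l.
Proof.
move=> Gp oW Wx Wp Wq ls; have px := Wp _ Wx; have qx := Wq _ Wx.
have E1 : forall w : 'rV[C]_n, \sum_k w 0 k *: mpderiv k (loc s phi p) (cmap p x) =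
   \sum_l (w *m toC (jac p q x)) 0 l *: mpderiv l (loc s phi q) (cmap q x).
  move=> w'; apply: sum_change_basis => k.
  exact: (mpderiv_change (F := fun z => phi z (s z)) k oW Wx px qx (loc_smooth Gp oW Wq ls)).
have split_cov r (w' : 'rV[C]_n) : \sum_k w' 0 k *: cov r s phi x k =
    \sum_k w' 0 k *: mpderiv k (loc s phi r) (cmap r x) +
    rdiff V (\sum_k w' 0 k *: frame_form r s x k) *m phi x (s x).
  rewrite linear_sum /= mulmx_suml -big_split /=; apply: eq_bigr => k _.
  by rewrite covE linearZ /= -scalemxAl -scalerDr.
apply: (etrans (split_cov p w)); apply: (etrans _ (esym (split_cov q (w *m toC (jac p q x))))).
exact: (f_equal2 (fun a b => a + rdiff V b *m phi x (s x)) (E1 w) (frame_form_change w oW Wx Wp Wq ls)).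
Qed.

(** The derivative of the gauge factor is cancelled by the inhomogeneous term in the change of the
    connection form: the two are opposite, as one sees by differentiating b b^* = 1. *)
Lemma cov_gauge p s s' phi x k W : Gamma_on W phi -> open W -> W x -> W `<=` cdom p ->
  local_frame W s -> local_frame W s' ->
  exists a, [/\ a \is unitarymx, s' x = a *m s x & cov p s' phi x k = rmap V (cjmx a) *m cov p s phi x k].
Proof.
move=> Gp oW Wx Wp ls ls'; have px := Wp _ Wx.
have sS := frame_smooth oW Wp ls; have sS' := frame_smooth oW Wp ls'; have oU := cimage_open (p := p) oW.
have sG : msmooth_on (cimage p W) (fun y => cgram p (cinv p y)).
  by apply: msmooth_sub (gram_smooth p); exact: cimage_sub.
have Ux : cimage p W (cmap p x) by exact: cimage_mem.
pose a y : 'M[C]_m := vcomp p s' (cinv p y) *m cgram p (cinv p y) *m (vcomp p s (cinv p y)) ^t*.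
have sa : msmooth_on (cimage p W) a by apply: msmooth_mul => //; [exact: msmooth_mul|exact: msmooth_adj].
have Ha y : cimage p W y -> a y \is unitarymx /\ s' (cinv p y) = a y *m s (cinv p y).
  move=> Uy; have Wy := cimageP Uy; have py := Wp _ Wy.
  have f := frame_in_chart py (proj1 ls _ Wy); have f' := frame_in_chart py (proj1 ls' _ Wy).
  have [b ub E] := frame_gauge (cpx_met_orth py) (gram_sym _ _) (gram_unit py) f f'.
  have SE : vcomp p s' (cinv p y) = b *m vcomp p s (cinv p y) by rewrite !vcompE.
  have aE : a y = b.
    rewrite /a SE; have := proj2 f; rewrite -vcompE -[toC (gram _ _)]/(cgram p (cinv p y)).
    by move: (vcomp p s _) (cgram _ _) => S G SG; rewrite -!mulmxA [S *m _]mulmxA SG mulmx1.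
  by split; [rewrite aE|rewrite -(vcompK s' py) SE aE -mulmxA vcompK].
have [ux E0] := Ha _ Ux; rewrite man_cmapK // in E0.
exists (a (cmap p x)); split=> //.
pose b y := cjmx (a y); have sb : msmooth_on (cimage p W) b by exact: msmooth_conj.
have ub y : cimage p W y -> b y \is unitarymx.
  by move=> /Ha[ua _]; rewrite /b -adjmx_tr trmxC_unitary trmx_unitary.
have sf := loc_smooth Gp oW Wp ls.
have locG y : cimage p W y -> loc s' phi p y = rmap V (b y) *m loc s phi p y.
  move=> Uy; have [ua E] := Ha _ Uy; have Wy := cimageP Uy.
  by rewrite !locE E (section_gauge Gp Wy (proj1 ls _ Wy) ua).
have D1 := is_mxderive_pderiv (is_mxderiveM (rmap_derive k oU Ux sb ub) (msmooth_is_derive k sf Ux)).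
have D2 : mpderiv k b (cmap p x) *m (b (cmap p x)) ^t* + b (cmap p x) *m (mpderiv k b (cmap p x)) ^t* = 0.
  rewrite -(mpderiv_adj k sb Ux) -(mpderivM k sb (msmooth_adj oU sb) Ux) -[RHS](mpderiv_cst 1%:M k (cmap p x)).
  by apply: (mpderiv_ext k oU _ Ux) => y /ub/unitarymxP.
have SE y : cimage p W y -> vcomp p s' (cinv p y) = a y *m vcomp p s (cinv p y).
  by move=> Uy; have [_ E] := Ha _ Uy; rewrite !vcompE E mulmxA.
have SEx : vcomp p s' x = a (cmap p x) *m vcomp p s x by have := SE _ Ux; rewrite man_cmapK.
have N' : vnabla p s' x k = mpderiv k a (cmap p x) *m vcomp p s x + a (cmap p x) *m vnabla p s x k.
  rewrite !vnablaE (mpderiv_ext k oU SE Ux) (mpderivM k sa sS Ux) man_cmapK //.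
  by rewrite SEx mulmxDr !mulmxA addrA.
have F' : frame_form p s' x k =
    b (cmap p x) *m (mpderiv k b (cmap p x)) ^t* + b (cmap p x) *m frame_form p s x k *m (b (cmap p x)) ^t*.
  have dbE : mpderiv k b (cmap p x) = cjmx (mpderiv k a (cmap p x)) by exact: (mpderivJ k sa Ux).
  rewrite dbE /b !frame_formE N' SEx.
  have := proj2 (frame_in_chart px (proj1 ls _ Wx)); rewrite -vcompE -[toC (gram _ _)]/(cgram p x).
  move: (vcomp p s x) (cgram p x) (vnabla p s x k) (a _) (mpderiv _ _ _) => S G N A dA SG.
  have -> : (dA *m S + A *m N) *m G *m (A *m S) ^t* = dA *m A ^t* + A *m (N *m G *m S ^t*) *m A ^t*.
    have -> : dA *m A ^t* = dA *m (S *m G *m S ^t*) *m A ^t* by rewrite SG mulmx1.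
    by rewrite adjmxM !mulmxDl !mulmxA.
  by rewrite linearD /= !trmx_mul !adjmx_cj mulmxA adjmxE cjmxT trmxK.
rewrite !covE (mpderiv_ext k oU locG Ux) D1 F' linearD /= mulmxDl E0 (section_gauge Gp Wx (proj1 ls _ Wx) ux).
rewrite locE man_cmapK // -/(b (cmap p x)) -(rmap_rdiff V _ (ub _ Ux)).
have rK := rmap_adjK V (ub _ Ux).
have Z : rdiff V (mpderiv k b (cmap p x) *m b (cmap p x) ^t*) + rdiff V (b (cmap p x) *m mpderiv k b (cmap p x) ^t*) = 0.
  by rewrite -linearD D2 linear0.
have gen (X Y Om rb : 'M[C]_d) (df f : 'cV[C]_d) : X + Y = 0 -> rb ^t* *m rb = 1%:M ->
    X *m rb *m f + rb *m df + (Y *m (rb *m f) + rb *m Om *m rb ^t* *m (rb *m f)) = rb *m (df + Om *m f).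
  move=> XY rK'; have -> : rb *m Om *m rb ^t* *m (rb *m f) = rb *m (Om *m f).
    by rewrite -mulmxA [rb ^t* *m _]mulmxA rK' mul1mx mulmxA.
  by rewrite mulmxDr -[X *m rb *m f]mulmxA addrACA -mulmxDl XY mul0mx add0r.
exact: gen Z rK.
Qed.

Lemma frame_cancel x (u : 'M[C]_(m, n)) (a b : 'M[C]_m) : unitary_frame x u -> a *m u = b *m u -> a = b.
Proof.
move=> [_ uu] /(congr1 (fun Y => Y *m toC (met x) *m u ^t*)).
by rewrite -!mulmxA [u *m _]mulmxA uu !mulmx1.
Qed.

Lemma nabla_at_through phi x u v : unitary_frame x u ->
  nabla_at phi x u v = \sum_k v 0 k *: cov x (frame_through x u) phi x k.
Proof.
move=> uf; have [su _] := frame_throughP uf.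
rewrite /nabla_at dirdermxE connection_formE linear_sum /= mulmx_suml -big_split /=.
by apply: eq_bigr => k _; rewrite linearZ /= -scalemxAl -scalerDr covE su.
Qed.

Lemma cov_same p s s' phi x k W : Gamma_on W phi -> open W -> W x -> W `<=` cdom p ->
  local_frame W s -> local_frame W s' -> s' x = s x -> cov p s' phi x k = cov p s phi x k.
Proof.
move=> Gp oW Wx Wp ls ls' E; have [a [ua sa ->]] := cov_gauge k Gp oW Wx Wp ls ls'.
have -> : a = 1%:M by apply: (frame_cancel (proj1 ls _ Wx)); rewrite -sa E mul1mx.
by rewrite cjmx1 rmap1 mul1mx.
Qed.

Definition covm p s phi x : 'M[C]_(d, n) := \matrix_(i, k) cov p s phi x k i 0.

Lemma covm_mul p s phi x (w : 'rV[C]_n) : covm p s phi x *m w^T = \sum_k w 0 k *: cov p s phi x k.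
Proof.
apply/matrixP => i j; rewrite summxE mxE; apply: eq_bigr => k _.
rewrite [covm _ _ _ _ _ _]mxE [w^T _ _]mxE [RHS]mxE (ord1 j); exact: mulrC.
Qed.

(** [nabla_at] uses the frame chosen by [frame_through] and the chart at x. By [cov_same] and
    [cov_change], any local frame with the same value at x and any chart give the same result. *)
Lemma nabla_atE p s phi x v W : Gamma_on W phi -> open W -> W x -> W `<=` cdom p -> local_frame W s ->
  nabla_at phi x (s x) v = covm p s phi x *m (v *m toC (jac x p x))^T.
Proof.
move=> Gp oW Wx Wp ls; have uf := proj1 ls _ Wx.
have [su [W0 [oW0 W0x W0d ls0]]] := frame_throughP uf.
have oW1 : open (W `&` W0) by exact: openI.
have W1x : (W `&` W0) x by [].
have Gp1 := Gamma_on_sub (@subIsetl _ W W0) Gp.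
have ls1 := local_frame_sub (@subIsetl _ W W0) ls; have ls1' := local_frame_sub (@subIsetr _ W W0) ls0.
have W1p : W `&` W0 `<=` cdom p by move=> z [/Wp].
have W1d : W `&` W0 `<=` cdom x by move=> z [_ /W0d].
rewrite nabla_at_through // covm_mul -(cov_change v Gp1 oW1 W1x W1d W1p ls1).
by apply: eq_bigr => k _; rewrite (cov_same k Gp1 oW1 W1x W1d ls1 ls1' su).
Qed.

Lemma nabla_at_linear W phi x u : Gamma_on W phi -> open W -> W x -> unitary_frame x u ->
  exists K : 'M[C]_(d, n), forall v, nabla_at phi x u v = K *m v^T.
Proof.
move=> Gp oW Wx uf; have [su [W0 [oW0 W0x W0d ls0]]] := frame_throughP uf.
have oW1 : open (W `&` W0) by exact: openI.
have Gp1 := Gamma_on_sub (@subIsetl _ W W0) Gp; have ls1 := local_frame_sub (@subIsetr _ W W0) ls0.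
have W1d : W `&` W0 `<=` cdom x by move=> z [_ /W0d].
exists (covm x (frame_through x u) phi x) => v.
by have := nabla_atE v Gp1 oW1 (conj Wx W0x) W1d ls1; rewrite su jac_id ?toC1 ?mulmx1 //; exact: W0d.
Qed.

Lemma nabla_at_rotate W0 phi x u v a : Gamma_on W0 phi -> open W0 -> W0 x -> unitary_frame x u -> a \is unitarymx ->
  nabla_at phi x (a *m u) v = rmap V (cjmx a) *m nabla_at phi x u v.
Proof.
move=> Gp oW0 W0x uf ua; have [su [W [oW Wx Wd ls]]] := frame_throughP uf.
have uf' : unitary_frame x (a *m u) by exact: frame_rotate uf ua.
have [su' [W' [oW' W'x Wd' ls']]] := frame_throughP uf'.
pose W1 := W0 `&` (W `&` W'); have oW1 : open W1 by apply: openI => //; exact: openI.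
have W1x : W1 x by [].
have Gp1 : Gamma_on W1 phi by apply: Gamma_on_sub Gp => z [].
have ls1 : local_frame W1 (frame_through x u) by apply: local_frame_sub ls => z [_ []].
have ls1' : local_frame W1 (frame_through x (a *m u)) by apply: local_frame_sub ls' => z [_ []].
have W1d : W1 `<=` cdom x by move=> z [_ [/Wd]].
rewrite !nabla_at_through // mulmx_sumr; apply: eq_bigr => k _; rewrite -scalemxAr; congr (_ *: _).
have [b [ub sb ->]] := cov_gauge k Gp1 oW1 W1x W1d ls1 ls1'.
by congr (rmap V (cjmx _) *m _); apply: (frame_cancel uf); rewrite -su' sb su.
Qed.

Section Matrices.
Variables (phi : sect M d 1) (x : M) (u : 'M[C]_(m, n)) (K : 'M[C]_(d, n)).
Hypothesis HK : forall v, nabla_at phi x u v = K *m v^T.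

Lemma nabla10_mx : nabla10 M V phi x u = K *m u^T.
Proof. by apply/matrixP => i k; rewrite mxE HK !mxE; apply: eq_bigr => j _; rewrite !mxE. Qed.

Lemma nabla01_mx : nabla01 M V phi x u = K *m u ^t*.
Proof. by apply/matrixP => i k; rewrite mxE HK !mxE; apply: eq_bigr => j _; rewrite !mxE. Qed.

Lemma nabla_mx : nabla M V phi x u = K.
Proof.
apply/matrixP => i k; rewrite mxE HK mxE (bigD1 k) //= !mxE !eqxx mulr1 big1 ?addr0 // => j jk.
by rewrite !mxE (negbTE jk) andbF mulr0.
Qed.

End Matrices.

Section Frame.
Context {p : M} {s : M -> 'M[C]_(m, n)} {phi : sect M d 1} {x : M} {W : set M}.
Hypotheses (Gp : Gamma_on W phi) (oW : open W) (Wx : W x) (Wp : W `<=` cdom p) (ls : local_frame W s).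

Let HK v : nabla_at phi x (s x) v = (covm p s phi x *m (toC (jac x p x))^T) *m v^T.
Proof. by rewrite (nabla_atE v Gp oW Wx Wp ls) trmx_mul mulmxA. Qed.

Lemma nabla10E : nabla10 M V phi x (s x) = covm p s phi x *m (vcomp p s x)^T.
Proof. by rewrite (nabla10_mx HK) vcompE trmx_mul mulmxA. Qed.

Lemma nabla01E : nabla01 M V phi x (s x) = covm p s phi x *m (vcomp p s x) ^t*.
Proof. by rewrite (nabla01_mx HK) vcompE adjmxM adjmx_toC toC_tr mulmxA. Qed.

Lemma nablaE : nabla M V phi x (s x) *m (toC (jac p x x))^T = covm p s phi x.
Proof.
have px := Wp Wx; have cx := man_center x.
by rewrite (nabla_mx HK) -mulmxA -trmx_mul -toC_mul (jac_inv px cx) toC1 trmx1 mulmx1.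
Qed.

End Frame.

Lemma covm_smooth p s phi W : Gamma_on W phi -> open W -> W `<=` cdom p -> local_frame W s ->
  msmooth_on (cimage p W) (fun y => covm p s phi (cinv p y)).
Proof.
move=> Gp oW Wp ls; have oU := cimage_open (p := p) oW; have sf := loc_smooth Gp oW Wp ls.
have sc k : msmooth_on (cimage p W) (fun y => cov p s phi (cinv p y) k).
  have sw := frame_form_smooth k oW Wp ls.
  apply: msmooth_ext (msmooth_add oU (msmooth_pderiv k sf) (msmooth_mul oU (msmooth_lin (rdiff V) oU sw) sf)) => // y Uy.
  by have [_ E] := cimage_dom Uy; rewrite covE E locE.
by move=> i k; apply: csmooth_ext oU _ (sc k i 0) => y _; rewrite [RHS]mxE.
Qed.

Lemma smooth_on_frames d' k (F : M -> 'M[C]_(d', k)) p W : open W ->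
  (forall W', W' `<=` W -> W' `<=` cdom p -> open W' -> msmooth_on (cimage p W') (fun y => F (cinv p y))) ->
  forall i j, csmooth_fun (W `&` cdom p) (fun x => F x i j).
Proof.
move=> oW H i j; have oW' : open (W `&` cdom p) by apply: openI => //; exact: man_dom_open.
have Wp : W `&` cdom p `<=` cdom p by move=> z [].
by apply: (csmooth_fun_chart oW' Wp); apply: H oW' i j => // z [].
Qed.

Lemma Gamma_nabla10 phi : Gamma_S M V phi -> Gamma (S01_bundle M V) (nabla10 M V phi).
Proof.
move=> Gp; split=> [x u a uf ua | W s oW ls p i j].
  have [K HK] := nabla_at_linear (Gamma_S_on setT Gp) openT I uf; have ut : a^T \is unitarymx by rewrite trmx_unitary.
  have HK' v : nabla_at phi x (a^T *m u) v = (rmap V (cjmx a^T) *m K) *m v^T.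
    by rewrite (nabla_at_rotate v (Gamma_S_on setT Gp) openT I uf ut) HK mulmxA.
  rewrite (nabla10_mx HK) (nabla10_mx HK') /= /act_minus trmx_mul trmxK -adjmxE (rmap_adj V ua) !mulmxA rmapK //.
  by rewrite mul1mx -mulmxA (unitarymxP ua) mulmx1.
apply: (smooth_on_frames (F := fun x => nabla10 M V phi x (s x))) => // W' sW W'p oW'.
have ls' := local_frame_sub sW ls; have oU := cimage_open (p := p) oW'.
apply: msmooth_ext (msmooth_mul oU (covm_smooth (Gamma_S_on W' Gp) oW' W'p ls') (msmooth_tr (frame_smooth oW' W'p ls'))) => // y Uy.
by rewrite (nabla10E (Gamma_S_on W' Gp) oW' (cimageP Uy) W'p ls').
Qed.

Lemma Gamma_nabla01 phi : Gamma_S M V phi -> Gamma (S10_bundle M V) (nabla01 M V phi).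
Proof.
move=> Gp; split=> [x u a uf ua | W s oW ls p i j].
  have [K HK] := nabla_at_linear (Gamma_S_on setT Gp) openT I uf; have ut : a^T \is unitarymx by rewrite trmx_unitary.
  have HK' v : nabla_at phi x (a^T *m u) v = (rmap V (cjmx a^T) *m K) *m v^T.
    by rewrite (nabla_at_rotate v (Gamma_S_on setT Gp) openT I uf ut) HK mulmxA.
  rewrite (nabla01_mx HK) (nabla01_mx HK') /= /act_plus adjmxM adjmx_tr -adjmxE (rmap_adj V ua) !mulmxA rmapK //.
  have aa : cjmx a *m a^T = 1%:M by rewrite -cjmx1 -(unitarymxP ua) cjmxM adjmxE cjmxK.
  by rewrite mul1mx -mulmxA aa mulmx1.
apply: (smooth_on_frames (F := fun x => nabla01 M V phi x (s x))) => // W' sW W'p oW'.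
have ls' := local_frame_sub sW ls; have oU := cimage_open (p := p) oW'.
apply: msmooth_ext (msmooth_mul oU (covm_smooth (Gamma_S_on W' Gp) oW' W'p ls') (msmooth_adj oU (frame_smooth oW' W'p ls'))) => // y Uy.
by rewrite (nabla01E (Gamma_S_on W' Gp) oW' (cimageP Uy) W'p ls').
Qed.

Lemma Gamma_nabla phi : Gamma_S M V phi -> Gamma (SForm_bundle M V) (nabla M V phi).
Proof.
move=> Gp; split=> [x u a uf ua | W s oW ls p i j].
  have [K HK] := nabla_at_linear (Gamma_S_on setT Gp) openT I uf; have ut : a^T \is unitarymx by rewrite trmx_unitary.
  have HK' v : nabla_at phi x (a^T *m u) v = (rmap V (cjmx a^T) *m K) *m v^T.
    by rewrite (nabla_at_rotate v (Gamma_S_on setT Gp) openT I uf ut) HK mulmxA.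
  by rewrite (nabla_mx HK) (nabla_mx HK') /= -adjmxE (rmap_adj V ua) mulmxA rmapK // mul1mx.
apply: (smooth_on_frames (F := fun x => nabla M V phi x (s x) *m (toC (jac p x x))^T)) => // W' sW W'p oW'.
have ls' := local_frame_sub sW ls; have oU := cimage_open (p := p) oW'.
apply: msmooth_ext (covm_smooth (Gamma_S_on W' Gp) oW' W'p ls') => // y Uy.
by rewrite (nablaE (Gamma_S_on W' Gp) oW' (cimageP Uy) W'p ls').
Qed.

Lemma msmooth_linear_map U a b a' b' (h : 'M[C]_(a, b) -> 'M[C]_(a', b')) (F : 'rV[R]_n -> 'M[C]_(a, b)) :
  (forall c A B, h (c *: A + B) = c *: h A + h B) -> open U -> msmooth_on U F -> msmooth_on U (fun y => h (F y)).
Proof.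
move=> hl oU sF; pose hL := GRing.isLinear.Build C _ _ _ h hl.
pose h' : {linear 'M[C]_(a, b) -> 'M[C]_(a', b')} := HB.pack h hL.
exact: (msmooth_lin h' oU sF).
Qed.

Lemma Vminus_piece i : Vminus V i = piece V false i.
Proof.
rewrite /Vminus /piece; congr (summand _ _ _).
by apply: funext => X; apply: funext => A; rewrite /dact_minus /dactR /= mulmxN.
Qed.

Lemma Gamma_Dplus i phi : dominant rho -> Gamma_S M V phi -> Gamma_Splus M V i (Dplus M V i phi).
Proof.
move=> dom Gp; have [G1 G2] := Gamma_nabla01 Gp; split; last by move=> x u _; exact: (@proj_in _ _ _ V true dom i).
split=> [x u a uf ua | W s oW ls p k l].
  rewrite /Dplus -[nabla01 M V phi x u](G1 x u a uf ua); apply/esym.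
  exact: (@proj_act _ _ _ V true dom i a _ ua).
apply: (smooth_on_frames (F := fun x => Dplus M V i phi x (s x))) => // W' sW W'p oW'.
have oU := cimage_open (p := p) oW'; apply: msmooth_linear_map => //; first exact: (@proj_linear _ _ _ V true dom i).
move=> a b; have /csmooth_funP/(_ p) := G2 W s oW ls p a b.
by apply: csmooth_sub; apply: cimage_sub => z W'z; split; [exact: sW|exact: W'p].
Qed.

Lemma Gamma_Dminus i phi : dominant rho -> Gamma_S M V phi -> Gamma_Sminus M V i (Dminus M V i phi).
Proof.
move=> dom Gp; have [G1 G2] := Gamma_nabla10 Gp.
have DE : Dminus M V i phi = fun x u => orth_proj (piece V false i) (nabla10 M V phi x u).
  by rewrite /Dminus Vminus_piece.
rewrite DE; split; last by move=> x u _; rewrite Vminus_piece; exact: (@proj_in _ _ _ V false dom i).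
split=> [x u a uf ua | W s oW ls p k l].
  rewrite -[nabla10 M V phi x u](G1 x u a uf ua); apply/esym.
  exact: (@proj_act _ _ _ V false dom i a _ ua).
apply: (smooth_on_frames (F := fun x => orth_proj (piece V false i) (nabla10 M V phi x (s x)))) => // W' sW W'p oW'.
have oU := cimage_open (p := p) oW'; apply: msmooth_linear_map => //; first exact: (@proj_linear _ _ _ V false dom i).
move=> a b; have /csmooth_funP/(_ p) := G2 W s oW ls p a b.
by apply: csmooth_sub; apply: cimage_sub => z W'z; split; [exact: sW|exact: W'p].
Qed.

End CovariantDerivative.

(** * Curvature *)

Section Curvature.
Context {R : realType} {m : nat} (M : kahler R m) {rho : 'I_m -> int} (V : unirrep (R := R) rho).
Implicit Types (p q x : M) (W : set M) (s : M -> 'M[R[i]]_(m, m.*2)).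
Local Notation C := R[i].
Local Notation n := (m.*2).
Local Notation d := (rdim V).
Implicit Types (phi : sect M d 1) (X Y : M -> 'rV[C]_n).

Lemma trmxDE a b (A B : 'M[C]_(a, b)) : (A + B)^T = A^T + B^T.
Proof. by apply/matrixP => i j; rewrite !mxE. Qed.

Lemma trmxNE a b (A : 'M[C]_(a, b)) : (- A)^T = - A^T.
Proof. by apply/matrixP => i j; rewrite !mxE. Qed.

Lemma bracketE X Y x : bracket X Y x =
  \sum_k X x 0 k *: mpderiv k (fun y => vcomp x Y (cinv x y)) (cmap x x) -
  \sum_k Y x 0 k *: mpderiv k (fun y => vcomp x X (cinv x y)) (cmap x x).
Proof. by rewrite /bracket !dirdermxE. Qed.

Definition field_smooth W Y : Prop := forall p W', W' `<=` W -> open W' -> W' `<=` cdom p ->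
  msmooth_on (cimage p W') (fun y => vcomp p Y (cinv p y)).

Local Opaque frame_form vnabla vcomp cgram cchris gram christoffel jac cov loc.

Lemma torsion_free p x (v w : 'rV[C]_n) :
  \sum_k v 0 k *: (w *m cchris p x k) = \sum_k w 0 k *: (v *m cchris p x k).
Proof.
apply/matrixP => i j; rewrite !summxE.
under eq_bigr do rewrite mxE mxE mulr_sumr.
under [RHS]eq_bigr do rewrite mxE mxE mulr_sumr.
rewrite exchange_big; apply: eq_bigr => l _; apply: eq_bigr => k _.
by rewrite (ord1 i) cchris_sym mulrCA.
Qed.

Lemma bracket_vnabla X Y x : bracket X Y x =
  \sum_k X x 0 k *: vnabla x Y x k - \sum_k Y x 0 k *: vnabla x X x k.
Proof.
rewrite bracketE; apply/esym.
under eq_bigr do rewrite vnablaE vcomp_center scalerDr.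
under [X in _ - X]eq_bigr do rewrite vnablaE vcomp_center scalerDr.
by rewrite !big_split /= (torsion_free x x (X x) (Y x)) opprD addrACA subrr addr0.
Qed.

Lemma bracket_chart p X Y x W : open W -> W x -> W `<=` cdom p -> field_smooth W X -> field_smooth W Y ->
  bracket X Y x *m toC (jac x p x) =
  \sum_k vcomp p X x 0 k *: mpderiv k (fun y => vcomp p Y (cinv p y)) (cmap p x) -
  \sum_k vcomp p Y x 0 k *: mpderiv k (fun y => vcomp p X (cinv p y)) (cmap p x).
Proof.
move=> oW Wx Wp sX sY; pose W1 := W `&` cdom x; have cx := man_center x.
have oW1 : open W1 by apply: openI => //; exact: man_dom_open.
have W1x : W1 x by []. have W1W : W1 `<=` W by move=> z [].
have W1p : W1 `<=` cdom p by move=> z [/Wp]. have W1d : W1 `<=` cdom x by move=> z [].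
have ch (Z Z' : M -> 'rV[C]_n) : field_smooth W Z' ->
    (\sum_k Z x 0 k *: vnabla x Z' x k) *m toC (jac x p x) = \sum_k vcomp p Z x 0 k *: vnabla p Z' x k.
  move=> sZ'; rewrite mulmx_suml.
  under eq_bigr do rewrite -scalemxAl (vnabla_change _ oW1 W1x W1d W1p (sZ' x W1 W1W oW1 W1d)) .
  transitivity (\sum_k Z x 0 k *: (\sum_l toC (jac x p x) k l *: vnabla p Z' x l)); first by [].
  by rewrite (sum_change_basis (A := fun k => \sum_l toC (jac x p x) k l *: vnabla p Z' x l) (Z x) (fun k => erefl)).
rewrite bracket_vnabla mulmxBl (ch X Y sY) (ch Y X sX).
under eq_bigr do rewrite vnablaE scalerDr.
under [X in _ - X]eq_bigr do rewrite vnablaE scalerDr.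
by rewrite !big_split /= (torsion_free p x (vcomp p X x) (vcomp p Y x)) opprD addrACA subrr addr0.
Qed.

Lemma Gamma_nabla_field W Y phi : open W -> Gamma_on W phi -> field_smooth W Y ->
  Gamma_on W (nabla_field Y phi).
Proof.
move=> oW Gp sY; split=> [x u a Wx uf ua | W' s p sW oW' ls Wp].
  have ut : a^T \is unitarymx by rewrite trmx_unitary.
  rewrite /nabla_field (nabla_at_rotate _ Gp oW Wx uf ut) -adjmxE (rmap_adj V ua) mulmxA rmapK //.
  by rewrite mul1mx.
have Gp' := Gamma_on_sub sW Gp; have oU := cimage_open (p := p) oW'.
apply: msmooth_ext (msmooth_mul oU (covm_smooth Gp' oW' Wp ls) (msmooth_tr (sY p W' sW oW' Wp))) => // y Uy.
by rewrite locE /nabla_field (nabla_atE _ Gp' oW' (cimageP Uy) Wp ls) vcompE.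
Qed.

(** The components of the curvature form d omega + omega ^ omega of the frame. *)
Definition curv_form p s x i j : 'M[C]_m :=
  mpderiv i (fun y => frame_form p s (cinv p y) j) (cmap p x) -
  mpderiv j (fun y => frame_form p s (cinv p y) i) (cmap p x) +
  (frame_form p s x i *m frame_form p s x j - frame_form p s x j *m frame_form p s x i).

Lemma covmE p s phi x i k : covm p s phi x i k = cov p s phi x k i 0.
Proof. by rewrite mxE. Qed.

Section InFrame.
Context {p : M} {s : M -> 'M[C]_(m, n)} {phi : sect M d 1} {W : set M}.
Hypotheses (oW : open W) (Gp : Gamma_on W phi) (Wp : W `<=` cdom p) (ls : local_frame W s).

Let oU := cimage_open (p := p) oW.
Let sf := loc_smooth Gp oW Wp ls.
Let sw k := frame_form_smooth k oW Wp ls.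

Lemma cov_smooth k : msmooth_on (cimage p W) (fun y => cov p s phi (cinv p y) k).
Proof.
apply: msmooth_ext (msmooth_add oU (msmooth_pderiv k sf)
  (msmooth_mul oU (msmooth_lin (rdiff V) oU (sw k)) sf)) => // y Uy.
by have [_ E] := cimage_dom Uy; rewrite covE E locE.
Qed.

(** The second covariant derivative without the Christoffel term of the index l. It is eventually
    used after antisymmetrisation in k and l, where the symmetric symbols cancel. *)
Definition cov2 x k l : 'cV[C]_d :=
  mpderiv k (fun y => cov p s phi (cinv p y) l) (cmap p x) + rdiff V (frame_form p s x k) *m cov p s phi x l.

Lemma ricci_identity x k l : W x -> cov2 x k l - cov2 x l k = rdiff V (curv_form p s x k l) *m phi x (s x).
Proof.
move=> Wx; have px := Wp Wx; have Ux : cimage p W (cmap p x) by exact: cimage_mem.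
have [om omE] : exists om : 'I_n -> 'rV[R]_n -> 'M[C]_d, forall k y, om k y = rdiff V (frame_form p s (cinv p y) k).
  by exists (fun k y => rdiff V (frame_form p s (cinv p y) k)).
have som k' : msmooth_on (cimage p W) (om k').
  by apply: msmooth_ext (msmooth_lin (rdiff V) oU (sw k')) => // y _; rewrite omE.
have dom k' l' : mpderiv k' (om l') (cmap p x) =
    rdiff V (mpderiv k' (fun y => frame_form p s (cinv p y) l') (cmap p x)).
  rewrite -(mpderiv_lin (rdiff V) k' (sw l') Ux).
  by congr (mpderiv _ _ _); apply: funext => y; rewrite omE.
have ox k0 : rdiff V (frame_form p s x k0) = om k0 (cmap p x) by rewrite omE man_cmapK.
have fx : loc s phi p (cmap p x) = phi x (s x) by rewrite locE man_cmapK.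
have D1 k' l' : mpderiv k' (fun y => cov p s phi (cinv p y) l') (cmap p x) =
    mpderiv k' (mpderiv l' (loc s phi p)) (cmap p x) +
    (rdiff V (mpderiv k' (fun y => frame_form p s (cinv p y) l') (cmap p x)) *m phi x (s x)
     + om l' (cmap p x) *m mpderiv k' (loc s phi p) (cmap p x)).
  have Ec y : cimage p W y -> cov p s phi (cinv p y) l' = mpderiv l' (loc s phi p) y + om l' y *m loc s phi p y.
    by move=> Uy; have [_ yE] := cimage_dom Uy; rewrite covE yE locE omE.
  rewrite (mpderiv_ext k' oU Ec Ux) (mpderivD k' (msmooth_pderiv l' sf) (msmooth_mul oU (som l') sf) Ux).
  by rewrite (mpderivM k' (som l') sf Ux) fx dom.
have D2 l' : cov p s phi x l' = mpderiv l' (loc s phi p) (cmap p x) + om l' (cmap p x) *m phi x (s x).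
  by rewrite covE ox.
have E k' l' : cov2 x k' l' = mpderiv k' (mpderiv l' (loc s phi p)) (cmap p x) +
    (rdiff V (mpderiv k' (fun y => frame_form p s (cinv p y) l') (cmap p x)) *m phi x (s x)
     + om l' (cmap p x) *m mpderiv k' (loc s phi p) (cmap p x)) +
    (om k' (cmap p x) *m mpderiv l' (loc s phi p) (cmap p x) +
     om k' (cmap p x) *m om l' (cmap p x) *m phi x (s x)).
  by rewrite /cov2 D1 D2 ox mulmxDr mulmxA.
rewrite !E (mschwarz k l oU sf Ux) /curv_form (linearD (rdiff V)) (linearB (rdiff V)) rdiff_bracket.
rewrite -(ox k) -(ox l).
have gen (A B D f : 'cV[C]_d) (a b K L : 'M[C]_d) :
    A + (a *m f + B) + (D + K *m f) - (A + (b *m f + D) + (B + L *m f)) = (a - b + (K - L)) *m f.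
  rewrite !mulmxDl !mulNmx; move: (a *m f) (b *m f) (K *m f) (L *m f) => a' b' K' L'.
  by apply/matrixP => i j; rewrite !mxE; ring.
exact: gen.
Qed.

Lemma nabla_field_nabla x X Y : W x -> field_smooth W X -> field_smooth W Y ->
  nabla_field X (nabla_field Y phi) x (s x) =
  \sum_k \sum_l (vcomp p X x 0 k * vcomp p Y x 0 l) *: cov2 x k l +
  covm p s phi x *m (\sum_k vcomp p X x 0 k *: mpderiv k (fun y => vcomp p Y (cinv p y)) (cmap p x))^T.
Proof.
move=> Wx sX sY; have px := Wp Wx; have Ux : cimage p W (cmap p x) by exact: cimage_mem.
have Gn := Gamma_nabla_field oW Gp sY; have sYp := sY p W (fun z Wz => Wz) oW Wp.
rewrite {1}/nabla_field (nabla_atE _ Gn oW Wx Wp ls) -vcompE covm_mul.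
rewrite [in X in _ + X]linear_sum mulmx_sumr -big_split /=; apply: eq_bigr => k _.
rewrite linearZ /= -scalemxAr.
under eq_bigr do rewrite -scalerA.
rewrite -scaler_sumr -scalerDr; congr (_ *: _).
have locN y : cimage p W y -> loc s (nabla_field Y phi) p y = covm p s phi (cinv p y) *m (vcomp p Y (cinv p y))^T.
  by move=> Uy; rewrite locE /nabla_field (nabla_atE _ Gp oW (cimageP Uy) Wp ls) vcompE.
rewrite covE (mpderiv_ext k oU locN Ux) (mpderivM k (covm_smooth Gp oW Wp ls) (msmooth_tr sYp) Ux) mpderivT man_cmapK //.
have -> : nabla_field Y phi x (s x) = covm p s phi x *m (vcomp p Y x)^T.
  by rewrite /nabla_field (nabla_atE _ Gp oW Wx Wp ls) vcompE.
rewrite addrAC; congr (_ + _); rewrite mulmxA -mulmxDl.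
apply/matrixP => i j; rewrite summxE mxE; apply: eq_bigr => l _.
rewrite [(vcomp p Y x)^T _ _]mxE [RHS]mxE mulrC (ord1 j); congr (_ * _).
rewrite [LHS]mxE /cov2 [RHS]mxE mpderivE; congr (_ + _).
  rewrite mpderivE.
  exact: (f_equal (fun g => cpderiv k g (cmap p x)) (funext (fun y => covmE p s phi (cinv p y) i l))).
by rewrite !mxE; apply: eq_bigr => i' _; rewrite [covm _ _ _ _ _ _]mxE.
Qed.

Lemma curvatureE x X Y : W x -> field_smooth W X -> field_smooth W Y ->
  curvature X Y phi x (s x) =
  \sum_k \sum_l (vcomp p X x 0 k * vcomp p Y x 0 l) *: (rdiff V (curv_form p s x k l) *m phi x (s x)).
Proof.
move=> Wx sX sY; rewrite /curvature (nabla_field_nabla Wx sX sY) (nabla_field_nabla Wx sY sX).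
have -> : nabla_field (bracket X Y) phi x (s x) = covm p s phi x *m (bracket X Y x *m toC (jac x p x))^T.
  by rewrite /nabla_field (nabla_atE _ Gp oW Wx Wp ls).
rewrite (bracket_chart oW Wx Wp sX sY) linearB /= mulmxBr.
have gen (A B a b : 'cV[C]_d) : A + a - (B + b) - (a - b) = A - B.
  by apply/matrixP => i j; rewrite !mxE; ring.
rewrite gen [X in _ - X]exchange_big /= -sumrB; apply: eq_bigr => k _.
rewrite -sumrB; apply: eq_bigr => l _.
by rewrite [vcomp p Y x 0 l * _]mulrC -scalerBr (ricci_identity k l Wx).
Qed.

End InFrame.

(** [Rq] extends the frame at x by [frame_through], not by s. Curvature is tensorial, so only the
    common value at x matters. *)
Lemma Rq_sumE (q : nat) p s phi W x : open W -> Gamma_on W phi -> W `<=` cdom p -> local_frame W s -> W x ->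
  Rq M V q phi x (s x) = \sum_k \sum_l epow (pi_e V) q l k *m
    \sum_i \sum_j (vcomp p s x k i * Num.conj (vcomp p s x l j)) *:
       (rdiff V (curv_form p s x i j) *m phi x (s x)).
Proof.
move=> oW Gp Wp ls Wx; have uf := proj1 ls _ Wx; have [su [W0 [oW0 W0x W0d ls0]]] := frame_throughP uf.
have f1 (k : 'I_m) : field_smooth (W `&` W0) (fun y => row k (frame_through x (s x) y)).
  move=> p' W' sW' oW' W'p; have ls' := local_frame_sub (subset_trans sW' (@subIsetr _ W W0)) ls0.
  move=> i j; apply: csmooth_ext (cimage_open oW') _ (frame_smooth oW' W'p ls' k j) => y _.
  by rewrite !vcompE -row_mul [RHS]mxE.
have f2 (l : 'I_m) : field_smooth (W `&` W0) (fun y => cjmx (row l (frame_through x (s x) y))).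
  move=> p' W' sW' oW' W'p; have oU' := cimage_open (p := p') oW'.
  apply: msmooth_ext (msmooth_conj oU' (f1 l p' W' sW' oW' W'p)) => // y _.
  by rewrite !vcompE cjmxM cjmx_toC.
rewrite /Rq; apply: eq_bigr => k _; apply: eq_bigr => l _; congr (_ *m _).
have oW1 : open (W `&` W0) by exact: openI.
have Gp1 := Gamma_on_sub (@subIsetl _ W W0) Gp; have ls1 := local_frame_sub (@subIsetl _ W W0) ls.
have W1p : W `&` W0 `<=` cdom p by move=> z [/Wp].
rewrite (curvatureE oW1 Gp1 W1p ls1 (conj Wx W0x) (f1 k) (f2 l)).
apply: eq_bigr => i _; apply: eq_bigr => j _; congr (_ * _ *: _).
  by rewrite !vcompE su -row_mul mxE.
by rewrite !vcompE su -{1}[toC _]cjmx_toC -cjmxM -row_mul 2!mxE.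
Qed.

Definition criem p x i j : 'M[C]_n :=
  mpderiv i (fun y => cchris p (cinv p y) j) (cmap p x) - mpderiv j (fun y => cchris p (cinv p y) i) (cmap p x) +
  (cchris p x j *m cchris p x i - cchris p x i *m cchris p x j).

Lemma criem_center x i j : criem x x i j = toC (riem x i j).
Proof.
rewrite /criem /riem !toC_add !toC_opp !toC_mul !addrA; congr (_ - _ + _ - _).
- exact: (mpderiv_toC (fun y => christoffel x (cinv x y) j)).
- exact: (mpderiv_toC (fun y => christoffel x (cinv x y) i)).
Qed.

Lemma criem_anti p x i j : criem p x i j = - criem p x j i.
Proof. by rewrite /criem opprD !opprB. Qed.

(** By the symmetry of the Christoffel symbols each term is symmetric in two of the indices, and the
    cyclic sum cancels in pairs. *)
Lemma criem_bianchi p x (i j a b : 'I_n) : cdom p x ->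
  criem p x i j a b + criem p x j a i b + criem p x a i j b = 0.
Proof.
move=> px.
have dsym (k l c e : 'I_n) : mpderiv k (fun y => cchris p (cinv p y) l) (cmap p x) c e =
    mpderiv k (fun y => cchris p (cinv p y) c) (cmap p x) l e.
  rewrite [LHS]mpderivE [RHS]mpderivE.
  exact: (f_equal (fun g => cpderiv k g (cmap p x)) (funext (fun y => cchris_sym p (cinv p y) l c e))).
have msym (k l c e : 'I_n) : (cchris p x l *m cchris p x k) c e = (cchris p x c *m cchris p x k) l e.
  by rewrite [LHS]mxE [RHS]mxE; apply: eq_bigr => f _; rewrite (cchris_sym p x l).
have E k l c e : criem p x k l c e =
   mpderiv k (fun y => cchris p (cinv p y) l) (cmap p x) c e - mpderiv l (fun y => cchris p (cinv p y) k) (cmap p x) c e +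
   ((cchris p x l *m cchris p x k) c e - (cchris p x k *m cchris p x l) c e).
  rewrite /criem; move: (mpderiv k _ _) (mpderiv l _ _) (cchris p x l *m _) (cchris p x k *m _) => A B D F.
  by rewrite !mxE.
have gen (D Q : 'I_n -> 'I_n -> 'I_n -> 'I_n -> C) : (forall k l c e, D k l c e = D k c l e) ->
    (forall k l c e, Q k l c e = Q k c l e) ->
    (D i j a b - D j i a b + (Q i j a b - Q j i a b)) + (D j a i b - D a j i b + (Q j a i b - Q a j i b)) +
    (D a i j b - D i a j b + (Q a i j b - Q i a j b)) = 0.
  by move=> hD hQ; rewrite (hD i j) (hD j i) (hD a j) (hQ i j) (hQ j i) (hQ a j); ring.
apply: (etrans (f_equal2 +%R (f_equal2 +%R (E i j a b) (E j a i b)) (E a i j b))).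
exact: (gen (fun k l c e => mpderiv k (fun y => cchris p (cinv p y) l) (cmap p x) c e)
  (fun k l c e => (cchris p x l *m cchris p x k) c e)).
Qed.

Section InFrame.
Context {p : M} {s : M -> 'M[C]_(m, n)} {W : set M}.
Hypotheses (oW : open W) (Wp : W `<=` cdom p) (ls : local_frame W s).

Let oU := cimage_open (p := p) oW.
Let sw k := frame_form_smooth k oW Wp ls.
Let sS := frame_smooth oW Wp ls.

Lemma curv_form_smooth i j : msmooth_on (cimage p W) (fun y => curv_form p s (cinv p y) i j).
Proof.
have sC a b : msmooth_on (cimage p W) (fun y => frame_form p s (cinv p y) a *m frame_form p s (cinv p y) b).
  exact: (msmooth_mul oU (sw a) (sw b)).
apply: msmooth_ext (msmooth_add oU (msmooth_add oU (msmooth_pderiv i (sw j)) (msmooth_opp oU (msmooth_pderiv j (sw i))))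
  (msmooth_add oU (sC i j) (msmooth_opp oU (sC j i)))) => // y Uy.
by have [_ E] := cimage_dom Uy; rewrite /curv_form E.
Qed.

Lemma curv_form_skew x i j : W x -> (curv_form p s x i j) ^t* = - curv_form p s x i j.
Proof.
move=> Wx; have px := Wp Wx; have Ux : cimage p W (cmap p x) by exact: cimage_mem.
have sk k := frame_form_skew k oW Wx Wp ls.
have dsk k l : (mpderiv k (fun y => frame_form p s (cinv p y) l) (cmap p x)) ^t* =
    - mpderiv k (fun y => frame_form p s (cinv p y) l) (cmap p x).
  rewrite -(mpderiv_adj k (sw l) Ux).
  have E y : cimage p W y -> (frame_form p s (cinv p y) l) ^t* = (-1) *: frame_form p s (cinv p y) l.
    by move=> Uy; rewrite (frame_form_skew l oW (cimageP Uy) Wp ls) scaleN1r.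
  rewrite (mpderiv_ext k oU E Ux) (mpderivZ k (csmooth_cst _ (- 1)) (sw l) Ux).
  have -> : cpderiv k (fun=> - 1 : C) (cmap p x) = 0 by apply: is_cderive_pderiv; exact: is_cderive_cst.
  by rewrite scale0r add0r scaleN1r.
rewrite /curv_form; move: (dsk i j) (dsk j i) (sk i) (sk j).
move: (mpderiv i _ _) (mpderiv j _ _) (frame_form p s x i) (frame_form p s x j) => A B D F hA hB hD hF.
have adN (X : 'M[C]_m) : (- X) ^t* = - X ^t* by rewrite -scaleN1r adjmxZ rmorphN1 scaleN1r.
rewrite !adjmxD !adN !adjmxM hA hB hD hF !(mulNmx, mulmxN) !opprK opprD; congr (_ + _); rewrite ?opprB //.
  by rewrite addrC.
Qed.

(** The integrability condition of the first order system satisfied by the frame matrix S: its mixed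
    second derivatives are computed in both orders from d S = omega^T S - S Gamma. *)
Lemma curv_form_riem x i j : W x -> (curv_form p s x i j)^T *m vcomp p s x = vcomp p s x *m criem p x i j.
Proof.
move=> Wx; have px := Wp Wx; have Ux : cimage p W (cmap p x) by exact: cimage_mem.
have sG k : msmooth_on (cimage p W) (fun y => cchris p (cinv p y) k) by exact: (cchris_smooth k oW Wp ls).
have sT k : msmooth_on (cimage p W) (fun y => (frame_form p s (cinv p y) k)^T) by exact: msmooth_tr (sw k).
pose S y := vcomp p s (cinv p y).
have dS k y : cimage p W y -> mpderiv k S y =
    (frame_form p s (cinv p y) k)^T *m S y + (-1) *: (S y *m cchris p (cinv p y) k).
  move=> Uy; have [_ yE] := cimage_dom Uy.
  by rewrite (frame_formK k oW (cimageP Uy) Wp ls) vnablaE yE scaleN1r addrK.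
have dS0 k : mpderiv k S (cmap p x) = (frame_form p s x k)^T *m vcomp p s x - vcomp p s x *m cchris p x k.
  by rewrite (dS k _ Ux) /S man_cmapK // scaleN1r.
have ddS l k : mpderiv l (mpderiv k S) (cmap p x) =
   (mpderiv l (fun y => frame_form p s (cinv p y) k) (cmap p x))^T *m vcomp p s x
   + (frame_form p s x k)^T *m mpderiv l S (cmap p x)
   - (mpderiv l S (cmap p x) *m cchris p x k + vcomp p s x *m mpderiv l (fun y => cchris p (cinv p y) k) (cmap p x)).
  rewrite (mpderiv_ext l oU (dS k) Ux).
  rewrite (mpderivD l (msmooth_mul oU (sT k) sS) (msmooth_scale oU (csmooth_cst _ (-1)) (msmooth_mul oU sS (sG k))) Ux).
  rewrite (mpderivZ l (csmooth_cst _ (- 1)) (msmooth_mul oU sS (sG k)) Ux).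
  have -> : cpderiv l (fun=> - 1 : C) (cmap p x) = 0 by apply: is_cderive_pderiv; exact: is_cderive_cst.
  rewrite scale0r add0r scaleN1r (mpderivM l (sT k) sS Ux) (mpderivM l sS (sG k) Ux) mpderivT /S man_cmapK //.
have gen (A B F G : 'M[C]_m) (Z : 'M[C]_(m, n)) (A' B' P Q : 'M[C]_n) :
    A^T *m Z + G^T *m (F^T *m Z - Z *m P) - ((F^T *m Z - Z *m P) *m Q + Z *m A') =
    B^T *m Z + F^T *m (G^T *m Z - Z *m Q) - ((G^T *m Z - Z *m Q) *m P + Z *m B') ->
    (A - B + (F *m G - G *m F))^T *m Z = Z *m (A' - B' + (Q *m P - P *m Q)).
  rewrite !(trmxDE, trmxNE) !trmx_mul.
  rewrite !(mulmxDl, mulmxDr, mulmxBl, mulmxBr, mulNmx, mulmxN, mulmxA) => /eqP; rewrite -subr_eq0 => /eqP E.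
  apply/eqP; rewrite -subr_eq0; apply/eqP; rewrite -[RHS]E.
  by apply/matrixP => k l; rewrite !mxE; ring.
have ddS' l k : mpderiv l (mpderiv k S) (cmap p x) =
   (mpderiv l (fun y => frame_form p s (cinv p y) k) (cmap p x))^T *m vcomp p s x
   + (frame_form p s x k)^T *m ((frame_form p s x l)^T *m vcomp p s x - vcomp p s x *m cchris p x l)
   - (((frame_form p s x l)^T *m vcomp p s x - vcomp p s x *m cchris p x l) *m cchris p x k
      + vcomp p s x *m mpderiv l (fun y => cchris p (cinv p y) k) (cmap p x)).
  by rewrite ddS (dS0 l).
have H : mpderiv i (mpderiv j S) (cmap p x) = mpderiv j (mpderiv i S) (cmap p x) by exact: mschwarz oU sS Ux.
rewrite /curv_form /criem; apply: gen; exact: (etrans (esym (ddS' i j)) (etrans H (ddS' j i))).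
Qed.

End InFrame.

Lemma unitary_row_dot (b : 'M[C]_m) i j : b \is unitarymx -> \sum_k Num.conj (b i k) * b j k = (i == j)%:R.
Proof.
move=> /unitarymxP/(congr1 (fun A : 'M[C]_m => A j i)); rewrite !mxE eq_sym => <-.
by apply: eq_bigr => k _; rewrite !mxE mulrC.
Qed.

Lemma unitary_col_dot (b : 'M[C]_m) k l : b \is unitarymx -> \sum_i b i k * Num.conj (b i l) = (k == l)%:R.
Proof.
move=> ub; have : b ^t* *m b = 1%:M by apply: mulmx1C; apply/unitarymxP.
move/(congr1 (fun A : 'M[C]_m => A l k)); rewrite !mxE eq_sym => <-.
by apply: eq_bigr => i _; rewrite !mxE mulrC.
Qed.

Lemma unitary_contract a c e (b : 'M[C]_m) (x : 'I_m -> 'M[C]_(a, c)) (y : 'I_m -> 'M[C]_(c, e)) :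
  b \is unitarymx ->
  \sum_i (\sum_k Num.conj (b k i) *: x k) *m (\sum_f b f i *: y f) = \sum_k x k *m y k.
Proof.
move=> ub.
have E i : (\sum_k Num.conj (b k i) *: x k) *m (\sum_f b f i *: y f) =
    \sum_k \sum_f (Num.conj (b k i) * b f i) *: (x k *m y f).
  rewrite mulmx_suml; apply: eq_bigr => k _; rewrite mulmx_sumr; apply: eq_bigr => f _.
  by rewrite -scalemxAl -scalemxAr scalerA.
rewrite (eq_bigr _ (fun i _ => E i)) exchange_big; apply: eq_bigr => k _.
rewrite exchange_big (bigD1 k) //= [X in _ + X]big1 ?addr0 => [|f fk].
  by rewrite -scaler_suml (unitary_row_dot _ _ ub) eqxx scale1r.
by rewrite -scaler_suml (unitary_row_dot _ _ ub) eq_sym (negbTE fk) scale0r.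
Qed.

(** Equivariance of e^q: the inner summation indices are rotated by b and its conjugate, which
    [unitary_contract] removes. *)
Lemma epow_conj (b : 'M[C]_m) (q : nat) k l : b \is unitarymx ->
  rmap V b *m epow (pi_e V) q k l *m (rmap V b) ^t* =
  \sum_i \sum_j (b i k * Num.conj (b j l)) *: epow (pi_e V) q i j.
Proof.
move=> ub; elim: q k l => [|q IH] k l.
  transitivity ((k == l)%:R *: (1%:M : 'M[C]_d)).
    rewrite /=; case: (k == l); last by rewrite mulr0n mulmx0 mul0mx scale0r.
    by rewrite scale1r mulmx1 rmapK.
  rewrite -(unitary_col_dot k l ub) scaler_suml; apply: eq_bigr => i _.
  rewrite (bigD1 i) //= eqxx big1 ?addr0 // => j ji.
  by rewrite eq_sym (negbTE ji) scaler0.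
have fE i : rmap V b *m pi_e V k i *m (rmap V b) ^t* =
    \sum_a b a k *: \sum_c Num.conj (b c i) *: pi_e V a c.
  rewrite /pi_e rmap_rdiff // pi_eE; apply: eq_bigr => a _; rewrite scaler_sumr; apply: eq_bigr => c _.
  rewrite scalerA; congr (_ *: _); rewrite mxE (bigD1 i) //= big1 ?addr0 => [|j ji].
    rewrite mxE (bigD1 k) //= big1 ?addr0 => [|j jk]; last by rewrite !mxE (negbTE jk) mulr0.
    by rewrite !mxE !eqxx mulr1.
  by rewrite [X in X * _]mxE big1 ?mul0r // => f _; rewrite !mxE (negbTE ji) andbF mulr0.
have -> : rmap V b *m epow (pi_e V) q.+1 k l *m (rmap V b) ^t* =
    \sum_i (rmap V b *m pi_e V k i *m (rmap V b) ^t*) *m (rmap V b *m epow (pi_e V) q i l *m (rmap V b) ^t*).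
  rewrite /= mulmx_sumr mulmx_suml; apply: eq_bigr => i _.
  by rewrite !mulmxA -[_ *m (rmap V b) ^t* *m rmap V b]mulmxA rmap_adjK // mulmx1.
have gE i : rmap V b *m epow (pi_e V) q i l *m (rmap V b) ^t* =
    \sum_g Num.conj (b g l) *: \sum_f b f i *: epow (pi_e V) q f g.
  rewrite IH exchange_big; apply: eq_bigr => g _; rewrite scaler_sumr; apply: eq_bigr => f _.
  by rewrite scalerA mulrC.
under eq_bigr do rewrite fE gE mulmx_suml.
rewrite exchange_big; apply: eq_bigr => a _.
under eq_bigr do rewrite mulmx_sumr.
rewrite exchange_big; apply: eq_bigr => g _.
under eq_bigr do rewrite -scalemxAl -scalemxAr scalerA.
by rewrite -scaler_sumr unitary_contract.
Qed.

(** The curvature R(eps_k, conj eps_l) of the frame bundle, an element of gl(m, C). *)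
Definition theta p s x (k l : 'I_m) : 'M[C]_m :=
  \sum_i \sum_j (vcomp p s x k i * Num.conj (vcomp p s x l j)) *: curv_form p s x i j.

Lemma RqE (q : nat) p s phi W x : open W -> Gamma_on W phi -> W `<=` cdom p -> local_frame W s -> W x ->
  Rq M V q phi x (s x) = \sum_k \sum_l epow (pi_e V) q l k *m (rdiff V (theta p s x k l) *m phi x (s x)).
Proof.
move=> oW Gp Wp ls Wx; rewrite (Rq_sumE q oW Gp Wp ls Wx); apply: eq_bigr => k _; apply: eq_bigr => l _.
congr (_ *m _); rewrite /theta linear_sum mulmx_suml; apply: eq_bigr => i _.
by rewrite linear_sum mulmx_suml; apply: eq_bigr => j _; rewrite (linearZZ (rdiff V)) -scalemxAl.
Qed.

Lemma curv_formE p s x W i j : open W -> W `<=` cdom p -> local_frame W s -> W x ->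
  curv_form p s x i j = (vcomp p s x *m criem p x i j *m cgram p x *m (vcomp p s x) ^t*)^T.
Proof.
move=> oW Wp ls Wx; rewrite -(curv_form_riem oW Wp ls i j Wx).
have gen (Om : 'M[C]_m) (S : 'M[C]_(m, n)) (G : 'M[C]_n) :
    S *m G *m S ^t* = 1%:M -> Om = (Om^T *m S *m G *m S ^t*)^T.
  by move=> SG; rewrite -!mulmxA [S *m _]mulmxA SG mulmx1 trmxK.
apply: gen; have := proj2 (frame_in_chart (Wp _ Wx) (proj1 ls _ Wx)).
by rewrite -vcompE -[toC (gram _ _)]/(cgram p x).
Qed.

Lemma theta_gauge p s s' x W a k l : open W -> W `<=` cdom p -> local_frame W s -> local_frame W s' -> W x ->
  s' x = a *m s x ->
  theta p s' x k l = \sum_k' \sum_l' (a k k' * Num.conj (a l l')) *: (cjmx a *m theta p s x k' l' *m a^T).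
Proof.
move=> oW Wp ls ls' Wx E.
have SE : vcomp p s' x = a *m vcomp p s x by rewrite !vcompE E mulmxA.
have cE i j : curv_form p s' x i j = cjmx a *m curv_form p s x i j *m a^T.
  rewrite (curv_formE i j oW Wp ls Wx) (curv_formE i j oW Wp ls' Wx) SE.
  move: (vcomp p s x) (criem p x i j) (cgram p x) => S r G.
  have -> : a *m S *m r *m G *m (a *m S) ^t* = a *m (S *m r *m G *m S ^t*) *m a ^t*.
    by rewrite adjmxM !mulmxA.
  by rewrite !(trmx_mul a _, trmx_mul _ (a ^t*)) adjmxE cjmxT trmxK mulmxA.
transitivity (\sum_i \sum_j (\sum_k' \sum_l' (a k k' * Num.conj (a l l')) *:
   ((vcomp p s x k' i * Num.conj (vcomp p s x l' j)) *: (cjmx a *m curv_form p s x i j *m a^T)))).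
  rewrite /theta; apply: eq_bigr => i _; apply: eq_bigr => j _; rewrite SE cE.
  move: (cjmx a *m _ *m _) (vcomp p s x) => X S.
  rewrite [(a *m S) k i]mxE [(a *m S) l j]mxE rmorph_sum mulr_suml scaler_suml; apply: eq_bigr => k' _.
  rewrite mulr_sumr scaler_suml; apply: eq_bigr => l' _; rewrite rmorphM scalerA; congr (_ *: _).
  by rewrite mulrACA.
under eq_bigr do rewrite exchange_big; rewrite exchange_big; apply: eq_bigr => k' _.
under eq_bigr do rewrite exchange_big; rewrite exchange_big; apply: eq_bigr => l' _.
rewrite /theta mulmx_sumr mulmx_suml scaler_sumr; apply: eq_bigr => i _.
rewrite mulmx_sumr mulmx_suml scaler_sumr; apply: eq_bigr => j _.
by rewrite -scalemxAr -scalemxAl.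
Qed.

(** The sum over k and l contracts the indices of e^q with those of the curvature, and both are
    rotated by the same unitary matrix. *)
Lemma Rq_gauge (q : nat) p s s' phi W x a : open W -> Gamma_on W phi -> W `<=` cdom p -> local_frame W s ->
  local_frame W s' -> W x -> a \is unitarymx -> s' x = a *m s x ->
  Rq M V q phi x (s' x) = rmap V (cjmx a) *m Rq M V q phi x (s x).
Proof.
move=> oW Gp Wp ls ls' Wx ua E.
rewrite (RqE q oW Gp Wp ls Wx) (RqE q oW Gp Wp ls' Wx).
have ub : cjmx a \is unitarymx by rewrite -adjmx_tr trmxC_unitary trmx_unitary.
rewrite E (section_gauge Gp Wx (proj1 ls _ Wx) ua); move: (phi x (s x)) => f.
set b := cjmx a in ub *; have bT : a^T = b ^t* by rewrite /b adjmx_cj.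
have tg k l : rdiff V (theta p s' x k l) *m (rmap V b *m f) =
    \sum_k' \sum_l' (Num.conj (b k k') * b l l') *: (rmap V b *m (rdiff V (theta p s x k' l') *m f)).
  rewrite (theta_gauge k l oW Wp ls ls' Wx E) linear_sum mulmx_suml; apply: eq_bigr => k' _.
  rewrite linear_sum mulmx_suml; apply: eq_bigr => l' _.
  rewrite (linearZZ (rdiff V)) -scalemxAl bT -rmap_rdiff // -/b.
  congr (_ *: _); first by rewrite [b k k']mxE [b l l']mxE conjCK.
  by rewrite -!mulmxA [_ ^t* *m (_ *m f)]mulmxA rmap_adjK // mul1mx.
under eq_bigr do under eq_bigr do rewrite tg.
have gen (Y : 'I_m -> 'I_m -> 'cV[C]_d) :
    \sum_k \sum_l epow (pi_e V) q l k *m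
      (\sum_k' \sum_l' (Num.conj (b k k') * b l l') *: (rmap V b *m Y k' l')) =
    rmap V b *m \sum_k \sum_l epow (pi_e V) q l k *m Y k l.
  transitivity (\sum_k \sum_l \sum_k' \sum_l'
      (Num.conj (b k k') * b l l') *: (epow (pi_e V) q l k *m (rmap V b *m Y k' l'))).
    apply: eq_bigr => k _; apply: eq_bigr => l _; rewrite mulmx_sumr; apply: eq_bigr => k' _.
    by rewrite mulmx_sumr; apply: eq_bigr => l' _; rewrite -scalemxAr.
  under eq_bigr do rewrite exchange_big; rewrite exchange_big mulmx_sumr; apply: eq_bigr => k' _.
  under eq_bigr do rewrite exchange_big; rewrite exchange_big mulmx_sumr; apply: eq_bigr => l' _.
  have -> : rmap V b *m (epow (pi_e V) q l' k' *m Y k' l') =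
      (rmap V b *m epow (pi_e V) q l' k' *m (rmap V b) ^t*) *m (rmap V b *m Y k' l').
    by rewrite -!mulmxA [_ ^t* *m (_ *m Y k' l')]mulmxA rmap_adjK // mul1mx.
  rewrite (epow_conj q l' k' ub) mulmx_suml exchange_big; apply: eq_bigr => l _.
  by rewrite mulmx_suml; apply: eq_bigr => k _; rewrite -scalemxAl mulrC.
exact: gen.
Qed.

Lemma Gamma_Rq (q : nat) phi : Gamma_S M V phi -> Gamma_S M V (Rq M V q phi).
Proof.
move=> Gp; split=> [x u a uf ua | W s oW ls p i j].
  have ut : a^T \is unitarymx by rewrite trmx_unitary.
  have uf' : unitary_frame x (a^T *m u) by exact: frame_rotate uf ut.
  have [su [W [oW Wx Wd ls]]] := frame_throughP uf.
  have [su' [W' [oW' W'x Wd' ls']]] := frame_throughP uf'.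
  have oW1 : open (W `&` W') by exact: openI.
  have ls1 := local_frame_sub (@subIsetl _ W W') ls; have ls1' := local_frame_sub (@subIsetr _ W W') ls'.
  have W1d : W `&` W' `<=` cdom x by move=> z [/Wd].
  have E : frame_through x (a^T *m u) x = a^T *m frame_through x u x by rewrite su su'.
  have := Rq_gauge q oW1 (Gamma_S_on _ Gp) W1d ls1 ls1' (conj Wx W'x) ut E.
  by rewrite su su' /= => ->; rewrite -adjmxE (rmap_adj V ua) mulmxA rmapK // mul1mx.
apply: (smooth_on_frames (F := fun x => Rq M V q phi x (s x))) => // W' sW W'p oW'.
have ls' := local_frame_sub sW ls; have oU := cimage_open (p := p) oW'.
have Gp' := Gamma_S_on W' Gp; have sS := frame_smooth oW' W'p ls'; have sf := loc_smooth Gp' oW' W'p ls'.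
apply: (msmooth_ext (F := fun y => \sum_k \sum_l epow (pi_e V) q l k *m
   (rdiff V (theta p s (cinv p y) k l) *m loc s phi p y))) => //.
  by move=> y Uy; rewrite (RqE q oW' Gp' W'p ls' (cimageP Uy)) locE.
apply: msmooth_sum => // k; apply: msmooth_sum => // l; apply: msmooth_mul => //; first exact: msmooth_cst.
apply: msmooth_mul => //; apply: (msmooth_lin (rdiff V)) => //.
apply: msmooth_sum => // a; apply: msmooth_sum => // c; apply: msmooth_scale => //.
  exact: (csmooth_mul oU (sS k a) (csmooth_conj oU (sS l c))).
exact: curv_form_smooth.
Qed.

(** * Ricci-flat manifolds *)

Section RicciFlat.
Context {x : M} {s : M -> 'M[C]_(m, n)} {W : set M}.
Hypotheses (oW : open W) (Wx : W x) (Wd : W `<=` cdom x) (ls : local_frame W s).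
Hypothesis ric0 : ricci x = 0.

Let S := vcomp x s x.
Let r i j := criem x x i j.
(** The coordinates of the sum of eps_k (x) conj eps_k. The skew matrix K is proportional to the
    Kaehler form with raised indices. *)
Let H : 'M[C]_n := S^T *m cjmx S.
Let K := H - H^T.

Lemma H_riem i j : H *m r i j = - (r i j)^T *m H.
Proof.
have E := curv_form_riem oW Wd ls i j Wx; have sk := curv_form_skew oW Wd ls i j Wx.
have rc : cjmx (r i j) = r i j by rewrite /r criem_center cjmx_toC.
rewrite /H -/S in E *; rewrite -mulmxA -{1}rc -cjmxM -E cjmxM -adjmxE sk mulNmx mulmxN mulNmx !mulmxA.
have -> : (r i j)^T *m S^T = S^T *m curv_form x s x i j by rewrite -trmx_mul -[S *m r i j]E trmx_mul trmxK.
by [].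
Qed.

Lemma K_riem i j : K *m r i j = - ((r i j)^T *m K).
Proof.
have rc : cjmx (r i j) = r i j by rewrite /r criem_center cjmx_toC.
have HT : H^T = cjmx H by rewrite /H trmx_mul cjmxM cjmxT trmxK cjmxK.
have E := H_riem i j; have E' : H^T *m r i j = - ((r i j)^T *m H^T).
  have cN (A : 'M[C]_n) : cjmx (- A) = - cjmx A by exact: map_mxN.
  by rewrite HT -{1}rc -cjmxM E mulNmx cN cjmxM cjmxT rc.
by rewrite /K mulmxBl mulmxBr E E' mulNmx opprK opprB addrC.
Qed.

Lemma riem_trace_flat a f : \sum_i r a i f i = 0.
Proof.
have /(congr1 (fun A : 'M[R]_n => A a f)) := ric0; rewrite !mxE => E.
transitivity (- \sum_i Complex (riem x i a f i) 0).
  by rewrite -sumrN; apply: eq_bigr => i _; rewrite /r criem_anti criem_center 2!mxE.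
by rewrite -(rmorph_sum (real_complex R)) E rmorph0 oppr0.
Qed.

(** The Bianchi identity replaces R_ij by curvatures R_ai and R_ja. Moving K across them by [K_riem]
    exposes the trace that defines the Ricci tensor. *)
Lemma K_riem_sum : \sum_i \sum_j K i j *: r i j = 0.
Proof.
have Ka i j : K j i = - K i j by rewrite /K !mxE opprB.
apply/matrixP => a b; rewrite [RHS]mxE summxE.
transitivity (\sum_i \sum_j K i j * r i j a b).
  by apply: eq_bigr => i _; rewrite summxE; apply: eq_bigr => j _; rewrite mxE.
transitivity (- (\sum_i \sum_j K i j * r j a i b) - \sum_i \sum_j K i j * r a i j b).
  rewrite -opprD -big_split -sumrN; apply: eq_bigr => i _; rewrite -big_split -sumrN; apply: eq_bigr => j _ /=.
  have := criem_bianchi i j a b (man_center x); rewrite -/(r i j) -/(r j a) -/(r a i) => B.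
  by rewrite -mulrDr -mulrN; congr (_ * _); apply/eqP; rewrite -subr_eq0 opprK addrA B.
have Z : \sum_i \sum_j K i j * r a i j b = 0.
  have E i : \sum_j K i j * r a i j b = - \sum_f r a i f i * K f b.
    transitivity ((K *m r a i) i b); first by rewrite mxE.
    rewrite K_riem mxE mxE; congr (- _); apply: eq_bigr => f _.
    by rewrite [(r a i)^T i f]mxE.
  rewrite (eq_bigr _ (fun i _ => E i)) sumrN exchange_big big1 ?oppr0 // => f _.
  by rewrite -mulr_suml riem_trace_flat mul0r.
rewrite Z subr0 exchange_big; apply/eqP; rewrite oppr_eq0; apply/eqP; rewrite -[RHS]Z.
apply: eq_bigr => j _; apply: eq_bigr => i _.
have rA : r j a i b = - r a j i b by rewrite /r criem_anti mxE.
have gen (k1 k2 r1 r2 : C) : k1 = - k2 -> r1 = - r2 -> k1 * r1 = k2 * r2 by move=> -> ->; rewrite mulrNN.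
exact: gen (Ka j i) rA.
Qed.

(** The trace over the frame contracts H with the curvature, which is skew in i and j; so only K
    contributes. *)
Lemma theta_trace_flat : \sum_k theta x s x k k = 0.
Proof.
have HE i j : \sum_k S k i * Num.conj (S k j) = H i j.
  by rewrite /H mxE; apply: eq_bigr => k _; rewrite !mxE.
have Q0 : \sum_i \sum_j H i j *: r i j = 0.
  have : (\sum_i \sum_j H i j *: r i j) *+ 2 = 0.
    rewrite -[RHS]K_riem_sum mulr2n [X in _ + X]exchange_big -big_split /=; apply: eq_bigr => i _.
    rewrite -big_split /=; apply: eq_bigr => j _.
    rewrite /r (criem_anti x x j i) scalerN -scalerBl.
    by congr (_ *: _); rewrite /K !mxE.
  rewrite -scaler_nat => /eqP; rewrite scaler_eq0 pnatr_eq0 => /eqP //.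
transitivity ((S *m (\sum_i \sum_j H i j *: r i j) *m cgram x x *m S ^t*)^T); last first.
  by rewrite Q0 mulmx0 !mul0mx trmx0.
rewrite /theta exchange_big mulmx_sumr !mulmx_suml linear_sum; apply: eq_bigr => i _.
rewrite exchange_big mulmx_sumr !mulmx_suml linear_sum; apply: eq_bigr => j _.
rewrite -scaler_suml -/S HE -scalemxAr -!scalemxAl linearZ /=; congr (_ *: _).
exact: (curv_formE i j oW Wd ls Wx).
Qed.

End RicciFlat.

Lemma Rq0_ricci_flat phi x u : ricci_flat M -> Gamma_S M V phi -> unitary_frame x u -> Rq M V 0 phi x u = 0.
Proof.
move=> ric Gp uf; have [su [W [oW Wx Wd ls]]] := frame_throughP uf.
rewrite -su (RqE 0 oW (Gamma_S_on W Gp) Wd ls Wx).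
transitivity (rdiff V (\sum_k theta x (frame_through x u) x k k) *m phi x (frame_through x u x)); last first.
  by rewrite (theta_trace_flat oW Wx Wd ls (ric x)) linear0 mul0mx.
rewrite linear_sum mulmx_suml; apply: eq_bigr => k _; rewrite (bigD1 k) //= eqxx big1 ?addr0 => [|l lk].
  by rewrite mul1mx.
by rewrite (negbTE lk) mul0mx.
Qed.

End Curvature.

(** * Integration of compactly supported functions *)

Section CompactSupport.
Context {R : realType}.
Local Notation mu := (@lebesgue_measure R).

Section OneDim.
Variables (A : R) (g : R -> R).
Hypotheses (A0 : 0 < A) (cg : continuous g) (sg : forall t, A < `|t| -> g t = 0).

Lemma restrict_supp : g \_ `[- A, A] = g.
Proof.
apply: funext => t; rewrite patchE; case: ifPn => // nt; rewrite sg //.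
by rewrite ltNge; apply/negP => tA; move/negP: nt; apply; rewrite inE /= in_itv /= -ler_norml.
Qed.

Lemma Rintegral_supp : \int[mu]_t g t = \int[mu]_(t in `[- A, A]) g t.
Proof. by rewrite [RHS]Rintegral_mkcond restrict_supp. Qed.

Lemma integrable_itv : mu.-integrable `[- A, A] (EFin \o g).
Proof.
apply: continuous_compact_integrable; first exact: segment_compact.
by apply: continuous_subspaceT; exact: cg.
Qed.

Lemma integrable_supp : mu.-integrable setT (EFin \o g).
Proof.
have := integrable_itv; rewrite integrable_mkcond //.
by rewrite restrict_EFin restrict_supp.
Qed.

Lemma Rintegral_bound (B : R) : (forall t, `|g t| <= B) -> `|\int[mu]_t g t| <= 2 * A * B.
Proof.
move=> gB; rewrite Rintegral_supp.
apply: le_trans (le_normr_Rintegral _ integrable_itv) _ => //.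
have I : \int[mu]_(t in `[- A, A]) B = 2 * A * B.
  have mE : lebesgue_measure (`[- A, A]%classic : set R) = (2 * A)%:E.
    by rewrite lebesgue_measure_itv /= lte_fin gtrN // -EFinD; congr EFin; lra.
  by rewrite Rintegral_cst // mulrC; congr (_ * _); rewrite [X in fine X]mE.
rewrite -I; apply: le_Rintegral => //.
- exact: (integrable_norm integrable_itv).
- apply: continuous_compact_integrable; first exact: segment_compact.
  by apply: continuous_subspaceT => x; exact: cst_continuous.
Qed.

Lemma Rintegral_gt0 t0 : (forall t, 0 <= g t) -> 0 < g t0 -> 0 < \int[mu]_t g t.
Proof.
move=> g0 gt0; pose c := g t0 / 2; have c0 : 0 < c by rewrite divr_gt0.
have : \forall t \near t0, c < g t.
  have cz : c < g t0 by rewrite /c ltr_pdivrMr // ltr_pMr // ltr1n.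
  by have := @cg t0; move=> /cvgr_gt H; exact: H.
move=> /nbhs_ballP[e /= e0 He].
pose D : set R := `[t0 - e / 2, t0 + e / 2]%classic.
have e2 : 0 < e / 2 by rewrite divr_gt0.
have HD t : D t -> c <= g t.
  rewrite /D /= in_itv /= => /andP[h1 h2]; apply/ltW/He; rewrite /ball /= ltr_norml.
  by apply/andP; split; lra.
have cD : continuous (fun _ : R => c) by move=> x; exact: cst_continuous.
have iD h : continuous h -> mu.-integrable D (EFin \o h).
  by move=> ch; apply: continuous_compact_integrable; [exact: segment_compact|exact: continuous_subspaceT].
apply: (@lt_le_trans _ _ (\int[mu]_(t in D) c)).
  have mE : lebesgue_measure (D : set R) = e%:E.
    rewrite lebesgue_measure_itv /= lte_fin ifT; last by lra.
    by rewrite -EFinB; congr EFin; lra.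
  by rewrite /D Rintegral_cst // [X in fine X]mE mulr_gt0.
apply: (@le_trans _ _ (\int[mu]_(t in D) g t)); first by apply: le_Rintegral; [exact: measurable_itv|exact: (iD _ cD)|exact: (iD _ cg)|exact: HD].
rewrite /Rintegral fine_le //.
- by apply: integrable_fin_num; [exact: measurable_itv|exact: (iD _ cg)].
- by apply: integrable_fin_num; [exact: measurableT|exact: integrable_supp].
- apply: ge0_subset_integral; [exact: measurable_itv|exact: measurableT| | |exact: subsetT]; last by move=> t _; rewrite lee_fin.
  exact: (measurable_int _ integrable_supp).
Qed.

Lemma Rintegral_derive (G : R -> R) : (forall t, is_derive t (1 : R) G (g t)) ->
  (forall t, A < `|t| -> G t = 0) -> \int[mu]_t g t = 0.
Proof.
(* G is known to vanish only strictly beyond A, so the end points are moved outwards. *)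
move=> dG sG; pose A' := A + 1; have A'0 : 0 < A' by rewrite addr_gt0.
have AA' : A < A' by rewrite ltrDl.
have cG : continuous G.
  by move=> t; apply: differentiable_continuous; apply/derivable1_diffP; have [] := dG t.
have sg' t : A' < `|t| -> g t = 0 by move=> h; apply: sg; exact: lt_trans h.
have -> : \int[mu]_t g t = \int[mu]_(t in `[- A', A']) g t.
  rewrite [RHS]Rintegral_mkcond; congr (Rintegral _ _ _); apply: funext => t; rewrite patchE; case: ifPn => // nt.
  rewrite sg' // ltNge; apply/negP => tA; move/negP: nt; apply; rewrite inE /= in_itv /= -ler_norml //.
rewrite /Rintegral (@continuous_FTC2 _ g G).
- have -> : G A' = 0 by apply: sG; rewrite gtr0_norm.
  have -> : G (- A') = 0 by apply: sG; rewrite normrN gtr0_norm.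
  by rewrite subee.
- by rewrite gtrN.
- by apply: continuous_subspaceT; exact: cg.
- split.
  + by move=> t _; have [] := dG t.
  + by apply: cvg_at_right_filter; exact: cG.
  + by apply: cvg_at_left_filter; exact: cG.
- by move=> t _; rewrite derive1E; have [_ ->] := dG t.
Qed.

End OneDim.

Section Cons.
Context {n : nat}.
Implicit Types (t : R) (y : 'rV[R]_n).

Definition rcons_mx t y : 'rV[R]_n.+1 := row_mx (const_mx t : 'rV[R]_1) y.

Lemma rcons_mx0 t y : rcons_mx t y 0 ord0 = t.
Proof. by rewrite /rcons_mx mxE; case: splitP => j; rewrite ?mxE //= => /eqP; rewrite eqE /= add1n. Qed.

Lemma rcons_mxS t y i : rcons_mx t y 0 (lift ord0 i) = y 0 i.
Proof.
rewrite /rcons_mx mxE; case: splitP => j //=; first by rewrite (ord1 j).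
by rewrite /bump /= add1n => -[E]; congr (y _ _); apply: val_inj.
Qed.

Lemma rcons_mx_surj (z : 'rV[R]_n.+1) : exists t y, z = rcons_mx t y.
Proof.
exists (z 0 ord0), (\row_i z 0 (lift ord0 i)); apply/rowP => i.
by case: (unliftP ord0 i) => [j|] ->; rewrite ?rcons_mx0 ?rcons_mxS ?mxE.
Qed.

Lemma rcons_mx_dist t t' y y' (e : R) : `|t - t'| <= e -> `|y - y'| <= e -> `|rcons_mx t y - rcons_mx t' y'| <= e.
Proof.
move=> Ht Hy; apply: rV_norm_le => [|i]; first exact: le_trans Ht.
case: (unliftP ord0 i) => [j|] ->; rewrite [X in `|X|]mxE [X in _ + X]mxE.
  rewrite !rcons_mxS; have := rV_coord_le (y - y') j; rewrite [X in `|X|]mxE [X in _ + X]mxE => /le_trans; exact.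
by rewrite !rcons_mx0.
Qed.

Lemma rcons_mxD0 t h y : rcons_mx t y + h *: delta_mx 0 ord0 = rcons_mx (t + h) y.
Proof.
apply/rowP => i; case: (unliftP ord0 i) => [j|] ->; rewrite [LHS]mxE [X in _ + X]mxE [X in _ * X]mxE.
  by rewrite !rcons_mxS eqxx /= mulr0 addr0.
by rewrite !rcons_mx0 eqxx /= mulr1.
Qed.

Lemma rcons_mxDS t h y i : rcons_mx t y + h *: delta_mx 0 (lift ord0 i) = rcons_mx t (y + h *: delta_mx 0 i).
Proof.
apply/rowP => k; case: (unliftP ord0 k) => [j|] ->; rewrite [LHS]mxE [X in _ + X]mxE [X in _ * X]mxE.
  by rewrite !rcons_mxS !mxE (inj_eq lift_inj).
by rewrite !rcons_mx0 (negbTE (neq_lift _ _)) andbF mulr0 addr0.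
Qed.

End Cons.

Definition supp_in n (A : R) (f : 'rV[R]_n -> R) : Prop := forall y : 'rV[R]_n, (exists i, A < `|y 0 i|) -> f y = 0.

(** Compactness of the box gives a uniform radius for centres in the box. If only z lies in the box,
    the two points are exchanged; if neither does, both values are 0. *)
Lemma supp_uniform n A (f : 'rV[R]_n -> R) : continuous f -> supp_in A f ->
  forall e, 0 < e -> exists2 r, 0 < r & forall y z, `|z - y| < r -> `|f z - f y| < e.
Proof.
move=> cf sf e e0.
pose K := [set v : 'rV[R]_n | forall i, `[- A, A]%classic (v 0 i)].
have cK : compact K by apply: (@rV_compact _ _ (fun=> `[- A, A]%classic)) => _; exact: segment_compact.
have sK y : ~ K y -> f y = 0.
  move=> nK; apply: sf; apply: contrapT => H; apply: nK => i; rewrite /= in_itv /= -ler_norml.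
  by rewrite leNgt; apply/negP => Hi; apply: H; exists i.
pose P (d : R) (x : 'rV[R]_n) := forall z, `|z - x| < d -> `|f z - f x| < e.
have := (compact_near_coveringP K).1 cK R (0 : R)^'+ P _.
have H : forall x, K x -> \forall x' \near x & d \near (0 : R)^'+, P d x'.
  move=> x Kx; have e2 : 0 < e / 2 by rewrite divr_gt0.
  have := cf x; move=> /cvgrPdist_lt /(_ _ e2) /nbhs_rV_ball[r r0 Hr].
  have r2 : 0 < r / 2 by rewrite divr_gt0.
  exists ([set y | `|y - x| < r / 2], [set d : R | d < r / 2]).
    split; first by apply: (ball_nbhs_rV r2) => z.
    exact: nbhs_right_lt.
  move=> [x' d] [/= h1 h2] z h3.
  have h4 : `|z - x| < r.
    rewrite -(subrKA x'); apply: le_lt_trans (ler_normD _ _) _.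
    by rewrite (splitr r) ltrD // (lt_trans h3).
  have h5 : `|x' - x| < r by apply: lt_trans h1 _; rewrite ltr_pdivrMr // ltr_pMr // ltr1n.
  have := Hr _ h4; have := Hr _ h5 => a1 a2.
  rewrite -(subrKA (f x)); apply: le_lt_trans (ler_normD _ _) _.
  by rewrite (splitr e) ltrD // distrC.
move=> /(_ _ H) Hd.
have [d [d0 Pd]] : exists d, 0 < d /\ forall x, K x -> P d x.
  have : \forall d \near (0 : R)^'+, 0 < d /\ (forall x, K x -> P d x).
    by apply: filterI => //; exact: nbhs_right_gt.
  by move=> /filter_ex[d]; exists d.
exists d => // y z yz; have [Ky|nKy] := pselect (K y); first exact: Pd.
have [Kz|nKz] := pselect (K z); last by rewrite !sK // subrr normr0.
by rewrite distrC; apply: Pd => //; rewrite distrC.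
Qed.

Definition test_fun n (A : R) (f : 'rV[R]_n -> R) : Prop := [/\ 0 < A, continuous f & supp_in A f].

Lemma rcons_mx_continuous n t : continuous (@rcons_mx n t).
Proof.
move=> y B /nbhs_rV_ball[e e0 He]; apply: (ball_nbhs_rV (r := e / 2)); first by rewrite divr_gt0.
move=> z zy; apply: He; apply: (@le_lt_trans _ _ (e / 2)); last by rewrite ltr_pdivrMr // ltr_pMr // ltr1n.
apply: rcons_mx_dist; first by rewrite subrr normr0 divr_ge0 // ltW.
exact: ltW.
Qed.

Lemma test_fun_rcons n A (f : 'rV[R]_n.+1 -> R) t : test_fun A f -> test_fun A (fun y => f (rcons_mx t y)).
Proof.
move=> [A0 cf sf]; split=> // [y|y [i Hi]].
  by apply: continuous_comp; [exact: rcons_mx_continuous|exact: cf].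
by apply: sf; exists (lift ord0 i); rewrite rcons_mxS.
Qed.

Lemma test_fun_lin n A (f g : 'rV[R]_n -> R) c : test_fun A f -> test_fun A g ->
  test_fun A (fun y => f y + c * g y).
Proof.
move=> [A0 cf sf] [_ cg sg]; split=> // [y|y Hy]; last by rewrite sf // sg // mulr0 addr0.
have H : (fun y : 'rV[R]_n => f y + c * g y) @ y --> f y + c * g y.
  exact: (cvgD (cf y) (cvgM (cvg_cst c) (cg y))).
exact: H.
Qed.

(** Linearity and the bound are carried together through the induction on the dimension: continuity
    of the partial integral, which gives integrability in the next variable, rests on both of them
    in one dimension less. *)
Definition integral_linear n : Prop := forall A (f g : 'rV[R]_n -> R) c, test_fun A f -> test_fun A g ->
  integralRn (fun y => f y + c * g y) = integralRn f + c * integralRn g.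

Definition integral_bounded n : Prop := forall A (f : 'rV[R]_n -> R) B, test_fun A f ->
  (forall y, `|f y| <= B) -> `|integralRn f| <= (2 * A) ^+ n * B.

Definition partial_integral n (f : 'rV[R]_n.+1 -> R) t := integralRn (fun y : 'rV[R]_n => f (rcons_mx t y)).

Lemma integralRnS n (f : 'rV[R]_n.+1 -> R) : integralRn f = \int[mu]_t partial_integral f t.
Proof. by []. Qed.

Section Step.
Context {n : nat}.
Hypotheses (IL : integral_linear n) (IB : integral_bounded n).

Lemma partial_integral_supp A (f : 'rV[R]_n.+1 -> R) t : test_fun A f -> A < `|t| -> partial_integral f t = 0.
Proof.
move=> tf tA; apply/eqP; rewrite -normr_le0; have [A0 cf sf] := tf.
have := IB (test_fun_rcons t tf) (B := 0); rewrite mulr0; apply => y.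
by rewrite sf ?normr0 //; exists ord0; rewrite rcons_mx0.
Qed.

Lemma partial_integral_dist A (f g : 'rV[R]_n.+1 -> R) t t' (e : R) : test_fun A f -> test_fun A g ->
  (forall y : 'rV[R]_n, `|f (rcons_mx t y) - g (rcons_mx t' y)| <= e) ->
  `|partial_integral f t - partial_integral g t'| <= (2 * A) ^+ n * e.
Proof.
move=> tf tg H.
have := IL (-1) (test_fun_rcons t tf) (test_fun_rcons t' tg); rewrite mulN1r => <-.
apply: IB; first exact: (test_fun_lin _ (test_fun_rcons t tf) (test_fun_rcons t' tg)).
by move=> y; rewrite mulN1r.
Qed.

Lemma partial_integral_continuous A (f : 'rV[R]_n.+1 -> R) : test_fun A f -> continuous (partial_integral f).
Proof.
move=> tf t; have [A0 cf sf] := tf; apply/cvgrPdist_lt => e e0.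
have C0 : 0 < (2 * A) ^+ n + 1 by rewrite ltr_pwDr // exprn_ge0 // mulr_ge0 // ltW.
(* The added 1 makes the final estimate strict. *)
pose e' := e / ((2 * A) ^+ n + 1); have e'0 : 0 < e' by rewrite divr_gt0.
have [r r0 Hr] := supp_uniform cf sf e'0.
apply/nbhs_ballP; exists (r / 2) => /=; first by rewrite divr_gt0.
move=> t' tt'; apply: (@le_lt_trans _ _ ((2 * A) ^+ n * e')).
  apply: (partial_integral_dist tf tf) => y; apply: ltW; apply: Hr.
  apply: (@le_lt_trans _ _ (r / 2)); last by rewrite ltr_pdivrMr // ltr_pMr // ltr1n.
  by apply: rcons_mx_dist; [exact: ltW|rewrite subrr normr0 divr_ge0 // ltW].
by rewrite /e' mulrA ltr_pdivrMr // mulrC ltr_pM2l // ltrDl.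
Qed.

Lemma integral_linearS : integral_linear n.+1.
Proof.
move=> A f g c tf tg; rewrite !integralRnS; have [A0 _ _] := tf.
have If := integrable_supp (partial_integral_continuous tf) (fun t => partial_integral_supp tf).
have Ig := integrable_supp (partial_integral_continuous tg) (fun t => partial_integral_supp tg).
rewrite -(RintegralZl c measurableT Ig) -RintegralD //; last exact: (integrableZl measurableT c Ig).
apply: eq_Rintegral => t _.
exact: (IL c (test_fun_rcons t tf) (test_fun_rcons t tg)).
Qed.

Lemma integral_boundedS : integral_bounded n.+1.
Proof.
move=> A f B tf fB; rewrite integralRnS; have [A0 _ _] := tf.
rewrite exprS -mulrA; apply: (Rintegral_bound A0 (partial_integral_continuous tf) (fun t => partial_integral_supp tf)) => t.
by apply: IB (test_fun_rcons t tf) _.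
Qed.

End Step.

Lemma integralRn_linear n : integral_linear n /\ integral_bounded n.
Proof.
elim: n => [|n [IL IB]]; last by split; [exact: integral_linearS|exact: integral_boundedS].
by split=> [A f g c _ _|A f B _ H] //=; rewrite expr0 mul1r.
Qed.

Lemma integralRn_lin n A (f g : 'rV[R]_n -> R) c : test_fun A f -> test_fun A g ->
  integralRn (fun y => f y + c * g y) = integralRn f + c * integralRn g.
Proof. exact: (proj1 (integralRn_linear n)). Qed.

Lemma integralRn_ge0 n (f : 'rV[R]_n -> R) : (forall y, 0 <= f y) -> 0 <= integralRn f.
Proof.
elim: n f => [|n IH] f f0; first exact: f0.
rewrite integralRnS; apply: Rintegral_ge0 => t _.
by apply: IH => y; exact: f0.
Qed.

Lemma integralRn_gt0 n A (f : 'rV[R]_n -> R) y0 : test_fun A f -> (forall y, 0 <= f y) -> 0 < f y0 ->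
  0 < integralRn f.
Proof.
elim: n f y0 => [|n IH] f y0 tf f0 fy0; first by rewrite /= (_ : 0 = y0) //; apply/rowP => -[].
have [A0 _ _] := tf; have [IL IB] := integralRn_linear n; have [t0 [y1 E]] := rcons_mx_surj y0.
rewrite integralRnS; apply: (Rintegral_gt0 (partial_integral_continuous IL IB tf)
  (fun t => partial_integral_supp IB tf) (t0 := t0)).
  by move=> t; apply: integralRn_ge0 => y; exact: f0.
by apply: (IH _ y1 (test_fun_rcons t0 tf)); rewrite -?E.
Qed.

Lemma diff_quot_rcons n (F : 'rV[R]_n.+1 -> R) t (y : 'rV[R]_n) (i : 'I_n) :
  (fun h : R => h^-1 *: ((F \o shift (rcons_mx t y)) (h *: delta_mx 0 (lift ord0 i)) - F (rcons_mx t y))) =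
  (fun h : R => h^-1 *: (((fun y => F (rcons_mx t y)) \o shift y) (h *: delta_mx 0 i) - F (rcons_mx t y))).
Proof.
apply: funext => h /=.
by rewrite [h *: _ + rcons_mx t y]addrC rcons_mxDS [y + _]addrC.
Qed.

Lemma pderiv_rcons n (F : 'rV[R]_n.+1 -> R) t (y : 'rV[R]_n) (i : 'I_n) :
  pderiv (lift ord0 i) F (rcons_mx t y) = pderiv i (fun y => F (rcons_mx t y)) y.
Proof.
rewrite /pderiv /derive; have -> : (fun h : R => h^-1 *: ((F \o shift (rcons_mx t y)) (h *: delta_mx 0 (lift ord0 i)) - F (rcons_mx t y))) =
  (fun h : R => h^-1 *: (((fun y => F (rcons_mx t y)) \o shift y) (h *: delta_mx 0 i) - F (rcons_mx t y))) => //.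
exact: diff_quot_rcons.
Qed.

(** Differentiation under the integral: by the mean value theorem the difference quotient is the
    derivative at a point closer than h, and uniform continuity bounds the error before
    integration. *)
Lemma partial_integral_derive n A (F : 'rV[R]_n.+1 -> R) t : test_fun A F -> test_fun A (pderiv ord0 F) ->
  (forall y, derivable F y (delta_mx 0 ord0 : 'rV[R]_n.+1)) ->
  is_derive t (1 : R) (partial_integral F) (partial_integral (pderiv ord0 F) t).
Proof.
move=> tF tD dF; have [A0 cD sD] := tD; have [IL IB] := integralRn_linear n.
suff cv : (fun h : R => h^-1 *: ((partial_integral F \o shift t) (h *: (1 : R)) - partial_integral F t)) h
    @[h --> 0^'] --> partial_integral (pderiv ord0 F) t.
  by apply: DeriveDef; [apply/cvg_ex; eexists; exact: cv|apply: cvg_lim].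
apply/cvgrPdist_lt => e e0.
have C0 : 0 < (2 * A) ^+ n + 1 by rewrite ltr_pwDr // exprn_ge0 // mulr_ge0 // ltW.
pose e' := e / ((2 * A) ^+ n + 1); have e'0 : 0 < e' by rewrite divr_gt0.
have [r r0 Hr] := supp_uniform cD sD e'0.
have r2 : 0 < r / 2 by rewrite divr_gt0.
have Hr2 : \forall h \near (0 : R)^', `|h| < r / 2.
  by apply: nbhs_dnbhs; apply/nbhs_ballP; exists (r / 2) => //= h; rewrite /ball /= sub0r normrN.
have H0 : \forall h \near (0 : R)^', h != 0 by near=> h; near: h; exact: nbhs_dnbhs_neq.
apply: filterS2 H0 Hr2 => h h0 hr; rewrite /= [_%:A]mulr1.
have tFh : test_fun A (fun y : 'rV[R]_n => F (rcons_mx (h + t) y)) by exact: test_fun_rcons.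
have E : partial_integral (pderiv ord0 F) t - h^-1 *: (partial_integral F (h + t) - partial_integral F t) =
    integralRn (fun y : 'rV[R]_n => pderiv ord0 F (rcons_mx t y) +
       (- h^-1) * (F (rcons_mx (h + t) y) + (- 1) * F (rcons_mx t y))).
  rewrite (IL _ _ _ _ (test_fun_rcons t tD) (test_fun_lin (- 1) tFh (test_fun_rcons t tF))).
  rewrite (IL _ _ _ _ tFh (test_fun_rcons t tF)) mulN1r mulNr; congr (_ - _).
rewrite E; apply: (@le_lt_trans _ _ ((2 * A) ^+ n * e')); last first.
  by rewrite /e' mulrA ltr_pdivrMr // mulrC ltr_pM2l // ltrDl.
apply: IB => [|y].
  exact: (test_fun_lin _ (test_fun_rcons t tD) (test_fun_lin (- 1) tFh (test_fun_rcons t tF))).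
have [|th thh Eth] := @line_MVT R n.+1 F (rcons_mx t y) (delta_mx 0 ord0) h; first by move=> th _; exact: dF.
rewrite mulN1r [h + t]addrC -(rcons_mxD0 t h y) Eth mulNr mulKf //.
rewrite distrC; apply: ltW; apply: Hr.
rewrite addrC addKr; apply: (@le_lt_trans _ _ (r / 2)); last by rewrite ltr_pdivrMr // ltr_pMr // ltr1n.
apply: rV_norm_le => [|i]; first exact: ltW.
rewrite !mxE normrM; apply: (@le_trans _ _ `|th|); last by apply: le_trans thh (ltW hr).
by rewrite ler_piMr //; case: (_ && _); rewrite ?normr1 ?normr0.
Unshelve. all: by end_near.
Qed.

(** In the first variable this is the fundamental theorem for the partial integral; in any other
    variable the inner integral is already 0 by induction. *)
Lemma integralRn_pderiv n A (F : 'rV[R]_n -> R) j : test_fun A F -> test_fun A (pderiv j F) ->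
  (forall y, derivable F y (delta_mx 0 j : 'rV[R]_n)) -> integralRn (pderiv j F) = 0.
Proof.
elim: n F j => [|n IH] F j tF tD dF; first by case: j tD dF.
have [A0 _ _] := tF; have [IL IB] := integralRn_linear n.
case: (unliftP ord0 j) tD dF => [i|] -> tD dF; rewrite integralRnS.
  rewrite (_ : partial_integral _ = fun=> 0); first by rewrite Rintegral_cst // mul0r.
  apply: funext => t.
  have Ep : (fun y : 'rV[R]_n => pderiv (lift ord0 i) F (rcons_mx t y)) = pderiv i (fun y => F (rcons_mx t y)).
    by apply: funext => y; rewrite pderiv_rcons.
  rewrite /partial_integral Ep; apply: IH; first exact: test_fun_rcons.
    by rewrite -Ep; exact: test_fun_rcons.
  move=> y; have := dF (rcons_mx t y); rewrite /derivable.
  by rewrite diff_quot_rcons.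
apply: (Rintegral_derive A0 (partial_integral_continuous IL IB tD) (fun t => partial_integral_supp IB tD)
  (G := partial_integral F)).
  by move=> t; exact: partial_integral_derive tF tD dF.
by move=> t; exact: (partial_integral_supp IB tF).
Qed.

End CompactSupport.

(** * Smooth bump functions *)

Section Bump.
Context {R : realType}.

(* Up to linear combinations, the derivatives of [exp (- 1 / t)], extended by 0. *)
Definition flat_exp (j : nat) (t : R) : R := if 0 < t then t^-1 ^+ j * expR (- t^-1) else 0.

Lemma flat_exp_ge0 j t : 0 <= flat_exp j t.
Proof.
by rewrite /flat_exp; case: ifP => // /ltW t0; rewrite mulr_ge0 ?expR_ge0 // exprn_ge0 // invr_ge0.
Qed.

(** From exp(s) >= (s/N)^N with s = 1/t and N = j + 2. The quadratic bound makes the derivative at 0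
    vanish. *)
Lemma flat_exp_bound j : exists2 c : R, 0 <= c & forall t, flat_exp j t <= c * t ^+ 2.
Proof.
pose N : R := j.+2%:R; have N0 : 0 < N by rewrite ltr0n.
exists (N ^+ j.+2) => [|t]; first by rewrite exprn_ge0 // ltW.
rewrite /flat_exp; case: ifP => [t0|_]; last by rewrite mulr_ge0 ?sqr_ge0 // exprn_ge0 // ltW.
have s0 : 0 < t^-1 by rewrite invr_gt0.
have H : (t^-1 / N) ^+ j.+2 <= expR t^-1.
  have -> : expR t^-1 = expR (t^-1 / N) ^+ j.+2.
    by rewrite -expRM_natl mulr_natl -[_ *+ _]mulr_natr -/N divfK // gt_eqF.
  apply: lerXn2r; rewrite ?nnegrE ?expR_ge0 //; first by rewrite divr_ge0 // ltW.
  by apply: le_trans (expR_ge1Dx _); rewrite lerDr.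
rewrite expRN ler_pdivrMr ?expR_gt0 //.
apply: (@le_trans _ _ (N ^+ j.+2 * t ^+ 2 * (t^-1 / N) ^+ j.+2)).
  rewrite expr_div_n [_ / N ^+ _]mulrC mulrACA mulfV ?mul1r; last by rewrite expf_neq0 // gt_eqF.
  by rewrite !exprS expr0 mulr1 -!mulrA !mulVKf ?gt_eqF // mulVKf ?gt_eqF.
by apply: ler_wpM2l => //; rewrite mulr_ge0 ?sqr_ge0 // exprn_ge0 // ltW.
Qed.

Lemma flat_exp_derive j (t : R) :
  is_derive t (1 : R) (flat_exp j) (flat_exp j.+2 t - j%:R * flat_exp j.+1 t).
Proof.
have [t0|t0|<-] := ltgtP 0 t; last first.
- have [c c0 Hc] := flat_exp_bound j.
  rewrite /flat_exp ltxx mulr0 subr0.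
  have cv : (fun h : R => h^-1 *: ((flat_exp j \o shift (0 : R)) (h *: (1 : R)) - flat_exp j 0)) h @[h --> 0^'] --> (0 : R).
    apply/cvgrPdist_lt => e e0; have ec : 0 < e / (c + 1) by rewrite divr_gt0 // ltr_pwDr.
    have Hr2 : \forall h \near (0 : R)^', `|h| < e / (c + 1).
      by apply: nbhs_dnbhs; apply/nbhs_ballP; exists (e / (c + 1)) => //= h; rewrite /ball /= sub0r normrN.
    have H0 : \forall h \near (0 : R)^', h != 0 by near=> h; near: h; exact: nbhs_dnbhs_neq.
    apply: filterS2 H0 Hr2 => h h0 hr; rewrite /= addr0 [_%:A]mulr1 sub0r normrN {2}/flat_exp ltxx subr0.
    rewrite normrM normfV ltr_pdivrMl ?normr_gt0 // ger0_norm ?flat_exp_ge0 //.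
    apply: le_lt_trans (Hc h) _; rewrite -real_normK ?num_real // expr2 mulrCA mulrA [_ * c]mulrC -mulrA.
    rewrite mulrCA ltr_pM2l ?normr_gt0 //.
    apply: (@le_lt_trans _ _ (c * (e / (c + 1)))); first by apply: ler_wpM2l => //; exact: ltW.
    by rewrite mulrA ltr_pdivrMr ?ltr_pwDr // mulrC ltr_pM2l // ltrDl.
  by apply: DeriveDef; [apply/cvg_ex; eexists; exact: cv|apply: cvg_lim].
- have -> : flat_exp j.+2 t - j%:R * flat_exp j.+1 t = 0 by rewrite /flat_exp ltNge (ltW t0) /= mulr0 subrr.
  have : \forall z \near t, 0 = flat_exp j z.
    near=> z; rewrite /flat_exp ltNge; have -> // : z <= 0.
    by apply: ltW; near: z; exact: lt_nbhsl.
  by move=> H; apply: (near_eq_is_derive H); exact: is_derive_cst.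
- have : \forall z \near t, z^-1 ^+ j * expR (- z^-1) = flat_exp j z.
    by near=> z; rewrite /flat_exp ifT //; near: z; exact: lt_nbhsr.
  move=> H; apply: (near_eq_is_derive H).
  have tn : t != 0 by rewrite gt_eqF.
  have D1 : is_derive t (1 : R) (fun z : R => z^-1) (- t^-1 ^+ 2).
    have D0 := is_deriveV (f := id) (x := t) (t := 1) tn (is_derive_id t 1).
    by apply: is_derive_eq; rewrite /GRing.scale /= mulr1 exprVn.
  have D2 := is_deriveX j D1.
  have D3 : is_derive t (1 : R) (fun z : R => expR (- z^-1)) (t^-1 ^+ 2 * expR (- t^-1)).
    have D4 : is_derive t (1 : R) (fun z : R => - z^-1) (t^-1 ^+ 2) by apply: is_derive_eq; rewrite opprK.
    exact: (is_derive_comp1 D4 (is_derive_expR (- t^-1))).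
  rewrite /flat_exp t0; have -> : (fun z => z^-1 ^+ j * expR (- z^-1)) = ((fun z : R => z^-1) ^+ j) * (fun z => expR (- z^-1)).
    by apply: funext => z; rewrite /= exprfctE.
  apply: (is_derive_eq (is_deriveM D2 D3)); rewrite /GRing.scale /= exprfctE.
  by case: j {H D2} => [|j]; rewrite ?mul0r ?expr0 /= ?exprS; ring.
Unshelve. all: by end_near.
Qed.

Lemma Ck_on_flat_exp n (U : set 'rV[R]_n) (f : 'rV[R]_n -> R) k j :
  open U -> Ck_on k U f -> Ck_on k U (flat_exp j \o f).
Proof.
move=> oU; elim: k j => [|k IH] j Hf0.
  split=> // y Uy; apply: continuous_comp; first exact: (proj1 Hf0 y Uy).
  apply: differentiable_continuous; apply/derivable1_diffP.
  by have [] := flat_exp_derive j (f y).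
have [cf Hf] := Hf0; split.
  exact: (proj1 (Ck_on_leq (leq0n k) (IH j (Ck_on_pred Hf0)))).
move=> i; have [f1 f2] := Hf i.
have D y : U y -> is_derive y (delta_mx 0 i : 'rV[R]_n) (flat_exp j \o f)
    (pderiv i f y * (flat_exp j.+2 (f y) - j%:R * flat_exp j.+1 (f y))).
  move=> Uy; apply: is_derive_comp1; last exact: flat_exp_derive.
  by apply: DeriveDef; first exact: f1.
split; first by move=> y Uy; have [] := D y Uy.
have H1 := IH j.+2 (Ck_on_pred Hf0); have H2 := IH j.+1 (Ck_on_pred Hf0).
apply: Ck_on_ext (Ck_on_mul oU f2 (Ck_on_add oU H1 (Ck_on_mul oU (Ck_on_cst k U (- j%:R)) H2))) => // y Uy.
have [_] := D y Uy; rewrite /pderiv => ->; by rewrite /= mulNr.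
Qed.

Lemma bump_exists n (y0 : 'rV[R]_n) (r : R) : 0 < r -> exists eta : 'rV[R]_n -> R,
  [/\ smooth_on setT eta, forall y, 0 <= eta y, 0 < eta y0 & forall y, r <= `|y - y0| -> eta y = 0].
Proof.
(* r^2 minus the squared Euclidean distance. The norm of the statement is the maximum norm, which
   the Euclidean one dominates, so q is nonpositive where that norm is at least r. *)
move=> r0; pose q (y : 'rV[R]_n) := r ^+ 2 + \sum_i (- 1) * ((y 0 i + - y0 0 i) * (y 0 i + - y0 0 i)).
exists (flat_exp 0 \o q); split=> [k|y||y yr].
- apply: Ck_on_flat_exp; first exact: openT.
  have C c := @Ck_on_cst R n k setT c; have D i := @Ck_on_coord R n k setT i openT.
  have Di i := Ck_on_add openT (D i) (C (- y0 0 i)).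
  apply: Ck_on_add => //; first exact: openT.
  by apply: Ck_on_sum => [|i]; [exact: openT|apply: Ck_on_mul => //; [exact: openT|apply: Ck_on_mul => //; exact: openT]].
- exact: flat_exp_ge0.
- rewrite /= /q big1 => [|i _]; last by rewrite subrr mulr0 mulr0.
  by rewrite addr0 /flat_exp exprn_gt0 // expr0 mul1r expR_gt0.
- rewrite /= /flat_exp ifF //; apply/negbTE; rewrite -leNgt.
  have [i Hi] : exists i, r <= `|(y - y0) 0 i|.
    apply: contrapT => H; have : `|y - y0| < r.
      pose c := \big[Order.max/0]_i `|(y - y0) 0 i|.
      have Hlt i : `|(y - y0) 0 i| < r by rewrite ltNge; apply/negP => Hi; apply: H; exists i.
      apply: (@le_lt_trans _ _ c); last by apply: bigmax_lt => // i _; exact: Hlt.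
      apply: rV_norm_le => [|i]; first exact: bigmax_ge_id.
      exact: le_bigmax.
    by rewrite ltNge yr.
  have S : \sum_(i0 | i0 != i) -1 * ((y 0 i0 + - y0 0 i0) * (y 0 i0 + - y0 0 i0)) <= 0.
    by apply: sumr_le0 => l _; rewrite mulN1r oppr_le0 -expr2 sqr_ge0.
  have Q : r ^+ 2 <= (y 0 i + - y0 0 i) * (y 0 i + - y0 0 i).
    move: Hi; rewrite !mxE -expr2 -[X in _ -> _ <= X]real_normK ?num_real // => Hi.
    by rewrite lerXn2r ?nnegrE // ltW.
  rewrite /q (bigD1 i) //= addrA; apply: le_trans (_ : _ <= r ^+ 2 + -1 * ((y 0 i + - y0 0 i) * (y 0 i + - y0 0 i))) _.
    by rewrite gerDl.
  by rewrite mulN1r subr_le0.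
Qed.

End Bump.

(** * Derivative of a determinant *)

Section DetDerivative.
Context {R : realType}.

Lemma is_derive_prod (V : normedModType R) (x v : V) (I : eqType) (r : seq I) (f : I -> V -> R) (f' : I -> R) :
  uniq r -> (forall i, is_derive x v (f i) (f' i)) ->
  is_derive x v (fun z => \prod_(i <- r) f i z) (\sum_(i <- r) f' i * \prod_(j <- r | j != i) f j x).
Proof.
move=> ur Hf; elim: r ur => [_|i r IH /= /andP[ir ur]].
  rewrite big_nil (_ : (fun z => _) = fun=> 1); last by apply: funext => z; rewrite big_nil.
  exact: is_derive_cst.
rewrite (_ : (fun z => _) = f i * (fun z => \prod_(i <- r) f i z)); last by apply: funext => z; rewrite big_cons.
have := is_deriveM (Hf i) (IH ur) => /is_derive_eq; apply.
rewrite !big_cons eqxx /= /GRing.scale /= addrC; congr (_ + _).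
  rewrite mulrC; congr (_ * _); rewrite big_seq_cond [RHS]big_seq_cond; apply: eq_bigl => j.
  by case jr: (j \in r) => //=; case: eqP => // E; rewrite -E jr in ir.
rewrite big_distrr big_seq_cond [RHS]big_seq_cond; apply: eq_bigr => k /andP[kr _] /=.
rewrite big_cons ifT; first by rewrite mulrCA.
by apply/eqP => E; rewrite E kr in ir.
Qed.

Lemma is_derive_bigsum (V : normedModType R) (x v : V) I (r : seq I) (f : I -> V -> R) (f' : I -> R) :
  (forall i, is_derive x v (f i) (f' i)) ->
  is_derive x v (fun z => \sum_(i <- r) f i z) (\sum_(i <- r) f' i).
Proof.
move=> Hf; elim: r => [|i r IH].
  by rewrite big_nil (_ : (fun z => _) = fun=> 0); [exact: is_derive_cst|apply: funext => z; rewrite big_nil].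
rewrite big_cons (_ : (fun z => _) = f i + (fun z => \sum_(i <- r) f i z)).
  exact: is_deriveD.
by apply: funext => z; rewrite big_cons.
Qed.

(** Jacobi's formula. The product rule in the Leibniz expansion gives the sum of the determinants
    with one row differentiated; expansion along that row produces the adjugate. *)
Lemma is_derive_det (V : normedModType R) (x v : V) n (A : V -> 'M[R]_n) (A' : 'M[R]_n) :
  (forall i j, is_derive x v (fun z => A z i j) (A' i j)) ->
  is_derive x v (fun z => \det (A z)) (\tr (A' *m \adj (A x))).
Proof.
move=> HA; have HP (s : {perm 'I_n}) : is_derive x v (fun z => (-1) ^+ s * \prod_i A z i (s i))
    ((-1) ^+ s * \sum_i A' i (s i) * \prod_(j | j != i) A x j (s j)).
  exact: (is_deriveZ ((-1) ^+ s) (is_derive_prod (index_enum_uniq 'I_n) (fun i => HA i (s i)))).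
pose B i : 'M[R]_n := \matrix_(k, l) if k == i then A' i l else A x k l.
have E : \tr (A' *m \adj (A x)) =
    \sum_(s : {perm 'I_n}) (-1) ^+ s * \sum_i A' i (s i) * \prod_(j | j != i) A x j (s j).
  transitivity (\sum_i \det (B i)).
    apply: eq_bigr => i _; rewrite mxE (expand_det_row _ i); apply: eq_bigr => l _.
    rewrite !mxE eqxx; congr (_ * _); rewrite /cofactor; congr (_ * \det _).
    by apply/matrixP => k k'; rewrite !mxE eq_sym (negbTE (neq_lift i k)).
  rewrite exchange_big; apply: eq_bigr => s _; rewrite big_distrr; apply: eq_bigr => i _ /=.
  rewrite (bigD1 i) //= mxE eqxx; congr (_ * (_ * _)).
  by apply: eq_bigr => j /negbTE ji; rewrite mxE ji.
rewrite E; exact: (is_derive_bigsum (index_enum {perm 'I_n}) HP).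
Qed.

Lemma Ck_on_prod n k (U : set 'rV[R]_n) I (r : seq I) (f : I -> 'rV[R]_n -> R) : open U ->
  (forall i, Ck_on k U (f i)) -> Ck_on k U (fun y => \prod_(i <- r) f i y).
Proof.
move=> oU H; elim: r => [|i r IH].
  by apply: (@Ck_on_ext _ n k U (fun=> 1)) => //; [move=> y _; rewrite big_nil|exact: Ck_on_cst].
apply: (@Ck_on_ext _ n k U (fun y => f i y * \prod_(j <- r) f j y)) => //.
  by move=> y _; rewrite big_cons.
exact: Ck_on_mul.
Qed.

Lemma smooth_det n l (U : set 'rV[R]_n) (A : 'rV[R]_n -> 'M[R]_l) : open U ->
  (forall i j, smooth_on U (fun y => A y i j)) -> smooth_on U (fun y => \det (A y)).
Proof.
move=> oU H k; apply: Ck_on_sum => // s; apply: Ck_on_mul => //; first exact: Ck_on_cst.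
by apply: Ck_on_prod => // i; exact: H.
Qed.

End DetDerivative.

Lemma integralRn_sum0 (R : realType) (A : R) n I (s : seq I) (f : I -> 'rV[R]_n -> R) : 0 < A ->
  (forall i, test_fun A (f i)) -> (forall i, integralRn (f i) = 0) ->
  test_fun A (fun y => \sum_(i <- s) f i y) /\ integralRn (fun y => \sum_(i <- s) f i y) = 0.
Proof.
move=> A0 tf f0; elim: s => [|i s [tS S0]].
  have t0 : test_fun A (fun _ : 'rV[R]_n => 0 : R).
    by split=> // y; exact: cst_continuous.
  rewrite (_ : (fun y => _) = fun=> 0); last by apply: funext => y; rewrite big_nil.
  split=> //; have := integralRn_lin (-1) t0 t0.
  by rewrite (_ : (fun y => _) = fun=> 0); [rewrite mulN1r subrr|apply: funext => y; rewrite mulr0 addr0].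
rewrite (_ : (fun y => _) = fun y => f i y + 1 * \sum_(j <- s) f j y).
  by split; [exact: test_fun_lin|rewrite (integralRn_lin _ (tf i) tS) f0 S0 mulr0 addr0].
by apply: funext => y; rewrite big_cons mul1r.
Qed.

(** * Integrals of functions supported in a chart ball *)

Section ChartIntegral.
Context {R : realType} {n : nat} (M : riemannian R n).
Variables (vol : {measure set (borel M) -> \bar R}) (p : M) (W : set M) (y0 : 'rV[R]_n) (r : R).
Local Notation C := R[i].
Local Notation U := (cimage p W).
Hypotheses (volP : is_volume vol) (oW : open W) (Wp : W `<=` cdom p) (r0 : 0 < r).
Hypothesis ballU : forall z : 'rV[R]_n, `|z - y0| <= r -> U z.
Hypothesis det_pos : forall y, U y -> 0 < \det (gram p (cinv p y)).

Definition density (y : 'rV[R]_n) : R := Num.sqrt (\det (gram p (cinv p y))).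

Definition chart_supp T (z : T) (F : M -> T) : Prop :=
  forall x, ~ (cdom p x /\ `|cmap p x - y0| < r) -> F x = z.

Definition chart_test (F : M -> C) : Prop := chart_supp 0 F /\ csmooth_on U (F \o cinv p).

Definition real_test (f : M -> R) : Prop := chart_supp 0 f /\ smooth_on U (f \o cinv p).

(** Extension by 0 beyond the chart image. It is smooth for functions vanishing off the open ball,
    because the closed ball lies inside U. *)
Definition zext (h : 'rV[R]_n -> R) (y : 'rV[R]_n) : R := if `[< U y >] then h y else 0.

Lemma zextE h y : U y -> zext h y = h y.
Proof. by rewrite /zext => /asboolP ->. Qed.

Lemma zext_out h y : (forall y, U y -> r <= `|y - y0| -> h y = 0) -> r <= `|y - y0| -> zext h y = 0.
Proof. by move=> H yr; rewrite /zext; case: asboolP => // Uy; exact: H. Qed.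

Lemma density_gt0 y : U y -> 0 < density y.
Proof. by move=> Uy; rewrite sqrtr_gt0; exact: det_pos. Qed.

Lemma det_smooth : smooth_on U (fun y => \det (gram p (cinv p y))).
Proof.
apply: smooth_det; first exact: cimage_open.
move=> i j k; have [H _] := @gram_smooth R n M p i j.
have E : (fun y => complex.Re (cgram p (cinv p y) i j)) = fun y => gram p (cinv p y) i j.
  by apply: funext => y; rewrite mxE.
rewrite -E; apply: (Ck_on_sub _ (H k)); exact: cimage_sub.
Qed.

(** The square root of the determinant is the determinant times its inverse square root, so
    [smooth_rsqrt] applies. *)
Lemma density_smooth : smooth_on U density.
Proof.
have oU := @cimage_open _ _ M p W oW.
have H := smooth_rsqrt oU det_smooth det_pos.
move=> k; apply: Ck_on_ext (Ck_on_mul oU (det_smooth k) (H k)) => // y Uy.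
rewrite /density -{1}(sqr_sqrtr (ltW (det_pos Uy))) expr2 mulfK // gt_eqF // sqrtr_gt0.
exact: det_pos.
Qed.

Definition chart_out := [set y : 'rV[R]_n | r < `|y - y0|].

Lemma chart_out_open : open chart_out.
Proof.
rewrite openE => y /= ry; apply: (ball_nbhs_rV (r := `|y - y0| - r)); first by rewrite subr_gt0.
move=> z zy; rewrite /chart_out /=; have : `|y - y0| <= `|y - z| + `|z - y0|.
  by rewrite -{1}(subrKA z) ler_normD.
by rewrite distrC in zy; lra.
Qed.

Lemma zext_smooth h : smooth_on U h -> (forall y, U y -> r <= `|y - y0| -> h y = 0) ->
  smooth_on setT (zext h).
Proof.
move=> sh h0 k; have oU := @cimage_open _ _ M p W oW.
apply: (Ck_on_setU (V := fun b : bool => if b then U else chart_out)) => [y _|[|]].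
- have [yr|yr] := leP `|y - y0| r; first by exists true; exact: ballU.
  by exists false.
- by apply: Ck_on_ext (sh k) => // y Uy; rewrite zextE.
- apply: Ck_on_ext (Ck_on_cst k chart_out 0) => //; first exact: chart_out_open.
  by move=> y /ltW yr; rewrite zext_out.
Qed.

Lemma test_fun_out (h : 'rV[R]_n -> R) : continuous h -> (forall y, r < `|y - y0| -> h y = 0) ->
  test_fun (`|y0| + r) h.
Proof.
move=> ch h0; split=> //; first by rewrite ltr_wpDl.
move=> y [i Hi]; apply: h0.
have H1 := rV_coord_le y i; have H2 := lerB_dist y y0.
by move: Hi; lra.
Qed.

Lemma zext_test_fun h : smooth_on U h -> (forall y, U y -> r <= `|y - y0| -> h y = 0) ->
  test_fun (`|y0| + r) (zext h).
Proof.
move=> sh h0; apply: test_fun_out => [y|y /ltW yr]; last exact: zext_out.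
by have [H _] := zext_smooth sh h0 0; exact: H.
Qed.

Lemma closed_box_compact : compact [set z : 'rV[R]_n | `|z - y0| <= r].
Proof.
have -> : [set z : 'rV[R]_n | `|z - y0| <= r] = [set v | forall i, `[y0 0 i - r, y0 0 i + r]%classic (v 0 i)].
  apply/seteqP; split=> [z /= zr i|z /= H].
    by rewrite /= in_itv /= -ler_distl; have := rV_coord_le (z - y0) i; rewrite !mxE => /le_trans; apply.
  by apply: rV_norm_le => [|i]; [exact: ltW|have := H i; rewrite /= in_itv /= -ler_distl !mxE].
by apply: (@rV_compact _ _ (fun i => `[y0 0 i - r, y0 0 i + r]%classic)) => i; exact: segment_compact.
Qed.

Definition chart_box : set M := cinv p @` [set z : 'rV[R]_n | `|z - y0| <= r].

Lemma chart_box_compact : compact chart_box.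
Proof.
apply: continuous_compact; last exact: closed_box_compact.
apply: continuous_in_subspaceT => z /set_mem /= /ballU Uz.
by have [d e] := cimage_dom Uz; rewrite -e; exact: man_cinv_cont.
Qed.

Lemma chart_box_out (x : M) : ~ chart_box x -> ~ (cdom p x /\ `|cmap p x - y0| < r).
Proof.
move=> nK [px xr]; apply: nK; exists (cmap p x); last exact: man_cmapK.
exact: ltW.
Qed.

Lemma chart_box_closed : closed chart_box.
Proof. by apply: compact_closed; [exact: man_hausdorff|exact: chart_box_compact]. Qed.

Lemma chart_box_dom : chart_box `<=` cdom p.
Proof. by move=> x [z /ballU Uz <-]; have [] := cimage_dom Uz. Qed.

(** Off the chart domain f vanishes near x, because the compact set [chart_box] is closed in the
    Hausdorff space M. *)
Lemma pull_continuous (f : M -> R) (h : 'rV[R]_n -> R) : continuous h -> chart_supp 0 f ->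
  (forall x, cdom p x -> f x = h (cmap p x)) -> continuous f.
Proof.
move=> ch f0 fh x; have [px|npx] := pselect (cdom p x).
  have H : {for x, continuous (h \o cmap p)}.
    by apply: continuous_comp; [exact: man_cmap_cont|exact: ch].
  have E : \forall z \near x, (h \o cmap p) z = f z.
    have : nbhs x (cdom p) by apply: open_nbhs_nbhs; split; [exact: man_dom_open|].
    by apply: filterS => z pz; rewrite /= fh.
  rewrite /continuous_at -(nbhs_singleton E) /=; apply: cvg_trans H.
  exact: near_eq_cvg.
have E : \forall z \near x, 0 = f z.
  have : nbhs x (~` chart_box).
    by apply: open_nbhs_nbhs; split; [exact: closed_openC chart_box_closed|move/chart_box_dom].
  by apply: filterS => z /chart_box_out/f0.
have H : {for x, continuous (fun _ : M => 0 : R)} by exact: cst_continuous.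
rewrite /continuous_at -(nbhs_singleton E); apply: cvg_trans H.
exact: near_eq_cvg.
Qed.

Lemma chart_supp_inv (f : M -> R) y : chart_supp 0 f -> U y -> r <= `|y - y0| -> f (cinv p y) = 0.
Proof.
move=> f0 /cimage_dom[py yE] yr; apply: f0 => -[_]; rewrite yE => /(le_lt_trans yr).
by rewrite ltxx.
Qed.

Lemma vol_real f : real_test f -> \int[vol]_x (f x : R) = integralRn (zext (fun y => f (cinv p y) * density y)).
Proof.
move=> [f0 sf]; have f0' y := @chart_supp_inv f y f0.
have fh x : cdom p x -> f x = zext (f \o cinv p) (cmap p x).
  move=> px; have [xr|rx] := ltP `|cmap p x - y0| r.
    by rewrite (zextE _ (ballU (ltW xr))) /= man_cmapK.
  by rewrite zext_out //; apply: f0 => -[_] /(le_lt_trans rx); rewrite ltxx.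
have ch : continuous (zext (f \o cinv p)).
  by move=> y; have [H _] := zext_smooth sf f0' 0; exact: H.
have cf : continuous f := pull_continuous ch f0 fh.
have cs : exists K : set M, [/\ compact K, K `<=` cdom p & forall x, ~ K x -> f x = 0].
  by exists chart_box; split; [exact: chart_box_compact|exact: chart_box_dom|move=> x /chart_box_out/f0].
rewrite /Rintegral (volP cf cs) /=; congr integralRn; apply: funext => y.
rewrite /zext; case: asboolP => [Uy|nUy].
  by rewrite indicE mem_set ?mul1r //; case: Uy.
rewrite indicE; case: (boolP (y \in _)) => [/set_mem yc|_]; last by rewrite mul0r.
rewrite mul1r [f _]f0 ?mul0r // => -[pc].
case: yc => x px xy; rewrite -xy man_cmapK // => H; apply: nUy; rewrite -xy.
exact: ballU (ltW H).
Qed.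

Lemma real_zext_test f : real_test f -> test_fun (`|y0| + r) (zext (fun y => f (cinv p y) * density y)).
Proof.
move=> [f0 sf]; have oU := @cimage_open _ _ M p W oW.
have z0 y : U y -> r <= `|y - y0| -> f (cinv p y) * density y = 0.
  by move=> Uy yr; rewrite chart_supp_inv // mul0r.
apply: zext_test_fun => // k.
by apply: Ck_on_mul; [|exact: sf|exact: density_smooth].
Qed.

Lemma real_test_lin f g c : real_test f -> real_test g -> real_test (fun x => f x + c * g x).
Proof.
move=> [f0 sf] [g0 sg]; have oU := @cimage_open _ _ M p W oW; split.
  by move=> x H; rewrite f0 // g0 // mulr0 addr0.
by move=> k; apply: Ck_on_add; [|exact: sf|apply: Ck_on_mul; [|exact: Ck_on_cst|exact: sg]].
Qed.

Lemma vol_lin f g c : real_test f -> real_test g ->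
  \int[vol]_x (f x + c * g x : R) = \int[vol]_x (f x : R) + c * \int[vol]_x (g x : R).
Proof.
move=> tf tg; have tfg := real_test_lin c tf tg.
rewrite !vol_real // -(integralRn_lin _ (real_zext_test tf) (real_zext_test tg)).
congr integralRn; apply: funext => y; rewrite /zext; case: asboolP => _; last by rewrite mulr0 addr0.
by rewrite mulrDl mulrA.
Qed.

Lemma vol_gt0 f : real_test f -> (forall x, 0 <= f x) -> (exists2 x, cdom p x & 0 < f x) -> 0 < \int[vol]_x (f x : R).
Proof.
move=> tf fp [x px fx]; rewrite vol_real //.
have Ux : U (cmap p x).
  apply: ballU; rewrite leNgt; apply/negP => rx.
  have [f0 _] := tf; have := fx; rewrite f0 ?ltxx // => -[_] /(lt_trans rx); rewrite ltxx //.
apply: (integralRn_gt0 (y0 := cmap p x) (real_zext_test tf)) => [y|].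
  by rewrite /zext; case: asboolP => // Uy; rewrite mulr_ge0 // ltW // density_gt0.
by rewrite zextE // man_cmapK // mulr_gt0 // density_gt0.
Qed.

Lemma vol_div f (Z : 'I_n -> 'rV[R]_n -> R) : real_test f -> (forall j, smooth_on U (Z j)) ->
  (forall j y, U y -> r <= `|y - y0| -> Z j y = 0) ->
  (forall y, U y -> f (cinv p y) * density y = \sum_j pderiv j (Z j) y) ->
  \int[vol]_x (f x : R) = 0.
Proof.
move=> tf sZ Z0 fZ; rewrite vol_real //; have oU := @cimage_open _ _ M p W oW.
have sz j := zext_smooth (sZ j) (Z0 j).
have tz j := zext_test_fun (sZ j) (Z0 j).
have pout j y : r < `|y - y0| -> pderiv j (zext (Z j)) y = 0.
  move=> yr; rewrite (@pderiv_ext _ _ chart_out _ (fun=> 0) j y chart_out_open) //.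
    by rewrite /pderiv derive_cst.
  by move=> z /ltW zr; rewrite zext_out //; exact: Z0.
have pz j y : U y -> pderiv j (zext (Z j)) y = pderiv j (Z j) y.
  by move=> Uy; apply: (pderiv_ext j oU) => // z Uz; rewrite zextE.
have tp j : test_fun (`|y0| + r) (pderiv j (zext (Z j))).
  apply: test_fun_out => [y|y]; last exact: pout.
  by have [_ /(_ j)[_ [H _]]] := sz j 1; exact: H.
have dz j y : derivable (zext (Z j)) y (delta_mx 0 j : 'rV[R]_n).
  by have [_ /(_ j)[H _]] := sz j 1; exact: H.
have -> : zext (fun y => f (cinv p y) * density y) = fun y => \sum_j pderiv j (zext (Z j)) y.
  apply: funext => y; rewrite /zext; case: asboolP => Uy.
    by rewrite fZ //; apply: eq_bigr => j _; rewrite pz.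
  rewrite big1 // => j _; apply: pout; rewrite ltNge; apply/negP => yr; exact: Uy (ballU yr).
have [] := @integralRn_sum0 _ (`|y0| + r) _ _ (index_enum 'I_n) (fun j => pderiv j (zext (Z j))) _ tp => //.
- by rewrite ltr_wpDl.
- by move=> j; exact: integralRn_pderiv (tz j) (tp j) (dz j).
Qed.

Lemma chart_test_Re F : chart_test F -> real_test (fun x => complex.Re (F x)).
Proof. by move=> [F0 [sF _]]; split=> // x H; rewrite F0. Qed.

Lemma chart_test_Im F : chart_test F -> real_test (fun x => complex.Im (F x)).
Proof. by move=> [F0 [_ sF]]; split=> // x H; rewrite F0. Qed.

Lemma chart_test_lin F G c : chart_test F -> chart_test G -> chart_test (fun x => F x + c * G x).
Proof.
move=> [F0 sF] [G0 sG]; have oU := @cimage_open _ _ M p W oW; split.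
  by move=> x H; rewrite F0 // G0 // mulr0 addr0.
by apply: csmooth_add => //; apply: csmooth_mul => //; exact: csmooth_cst.
Qed.

Lemma cintegral_lin F G c : chart_test F -> chart_test G ->
  cintegral vol (fun x => F x + c * G x) = cintegral vol F + c * cintegral vol G.
Proof.
move=> tF tG; have rF := chart_test_Re tF; have iF := chart_test_Im tF.
have rG := chart_test_Re tG; have iG := chart_test_Im tG.
apply: complexE; rewrite [RHS](ReD, ImD) /= (ReM, ImM) /=.
  rewrite (_ : (fun x => _) = fun x => complex.Re (F x) + complex.Re c * complex.Re (G x) + (- complex.Im c) * complex.Im (G x)).
    rewrite (vol_lin _ (real_test_lin _ rF rG) iG) (vol_lin _ rF rG) mulNr addrA //.
  by apply: funext => x; rewrite ReD ReM mulNr addrA.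
rewrite (_ : (fun x => _) = fun x => complex.Im (F x) + complex.Re c * complex.Im (G x) + complex.Im c * complex.Re (G x)).
  by rewrite (vol_lin _ (real_test_lin _ iF iG) rG) (vol_lin _ iF iG) addrA.
by apply: funext => x; rewrite ImD ImM addrA.
Qed.

Lemma cintegral_eq0 F : chart_test F -> (forall x, 0 <= F x) -> cintegral vol F = 0 -> forall x, F x = 0.
Proof.
move=> tF Fp F0; have FR x : F x = Complex (complex.Re (F x)) 0.
  by apply: complexE => //=; have := Fp x; case: (F x) => a b; rewrite lecE /= => /andP[/eqP].
have Rp x : 0 <= complex.Re (F x).
  by have := Fp x; case: (F x) => a b; rewrite lecE /= => /andP[].
move=> x; have [px|npx] := pselect (cdom p x); last by apply: tF.1 => -[].
rewrite FR; suff -> : complex.Re (F x) = 0 by [].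
apply/eqP; have := Rp x; rewrite le_eqVlt eq_sym => /orP[//|xp].
have := vol_gt0 (chart_test_Re tF) Rp (ex_intro2 _ _ x px xp).
by have := f_equal (@complex.Re R) F0; rewrite /= => ->; rewrite ltxx.
Qed.

Lemma cintegral_div F (Z : 'I_n -> 'rV[R]_n -> C) : chart_test F -> (forall j, csmooth_on U (Z j)) ->
  (forall j y, U y -> r <= `|y - y0| -> Z j y = 0) ->
  (forall y, U y -> F (cinv p y) * Complex (density y) 0 = \sum_j cpderiv j (Z j) y) ->
  cintegral vol F = 0.
Proof.
move=> tF sZ Z0 FZ; apply: complexE => /=.
- apply: (@vol_div _ (fun j y => complex.Re (Z j y)) (chart_test_Re tF)) => [j|j y Uy yr|y Uy].
  + by have [] := sZ j.
  + by rewrite Z0.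
  + by have := f_equal (@complex.Re R) (FZ y Uy); rewrite ReM re_sum /= mulr0 subr0.
- apply: (@vol_div _ (fun j y => complex.Im (Z j y)) (chart_test_Im tF)) => [j|j y Uy yr|y Uy].
  + by have [] := sZ j.
  + by rewrite Z0.
  + by have := f_equal (@complex.Im R) (FZ y Uy); rewrite ImM im_sum /= mulr0 add0r.
Qed.

End ChartIntegral.

(** * The divergence identity *)

Section ParallelTensor.
Context {R : realType} {m : nat} {rho : 'I_m -> int} (V : unirrep (R := R) rho).
Local Notation C := R[i].
Local Notation n := (m.*2).
Local Notation d := (rdim V).
Variable q : nat.
Local Notation ep := (epow (pi_e V) q).

Let cjM (a b : C) : Num.conj (a * b) = Num.conj a * Num.conj b.
Proof. exact: rmorphM. Qed.

Let cj_sum I (r : seq I) (F : I -> C) : Num.conj (\sum_(i <- r) F i) = \sum_(i <- r) Num.conj (F i).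
Proof. exact: rmorph_sum. Qed.

Lemma rdiff_pi_e_bracket (X : 'M[C]_m) a b : rdiff V X *m pi_e V a b - pi_e V a b *m rdiff V X =
  \sum_c X c a *: pi_e V c b - \sum_c X b c *: pi_e V a c.
Proof.
rewrite -rdiff_bracket linearB /=; congr (_ - _).
  transitivity (rdiff V (\sum_c X c a *: delta_mx c b)); last first.
    by rewrite linear_sum; apply: eq_bigr => c _; exact: linearZZ.
  congr (rdiff V _); apply/matrixP => i j; rewrite mxE summxE (bigD1 a) //= big1 ?addr0 => [|l la]; last first.
    by rewrite mxE (negbTE la) mulr0.
  rewrite (bigD1 i) //= big1 ?addr0 => [|l la]; last by rewrite !mxE eq_sym (negbTE la) mulr0.
  by rewrite !mxE !eqxx.
transitivity (rdiff V (\sum_c X b c *: delta_mx a c)); last first.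
  by rewrite linear_sum; apply: eq_bigr => c _; exact: linearZZ.
congr (rdiff V _); apply/matrixP => i j; rewrite mxE summxE (bigD1 b) //= big1 ?addr0 => [|l la]; last first.
  by rewrite mxE (negbTE la) andbF mul0r.
rewrite (bigD1 j) //= big1 ?addr0 => [|l la]; last by rewrite !mxE [j == l]eq_sym (negbTE la) andbF mulr0.
by rewrite !mxE !eqxx andbT mulrC.
Qed.

Lemma epow_bracket (X : 'M[C]_m) a b : rdiff V X *m ep a b - ep a b *m rdiff V X =
  \sum_c X c a *: ep c b - \sum_c X b c *: ep a c.
Proof.
elim: q a b => [|r IH] a b.
  rewrite /= (_ : (a == b)%:R = (a == b)%:R *: (1%:M : 'M[C]_d)); last first.
    by case: (a == b); rewrite ?scale1r ?scale0r.
  rewrite -scalemxAr mulmx1 -scalemxAl mul1mx subrr; apply/esym/eqP; rewrite subr_eq0; apply/eqP.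
  rewrite (bigD1 b) //= [RHS](bigD1 a) //= !eqxx !big1 // => c /negbTE cb; first by rewrite eq_sym cb scaler0.
  by rewrite cb scaler0.
have gen (e E : 'M[C]_d) (Y : 'M[C]_d) : Y *m (e *m E) - e *m E *m Y = (Y *m e - e *m Y) *m E + e *m (Y *m E - E *m Y).
  by rewrite mulmxBl mulmxBr !mulmxA addrA subrK.
have epS a' b' : epow (pi_e V) r.+1 a' b' = \sum_i pi_e V a' i *m epow (pi_e V) r i b' by [].
rewrite epS mulmx_sumr mulmx_suml -sumrB.
transitivity (\sum_c X c a *: (\sum_i pi_e V c i *m epow (pi_e V) r i b) -
  \sum_c X b c *: (\sum_i pi_e V a i *m epow (pi_e V) r i c)) => //.
transitivity (\sum_i ((\sum_c X c a *: pi_e V c i) *m epow (pi_e V) r i b -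
    (\sum_c X i c *: pi_e V a c) *m epow (pi_e V) r i b +
    (pi_e V a i *m (\sum_c X c i *: epow (pi_e V) r c b) - pi_e V a i *m (\sum_c X b c *: epow (pi_e V) r i c)))).
  by apply: eq_bigr => i _; rewrite gen rdiff_pi_e_bracket IH mulmxBl mulmxBr.
rewrite big_split /= !sumrB.
have -> : \sum_i (\sum_c X c a *: pi_e V c i) *m epow (pi_e V) r i b =
    \sum_c X c a *: \sum_i pi_e V c i *m epow (pi_e V) r i b.
  under eq_bigr do rewrite mulmx_suml.
  by rewrite exchange_big; apply: eq_bigr => c _; rewrite scaler_sumr; apply: eq_bigr => i _; rewrite -scalemxAl.
have -> : \sum_i (\sum_c X i c *: pi_e V a c) *m epow (pi_e V) r i b =
    \sum_i pi_e V a i *m (\sum_c X c i *: epow (pi_e V) r c b).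
  under eq_bigr do rewrite mulmx_suml.
  under [RHS]eq_bigr do rewrite mulmx_sumr.
  rewrite exchange_big; apply: eq_bigr => c _; apply: eq_bigr => i _.
  by rewrite -scalemxAl -scalemxAr.
have -> : \sum_i pi_e V a i *m (\sum_c X b c *: epow (pi_e V) r i c) =
    \sum_c X b c *: \sum_i pi_e V a i *m epow (pi_e V) r i c.
  under eq_bigr do rewrite mulmx_sumr.
  by rewrite exchange_big; apply: eq_bigr => c _; rewrite scaler_sumr; apply: eq_bigr => i _; rewrite -scalemxAr.
by rewrite addrA subrK.
Qed.

(** The tensor M^{ji} polarised in the frame, so that the product rule can differentiate one frame
    factor at a time. *)
Definition ptensor (A B : 'M[C]_(m, n)) j i : 'M[C]_d :=
  \sum_a \sum_b (Num.conj (A a j) * B b i) *: ep a b.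

Lemma ptensorDl A A' B j i : ptensor (A + A') B j i = ptensor A B j i + ptensor A' B j i.
Proof.
rewrite /ptensor -big_split; apply: eq_bigr => a _ /=; rewrite -big_split; apply: eq_bigr => b _ /=.
by rewrite mxE rmorphD mulrDl scalerDl.
Qed.

Lemma ptensorDr A B B' j i : ptensor A (B + B') j i = ptensor A B j i + ptensor A B' j i.
Proof.
rewrite /ptensor -big_split; apply: eq_bigr => a _ /=; rewrite -big_split; apply: eq_bigr => b _ /=.
by rewrite mxE mulrDr scalerDl.
Qed.

Lemma ptensorMl A B (D : 'M[C]_n) j i : ptensor (A *m D) B j i = \sum_l Num.conj (D l j) *: ptensor A B l i.
Proof.
transitivity (\sum_a \sum_b \sum_l Num.conj (D l j) *: ((Num.conj (A a l) * B b i) *: ep a b)).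
  apply: eq_bigr => a _; apply: eq_bigr => b _; rewrite mxE cj_sum mulr_suml scaler_suml.
  by apply: eq_bigr => l _; rewrite cjM scalerA; congr (_ *: _); rewrite mulrAC mulrC.
under eq_bigr do rewrite exchange_big.
rewrite exchange_big; apply: eq_bigr => l _; rewrite scaler_sumr; apply: eq_bigr => a _.
by rewrite scaler_sumr.
Qed.

Lemma ptensorMr A B (D : 'M[C]_n) j i : ptensor A (B *m D) j i = \sum_l D l i *: ptensor A B j l.
Proof.
transitivity (\sum_a \sum_b \sum_l D l i *: ((Num.conj (A a j) * B b l) *: ep a b)).
  apply: eq_bigr => a _; apply: eq_bigr => b _; rewrite mxE mulr_sumr scaler_suml.
  by apply: eq_bigr => l _; rewrite scalerA; congr (_ *: _); rewrite mulrA mulrC.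
under eq_bigr do rewrite exchange_big.
rewrite exchange_big; apply: eq_bigr => l _; rewrite scaler_sumr; apply: eq_bigr => a _.
by rewrite scaler_sumr.
Qed.

(** By [epow_bracket] a skew-Hermitian rotation of the frame has the effect of a commutator with
    [rdiff V X]. This is why N is parallel. *)
Lemma ptensor_rotate (X : 'M[C]_m) S j i : X ^t* = - X ->
  ptensor (X^T *m S) S j i + ptensor S (X^T *m S) j i =
  - (rdiff V X *m ptensor S S j i - ptensor S S j i *m rdiff V X).
Proof.
move=> Xs; have Xc a c : Num.conj (X c a) = - X a c.
  by have := congr1 (fun Y : 'M[C]_m => Y a c) Xs; rewrite !mxE.
have -> : rdiff V X *m ptensor S S j i - ptensor S S j i *m rdiff V X =
    \sum_a \sum_b (Num.conj (S a j) * S b i) *: (\sum_c X c a *: ep c b - \sum_c X b c *: ep a c).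
  rewrite /ptensor mulmx_sumr mulmx_suml -sumrB; apply: eq_bigr => a _.
  rewrite mulmx_sumr mulmx_suml -sumrB; apply: eq_bigr => b _.
  by rewrite -scalemxAr -scalemxAl -scalerBr epow_bracket.
have E1 : ptensor (X^T *m S) S j i = - \sum_a \sum_b (Num.conj (S a j) * S b i) *: \sum_c X c a *: ep c b.
  transitivity (\sum_a \sum_b \sum_c (- (Num.conj (S c j) * S b i * X a c)) *: ep a b).
    apply: eq_bigr => a _; apply: eq_bigr => b _; rewrite mxE cj_sum mulr_suml scaler_suml.
    apply: eq_bigr => c _; rewrite cjM [X^T _ _]mxE Xc mulNr mulNr; congr ((- _) *: _).
    by rewrite -mulrA mulrC.
  rewrite -sumrN; under eq_bigr do rewrite exchange_big.
  rewrite exchange_big; apply: eq_bigr => c _; rewrite -sumrN exchange_big; apply: eq_bigr => b _ /=.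
  by rewrite scaler_sumr -sumrN; apply: eq_bigr => a _; rewrite scalerA scaleNr.
have E2 : ptensor S (X^T *m S) j i = \sum_a \sum_b (Num.conj (S a j) * S b i) *: \sum_c X b c *: ep a c.
  transitivity (\sum_a \sum_b \sum_c ((Num.conj (S a j) * S c i * X c b)) *: ep a b).
    apply: eq_bigr => a _; apply: eq_bigr => b _; rewrite mxE mulr_sumr scaler_suml.
    by apply: eq_bigr => c _; rewrite [X^T _ _]mxE; congr (_ *: _); rewrite mulrCA mulrC.
  apply: eq_bigr => a _; rewrite exchange_big; apply: eq_bigr => c _.
  by rewrite scaler_sumr; apply: eq_bigr => b _; rewrite scalerA.
rewrite E1 E2 addrC -opprB; congr (- _); rewrite -sumrB; apply: eq_bigr => a _.
by rewrite -sumrB; apply: eq_bigr => b _; rewrite scalerBr.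
Qed.

End ParallelTensor.
Section DensityDerivative.
Context {R : realType} {n : nat} (M : riemannian R n) (p : M).

(** Jacobi's formula together with metric compatibility: the two halves of the derivative of the
    metric have the same trace. *)
Lemma density_derive (y : 'rV[R]_n) k : (cmap p @` cdom p) y -> 0 < \det (gram p (cinv p y)) ->
  pderiv k (density p) y = density p y * \tr (christoffel p (cinv p y) k).
Proof.
move=> cy; have Uy : cimage p setT y by [].
have [px yE] := cimage_dom Uy; set x := cinv p y in px yE *; move=> d0.
have Gu : gram p x \in unitmx by exact: gram_unit.
have dG i j : is_derive y (delta_mx 0 k : 'rV[R]_n) (fun z => gram p (cinv p z) i j) (dgram p x k i j).
  apply: DeriveDef; last by rewrite /dgram /pderiv yE.
  have [H _] := @gram_smooth R n M p i j.
  have E : (fun y => complex.Re (cgram p (cinv p y) i j)) = fun y => gram p (cinv p y) i j.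
    by apply: funext => z; rewrite mxE.
  rewrite E in H; have [_ /(_ k)[h _]] := H 1; exact: h.
have DG : is_derive y (delta_mx 0 k : 'rV[R]_n) (fun z => \det (gram p (cinv p z)))
    (\tr ((\matrix_(i, j) dgram p x k i j) *m \adj (gram p x))).
  by apply: is_derive_det => i j; apply: is_derive_eq (dG i j) _; rewrite mxE.
have D := is_derive_comp1 DG (is_derive1_sqrt d0).
rewrite /pderiv; have [_ ->] := D; rewrite -/x.
have E1 : \matrix_(i, j) dgram p x k i j = christoffel p x k *m gram p x + gram p x *m (christoffel p x k)^T.
  have H := cchris_metric k px; rewrite mpderiv_toC -!toC_tr -!toC_mul -toC_add in H.
  by rewrite -(toC_inj H); apply/matrixP => i j; rewrite !mxE.
have E2 : \adj (gram p x) = \det (gram p x) *: invmx (gram p x).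
  by rewrite /invmx Gu scalerA mulfV ?scale1r // gt_eqF.
rewrite E1 E2 -scalemxAr mxtraceZ mulmxDl mulmxK // mxtraceD [X in _ + X]mxtrace_mulC mulmxA mulVmx // mul1mx mxtrace_tr.
rewrite /density -/x -{1}(sqr_sqrtr (ltW d0)); set t := Num.sqrt _.
have t0 : t != 0 by rewrite gt_eqF // sqrtr_gt0.
by field.
Qed.

End DensityDerivative.

(** * Covariant divergence of the field Z *)

Section WeakIdentity.
Context {R : realType} {m : nat} (M : kahler R m) {rho : 'I_m -> int} (V : unirrep (R := R) rho).
Implicit Types (p x : M) (W : set M) (s : M -> 'M[R[i]]_(m, m.*2)).
Local Notation C := R[i].
Local Notation n := (m.*2).
Local Notation d := (rdim V).
Implicit Types (phi : sect M d 1).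
Local Opaque frame_form vnabla vcomp cgram cchris gram christoffel jac cov loc.

Lemma mpderivN l a b (U : set 'rV[R]_l) (F : 'rV[R]_l -> 'M[C]_(a, b)) k y : msmooth_on U F -> U y ->
  mpderiv k (fun z => - F z) y = - mpderiv k F y.
Proof.
move=> sF Uy; have -> : (fun z => - F z) = fun z => (-1) *: F z by apply: funext => z; rewrite scaleN1r.
rewrite (mpderivZ k (csmooth_cst U (-1)) sF Uy) (is_cderive_pderiv (is_cderive_cst _ _ _)).
by rewrite scale0r add0r scaleN1r.
Qed.

Lemma cpderiv_hdot l a b (U : set 'rV[R]_l) (F G : 'rV[R]_l -> 'M[C]_(a, b)) k y : open U ->
  msmooth_on U F -> msmooth_on U G -> U y ->
  cpderiv k (fun z => hdot (F z) (G z)) y = hdot (mpderiv k F y) (G y) + hdot (F y) (mpderiv k G y).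
Proof.
move=> oU sF sG Uy; have sG' := msmooth_adj oU sG.
have D := msmooth_is_derive k (msmooth_mul oU sF sG') Uy.
apply: is_cderive_pderiv; apply: is_cderive_eq.
  exact: (@is_cderive_sum _ _ y (delta_mx 0 k : 'rV[R]_l) _ (index_enum 'I_a) _ _ (fun i => D i i)).
rewrite /hdot -mxtraceD -(mpderiv_adj k sG Uy); congr (\tr _).
exact: (mpderivM k sF sG' Uy).
Qed.

Lemma csmooth_hdot l a b (U : set 'rV[R]_l) (F G : 'rV[R]_l -> 'M[C]_(a, b)) : open U ->
  msmooth_on U F -> msmooth_on U G -> csmooth_on U (fun z => hdot (F z) (G z)).
Proof.
move=> oU sF sG; have sM := msmooth_mul oU sF (msmooth_adj oU sG).
by apply: csmooth_sum => // i; exact: sM.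
Qed.

Lemma ptensor_smooth q l (U : set 'rV[R]_l) (F : 'rV[R]_l -> 'M[C]_(m, n)) j i : open U -> msmooth_on U F ->
  msmooth_on U (fun y => ptensor V q (F y) (F y) j i).
Proof.
move=> oU sF; apply: msmooth_sum => // a; apply: msmooth_sum => // b.
apply: msmooth_scale => //; last exact: msmooth_cst.
by apply: csmooth_mul => //; apply: csmooth_conj.
Qed.

Lemma ptensor_mpderiv q l (U : set 'rV[R]_l) (F : 'rV[R]_l -> 'M[C]_(m, n)) k y j i : open U ->
  msmooth_on U F -> U y ->
  mpderiv k (fun y => ptensor V q (F y) (F y) j i) y =
  ptensor V q (mpderiv k F y) (F y) j i + ptensor V q (F y) (mpderiv k F y) j i.
Proof.
move=> oU sF Uy.
have sc a b : csmooth_on U (fun z => Num.conj (F z a j) * F z b i).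
  by apply: csmooth_mul => //; apply: csmooth_conj.
have st a b : msmooth_on U (fun z => (Num.conj (F z a j) * F z b i) *: epow (pi_e V) q a b).
  by apply: msmooth_scale => //; exact: msmooth_cst.
have D a b := csmooth_is_derive k (sF a b) Uy.
rewrite /ptensor (mpderiv_sum _ _ _ Uy); last by move=> a; apply: msmooth_sum.
rewrite -big_split; apply: eq_bigr => a _ /=; rewrite (mpderiv_sum _ _ _ Uy) // -big_split; apply: eq_bigr => b _ /=.
rewrite (mpderivZ k (sc a b) (msmooth_cst _ _) Uy) mpderiv_cst scaler0 addr0 -scalerDl; congr (_ *: _).
by rewrite (is_cderive_pderiv (is_cderiveM (is_cderiveJ (D a j)) (D b i))) !mpderivE.
Qed.

Section Field.
Context {p : M} {s : M -> 'M[C]_(m, n)} {W : set M} (q : nat).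
Hypotheses (oW : open W) (Wp : W `<=` cdom p) (ls : local_frame W s).
Let oU := cimage_open (p := p) oW.
Let sS := frame_smooth oW Wp ls.

Lemma vcomp_mpderiv x k : W x -> mpderiv k (fun y => vcomp p s (cinv p y)) (cmap p x) =
  (frame_form p s x k)^T *m vcomp p s x - vcomp p s x *m cchris p x k.
Proof. by move=> Wx; rewrite (frame_formK k oW Wx Wp ls) vnablaE addrK. Qed.

Definition ftensor x j i : 'M[C]_d := ptensor V q (vcomp p s x) (vcomp p s x) j i.

(** The tensor is parallel: the derivative of the frame consists of a rotation by the connection
    form, which gives the commutator, and of Christoffel terms, one for each index. *)
Lemma ftensor_derive x k j i : W x ->
  mpderiv k (fun y => ftensor (cinv p y) j i) (cmap p x) =
  - (rdiff V (frame_form p s x k) *m ftensor x j i - ftensor x j i *m rdiff V (frame_form p s x k))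
  - (\sum_l cchris p x k l j *: ftensor x l i + \sum_l cchris p x k l i *: ftensor x j l).
Proof.
move=> Wx; have px := Wp Wx; have Ux : cimage p W (cmap p x) by exact: cimage_mem.
have gen (P Q : 'M[C]_(m, n)) (X : 'M[C]_m) (G : 'M[C]_n) : P = X^T *m Q - Q *m G -> X ^t* = - X -> cjmx G = G ->
    ptensor V q P Q j i + ptensor V q Q P j i =
    - (rdiff V X *m ptensor V q Q Q j i - ptensor V q Q Q j i *m rdiff V X)
    - (\sum_l G l j *: ptensor V q Q Q l i + \sum_l G l i *: ptensor V q Q Q j l).
  move=> -> Xs Gr; rewrite -(ptensor_rotate V q Q j i Xs) -mulmxN ptensorDl ptensorDr addrACA; congr (_ + _).
  rewrite ptensorMl ptensorMr opprD -!sumrN; congr (_ + _); apply: eq_bigr => l _; rewrite -scaleNr; congr (_ *: _).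
    by rewrite -[in RHS]Gr !mxE rmorphN.
  by rewrite !mxE.
rewrite /ftensor (ptensor_mpderiv q k j i oU sS Ux) man_cmapK //.
apply: gen; first exact: vcomp_mpderiv.
  exact: (frame_form_skew k oW Wx Wp ls).
by apply: cjmx_toC.
Qed.

(* The field N of the header. *)
Definition stensor x j i : 'M[C]_d := ftensor x j i - ftensor x i j.

Lemma stensor_skew x j i : stensor x j i = - stensor x i j.
Proof. by rewrite /stensor opprB. Qed.

Lemma stensor_smooth j i : msmooth_on (cimage p W) (fun y => stensor (cinv p y) j i).
Proof.
by apply: msmooth_add => //; [|apply: msmooth_opp => //]; apply: ptensor_smooth.
Qed.

Lemma stensor_derive x k j i : W x ->
  mpderiv k (fun y => stensor (cinv p y) j i) (cmap p x) =
  - (rdiff V (frame_form p s x k) *m stensor x j i - stensor x j i *m rdiff V (frame_form p s x k))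
  - (\sum_l cchris p x k l j *: stensor x l i + \sum_l cchris p x k l i *: stensor x j l).
Proof.
move=> Wx; have px := Wp Wx; have Ux : cimage p W (cmap p x) by exact: cimage_mem.
have st j' i' : msmooth_on (cimage p W) (fun y => ftensor (cinv p y) j' i') by apply: ptensor_smooth.
rewrite /stensor (mpderivD k (st j i) (msmooth_opp oU (st i j)) Ux).
have -> : mpderiv k (fun y => - ftensor (cinv p y) i j) (cmap p x) = - mpderiv k (fun y => ftensor (cinv p y) i j) (cmap p x).
  exact: (mpderivN k (st i j) Ux).
rewrite !(ftensor_derive _ _ _ Wx).
have E c : \sum_l cchris p x k l c *: (ftensor x l i - ftensor x i l) = \sum_l cchris p x k l c *: ftensor x l i - \sum_l cchris p x k l c *: ftensor x i l.
  by rewrite -sumrB; apply: eq_bigr => l _; rewrite scalerBr.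
have E' c : \sum_l cchris p x k l c *: (ftensor x j l - ftensor x l j) = \sum_l cchris p x k l c *: ftensor x j l - \sum_l cchris p x k l c *: ftensor x l j.
  by rewrite -sumrB; apply: eq_bigr => l _; rewrite scalerBr.
rewrite E E'.
have gen (X A B a1 a2 b1 b2 : 'M[C]_d) : - (X *m A - A *m X) - (a1 + a2) - (- (X *m B - B *m X) - (b1 + b2)) =
  - (X *m (A - B) - (A - B) *m X) - ((a1 - b2) + (a2 - b1)).
  rewrite mulmxBr mulmxBl; move: (X *m A) (A *m X) (X *m B) (B *m X) => x1 x2 x3 x4.
  by apply/matrixP => a b; rewrite !mxE; ring.
exact: gen.
Qed.

Section Flux.
Context {phi : sect M d 1}.
Hypothesis Gp : Gamma_on W phi.

(* The vector field Z of the header is [hdot phi' (flux x j)]. *)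
Definition flux x j : 'cV[C]_d := \sum_i stensor x j i *m cov p s phi x i.

Lemma flux_smooth j : msmooth_on (cimage p W) (fun y => flux (cinv p y) j).
Proof.
apply: msmooth_sum => // i; apply: msmooth_mul => //; first exact: stensor_smooth.
exact: (cov_smooth oW Gp Wp ls).
Qed.

Definition dflux x j : 'cV[C]_d :=
  mpderiv j (fun y => flux (cinv p y) j) (cmap p x) + rdiff V (frame_form p s x j) *m flux x j.

Lemma sum_sym_skew (a : 'I_n -> 'I_n -> C) (N : 'I_n -> 'I_n -> 'M[C]_d) : (forall j l, a j l = a l j) ->
  (forall j l, N j l = - N l j) -> \sum_j \sum_l a j l *: N j l = 0.
Proof.
move=> ha hN; have E : \sum_j \sum_l a j l *: N j l = - \sum_j \sum_l a j l *: N j l.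
  rewrite [LHS]exchange_big -sumrN; apply: eq_bigr => j _; rewrite -sumrN; apply: eq_bigr => l _.
  by rewrite ha hN scalerN.
have : \sum_j \sum_l a j l *: N j l + \sum_j \sum_l a j l *: N j l = 0 by rewrite {1}E addNr.
by rewrite -mulr2n -scaler_nat => /eqP; rewrite scaler_eq0 pnatr_eq0 => /eqP.
Qed.

(** In the divergence the Christoffel term of the second index pairs symmetric symbols with the skew
    N and vanishes. The first index leaves the traces of the symbols, which the derivative of the
    density will cancel. *)
Lemma christoffel_contract (N : 'I_n -> 'I_n -> 'M[C]_d) (Ch : 'I_n -> 'M[C]_n) (c A : 'I_n -> 'cV[C]_d) :
  (forall k j l, Ch k j l = Ch j k l) -> (forall j l, N j l = - N l j) ->
  \sum_j (A j - (\sum_i (\sum_l Ch j l j *: N l i) *m c i + \sum_i (\sum_l Ch j l i *: N j l) *m c i)) =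
  - (\sum_l \tr (Ch l) *: \sum_i N l i *m c i) + \sum_j A j.
Proof.
move=> Cs Ns; rewrite sumrB [LHS]addrC big_split /=; congr (- _ + _).
have -> : \sum_j \sum_i (\sum_l Ch j l i *: N j l) *m c i = 0.
  by rewrite exchange_big big1 // => i _; rewrite -mulmx_suml sum_sym_skew ?mul0mx.
rewrite addr0; transitivity (\sum_j \sum_l Ch j l j *: \sum_i N l i *m c i).
  apply: eq_bigr => j _; under eq_bigr do rewrite mulmx_suml.
  rewrite exchange_big; apply: eq_bigr => l _; rewrite scaler_sumr; apply: eq_bigr => i _.
  by rewrite scalemxAl.
rewrite exchange_big; apply: eq_bigr => l _; rewrite -scaler_suml; congr (_ *: _).
by apply: eq_bigr => j _; exact: Cs.
Qed.

(** Writing N as a difference antisymmetrises the second derivatives, and the Ricci identity turns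
    them into R^q. *)
Lemma flux_div x : W x -> \sum_j dflux x j =
  - (\sum_l \tr (cchris p x l) *: flux x l) - Rq M V q phi x (s x).
Proof.
move=> Wx; have px := Wp Wx; have Ux : cimage p W (cmap p x) by exact: cimage_mem.
have sc := cov_smooth oW Gp Wp ls.
have D j : dflux x j = \sum_i stensor x j i *m cov2 (p := p) (s := s) (phi := phi) x j i -
    (\sum_i (\sum_l cchris p x j l j *: stensor x l i) *m cov p s phi x i +
     \sum_i (\sum_l cchris p x j l i *: stensor x j l) *m cov p s phi x i).
  rewrite /dflux /flux (mpderiv_sum _ _ _ Ux) => [|i]; last exact: msmooth_mul (stensor_smooth j i) (sc i).
  rewrite mulmx_sumr -big_split -big_split -sumrB; apply: eq_bigr => i _ /=.
  rewrite (mpderivM j (stensor_smooth j i) (sc i) Ux) (stensor_derive _ _ _ Wx) man_cmapK // /cov2.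
  have gen (X A P Q : 'M[C]_d) (c e : 'cV[C]_d) : (- (X *m A - A *m X) - (P + Q)) *m c + A *m e + X *m (A *m c) =
      A *m (e + X *m c) - (P *m c + Q *m c).
    rewrite mulmxDr !mulmxDl !mulNmx !mulmxDl !mulNmx !mulmxA.
    move: (X *m A *m c) (A *m X *m c) (P *m c) (Q *m c) (A *m e) => x1 x2 x3 x4 x5.
    by apply/matrixP => a b; rewrite !mxE; ring.
  exact: gen.
apply: (etrans (eq_bigr _ (fun j _ => D j))); apply: (etrans (christoffel_contract _ _ _ _)).
- by move=> k j l; exact: cchris_sym.
- by move=> j l; exact: stensor_skew.
congr (_ + _); rewrite (Rq_sumE q oW Gp Wp ls Wx).
pose c2 := cov2 (p := p) (s := s) (phi := phi) x.
have -> : \sum_k \sum_l epow (pi_e V) q l k *m (\sum_i \sum_j (vcomp p s x k i * Num.conj (vcomp p s x l j)) *: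
       (rdiff V (curv_form p s x i j) *m phi x (s x))) = \sum_i \sum_j ftensor x j i *m (c2 i j - c2 j i).
  have -> : \sum_i \sum_j ftensor x j i *m (c2 i j - c2 j i) =
     \sum_i \sum_j ftensor x j i *m (rdiff V (curv_form p s x i j) *m phi x (s x)).
    by apply: eq_bigr => i _; apply: eq_bigr => j _; rewrite (ricci_identity oW Gp Wp ls i j Wx).
  have gen (S : 'M[C]_(m, n)) (Q : 'I_n -> 'I_n -> 'cV[C]_d) :
      \sum_k \sum_l epow (pi_e V) q l k *m (\sum_i \sum_j (S k i * Num.conj (S l j)) *: Q i j) =
      \sum_i \sum_j ptensor V q S S j i *m Q i j.
    transitivity (\sum_k \sum_l \sum_i \sum_j (S k i * Num.conj (S l j)) *: (epow (pi_e V) q l k *m Q i j)).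
      apply: eq_bigr => k _; apply: eq_bigr => l _; rewrite mulmx_sumr; apply: eq_bigr => i _.
      by rewrite mulmx_sumr; apply: eq_bigr => j _; rewrite scalemxAr.
    transitivity (\sum_i \sum_j \sum_l \sum_k (S k i * Num.conj (S l j)) *: (epow (pi_e V) q l k *m Q i j)).
      under eq_bigr do rewrite exchange_big /=.
      rewrite exchange_big; apply: eq_bigr => i _ /=.
      under eq_bigr do rewrite exchange_big /=.
      rewrite exchange_big; apply: eq_bigr => j _ /=.
      by rewrite exchange_big.
    apply: eq_bigr => i _; apply: eq_bigr => j _; rewrite /ptensor mulmx_suml; apply: eq_bigr => l _.
    by rewrite mulmx_suml; apply: eq_bigr => k _; rewrite -scalemxAl mulrC.
  exact: gen.
have gen (N : 'I_n -> 'I_n -> 'M[C]_d) (c : 'I_n -> 'I_n -> 'cV[C]_d) :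
    \sum_j \sum_i (N j i - N i j) *m c j i = - \sum_i \sum_j N j i *m (c i j - c j i).
  rewrite -sumrN; under eq_bigr do under eq_bigr do rewrite mulmxBl.
  under [RHS]eq_bigr do rewrite -sumrN.
  under [RHS]eq_bigr do under eq_bigr do rewrite mulmxBr opprB.
  under eq_bigr do rewrite sumrB; under [RHS]eq_bigr do rewrite sumrB.
  by rewrite !sumrB; congr (_ - _); rewrite exchange_big.
exact: gen.
Qed.

Section Pointwise.
Context {phi' : sect M d 1}.
Hypothesis Gp' : Gamma_on W phi'.
Local Notation S x := (vcomp p s x).

Lemma hdot_cols a b (A B : 'M[C]_(a, b)) : hdot A B = \sum_k hdot (col k A) (col k B).
Proof.
rewrite hdotE exchange_big; apply: eq_bigr => k _; rewrite hdotE; apply: eq_bigr => i _.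
by rewrite big_ord1 !mxE.
Qed.

Lemma col_blockop (F : 'I_m -> 'I_m -> 'M[C]_d) (B : 'M[C]_(d, m)) k :
  col k (blockop F B) = \sum_l F k l *m col l B.
Proof.
have dE (Y : 'M[C]_(d, m)) l k' : col k (Y *m delta_mx l k') = if k' == k then col l Y else 0.
  apply/matrixP => a b; rewrite !mxE (bigD1 l) //= big1 ?addr0 => [|c cl].
    by rewrite !mxE eqxx eq_sym; case: (k' == k); rewrite ?mulr1 ?mulr0 !mxE.
  by rewrite mxE (negbTE cl) mulr0.
transitivity (\sum_k' \sum_l (if k' == k then F k' l *m col l B else 0)).
  rewrite linear_sum; apply: eq_bigr => k' _; rewrite linear_sum; apply: eq_bigr => l _ /=.
  by rewrite dE; case: (k' == k) => //; rewrite !colE mulmxA.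
rewrite (bigD1 k) //= [X in _ + X]big1 ?addr0 => [|k' /negbTE k'k]; first by rewrite eqxx.
by rewrite big1 // => l _; rewrite k'k.
Qed.

Lemma hdot_blockop (A B : 'M[C]_(d, m)) F :
  hdot A (blockop F B) = \sum_k \sum_l hdot (col k A) (F k l *m col l B).
Proof. by rewrite hdot_cols; apply: eq_bigr => k _; rewrite col_blockop hdot_sumr. Qed.

Lemma hdot_expand (K' K : 'M[C]_(d, n)) (A : 'M[C]_(n, m)) (F : 'I_m -> 'I_m -> 'M[C]_d) :
  hdot (K' *m A) (blockop F (K *m A)) =
  \sum_j \sum_i \sum_k \sum_l (A j k * Num.conj (A i l)) * hdot (col j K') (F k l *m col i K).
Proof.
have cE (L : 'M[C]_(d, n)) k : col k (L *m A) = \sum_j A j k *: col j L.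
  apply/matrixP => a b; rewrite !mxE summxE; apply: eq_bigr => j _; rewrite !mxE; exact: mulrC.
rewrite hdot_blockop.
transitivity (\sum_k \sum_l \sum_j \sum_i (A j k * Num.conj (A i l)) * hdot (col j K') (F k l *m col i K)).
  apply: eq_bigr => k _; apply: eq_bigr => l _; rewrite !cE hdot_suml; apply: eq_bigr => j _.
  rewrite mulmx_sumr hdot_sumr; apply: eq_bigr => i _.
  by rewrite hdotZl -scalemxAr hdotZr mulrA.
under eq_bigr do rewrite exchange_big /=.
rewrite exchange_big; apply: eq_bigr => j _ /=.
under eq_bigr do rewrite exchange_big /=.
by rewrite exchange_big.
Qed.

Lemma hdot_ptensor (c' c : 'cV[C]_d) (T : 'M[C]_(m, n)) j i :
  hdot c' (ptensor V q T T j i *m c) =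
  \sum_k \sum_l (T k j * Num.conj (T l i)) * hdot c' (epow (pi_e V) q k l *m c).
Proof.
rewrite /ptensor mulmx_suml hdot_sumr; apply: eq_bigr => k _.
rewrite mulmx_suml hdot_sumr; apply: eq_bigr => l _.
rewrite -scalemxAl hdotZr; congr (_ * _).
have cjM (a b : C) : Num.conj (a * b) = Num.conj a * Num.conj b by exact: rmorphM.
by rewrite cjM conjCK.
Qed.

(** Both pairings are expanded in real components. Passing to the conjugate frame and the transposed
    power exchanges j and i, so the difference is governed by N. *)
Lemma hdot_nabla_diff x : W x ->
  hdot (nabla10 M V phi' x (s x)) (blockop (epow (pi_e V) q) (nabla10 M V phi x (s x))) -
  hdot (nabla01 M V phi' x (s x)) (blockop (fun k l => epow (pi_e V) q l k) (nabla01 M V phi x (s x))) =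
  \sum_j hdot (cov p s phi' x j) (flux x j).
Proof.
move=> Wx; rewrite (nabla10E Gp oW Wx Wp ls) (nabla01E Gp oW Wx Wp ls).
rewrite (nabla10E Gp' oW Wx Wp ls) (nabla01E Gp' oW Wx Wp ls).
have gen (K' K : 'M[C]_(d, n)) (T : 'M[C]_(m, n)) :
    hdot (K' *m T^T) (blockop (epow (pi_e V) q) (K *m T^T)) -
    hdot (K' *m T ^t*) (blockop (fun k l => epow (pi_e V) q l k) (K *m T ^t*)) =
    \sum_j \sum_i hdot (col j K') ((ptensor V q T T j i - ptensor V q T T i j) *m col i K).
  have e1 j i : \sum_k \sum_l (T^T j k * Num.conj (T^T i l)) * hdot (col j K') (epow (pi_e V) q k l *m col i K) =
      hdot (col j K') (ptensor V q T T j i *m col i K).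
    by rewrite hdot_ptensor; apply: eq_bigr => k _; apply: eq_bigr => l _; rewrite !mxE.
  have e2 j i : \sum_k \sum_l ((T ^t*) j k * Num.conj ((T ^t*) i l)) * hdot (col j K') (epow (pi_e V) q l k *m col i K) =
      hdot (col j K') (ptensor V q T T i j *m col i K).
    rewrite hdot_ptensor; apply: (etrans (exchange_big _ _ _ _ _ _)); apply: eq_bigr => l _; apply: eq_bigr => k _.
    by rewrite !mxE conjCK [X in X * _]mulrC.
  apply: (etrans (f_equal2 (fun a b => a - b) (hdot_expand _ _ _ _) (hdot_expand _ _ _ _))).
  rewrite -sumrB; apply: eq_bigr => j _; rewrite -sumrB; apply: eq_bigr => i _.
  by apply: (etrans (f_equal2 (fun a b => a - b) (e1 j i) (e2 j i))); rewrite mulmxBl hdotBr.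
have cc f j : col j (covm p s f x) = cov p s f x j.
  by apply/matrixP => a b; rewrite !mxE (ord1 b).
apply: (etrans (gen _ _ _)); apply: eq_bigr => j _; rewrite cc /flux hdot_sumr.
by apply: eq_bigr => i _; rewrite cc.
Qed.

Definition flux_form (j : 'I_n) (y : 'rV[R]_n) : C :=
  Complex (density p y) 0 * hdot (loc s phi' p y) (flux (cinv p y) j).

Hypothesis det_pos : forall y, cimage p W y -> 0 < \det (gram p (cinv p y)).

Lemma flux_form_smooth j : csmooth_on (cimage p W) (flux_form j).
Proof.
apply: csmooth_mul => //; first exact/csmooth_real/density_smooth.
by apply: csmooth_hdot => //; [exact: loc_smooth Gp' oW Wp ls|exact: flux_smooth].
Qed.

(** The derivative of the density cancels the Christoffel traces of [flux_div], and the skew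
    connection form cancels between the two arguments of the pairing. *)
Lemma flux_form_div x : W x ->
  \sum_j cpderiv j (flux_form j) (cmap p x) = Complex (density p (cmap p x)) 0 *
   (hdot (nabla10 M V phi' x (s x)) (blockop (epow (pi_e V) q) (nabla10 M V phi x (s x))) -
    hdot (nabla01 M V phi' x (s x)) (blockop (fun k l => epow (pi_e V) q l k) (nabla01 M V phi x (s x))) -
    hdot (phi' x (s x)) (Rq M V q phi x (s x))).
Proof.
move=> Wx; have px := Wp Wx; have Ux : cimage p W (cmap p x) by exact: cimage_mem.
have sf' := loc_smooth Gp' oW Wp ls; have sw := flux_smooth.
have sm : csmooth_on (cimage p W) (fun y => Complex (density p y) 0).
  by apply/csmooth_real/density_smooth.
rewrite (hdot_nabla_diff Wx).
have fE : loc s phi' p (cmap p x) = phi' x (s x) by rewrite locE man_cmapK.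
have D j : cpderiv j (flux_form j) (cmap p x) = Complex (density p (cmap p x)) 0 *
   (\tr (cchris p x j) * hdot (phi' x (s x)) (flux x j) +
    (hdot (cov p s phi' x j) (flux x j) + hdot (phi' x (s x)) (dflux x j))).
  rewrite /flux_form (is_cderive_pderiv (is_cderiveM (csmooth_is_derive j sm Ux)
    (csmooth_is_derive j (csmooth_hdot oU sf' (sw j)) Ux))).
  have -> : cpderiv j (fun y => Complex (density p y) 0) (cmap p x) =
      Complex (density p (cmap p x)) 0 * \tr (cchris p x j).
    have -> : cpderiv j (fun y => Complex (density p y) 0) (cmap p x) = Complex (pderiv j (density p) (cmap p x)) 0.
      by apply: complexE => //=; rewrite /pderiv derive_cst.
    rewrite (density_derive j (proj1 Ux) (det_pos Ux)) man_cmapK //.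
    have -> : \tr (cchris p x j) = Complex (\tr (christoffel p x j)) 0.
      rewrite /mxtrace; transitivity (\sum_i Complex (christoffel p x j i i) 0); first by apply: eq_bigr => i _; rewrite mxE.
      by apply: complexE; rewrite ?re_sum ?im_sum //= big1.
    by apply: complexE; rewrite ?ReM ?ImM /= ?mulr0 ?mul0r ?subr0 ?addr0.
  rewrite (cpderiv_hdot j oU sf' (sw j) Ux) man_cmapK // fE covE /dflux.
  have sk : (rdiff V (frame_form p s x j)) ^t* = - rdiff V (frame_form p s x j).
    by rewrite rdiff_adj (frame_form_skew j oW Wx Wp ls) linearN.
  have gen (mu t : C) (f f1 w w1 : 'cV[C]_d) (X : 'M[C]_d) : X ^t* = - X ->
     mu * t * hdot f w + mu * (hdot f1 w + hdot f w1) =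
     mu * (t * hdot f w + (hdot (f1 + X *m f) w + hdot f (w1 + X *m w))).
    move=> Xs; rewrite hdotDl hdotDr hdot_mull Xs mulNmx hdotNr -mulrA -mulrDr; congr (_ * (_ + _)).
    by rewrite addrACA addNr addr0.
  exact: gen.
apply: (etrans (eq_bigr _ (fun j _ => D j))); rewrite -mulr_sumr; congr (_ * _).
rewrite !big_split /= -hdot_sumr (flux_div Wx) hdotBr hdotNr hdot_sumr.
have -> : \sum_i hdot (phi' x (s x)) (\tr (cchris p x i) *: flux x i) =
    \sum_i \tr (cchris p x i) * hdot (phi' x (s x)) (flux x i).
  apply: eq_bigr => i _; rewrite hdotZr; congr (_ * _); rewrite rmorph_sum; apply: eq_bigr => l _.
  have := f_equal (fun G : 'M[C]_n => G l l) (cjmx_toC (christoffel p x i)); rewrite mxE; exact.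
have gen (a b c : C) : a + (b + (- a - c)) = b - c by ring.
exact: gen.
Qed.

End Pointwise.
End Flux.
End Field.
End WeakIdentity.

(** * Testing against sections supported in a chart *)

Section GramPositive.
Context {R : realType}.
Local Notation C := R[i].

Lemma det_adj_mul_ge0 a b (A : 'M[C]_(a, b)) : a = b -> 0 <= \det (A ^t* *m A).
Proof.
move=> ab; case: b / ab A => A; rewrite det_mulmx (_ : \det (A ^t*) = Num.conj (\det A)); last first.
  by rewrite det_map_mx det_tr.
by rewrite mulrC; exact: mul_conjC_ge0.
Qed.

Lemma det_toC n (A : 'M[R]_n) : \det (toC A) = Complex (\det A) 0.
Proof. exact: (det_map_mx (real_complex R)). Qed.

(** The inverse metric is P^* P, with P the frame stacked on its conjugate, so its determinant is a
    squared modulus; invertibility excludes 0. *)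
Lemma det_gram_pos m (M : kahler R m) (p x : M) (u : 'M[C]_(m, m.*2)) : cdom p x -> unitary_frame x u ->
  0 < \det (gram p x).
Proof.
move=> px uf; have Gu := gram_unit px.
have H := frame_inv_gram (cpx_met_orth px) Gu (frame_in_chart px uf).
set S := u *m _ in H.
have D : 0 <= \det (invmx (toC (gram p x))).
  rewrite -H; have -> : S ^t* *m S + S^T *m Defs.conjmx S = (col_mx S (Defs.conjmx S)) ^t* *m col_mx S (Defs.conjmx S).
    by rewrite tr_col_mx map_row_mx mul_row_col adjmx_cj.
  by apply: det_adj_mul_ge0; exact: addnn.
move: D; rewrite det_inv invr_ge0 det_toC lecE /= eqxx /= le_eqVlt eq_sym => /orP[/eqP d0|//].
by move: Gu; rewrite unitmxE d0 unitr0.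
Qed.

End GramPositive.

Section SmallSections.
Context {R : realType} {m : nat} {M : kahler R m} {rho : 'I_m -> int} {V : unirrep (R := R) rho}.
Local Notation C := R[i].
Local Notation n := (m.*2).
Local Notation d := (rdim V).
Implicit Types (x : M) (phi psi : sect M d 1).
Local Opaque frame_form vnabla vcomp cgram cchris gram christoffel jac cov loc.

Lemma nabla_at_zero N phi x u v : open N -> N x -> (forall y w, N y -> phi y w = 0) ->
  nabla_at phi x u v = 0.
Proof.
move=> oN Nx p0; rewrite /nabla_at p0 // mulmx0 addr0 dirdermxE big1 // => k _.
have Ux : cimage x N (cmap x x) by apply: cimage_mem => //; exact: man_center.
rewrite (mpderiv_ext (G := fun=> 0) k (cimage_open (p := x) oN) _ Ux) ?mpderiv_cst ?scaler0 //.
by move=> y [_ Ny] /=; exact: p0.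
Qed.

Lemma Gamma_S_lin phi psi c : Gamma_S M V phi -> Gamma_S M V psi ->
  Gamma_S M V (fun x u => phi x u + c *: psi x u).
Proof.
move=> [p1 p2] [q1 q2]; split=> [x u a uf ua|W s oW ls p i j] /=.
  have E1 : rmap V a *m phi x (a^T *m u) = phi x u := p1 x u a uf ua.
  have E2 : rmap V a *m psi x (a^T *m u) = psi x u := q1 x u a uf ua.
  by rewrite mulmxDr -scalemxAr E1 E2.
have /csmooth_funP H1 := p2 W s oW ls p i j; have /csmooth_funP H2 := q2 W s oW ls p i j.
apply/csmooth_funP => r; have oU : open (cimage r (W `&` cdom p)).
  by apply: cimage_open; apply: openI => //; exact: man_dom_open.
apply: csmooth_ext (csmooth_add oU (H1 r) (csmooth_mul oU (csmooth_cst _ c) (H2 r))) => // y _.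
by rewrite /= !mxE.
Qed.

Lemma Gamma_S_sum I (r : seq I) (c : I -> C) (F : I -> sect M d 1) : (forall i, Gamma_S M V (F i)) ->
  Gamma_S M V (fun x u => \sum_(i <- r) c i *: F i x u).
Proof.
move=> GF; elim: r => [|i r IH].
  have -> : (fun (x : M) (u : 'M[C]_(m, n)) => \sum_(i <- [::]) c i *: F i x u) = fun _ _ => 0.
    by apply: funext => x; apply: funext => u; rewrite big_nil.
  split=> [x u a _ _|W s oW ls p k j] /=; first exact: mulmx0.
  by apply/csmooth_funP => q; apply: csmooth_ext (csmooth_cst _ 0) => [|y _]; [apply: cimage_open; apply: openI => //; exact: man_dom_open|rewrite /= mxE].
have -> : (fun (x : M) (u : 'M[C]_(m, n)) => \sum_(i <- i :: r) c i *: F i x u) =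
    fun x u => \sum_(i <- r) c i *: F i x u + c i *: F i x u.
  by apply: funext => x; apply: funext => u; rewrite big_cons addrC.
exact: Gamma_S_lin.
Qed.

Section Chart.
Variables (vol : {measure set (borel M) -> \bar R}) (p : M) (W : set M) (s : M -> 'M[C]_(m, n)) (y0 : 'rV[R]_n) (r : R).
Hypotheses (volP : is_volume vol) (oW : open W) (Wp : W `<=` cdom p) (ls : local_frame W s) (r0 : 0 < r).
Hypothesis ballU : forall z : 'rV[R]_n, `|z - y0| <= r -> cimage p W z.
Hypothesis dom : dominant rho.

Let det_pos y : cimage p W y -> 0 < \det (gram p (cinv p y)).
Proof. by move=> Uy; have [py _] := cimage_dom Uy; apply: det_gram_pos py (proj1 ls _ (cimageP Uy)). Qed.

Let oU := cimage_open (p := p) oW.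

Definition vanish k (rr : R) (A : sect M d k) : Prop := forall x u, ~ (cdom p x /\ `|cmap p x - y0| < rr) -> A x u = 0.

Definition frame_smooth_in k (A : sect M d k) : Prop := msmooth_on (cimage p W) (fun y => A (cinv p y) (s (cinv p y))).

Definition hdot_inv k (A B : sect M d k) : Prop := forall x u a, unitary_frame x u -> a \is unitarymx ->
  hdot (A x (a *m u)) (B x (a *m u)) = hdot (A x u) (B x u).

(** The pairing is evaluated in the chosen frame [frame_at], which may vary discontinuously;
    [hdot_inv] allows a smooth frame to replace it. *)
Definition hpair k (A B : sect M d k) : M -> C := fun x => hdot (A x (frame_at x)) (B x (frame_at x)).

Lemma frame_atP x u : unitary_frame x u -> unitary_frame x (frame_at x).
Proof. by move=> uf; exact: (xgetPex 0 (ex_intro _ u uf)). Qed.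

Lemma hpairE k (A B : sect M d k) x u : hdot_inv A B -> unitary_frame x u -> hpair A B x = hdot (A x u) (B x u).
Proof.
move=> iv uf; have [a ua E] := unitary_gauge uf (frame_atP uf).
by rewrite /hpair E; exact: iv.
Qed.

Lemma hpair_test k (A B : sect M d k) : vanish r A -> hdot_inv A B -> frame_smooth_in A -> frame_smooth_in B ->
  chart_test p W y0 r (hpair A B).
Proof.
move=> vA iv sA sB; split=> [x nx|]; first by rewrite /hpair vA // hdot0l.
apply: csmooth_ext (csmooth_hdot oU sA sB) => // y Uy /=.
by rewrite (hpairE iv (proj1 ls _ (cimageP Uy))).
Qed.

Lemma Gamma_frame_smooth k (B : hbundle M d k) (A : sect M d k) : (forall q x Y, b_crd B q x Y = Y) ->
  Gamma B A -> frame_smooth_in A.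
Proof.
move=> crd [_ H] i j; have /csmooth_funP/(_ p) := H W s oW ls p i j.
move=> H'; apply: csmooth_ext (csmooth_sub _ H') => // [y _|]; first by rewrite /= crd.
by apply: cimage_sub => z Wz; split=> //; exact: Wp.
Qed.

Lemma Gamma_hdot_inv k (B : hbundle M d k) (A A' : sect M d k) :
  (forall a X Y, a \is unitarymx -> hdot (b_act B a X) (b_act B a Y) = hdot X Y) ->
  Gamma B A -> Gamma B A' -> hdot_inv A A'.
Proof.
move=> iso [H _] [H' _] x u a uf ua; have ut : a^T \is unitarymx by rewrite trmx_unitary.
have E := H x u a^T uf ut; have E' := H' x u a^T uf ut; rewrite trmxK in E E'.
by rewrite -E -E' iso.
Qed.

Lemma S_bundle_iso a (X Y : 'cV[C]_d) : a \is unitarymx -> hdot (b_act (S_bundle M V) a X) (b_act (S_bundle M V) a Y) = hdot X Y.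
Proof. by move=> ua; rewrite /= hdot_mull mulmxA rmap_adjK // mul1mx. Qed.

Lemma S10_bundle_iso a (X Y : 'M[C]_(d, m)) : a \is unitarymx -> hdot (b_act (S10_bundle M V) a X) (b_act (S10_bundle M V) a Y) = hdot X Y.
Proof. exact: (@actR_unitary _ _ _ V true a X Y). Qed.

Lemma S01_bundle_iso a (X Y : 'M[C]_(d, m)) : a \is unitarymx -> hdot (b_act (S01_bundle M V) a X) (b_act (S01_bundle M V) a Y) = hdot X Y.
Proof. exact: (@actR_unitary _ _ _ V false a X Y). Qed.

Lemma cintegral_sum I (l : seq I) (c : I -> C) (F : I -> M -> C) : (forall i, chart_test p W y0 r (F i)) ->
  chart_test p W y0 r (fun x => \sum_(i <- l) c i * F i x) /\
  cintegral vol (fun x => \sum_(i <- l) c i * F i x) = \sum_(i <- l) c i * cintegral vol (F i).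
Proof.
move=> tF; elim: l => [|i l [tS IS]].
  have -> : (fun x : M => \sum_(i <- [::]) c i * F i x) = fun=> 0 by apply: funext => x; rewrite big_nil.
  have t0 : chart_test p W y0 r (fun _ : M => 0 : C) by split=> //; exact: csmooth_cst.
  split=> //; rewrite big_nil; have := cintegral_lin volP oW r0 ballU det_pos (-1) t0 t0.
  have -> : (fun _ : M => 0 + -1 * 0 : C) = fun=> 0 by apply: funext => x; rewrite mulr0 addr0.
  by rewrite mulN1r subrr.
have -> : (fun x : M => \sum_(i <- i :: l) c i * F i x) = fun x => \sum_(i <- l) c i * F i x + c i * F i x.
  by apply: funext => x; rewrite big_cons addrC.
split; first exact: chart_test_lin.
by rewrite (cintegral_lin volP oW r0 ballU det_pos) // IS big_cons addrC.
Qed.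

Lemma chart_box_half x : ~ (cdom p x /\ `|cmap p x - y0| < r) -> ~ chart_box p y0 (r / 2) x.
Proof.
move=> H [z /= zr zx]; apply: H; have zr' : `|z - y0| < r.
  by apply: le_lt_trans zr _; rewrite ltr_pdivrMr // ltr_pMr // ltr1n.
have [px zE] := cimage_dom (ballU (ltW zr')); rewrite zx in px zE.
by rewrite zE.
Qed.

Let half0 : 0 < r / 2.
Proof. by rewrite divr_gt0. Qed.

Let ball_half (z : 'rV[R]_n) : `|z - y0| <= r / 2 -> cimage p W z.
Proof. by move=> H; apply: ballU; apply: le_trans H _; rewrite ler_pdivrMr // ler_pMr // ler1n. Qed.

Lemma half_open : open (~` chart_box p y0 (r / 2)).
Proof. by apply: closed_openC; exact: (chart_box_closed half0 ball_half). Qed.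

Lemma vanish_nabla_at phi x u v : vanish (r / 2) phi -> ~ (cdom p x /\ `|cmap p x - y0| < r) -> nabla_at phi x u v = 0.
Proof.
move=> v0 /chart_box_half nx; apply: (nabla_at_zero u v half_open nx) => y w /chart_box_out.
by move/v0; apply.
Qed.

Lemma vanish_le phi : vanish (r / 2) phi -> vanish r phi.
Proof.
move=> v0 x u H; apply: v0 => -[px xr]; apply: H; split=> //; apply: lt_trans xr _.
by rewrite ltr_pdivrMr // ltr_pMr // ltr1n.
Qed.

Lemma vanish_nabla10 phi : vanish (r / 2) phi -> vanish r (nabla10 M V phi).
Proof. by move=> v0 x u H; apply/matrixP => i k; rewrite mxE (vanish_nabla_at _ _ v0 H) !mxE. Qed.

Lemma vanish_nabla01 phi : vanish (r / 2) phi -> vanish r (nabla01 M V phi).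
Proof. by move=> v0 x u H; apply/matrixP => i k; rewrite mxE (vanish_nabla_at _ _ v0 H) !mxE. Qed.

Lemma vanish_nabla phi x u : vanish (r / 2) phi -> ~ (cdom p x /\ `|cmap p x - y0| < r) -> nabla M V phi x u = 0.
Proof. by move=> v0 H; apply/matrixP => i k; rewrite mxE (vanish_nabla_at _ _ v0 H) !mxE. Qed.

Lemma vanish_compact phi : vanish (r / 2) phi -> compactly_supported phi.
Proof.
move=> v0; exists (chart_box p y0 (r / 2)); first exact: (chart_box_compact half0 ball_half).
by move=> x u /chart_box_out nx _; exact: v0.
Qed.

Lemma cutoff_exists : cdom p (cinv p y0) -> exists chi : M -> R, [/\ forall x, 0 <= chi x, 0 < chi (cinv p y0),
  (forall x, ~ (cdom p x /\ `|cmap p x - y0| < r / 2) -> chi x = 0) &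
  csmooth_fun setT (fun x => Complex (chi x) 0)].
Proof.
move=> p0; have [eta [se e0 ey ev]] := bump_exists y0 half0.
have yE : cmap p (cinv p y0) = y0.
  by have [|_ ->] := @cimage_dom _ _ M p W y0; [apply: ballU; rewrite subrr normr0 ltW|].
pose chi x := if `[< cdom p x >] then eta (cmap p x) else 0.
have chi0 x : ~ (cdom p x /\ `|cmap p x - y0| < r / 2) -> chi x = 0.
  move=> H; rewrite /chi; case: asboolP => // px; apply: ev; rewrite leNgt; apply/negP => xr.
  exact: H.
exists chi; split=> //.
- by move=> x; rewrite /chi; case: asboolP.
- by rewrite /chi asboolT // yE.
apply: csmooth_fun_local => x _; have [px|npx] := pselect (cdom p x).
  exists (cdom p); split=> //; apply: (csmooth_fun_chart (p := p)) => //; first exact: man_dom_open.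
  have oV : open (cimage p (cdom p)) by apply: cimage_open; exact: man_dom_open.
  apply: (csmooth_ext (f := fun y => Complex (eta y) 0)) => //.
    by move=> y Uy; have [py yE'] := cimage_dom Uy; rewrite /= /chi asboolT // yE'.
  by apply: csmooth_real => k; apply: Ck_on_sub (se k).
exists (~` chart_box p y0 (r / 2)); split.
  by move=> /(chart_box_dom ball_half).
apply: (csmooth_fun_ext (f := fun=> 0)) half_open _ _ => [y /chart_box_out/chi0 -> //|].
by apply/csmooth_funP => q; exact: csmooth_cst.
Qed.

Lemma Gamma_S_cutoff chi phi : csmooth_fun setT (fun x : M => Complex (chi x) 0) -> Gamma_S M V phi ->
  Gamma_S M V (fun x u => Complex (chi x) 0 *: phi x u).
Proof.
move=> /csmooth_funP sc [p1 p2]; split=> [x u a uf ua|W' s' oW' ls' q i j] /=.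
  have E1 : rmap V a *m phi x (a^T *m u) = phi x u := p1 x u a uf ua.
  by rewrite -scalemxAr E1.
have /csmooth_funP H := p2 W' s' oW' ls' q i j.
apply/csmooth_funP => l; have oV : open (cimage l (W' `&` cdom q)).
  by apply: cimage_open; apply: openI => //; exact: man_dom_open.
have sc' : csmooth_on (cimage l (W' `&` cdom q)) ((fun x => Complex (chi x) 0) \o cinv l).
  by apply: csmooth_sub (sc l); exact: cimage_sub.
apply: csmooth_ext (csmooth_mul oV sc' (H l)) => // y _.
by rewrite /= !mxE.
Qed.

(** For a cutoff multiple of psi the integrand is chi |psi|^2, smooth in the chart and nonnegative;
    its integral being 0, it vanishes at the centre, where chi is positive. *)
Lemma weak_zero psi u : Gamma_S M V psi -> unitary_frame (cinv p y0) u ->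
  (forall phi, Gamma_S M V phi -> vanish (r / 2) phi -> cintegral vol (hpair phi psi) = 0) ->
  psi (cinv p y0) u = 0.
Proof.
move=> Gp uf H; have Uy : cimage p W y0 by apply: ballU; rewrite subrr normr0 ltW.
have [p0 _] := cimage_dom Uy; have [chi [chi0 chip chiv sc]] := cutoff_exists p0.
pose phi : sect M d 1 := fun x u => Complex (chi x) 0 *: psi x u.
have Gphi : Gamma_S M V phi := Gamma_S_cutoff sc Gp.
have vp : vanish (r / 2) phi by move=> x w nx; rewrite /phi chiv // (_ : Complex 0 0 = 0 :> C) // scale0r.
have crd q x (Y : 'cV[C]_d) : b_crd (S_bundle M V) q x Y = Y by [].
have t : chart_test p W y0 r (hpair phi psi).
  apply: hpair_test; first exact: vanish_le.
  - exact: (Gamma_hdot_inv S_bundle_iso Gphi Gp).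
  - exact: (Gamma_frame_smooth crd Gphi).
  - exact: (Gamma_frame_smooth crd Gp).
have pos x : 0 <= hpair phi psi x.
  by rewrite /hpair /phi hdotZl mulr_ge0 ?hdot_ge0 // lecE /= eqxx chi0.
have E := cintegral_eq0 volP oW r0 ballU det_pos t pos (H phi Gphi vp) (cinv p y0).
have := hpairE (Gamma_hdot_inv S_bundle_iso Gphi Gp) uf; rewrite E /phi hdotZl => /esym/eqP.
rewrite mulf_eq0 => /orP[/eqP c0|/eqP/hdot_eq0 //].
by have := f_equal (@complex.Re R) c0; rewrite /= => c0'; rewrite c0' ltxx in chip.
Qed.

Section Pairings.
Context {phi' : sect M d 1}.
Hypotheses (Gp' : Gamma_S M V phi') (v0 : vanish (r / 2) phi').

Definition weak (psi : sect M d 1) : C := cintegral vol (hpair phi' psi).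

Lemma test_S psi : Gamma_S M V psi -> chart_test p W y0 r (hpair phi' psi).
Proof.
move=> Gp; apply: hpair_test; first exact: vanish_le.
- exact: (Gamma_hdot_inv S_bundle_iso Gp' Gp).
- exact: (Gamma_frame_smooth (B := S_bundle M V) _ Gp').
- exact: (Gamma_frame_smooth (B := S_bundle M V) _ Gp).
Qed.

Lemma test_10 A : Gamma (S01_bundle M V) A -> chart_test p W y0 r (hpair (nabla10 M V phi') A).
Proof.
move=> GA; have Gn := Gamma_nabla10 Gp'; apply: hpair_test; first exact: vanish_nabla10.
- exact: (Gamma_hdot_inv S01_bundle_iso Gn GA).
- exact: (Gamma_frame_smooth (B := S01_bundle M V) _ Gn).
- exact: (Gamma_frame_smooth (B := S01_bundle M V) _ GA).
Qed.

Lemma test_01 A : Gamma (S10_bundle M V) A -> chart_test p W y0 r (hpair (nabla01 M V phi') A).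
Proof.
move=> GA; have Gn := Gamma_nabla01 Gp'; apply: hpair_test; first exact: vanish_nabla01.
- exact: (Gamma_hdot_inv S10_bundle_iso Gn GA).
- exact: (Gamma_frame_smooth (B := S10_bundle M V) _ Gn).
- exact: (Gamma_frame_smooth (B := S10_bundle M V) _ GA).
Qed.

Lemma weak_lin psi1 psi2 c : Gamma_S M V psi1 -> Gamma_S M V psi2 ->
  weak (fun x u => psi1 x u + c *: psi2 x u) = weak psi1 + Num.conj c * weak psi2.
Proof.
move=> G1 G2; rewrite -(cintegral_lin volP oW r0 ballU det_pos _ (test_S G1) (test_S G2)).
by congr cintegral; apply: funext => x; rewrite /hpair hdotDr hdotZr.
Qed.

Lemma weak_sum I (l : seq I) (c : I -> C) (F : I -> sect M d 1) : (forall i, Gamma_S M V (F i)) ->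
  weak (fun x u => \sum_(i <- l) c i *: F i x u) = \sum_(i <- l) Num.conj (c i) * weak (F i).
Proof.
move=> GF; have [_ <-] := @cintegral_sum _ l (fun i => Num.conj (c i)) (fun i => hpair phi' (F i)) (fun i => test_S (GF i)).
congr cintegral; apply: funext => x; rewrite /hpair hdot_sumr; apply: eq_bigr => i _; exact: hdotZr.
Qed.

Section Core.
Context {phi : sect M d 1}.
Hypothesis Gp : Gamma_S M V phi.

Definition pair_minus i : C := cintegral vol (hpair (nabla10 M V phi') (Dminus M V i phi)).
Definition pair_plus i : C := cintegral vol (hpair (nabla01 M V phi') (Dplus M V i phi)).

Lemma test_minus i : chart_test p W y0 r (hpair (nabla10 M V phi') (Dminus M V i phi)).
Proof. by apply: test_10; have [] := Gamma_Dminus i dom Gp. Qed.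

Lemma test_plus i : chart_test p W y0 r (hpair (nabla01 M V phi') (Dplus M V i phi)).
Proof. by apply: test_01; have [] := Gamma_Dplus i dom Gp. Qed.

(** The integrated divergence identity for a combination of degrees q, in which the two hypotheses
    replace powers of e and of its transpose by projections. Coefficients come out conjugated
    because the pairing is antilinear in its second argument. *)
Lemma core N (c : 'I_N -> C) (al be : 'I_m -> C) :
  (forall A, \sum_q c q *: blockop (epow (pi_e V) q) A = \sum_i al i *: orth_proj (Vminus V i) A) ->
  (forall A, \sum_q c q *: blockop (fun k l => epow (pi_e V) q l k) A = \sum_i be i *: orth_proj (Vplus V i) A) ->
  \sum_q Num.conj (c q) * weak (Rq M V q phi) =
  \sum_i Num.conj (al i) * pair_minus i - \sum_i Num.conj (be i) * pair_plus i.
Proof.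
move=> Ha Hb.
have [t1 I1] := @cintegral_sum _ (index_enum 'I_m) (fun i => Num.conj (al i)) _ test_minus.
have [t2 I2] := @cintegral_sum _ (index_enum 'I_m) (fun i => Num.conj (be i)) _ test_plus.
have [t3 I3] := @cintegral_sum _ (index_enum 'I_N) (fun q => Num.conj (c q)) _ (fun q : 'I_N => test_S (Gamma_Rq q Gp)).
have t12 := chart_test_lin oW (-1) t1 t2; have t := chart_test_lin oW (-1) t12 t3.
have Gon := Gamma_S_on W Gp; have Gon' := Gamma_S_on W Gp'.
have sfl (q : nat) := flux_form_smooth q oW Wp ls Gon Gon' det_pos.
have J : cintegral vol (fun x => (\sum_i Num.conj (al i) * hpair (nabla10 M V phi') (Dminus M V i phi) x +
    -1 * (\sum_i Num.conj (be i) * hpair (nabla01 M V phi') (Dplus M V i phi) x)) +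
    -1 * (\sum_(q < N) Num.conj (c q) * hpair phi' (Rq M V q phi) x)) =
    \sum_i Num.conj (al i) * pair_minus i + -1 * (\sum_i Num.conj (be i) * pair_plus i) +
    -1 * (\sum_q Num.conj (c q) * weak (Rq M V q phi)).
  apply: (etrans (cintegral_lin volP oW r0 ballU det_pos _ t12 t3)).
  apply: (f_equal2 (fun a b : C => a + -1 * b)); last exact: I3.
  apply: (etrans (cintegral_lin volP oW r0 ballU det_pos _ t1 t2)).
  exact: (f_equal2 (fun a b : C => a + -1 * b) I1 I2).
have concl (a b d : C) : a + -1 * b + -1 * d = 0 -> d = a - b.
  by rewrite !mulN1r => /eqP; rewrite subr_eq0 => /eqP.
apply: concl; apply: (etrans (esym J)).
(* The three sums of pairings form a single function whose product with the density is the
   divergence of the combined fluxes. *)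
apply: (cintegral_div volP oW r0 ballU (Z := fun j y => \sum_(q < N) Num.conj (c q) *
   flux_form (V := V) (p := p) (s := s) q (phi := phi) (phi' := phi') j y)) => // [j|j y Uy yr|y Uy].
- apply: csmooth_sum => // q; apply: csmooth_mul => //; first exact: csmooth_cst.
- rewrite big1 // => q _; rewrite /flux_form locE (vanish_le v0) ?hdot0l ?mulr0 //.
  by have [_ ->] := cimage_dom Uy => -[_] /(le_lt_trans yr); rewrite ltxx.
- have [py yE] := cimage_dom Uy; have Wx := cimageP Uy; have uf := proj1 ls _ Wx.
  have D j : cpderiv j (fun y => \sum_(q < N) Num.conj (c q) *
       flux_form (V := V) (p := p) (s := s) q (phi := phi) (phi' := phi') j y) y =
     \sum_(q < N) Num.conj (c q) * cpderiv j (flux_form (V := V) (p := p) (s := s) q (phi := phi) (phi' := phi') j) y.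
    have D' (q : 'I_N) := is_cderiveM (is_cderive_cst y (delta_mx 0 j : 'rV[R]_n) (Num.conj (c q))) (csmooth_is_derive j (sfl q j) Uy).
    rewrite (is_cderive_pderiv (is_cderive_sum (index_enum 'I_N) D')); apply: eq_bigr => q _.
    by rewrite mul0r add0r.
  rewrite [RHS](eq_bigr _ (fun j _ => D j)) exchange_big /=.
  have E (q : 'I_N) : \sum_j Num.conj (c q) * cpderiv j (flux_form (V := V) (p := p) (s := s) q (phi := phi) (phi' := phi') j) y =
      Num.conj (c q) * (Complex (density p y) 0 *
   (hdot (nabla10 M V phi' (cinv p y) (s (cinv p y))) (blockop (epow (pi_e V) q) (nabla10 M V phi (cinv p y) (s (cinv p y)))) -
    hdot (nabla01 M V phi' (cinv p y) (s (cinv p y))) (blockop (fun k l => epow (pi_e V) q l k) (nabla01 M V phi (cinv p y) (s (cinv p y)))) -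
    hdot (phi' (cinv p y) (s (cinv p y))) (Rq M V q phi (cinv p y) (s (cinv p y))))).
    by rewrite -mulr_sumr -{1}yE (flux_form_div q oW Wp ls Gon Gon' det_pos Wx) yE.
  rewrite [RHS](eq_bigr _ (fun q _ => E q)).
  have h1 i := hpairE (Gamma_hdot_inv S01_bundle_iso (Gamma_nabla10 Gp') (proj1 (Gamma_Dminus i dom Gp))) uf.
  have h2 i := hpairE (Gamma_hdot_inv S10_bundle_iso (Gamma_nabla01 Gp') (proj1 (Gamma_Dplus i dom Gp))) uf.
  have h3 (q : nat) := hpairE (Gamma_hdot_inv S_bundle_iso Gp' (Gamma_Rq q Gp)) uf.
  have HA : \sum_i Num.conj (al i) * hpair (nabla10 M V phi') (Dminus M V i phi) (cinv p y) =
     \sum_(q < N) Num.conj (c q) * hdot (nabla10 M V phi' (cinv p y) (s (cinv p y)))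
        (blockop (epow (pi_e V) q) (nabla10 M V phi (cinv p y) (s (cinv p y)))).
    transitivity (hdot (nabla10 M V phi' (cinv p y) (s (cinv p y)))
      (\sum_i al i *: orth_proj (Vminus V i) (nabla10 M V phi (cinv p y) (s (cinv p y))))).
      by rewrite hdot_sumr; apply: eq_bigr => i _; rewrite hdotZr; exact: (f_equal _ (h1 i)).
    by rewrite -Ha hdot_sumr; apply: eq_bigr => i _; rewrite hdotZr.
  have HB : \sum_i Num.conj (be i) * hpair (nabla01 M V phi') (Dplus M V i phi) (cinv p y) =
     \sum_(q < N) Num.conj (c q) * hdot (nabla01 M V phi' (cinv p y) (s (cinv p y)))
        (blockop (fun k l => epow (pi_e V) q l k) (nabla01 M V phi (cinv p y) (s (cinv p y)))).
    transitivity (hdot (nabla01 M V phi' (cinv p y) (s (cinv p y)))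
      (\sum_i be i *: orth_proj (Vplus V i) (nabla01 M V phi (cinv p y) (s (cinv p y))))).
      by rewrite hdot_sumr; apply: eq_bigr => i _; rewrite hdotZr; exact: (f_equal _ (h2 i)).
    by rewrite -Hb hdot_sumr; apply: eq_bigr => i _; rewrite hdotZr.
  have HC : \sum_(q < N) Num.conj (c q) * hpair phi' (Rq M V q phi) (cinv p y) =
     \sum_(q < N) Num.conj (c q) * hdot (phi' (cinv p y) (s (cinv p y))) (Rq M V q phi (cinv p y) (s (cinv p y))).
    by apply: eq_bigr => q _; exact: (f_equal _ (h3 q)).
  have gen (X Y Z mu : C) (A B D' : 'I_N -> C) : X = \sum_q Num.conj (c q) * A q ->
      Y = \sum_q Num.conj (c q) * B q -> Z = \sum_q Num.conj (c q) * D' q ->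
      (X + -1 * Y + -1 * Z) * mu = \sum_q Num.conj (c q) * (mu * (A q - B q - D' q)).
    move=> -> -> ->; rewrite !mulN1r -!sumrB mulr_suml; apply: eq_bigr => q _; ring.
  exact: (gen _ _ _ _ _ _ _ HA HB HC).
Qed.

Lemma pair_minus_sum : \sum_i pair_minus i = cintegral vol (hpair (nabla10 M V phi') (nabla10 M V phi)).
Proof.
have [_ I1] := @cintegral_sum _ (index_enum 'I_m) (fun=> 1) _ test_minus.
transitivity (\sum_i 1 * pair_minus i); first by apply: eq_bigr => i _; rewrite mul1r.
rewrite -I1; congr cintegral; apply: funext => x.
rewrite /hpair -[in RHS](proj_sum (V := V) false dom (nabla10 M V phi x (frame_at x))) hdot_sumr.
by apply: eq_bigr => i _; rewrite mul1r /Dminus Vminus_piece.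
Qed.

Lemma pair_plus_sum : \sum_i pair_plus i = cintegral vol (hpair (nabla01 M V phi') (nabla01 M V phi)).
Proof.
have [_ I1] := @cintegral_sum _ (index_enum 'I_m) (fun=> 1) _ test_plus.
transitivity (\sum_i 1 * pair_plus i); first by apply: eq_bigr => i _; rewrite mul1r.
rewrite -I1; congr cintegral; apply: funext => x.
rewrite /hpair -[in RHS](proj_sum (V := V) true dom (nabla01 M V phi x (frame_at x))) hdot_sumr.
by apply: eq_bigr => i _; rewrite mul1r.
Qed.

(** By [frame_inv_gram] the inverse metric splits over the frame and its conjugate, and so does the
    pairing of one-forms. Outside the ball, where no frame is at hand, all terms are 0. *)
Lemma L2dot_nabla : L2dot vol (SForm_bundle M V) (nabla M V phi') (nabla M V phi) =
  cintegral vol (hpair (nabla10 M V phi') (nabla10 M V phi)) + cintegral vol (hpair (nabla01 M V phi') (nabla01 M V phi)).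
Proof.
rewrite -[X in _ + X]mul1r -(cintegral_lin volP oW r0 ballU det_pos 1 (test_10 (Gamma_nabla10 Gp)) (test_01 (Gamma_nabla01 Gp))).
congr cintegral; apply: funext => x; rewrite mul1r /=.
have [H|H] := pselect (cdom p x /\ `|cmap p x - y0| < r); last first.
  have e1 : nabla M V phi' x (frame_at x) = 0 := vanish_nabla _ v0 H.
  have e2 : nabla10 M V phi' x (frame_at x) = 0 := vanish_nabla10 v0 _ H.
  have e3 : nabla01 M V phi' x (frame_at x) = 0 := vanish_nabla01 v0 _ H.
  have gen (N' N0 : 'M[C]_(d, n)) (P' P Q' Q : 'M[C]_(d, m)) G : N' = 0 -> P' = 0 -> Q' = 0 ->
      \tr (N' *m G *m N0 ^t*) = hdot P' P + hdot Q' Q.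
    by move=> -> -> ->; rewrite !hdot0l addr0 !mul0mx mxtrace0.
  exact: (gen _ _ _ _ _ _ _ e1 e2 e3).
have Wx : W x.
  by have [px xr] := H; have := cimageP (ballU (ltW xr)); rewrite man_cmapK.
have uf := frame_atP (proj1 ls _ Wx).
have [K HK] := nabla_at_linear (Gamma_S_on setT Gp) openT I uf.
have [K' HK'] := nabla_at_linear (Gamma_S_on setT Gp') openT I uf.
rewrite /hpair (nabla_mx HK) (nabla_mx HK') (nabla10_mx HK) (nabla10_mx HK') (nabla01_mx HK) (nabla01_mx HK').
have fi := frame_inv_gram (cpx_orth x) (met_unit x) uf.
move: (frame_at x) fi => u fi; rewrite toC_inv -fi addrC.
rewrite /hdot !adjmxM adjmxK adjmx_tr mulmxDr mulmxDl mxtraceD !mulmxA.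
by [].
Qed.

Section Adjoints.
Variables (Dp Dm : 'I_m -> sect M d m -> sect M d 1) (A10 A01 : sect M d m -> sect M d 1) (A : sect M d n -> sect M d 1).
Hypotheses
  (DpP : forall i, formal_adjoint vol (S_bundle M V) (Gamma_S M V) (S10_bundle M V) (Gamma_Splus M V i) (Dplus M V i) (Dp i))
  (DmP : forall i, formal_adjoint vol (S_bundle M V) (Gamma_S M V) (S01_bundle M V) (Gamma_Sminus M V i) (Dminus M V i) (Dm i))
  (A10P : formal_adjoint vol (S_bundle M V) (Gamma_S M V) (S01_bundle M V) (Gamma (S01_bundle M V)) (nabla10 M V) A10)
  (A01P : formal_adjoint vol (S_bundle M V) (Gamma_S M V) (S10_bundle M V) (Gamma (S10_bundle M V)) (nabla01 M V) A01)
  (AP : formal_adjoint vol (S_bundle M V) (Gamma_S M V) (SForm_bundle M V) (Gamma (SForm_bundle M V)) (nabla M V) A).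

Let cs := vanish_compact v0.

Lemma weak_minus i : weak (Dm i (Dminus M V i phi)) = pair_minus i.
Proof.
have [_ H] := DmP (Gamma_Dminus i dom Gp); have := H phi' Gp' cs; rewrite /L2dot => H'; apply: (etrans (esym H')).
congr cintegral; apply: funext => x; rewrite /= /hpair /Dminus Vminus_piece.
exact: (proj_hdot false dom).
Qed.

Lemma weak_plus i : weak (Dp i (Dplus M V i phi)) = pair_plus i.
Proof.
have [_ H] := DpP (Gamma_Dplus i dom Gp); have := H phi' Gp' cs; rewrite /L2dot => H'; apply: (etrans (esym H')).
congr cintegral; apply: funext => x.
exact: (proj_hdot true dom).
Qed.

Lemma weak_10 : weak (A10 (nabla10 M V phi)) = cintegral vol (hpair (nabla10 M V phi') (nabla10 M V phi)).
Proof. by have [_ H] := A10P (Gamma_nabla10 Gp); exact: (esym (H phi' Gp' cs)). Qed.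

Lemma weak_01 : weak (A01 (nabla01 M V phi)) = cintegral vol (hpair (nabla01 M V phi') (nabla01 M V phi)).
Proof. by have [_ H] := A01P (Gamma_nabla01 Gp); exact: (esym (H phi' Gp' cs)). Qed.

Lemma weak_nabla : weak (A (nabla M V phi)) = weak (A10 (nabla10 M V phi)) + weak (A01 (nabla01 M V phi)).
Proof. by have [_ H] := AP (Gamma_nabla Gp); rewrite weak_10 weak_01 -L2dot_nabla; exact: (esym (H phi' Gp' cs)). Qed.

End Adjoints.
End Core.
End Pairings.
End Chart.
End SmallSections.

(** * The identities *)

(** The witnesses are the coefficients of the Lagrange polynomial of the node x i, which has degree
    k - 1. *)
Lemma interpolation (F : fieldType) k (x : 'I_k -> F) i : injective x ->
  exists t : 'I_k -> F, forall j, \sum_q t q * x j ^+ q = (j == i)%:R.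
Proof.
move=> inj; pose s := [seq x j | j <- enum (predC1 i)].
pose P : {poly F} := \prod_(y <- s) ('X - y%:P).
have Pi : P.[x i] != 0.
  rewrite -/(root P (x i)) root_prod_XsubC; apply/negP => /mapP[j]; rewrite mem_enum !inE => ji /inj E.
  by rewrite E eqxx in ji.
have sP : size (P.[x i]^-1 *: P) = k.
  rewrite size_scale ?invr_eq0 // size_prod_XsubC size_map -cardE cardC1 card_ord prednK //.
  exact: leq_ltn_trans (leq0n i) (ltn_ord i).
exists (fun q => (P.[x i]^-1 *: P)`_q) => j.
rewrite -(horner_coef_wide (x j) (eq_leq sP)) hornerZ; case: eqVneq => [->|ji]; first by rewrite mulVf.
suff /rootP -> : root P (x j) by rewrite mulr0.
by rewrite root_prod_XsubC; apply/mapP; exists j => //; rewrite mem_enum.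
Qed.

Section Assembly.
Context {R : realType} {m : nat} {M : kahler R m} {rho : 'I_m -> int} {V : unirrep (R := R) rho}.
Local Notation C := R[i].
Local Notation n := (m.*2).
Local Notation d := (rdim V).
Variable vol : {measure set (borel M) -> \bar R}.
Variables (Dp Dm : 'I_m -> sect M d m -> sect M d 1) (A10 A01 : sect M d m -> sect M d 1) (A : sect M d n -> sect M d 1).
Hypotheses (volP : is_volume vol) (dom : dominant rho)
  (DpP : forall i, formal_adjoint vol (S_bundle M V) (Gamma_S M V) (S10_bundle M V) (Gamma_Splus M V i) (Dplus M V i) (Dp i))
  (DmP : forall i, formal_adjoint vol (S_bundle M V) (Gamma_S M V) (S01_bundle M V) (Gamma_Sminus M V i) (Dminus M V i) (Dm i))
  (A10P : formal_adjoint vol (S_bundle M V) (Gamma_S M V) (S01_bundle M V) (Gamma (S01_bundle M V)) (nabla10 M V) A10)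
  (A01P : formal_adjoint vol (S_bundle M V) (Gamma_S M V) (S10_bundle M V) (Gamma (S10_bundle M V)) (nabla01 M V) A01)
  (AP : formal_adjoint vol (S_bundle M V) (Gamma_S M V) (SForm_bundle M V) (Gamma (SForm_bundle M V)) (nabla M V) A).
Local Notation DDp i phi := (Dp i (Dplus M V i phi)).
Local Notation DDm i phi := (Dm i (Dminus M V i phi)).
Local Notation L10 phi := (A10 (nabla10 M V phi)).
Local Notation L01 phi := (A01 (nabla01 M V phi)).
Local Notation L phi := (A (nabla M V phi)).
Local Notation wp i := ((wplus rho i)%:~R : C).
Local Notation wm i := ((wminus rho i)%:~R : C).

Lemma weak_eq (psi1 psi2 : sect M d 1) : Gamma_S M V psi1 -> Gamma_S M V psi2 ->
  (forall p W s (y0 : 'rV[R]_n) r phi', open W -> W `<=` cdom p -> local_frame W s -> 0 < r ->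
     (forall z : 'rV[R]_n, `|z - y0| <= r -> cimage p W z) -> Gamma_S M V phi' -> vanish p y0 (r / 2) phi' ->
     weak vol (phi' := phi') psi1 = weak vol (phi' := phi') psi2) ->
  forall x u, unitary_frame x u -> psi1 x u = psi2 x u.
Proof.
move=> G1 G2 H x u uf; have [W [s [oW Wx Wd ls su]]] := local_frame_exists uf.
have Uy : cimage x W (cmap x x) by apply: cimage_mem => //; exact: man_center.
have xE : cinv x (cmap x x) = x by rewrite man_cmapK //; exact: man_center.
have [r r0 Hr] := nbhs_rV_ball (open_nbhs_nbhs (conj (cimage_open (p := x) oW) Uy)).
have h0 : 0 < r / 2 by rewrite divr_gt0.
have ball z : `|z - cmap x x| <= r / 2 -> cimage x W z.
  by move=> Hz; apply: Hr; apply: le_lt_trans Hz _; rewrite ltr_pdivrMr // ltr_pMr // ltr1n.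
have G := Gamma_S_lin (-1) G1 G2.
have uf' : unitary_frame (cinv x (cmap x x)) u by rewrite xE.
have := weak_zero volP oW Wd ls h0 ball G uf'; rewrite xE => Z.
apply/eqP; rewrite -subr_eq0 -scaleN1r; apply/eqP; apply: Z => phi' Gp' v0.
have := weak_lin volP oW Wd ls h0 ball Gp' v0 (-1) G1 G2; rewrite /weak => ->.
by rewrite rmorphN1 mulN1r; apply/eqP; rewrite subr_eq0; apply/eqP; exact: (H x W s _ _ phi' oW Wd ls h0 ball Gp' v0).
Qed.

Lemma GDm i phi : Gamma_S M V phi -> Gamma_S M V (DDm i phi).
Proof. by move=> Gp; have [] := DmP (Gamma_Dminus i dom Gp). Qed.

Lemma GDp i phi : Gamma_S M V phi -> Gamma_S M V (DDp i phi).
Proof. by move=> Gp; have [] := DpP (Gamma_Dplus i dom Gp). Qed.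

Lemma weitzenbock N (c : 'I_N -> C) (al be : 'I_m -> C) :
  (forall B, \sum_q c q *: blockop (epow (pi_e V) q) B = \sum_i al i *: orth_proj (Vminus V i) B) ->
  (forall B, \sum_q c q *: blockop (fun k l => epow (pi_e V) q l k) B = \sum_i be i *: orth_proj (Vplus V i) B) ->
  forall phi x u, Gamma_S M V phi -> unitary_frame x u ->
    \sum_q c q *: Rq M V q phi x u = \sum_i al i *: DDm i phi x u + (-1) *: (\sum_i be i *: DDp i phi x u).
Proof.
move=> Ha Hb phi x u Gp uf.
have GR (q : 'I_N) := Gamma_Rq q Gp; have Gm i := GDm i Gp; have Gl i := GDp i Gp.
have Sm := Gamma_S_sum (index_enum 'I_m) al Gm; have Sp := Gamma_S_sum (index_enum 'I_m) be Gl.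
apply: (weak_eq (Gamma_S_sum (index_enum 'I_N) c GR) (Gamma_S_lin (-1) Sm Sp) _ uf).
move=> p W s y0 r phi' oW Wp ls r0 ball Gp' v0.
rewrite (weak_lin volP oW Wp ls r0 ball Gp' v0 (-1) Sm Sp) !(weak_sum volP oW Wp ls r0 ball Gp' v0) //.
rewrite (core volP oW Wp ls r0 ball dom Gp' v0 Gp Ha Hb) rmorphN1 mulN1r; congr (_ - _).
  by apply: eq_bigr => i _; rewrite (weak_minus r0 ball dom Gp' v0 Gp DmP).
by apply: eq_bigr => i _; rewrite (weak_plus r0 ball dom Gp' v0 Gp DpP).
Qed.

Lemma sum_minus phi x u : Gamma_S M V phi -> unitary_frame x u -> \sum_i DDm i phi x u = L10 phi x u.
Proof.
move=> Gp uf; transitivity (\sum_i 1 *: DDm i phi x u); first by apply: eq_bigr => i _; rewrite scale1r.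
have Gm i := GDm i Gp; have [G10 _] := A10P (Gamma_nabla10 Gp).
apply: (weak_eq (Gamma_S_sum (index_enum 'I_m) (fun=> 1) Gm) G10 _ uf).
move=> p W s y0 r phi' oW Wp ls r0 ball Gp' v0.
rewrite (weak_sum volP oW Wp ls r0 ball Gp' v0) // (weak_10 r0 ball Gp' v0 Gp A10P).
rewrite -(pair_minus_sum volP oW Wp ls r0 ball dom Gp' v0 Gp); apply: eq_bigr => i _.
by rewrite (weak_minus r0 ball dom Gp' v0 Gp DmP) rmorph1 mul1r.
Qed.

Lemma sum_plus phi x u : Gamma_S M V phi -> unitary_frame x u -> \sum_i DDp i phi x u = L01 phi x u.
Proof.
move=> Gp uf; transitivity (\sum_i 1 *: DDp i phi x u); first by apply: eq_bigr => i _; rewrite scale1r.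
have Gm i := GDp i Gp; have [G01 _] := A01P (Gamma_nabla01 Gp).
apply: (weak_eq (Gamma_S_sum (index_enum 'I_m) (fun=> 1) Gm) G01 _ uf).
move=> p W s y0 r phi' oW Wp ls r0 ball Gp' v0.
rewrite (weak_sum volP oW Wp ls r0 ball Gp' v0) // (weak_01 r0 ball Gp' v0 Gp A01P).
rewrite -(pair_plus_sum volP oW Wp ls r0 ball dom Gp' v0 Gp); apply: eq_bigr => i _.
by rewrite (weak_plus r0 ball dom Gp' v0 Gp DpP) rmorph1 mul1r.
Qed.

Lemma rough_laplacian phi x u : Gamma_S M V phi -> unitary_frame x u -> L10 phi x u + L01 phi x u = L phi x u.
Proof.
move=> Gp uf; have [G10 _] := A10P (Gamma_nabla10 Gp); have [G01 _] := A01P (Gamma_nabla01 Gp).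
have [GL _] := AP (Gamma_nabla Gp).
have E := weak_eq (Gamma_S_lin 1 G10 G01) GL; have := E _ x u uf; rewrite scale1r; apply.
move=> p W s y0 r phi' oW Wp ls r0 ball Gp' v0.
rewrite (weak_lin volP oW Wp ls r0 ball Gp' v0 1 G10 G01) rmorph1 mul1r.
by rewrite (weak_nabla volP oW Wp ls r0 ball Gp' v0 Gp A10P A01P AP).
Qed.

Lemma blockop_epow (q : nat) B : blockop (epow (pi_e V) q) B = \sum_i wm i ^+ q *: orth_proj (Vminus V i) B.
Proof.
rewrite -iter_Bop_neg (iter_Bop false dom); apply: eq_bigr => i _.
by rewrite Vminus_piece.
Qed.

Lemma blockop_bpow (q : nat) B : blockop (bpow V q) B = \sum_i wp i ^+ q *: orth_proj (Vplus V i) B.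
Proof. by rewrite -iter_Bop_pos (iter_Bop true dom). Qed.

Lemma gauss_identity (q : nat) phi x u : Gamma_S M V phi -> unitary_frame x u ->
  \sum_(p < q.+1) ('C(q, p)%:R * (- m%:R) ^+ (q - p)) *: Rq M V p phi x u
  = (-1) ^+ q.+1 *: (\sum_i (\sum_(p < q.+1) wp i ^+ p * Kcoef V (q - p)) *: DDp i phi x u)
    + \sum_i (wm i - m%:R) ^+ q *: DDm i phi x u.
Proof.
move=> Gp uf; pose c (p : 'I_q.+1) : C := 'C(q, p)%:R * (- m%:R) ^+ (q - p).
have Ha B : \sum_p c p *: blockop (epow (pi_e V) p) B = \sum_i (wm i - m%:R) ^+ q *: orth_proj (Vminus V i) B.
  under eq_bigr do rewrite blockop_epow scaler_sumr.
  rewrite exchange_big; apply: eq_bigr => i _; under eq_bigr do rewrite scalerA.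
  rewrite -scaler_suml; congr (_ *: _); rewrite addrC exprDn; apply: eq_bigr => p _.
  by rewrite /c -mulrA mulr_natl.
(* The polynomials K enter here: the binomial combination of the powers of e is (-1)^q (m - e)^q,
   whose transposed entries [shifted_epow] expands in powers of minus the transpose. *)
have Hb B : \sum_p c p *: blockop (fun k l => epow (pi_e V) p l k) B =
    \sum_i ((-1) ^+ q * (\sum_(p < q.+1) wp i ^+ p * Kcoef V (q - p))) *: orth_proj (Vplus V i) B.
  transitivity ((-1) ^+ q *: \sum_(p < q.+1) Kcoef V (q - p) *: blockop (bpow V p) B).
    under eq_bigr do rewrite -blockop_scale.
    rewrite -blockop_sum; under [RHS]f_equal do under eq_bigr do rewrite -blockop_scale.
    rewrite -blockop_sum -blockop_scale; apply: blockop_ext => k l; exact: shifted_epow.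
  under eq_bigr do rewrite blockop_bpow scaler_sumr.
  rewrite exchange_big scaler_sumr; apply: eq_bigr => i _; under eq_bigr do rewrite scalerA mulrC.
  by rewrite -scaler_suml scalerA.
rewrite (weitzenbock Ha Hb Gp uf) addrC; congr (_ + _).
rewrite exprS -scalerA; congr (_ *: _); rewrite scaler_sumr; apply: eq_bigr => i _.
by rewrite scalerA.
Qed.

Lemma Rq_degree0 phi x u : Gamma_S M V phi -> unitary_frame x u ->
  Rq M V 0 phi x u = \sum_i DDm i phi x u - \sum_i DDp i phi x u.
Proof.
move=> Gp uf; pose c (p : 'I_1) : C := 1.
have Ha B : \sum_p c p *: blockop (epow (pi_e V) p) B = \sum_i 1 *: orth_proj (Vminus V i) B.
  by rewrite big_ord1 scale1r blockop_epow; apply: eq_bigr => i _; rewrite expr0.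
have Hb B : \sum_p c p *: blockop (fun k l => epow (pi_e V) p l k) B = \sum_i 1 *: orth_proj (Vplus V i) B.
  rewrite big_ord1 scale1r; transitivity (blockop (bpow V 0) B).
    by apply: blockop_ext => k l /=; rewrite eq_sym; case: (k == l); rewrite //= ?mulr0n ?raddf0.
  by rewrite blockop_bpow; apply: eq_bigr => i _; rewrite expr0.
have := weitzenbock Ha Hb Gp uf; rewrite big_ord1 scale1r scaleN1r => ->.
by congr (_ - _); apply: eq_bigr => i _; rewrite scale1r.
Qed.

Lemma Rq_degree1 phi x u : Gamma_S M V phi -> unitary_frame x u ->
  \sum_i (wm i *: DDm i phi x u + wp i *: DDp i phi x u) = Rq M V 1 phi x u.
Proof.
move=> Gp uf; pose c (p : 'I_2) : C := (p == 1%N :> nat)%:R.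
have S2 (T : lmodType C) (F : nat -> T) : \sum_(p < 2) c p *: F p = F 1%N.
  by rewrite !big_ord_recr big_ord0 /c /= scale0r !add0r scale1r.
have Ha B : \sum_p c p *: blockop (epow (pi_e V) p) B = \sum_i wm i *: orth_proj (Vminus V i) B.
  by rewrite (S2 _ (fun p => blockop (epow (pi_e V) p) B)) blockop_epow.
have Hb B : \sum_p c p *: blockop (fun k l => epow (pi_e V) p l k) B = \sum_i (- wp i) *: orth_proj (Vplus V i) B.
  rewrite (S2 _ (fun p => blockop (fun k l => epow (pi_e V) p l k) B)).
  transitivity ((-1) *: blockop (bpow V 1) B).
    rewrite -blockop_scale; apply: blockop_ext => k l /=.
    have -> : \sum_i pi_e V l i * (i == k)%:R = pi_e V l k.
      rewrite (bigD1 k) //= eqxx mulr1 big1 ?addr0 // => i /negbTE ik; by rewrite ik mulr0.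
    rewrite (bigD1 l) //= eqxx mulmx1 big1 ?addr0 => [|i /negbTE il]; first by rewrite scaleN1r opprK.
    by rewrite il raddf0 mulmx0.
  by rewrite blockop_bpow scaler_sumr; apply: eq_bigr => i _; rewrite scalerA mulN1r.
have := weitzenbock Ha Hb Gp uf; rewrite (S2 _ (fun p => Rq M V p phi x u)) => ->.
rewrite big_split /=; congr (_ + _); rewrite scaler_sumr; apply: eq_bigr => i _.
by rewrite scalerA mulN1r opprK.
Qed.

Lemma minus_from_plus i : exists a b : 'I_m -> C, forall phi x u, Gamma_S M V phi -> unitary_frame x u ->
  DDm i phi x u = \sum_j a j *: DDp j phi x u + \sum_(q < m) b q *: Rq M V q phi x u.
Proof.
have winj : injective (fun j => wm j - m%:R).
  by move=> j k /addIr /eqP; rewrite eqr_int => /eqP; exact: (conf_weight_inj (pos := false) dom).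
have [t Ht] := interpolation i winj.
pose c (q p : nat) : C := 'C(q, p)%:R * (- m%:R) ^+ (q - p).
pose g (q : nat) j : C := (-1) ^+ q.+1 * \sum_(p < q.+1) wp j ^+ p * Kcoef V (q - p).
exists (fun j => - \sum_q t q * g q j), (fun p => \sum_q t q * c q p) => phi x u Gp uf.
have E (q : 'I_m) : \sum_j (wm j - m%:R) ^+ q *: DDm j phi x u =
    \sum_(p < m) c q p *: Rq M V p phi x u - \sum_j g q j *: DDp j phi x u.
  have H := gauss_identity q Gp uf.
  (* For p > q the binomial coefficient is 0, so every identity of degree q < m can be summed over
     the same range p < m. *)
  have -> : \sum_(p < m) c q p *: Rq M V p phi x u = \sum_(p < q.+1) c q p *: Rq M V p phi x u.
    rewrite (big_ord_widen m (fun p => c q p *: Rq M V p phi x u) (ltn_ord q)) [RHS]big_mkcond.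
    apply: eq_bigr => p _; case: ifPn => //; rewrite -leqNgt => qp.
    by rewrite /c bin_small // mul0r scale0r.
  rewrite H scaler_sumr; under [in X in _ - X]eq_bigr do rewrite -scalerA.
  by rewrite addrAC subrr add0r.
transitivity (\sum_j (\sum_q t q * (wm j - m%:R) ^+ q) *: DDm j phi x u).
  rewrite (bigD1 i) //= Ht eqxx scale1r big1 ?addr0 // => j /negbTE ji.
  by rewrite Ht ji scale0r.
transitivity (\sum_q t q *: \sum_j (wm j - m%:R) ^+ q *: DDm j phi x u).
  under eq_bigr do rewrite scaler_suml.
  rewrite exchange_big; apply: eq_bigr => q _; rewrite scaler_sumr; apply: eq_bigr => j _.
  by rewrite scalerA.
under eq_bigr do rewrite E scalerBr.
rewrite sumrB addrC; congr (_ + _).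
  rewrite -sumrN; under eq_bigr do rewrite scaler_sumr -sumrN.
  rewrite exchange_big; apply: eq_bigr => j _; rewrite -sumrN scaler_suml; apply: eq_bigr => q _.
  by rewrite scaleNr scalerA.
under eq_bigr do rewrite scaler_sumr.
rewrite exchange_big; apply: eq_bigr => p _; rewrite scaler_suml; apply: eq_bigr => q _.
by rewrite scalerA.
Qed.

End Assembly.

Theorem theorem8p5 (R : realType) (m : nat) (m_gt0 : (0 < m)%N)
  (M : kahler R m)
  (vol : {measure set (borel M) -> \bar R}) (vol_is_volume : is_volume vol)
  (rho : 'I_m -> int) (rho_dominant : dominant rho) (V : @unirrep R m rho)
  (Dplus_adj Dminus_adj : 'I_m -> sect M (rdim V) m -> sect M (rdim V) 1)
  (nabla10_adj nabla01_adj : sect M (rdim V) m -> sect M (rdim V) 1)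
  (nabla_adj : sect M (rdim V) m.*2 -> sect M (rdim V) 1)
  (Dplus_adjP : forall i,
     formal_adjoint vol (S_bundle M V) (Gamma_S M V)
       (S10_bundle M V) (Gamma_Splus M V i) (Dplus M V i) (Dplus_adj i))
  (Dminus_adjP : forall i,
     formal_adjoint vol (S_bundle M V) (Gamma_S M V)
       (S01_bundle M V) (Gamma_Sminus M V i) (Dminus M V i) (Dminus_adj i))
  (nabla10_adjP :
     formal_adjoint vol (S_bundle M V) (Gamma_S M V)
       (S01_bundle M V) (Gamma (S01_bundle M V)) (nabla10 M V) nabla10_adj)
  (nabla01_adjP :
     formal_adjoint vol (S_bundle M V) (Gamma_S M V)
       (S10_bundle M V) (Gamma (S10_bundle M V)) (nabla01 M V) nabla01_adj)
  (nabla_adjP :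
     formal_adjoint vol (S_bundle M V) (Gamma_S M V)
       (SForm_bundle M V) (Gamma (SForm_bundle M V)) (nabla M V) nabla_adj) :
  let DDplus i phi := Dplus_adj i (Dplus M V i phi) in
  let DDminus i phi := Dminus_adj i (Dminus M V i phi) in
  let L10 phi := nabla10_adj (nabla10 M V phi) in
  let L01 phi := nabla01_adj (nabla01 M V phi) in
  let L phi := nabla_adj (nabla M V phi) in
  let wp i : R[i] := (wplus rho i)%:~R in
  let wm i : R[i] := (wminus rho i)%:~R in
  [/\ (* (1) *)
      (forall phi x u, Gamma_S M V phi -> unitary_frame x u ->
        [/\ \sum_i DDminus i phi x u = L10 phi x u,
            \sum_i DDplus i phi x u = L01 phi x u,
            \sum_i (DDminus i phi x u + DDplus i phi x u)
              = L10 phi x u + L01 phi x u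
            /\ L10 phi x u + L01 phi x u = L phi x u
          & \sum_i (DDminus i phi x u - DDplus i phi x u)
              = L10 phi x u - L01 phi x u
            /\ L10 phi x u - L01 phi x u = Rq M V 0 phi x u])
      /\
      (ricci_flat M ->
       forall phi x u, Gamma_S M V phi -> unitary_frame x u ->
         \sum_i DDminus i phi x u = \sum_i DDplus i phi x u),
      (* (2) *)
      (forall phi x u, Gamma_S M V phi -> unitary_frame x u ->
         \sum_i (wm i *: DDminus i phi x u + wp i *: DDplus i phi x u)
           = Rq M V 1 phi x u),
      (* (3) *)
      (forall (q : nat) phi x u, Gamma_S M V phi -> unitary_frame x u ->
         \sum_(p < q.+1) ('C(q, p)%:R * (- m%:R) ^+ (q - p)) *: Rq M V p phi x u
         = (-1) ^+ q.+1 *: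
             (\sum_i (\sum_(p < q.+1) wp i ^+ p *: Kpoly (pi_e V) (q - p))
                     *m DDplus i phi x u)
           + \sum_i (wm i - m%:R) ^+ q *: DDminus i phi x u)
    & (forall i, exists a b : 'I_m -> R[i],
         forall phi x u, Gamma_S M V phi -> unitary_frame x u ->
           DDminus i phi x u = \sum_j a j *: DDplus j phi x u
                             + \sum_(q < m) b q *: Rq M V q phi x u)].
Proof.
move=> DDplus DDminus L10 L01 L wp wm.
have deg0 phi x u : Gamma_S M V phi -> unitary_frame x u ->
    \sum_i DDminus i phi x u - \sum_i DDplus i phi x u = Rq M V 0 phi x u.
  by move=> Gp uf; rewrite (Rq_degree0 vol_is_volume rho_dominant Dplus_adjP Dminus_adjP Gp uf).
have s10 phi x u (Gp : Gamma_S M V phi) (uf : unitary_frame x u) :=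
  sum_minus vol_is_volume rho_dominant Dminus_adjP nabla10_adjP Gp uf.
have s01 phi x u (Gp : Gamma_S M V phi) (uf : unitary_frame x u) :=
  sum_plus vol_is_volume rho_dominant Dplus_adjP nabla01_adjP Gp uf.
split; first split.
- move=> phi x u Gp uf; split.
  + exact: s10.
  + exact: s01.
  + split; first by rewrite big_split /= s10 // s01.
    exact: (rough_laplacian vol_is_volume nabla10_adjP nabla01_adjP nabla_adjP Gp uf).
  + by rewrite sumrB -(deg0 phi x u Gp uf) s10 // s01.
- move=> ric phi x u Gp uf; apply/eqP; rewrite -subr_eq0 deg0 //.
  by rewrite (Rq0_ricci_flat ric Gp uf).
- move=> phi x u Gp uf.
  exact: (Rq_degree1 vol_is_volume rho_dominant Dplus_adjP Dminus_adjP Gp uf).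
- move=> q phi x u Gp uf.
  rewrite (gauss_identity vol_is_volume rho_dominant Dplus_adjP Dminus_adjP q Gp uf).
  congr (_ *: _ + _); apply: eq_bigr => i _.
  rewrite scaler_suml mulmx_suml; apply: eq_bigr => p _.
  by rewrite KpolyE -scalemxAl mul_scalar_mx scalerA.
- move=> i; exact: (minus_from_plus vol_is_volume rho_dominant Dplus_adjP Dminus_adjP i).
Qed.
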